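(* Let $n\ge 1$, let $(B_t)$ be a standard Brownian motion on $\mathbb{R}^n$, let $c>0$ be a real number, and let $(z^{(c)}_t)_{0\le t<1}$ be the solution of the stochastic differential equation $$dz_t=dB_t-\frac{c}{1-t}\,z_t\,dt,\qquad z_0=0,\quad t<1.$$ Then: (a) $(z^{(c)}_t)$ is a generalised Brownian bridge from $0$ to $0$ with terminal time $1$. (b) Denote by $\nu^{(c)}$ the probability distribution of $(z^{(c)}_t)_{0\le t\le 1}$ on the loop space $C_{0,0}([0,1];\mathbb{R}^n)$, and by $H^{(c)}$ the Cameron-Martin space of the Gaussian measure $\nu^{(c)}$. Then $H^{(c)}=H^{(1)}$ as sets if and only if $c>\frac12$. (c) The measures $\nu^{(1)}$ and $\nu^{(c)}$ are mutually singular unless $c=1$.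
   Context: $C_{0,0}([0,1];\mathbb{R}^n)$ is the space of continuous paths $\sigma:[0,1]\to\mathbb{R}^n$ with $\sigma(0)=\sigma(1)=0$, with the supremum norm. A generalised Brownian bridge from $0$ to $0$ in $\mathbb{R}^n$ with terminal time $1$ is a stochastic process $(z_t,t\in[0,1])$ with $z_0=0$ such that (1) $(z_t,t\in[0,1))$ is a Markov process with (time-dependent) infinitesimal generator $\frac12\Delta-f(t)\,x\cdot\nabla$, i.e. $\frac12\Delta-f(t)\nabla(\frac{|x|^2}{2})$, where $f$ is a suitably smooth real valued function on $[0,1)$ with $\lim_{t\to1}f(t)=\infty$; and (2) $\lim_{t\to 1}z_t=0$ almost surely. The process is extended to $t=1$ by $z^{(c)}_1=0$. The Cameron-Martin space of a centred Gaussian measure $\mu$ on a separable Banach space $E$ is the set of $h\in E$ for which $\sup\{|\ell(h)|:\ell\in E^*,\ \|\ell\|_{L^2(\mu)}\le 1\}<\infty$. The measure $\nu^{(1)}$ is the classical Brownian bridge measure, and its Cameron-Martin space is $H^{(1)}=H_{0,0}=\{h:[0,1]\to\mathbb{R}^n \text{ absolutely continuous}: \dot h\in L^2([0,1];\mathbb{R}^n),\ h(0)=h(1)=0\}$. *)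

(* Defs.v *)
From HB Require Import structures.
From mathcomp Require Import all_boot all_order all_algebra.
From mathcomp Require Import all_classical all_reals all_analysis.

Set Implicit Arguments.
Unset Strict Implicit.
Unset Printing Implicit Defensive.

Import Order.TTheory GRing.Theory Num.Theory.
Import numFieldNormedType.Exports.

Local Open Scope classical_set_scope.
Local Open Scope ring_scope.

Notation borel T := (g_sigma_algebraType (@open T)).

(** The loop space C_{0,0}([0,1]; R^n).  A loop is represented by its extension
    by 0 to the whole line, which is continuous since a loop vanishes at both
    ends.  R^n carries the max norm of 'rV[R]_n; the Euclidean norm would give
    an equivalent supremum norm, hence the same topology, Borel sets and dual. *)

Definition is_loop (R : realType) (n : nat) : {pred R -> 'rV[R]_n} :=
  [pred f : R -> 'rV[R]_n | `[< continuous f /\ forall t, t \notin `]0, 1[ -> f t = 0 >]].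

Section loop_space.
Variables (R : realType) (n : nat).

Record loop := Loop { loop_fun :> R -> 'rV[R]_n; loop_funP : is_loop loop_fun }.

HB.instance Definition _ := [isSub for loop_fun].
HB.instance Definition _ := [Choice of loop by <:].

Lemma is_loop_submod : submod_closed (@is_loop R n).
Proof.
split=> [|a f g /asboolP[cf f0] /asboolP[cg g0]]; apply/asboolP; split => //.
- by move=> x; exact: cvg_cst.
- move=> x; apply: cvgD; last exact: cg.
  by apply: cvgZr; exact: cf.
- by move=> t t01; rewrite !fctE f0// g0// scaler0 addr0.
Qed.

HB.instance Definition _ :=
  GRing.isSubmodClosed.Build R (R -> 'rV[R]_n) (@is_loop R n) is_loop_submod.
HB.instance Definition _ := [SubChoice_isSubLmodule of loop by <:].

Definition sup_norm (f : loop) : R := sup [set `|f t| | t in `[0, 1]].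

Lemma loop_continuous (f : loop) : continuous f.
Proof. by have /asboolP[] := loop_funP f. Qed.

Lemma loop_out (f : loop) t : t \notin `]0, 1[ -> f t = 0.
Proof. by have /asboolP[_] := loop_funP f; apply. Qed.

Lemma sup_norm_has_sup (f : loop) : has_sup [set `|f t| | t in `[0, 1]].
Proof.
split; first by exists `|f 0|, 0 => //=; rewrite in_itv/= lexx ler01.
have [] := @EVT_max R (fun t => `|f t|) 0 1 ler01.
  apply: continuous_subspaceT => t.
  by apply: cvg_comp; [exact: loop_continuous|exact: norm_continuous].
by move=> m _ fm; exists `|f m| => _ [t t01 <-]; exact: fm.
Qed.

Lemma sup_norm_ub (f : loop) t : `|f t| <= sup_norm f.
Proof.
have [t01|] := boolP (t \in `[0, 1]); last first.
  move=> t01; rewrite loop_out; last first.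
    by apply: contra t01; exact: subset_itv_oo_cc.
  rewrite normr0 (le_trans (normr_ge0 (f 0)))// /sup_norm.
  apply: ub_le_sup; first exact: (sup_norm_has_sup f).2.
  by exists 0 => //=; rewrite in_itv/= lexx ler01.
by apply: ub_le_sup; [exact: (sup_norm_has_sup f).2|exists t].
Qed.

Lemma sup_norm_le (f : loop) M : (forall t, `|f t| <= M) -> sup_norm f <= M.
Proof.
move=> fM; apply: ge_sup; first exact: (sup_norm_has_sup f).1.
by move=> _ [t _ <-].
Qed.

Lemma sup_normD f g : sup_norm (f + g) <= sup_norm f + sup_norm g.
Proof.
apply: sup_norm_le => t; rewrite (le_trans (ler_normD (f t) (g t)))//.
by rewrite lerD// sup_norm_ub.
Qed.

Lemma sup_normZ (l : R) f : sup_norm (l *: f) = `|l| * sup_norm f.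
Proof.
have le_Z k g : sup_norm (k *: g) <= `|k| * sup_norm g.
  apply: sup_norm_le => t.
  by rewrite [leLHS](normrZ k (g t)) ler_wpM2l// sup_norm_ub.
apply/eqP; rewrite eq_le le_Z/=.
have [->|l0] := eqVneq l 0.
  by rewrite normr0 mul0r (le_trans (normr_ge0 _) (sup_norm_ub _ 0)).
rewrite -[X in _ * sup_norm X](scalerKV l0) scalerA divff// scale1r.
rewrite -ler_pdivlMl ?normr_gt0// -normfV.
by rewrite -[X in sup_norm X <= _](scalerK l0).
Qed.

Lemma sup_norm0_eq0 f : sup_norm f = 0 -> f = 0.
Proof.
move=> f0; apply/val_inj/funext => t /=.
by apply/eqP; rewrite -normr_le0 -f0; exact: sup_norm_ub.
Qed.

HB.instance Definition _ :=
  Lmodule_isNormed.Build R loop sup_normD sup_normZ sup_norm0_eq0.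

End loop_space.

(* The case s = 0 is separate because normal_prob 0 0 is not the Dirac mass. *)
Definition is_centred_gaussian_law (R : realType) (m : set R -> \bar R) :=
  exists s : R, 0 <= s /\ forall A : set R, measurable A ->
    m A = if s == 0 then \d_(0 : R) A else normal_prob 0 s A.

Definition centred_gaussian (R : realType) (E : normedModType R)
    (mu : set (borel E) -> \bar R) :=
  forall l : {linear E -> R^o}, continuous l ->
    is_centred_gaussian_law (fun A => mu (l @^-1` A)).

Definition cameron_martin (R : realType) (E : normedModType R)
    (mu : {measure set (borel E) -> \bar R}) : set E :=
  [set h | (ereal_sup [set `|l h|%:E | l in
     [set l : {linear E -> R^o} |
        continuous l /\ 'N[mu]_2%:E[EFin \o l] <= 1]] < +oo)%E].

Definition mutually_singular d (T : measurableType d) (R : realType)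
    (mu nu : set T -> \bar R) :=
  exists A : set T, [/\ measurable A, mu A = 0%E & nu (~` A) = 0%E].

(* Processes are indexed by the whole line, but only the times in the relevant
   interval are ever constrained.  Paths need only be continuous almost surely.
   In the law of an increment, normal_prob takes a standard deviation. *)

Definition brownian_motion (R : realType) (n : nat) d (T : measurableType d)
    (P : probability T R) (B : R -> T -> 'rV[R]_n) :=
  [/\ forall t, 0 <= t -> measurable_fun setT (B t : T -> borel 'rV[R]_n),
      {ae P, forall w, B 0 w = 0},
      forall (k : nat) (t : nat -> R) (A : nat -> set (borel 'rV[R]_n)),
        0 <= t 0%N -> (forall i, (i < k)%N -> t i < t i.+1) ->
        (forall i, measurable (A i)) ->
        let inc i := (fun w => B (t i.+1) w - B (t i) w) @^-1` A i in
        P (\big[setI/setT]_(i < k) inc i) = (\prod_(i < k) P (inc i))%E,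
      forall (s t : R) (A : 'I_n -> set R), 0 <= s -> s < t ->
        (forall j, measurable (A j)) ->
        P [set w | forall j, A j ((B t w - B s w) 0 j)] =
          (\prod_(j < n) normal_prob 0 (Num.sqrt (t - s)) (A j))%E
    & {ae P, forall w, {within `[0, +oo[, continuous (B ^~ w)}}].

(* The noise being additive, the equation
     dz_t = dB_t - c / (1 - t) z_t dt,  z_0 = 0,  t < 1,
   involves no stochastic integral; it is
   understood path by path, for almost every path. *)
Definition bridge_sde (R : realType) (n : nat) d (T : measurableType d)
    (P : probability T R) (B : R -> T -> 'rV[R]_n) (c : R)
    (z : R -> T -> 'rV[R]_n) :=
  [/\ forall t, 0 <= t < 1 -> measurable_fun setT (z t : T -> borel 'rV[R]_n),
      {ae P, forall w, z 0 w = 0},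
      {ae P, forall w, {within `[0, 1[, continuous (z ^~ w)}}
    & {ae P, forall w t, 0 <= t < 1 -> forall j, z t w 0 j = B t w 0 j -
        \int[lebesgue_measure]_(s in `[0, t]) (c / (1 - s) * z s w 0 j)}].

Definition with_zero_end (R : realType) (n : nat) (T : Type)
    (z : R -> T -> 'rV[R]_n) : R -> T -> 'rV[R]_n :=
  fun t w => if t < 1 then z t w else 0.

Section generators.
Variables (R : realType) (n : nat).
Local Notation V := 'rV[R]_n.

Definition partial (i : 'I_n) (phi : V -> R) : V -> R :=
  fun x => 'D_(delta_mx 0 i) phi x.

Definition laplacian (phi : V -> R) : V -> R :=
  fun x => \sum_(i < n) partial i (partial i phi) x.

(* All iterated partial derivatives are differentiable: phi is C^oo. *)
Definition smooth (phi : V -> R) :=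
  forall (s : seq 'I_n) (x : V), differentiable (foldr partial phi s) x.

Definition test_function (phi : V -> R) :=
  smooth phi /\ compact (closure [set x | phi x != 0]).

Definition natural_filtration (T : Type) (z : R -> T -> V) (s : R) :
    set (set T) :=
  <<s [set G | exists u (A : set (borel V)),
         [/\ 0 <= u <= s, measurable A & G = z u @^-1` A]] >>.

Definition transition_kernels
    (kappa : R -> R -> R.-pker (borel V) ~> (borel V)) :=
  (forall s x (A : set (borel V)), 0 <= s < 1 -> measurable A ->
     kappa s s x A = \d_x A) /\
  (forall r s t x (A : set (borel V)), 0 <= r -> r <= s -> s <= t -> t < 1 ->
     measurable A ->
     kappa r t x A = (\int[kappa r s x]_y kappa s t y A)%E).

Definition markov_process d (T : measurableType d) (P : probability T R)
    (z : R -> T -> V) (kappa : R -> R -> R.-pker (borel V) ~> (borel V)) :=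
  transition_kernels kappa /\
  forall s t (G : set T) (A : set (borel V)), 0 <= s -> s <= t -> t < 1 ->
    natural_filtration z s G -> measurable A ->
    P (G `&` z t @^-1` A) = (\int[P]_(w in G) kappa s t (z s w) A)%E.

(* On test functions, L t is the right derivative at t of the transition
   operators phi |-> \int[kappa t (t + h) x]_y phi y, for the supremum norm. *)
Definition has_generator (kappa : R -> R -> R.-pker (borel V) ~> (borel V))
    (L : R -> (V -> R) -> (V -> R)) :=
  forall t phi, 0 <= t < 1 -> test_function phi ->
  forall e, 0 < e -> \forall h \near 0^'+, forall x : V,
    `|(\int[kappa t (t + h) x]_y phi y - phi x) / h - L t phi x| < e.

Definition bridge_generator (f : R -> R) : R -> (V -> R) -> (V -> R) :=
  fun t phi x =>
    2^-1 * laplacian phi x - f t * \sum_(i < n) x 0 i * partial i phi x.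

(* z is a process on [0, 1]; the Markov property and the generator concern its
   restriction to [0, 1).  f is C^oo on [0, 1), up to the endpoint 0. *)
Definition generalised_brownian_bridge d (T : measurableType d)
    (P : probability T R) (z : R -> T -> V) :=
  [/\ forall t, 0 <= t <= 1 -> measurable_fun setT (z t : T -> borel V),
      {ae P, forall w, z 0 w = 0},
      exists (f : R -> R) (kappa : R -> R -> R.-pker (borel V) ~> (borel V)),
        [/\ forall k t, 0 <= t < 1 -> derivable (derive1n k f) t 1,
            f t @[t --> 1^'-] --> +oo,
            markov_process P z kappa
          & has_generator kappa (bridge_generator f)]
    & {ae P, forall w, z t w @[t --> 1^'-] --> (0 : V)}].

End generators.

(* nu is the distribution on the loop space of a process whose paths are
   almost surely loops *)
Definition loop_distribution (R : realType) (n : nat) d (T : measurableType d)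
    (P : probability T R) (z : R -> T -> 'rV[R]_n)
    (nu : probability (borel (loop R n)) R) :=
  exists Z : T -> loop R n,
    [/\ measurable_fun setT (Z : T -> borel (loop R n)),
        {ae P, forall w t, 0 <= t <= 1 -> Z w t = z t w}
      & forall A : set (borel (loop R n)), measurable A ->
          nu A = P (Z @^-1` A)].

(* Main.v *)
Require Import Defs.
From HB Require Import structures.
From mathcomp Require Import all_boot all_order all_algebra.
From mathcomp Require Import all_classical all_reals all_analysis.
From mathcomp Require Import measurable_realfun ring lra.

Set Implicit Arguments.
Unset Strict Implicit.
Unset Printing Implicit Defensive.

Import Order.TTheory GRing.Theory Num.Theory.
Import numFieldNormedType.Exports.

Local Open Scope classical_set_scope.
Local Open Scope ring_scope.

(** Since the noise is additive, the equation is solved path by path by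
    z_t = B_t - c (1 - t)^c J_t, with J' = (1 - t)^(- c - 1) B, so that z_t / (1 - t)^c is a
    process with independent Gaussian increments and variance V(t) = int (1 - s)^(- 2c) ds.
    (a) The transition kernel from (s, x) is therefore the Gaussian law centred at
    ((1 - t) / (1 - s))^c x with variance (1 - t)^(2c) (V(t) - V(s)), and a Taylor expansion on
    test functions gives the generator; z_t -> 0 follows from the continuity of B at time 1.
    (b) A loop h lies in H^(c) iff the path h + c J, J = int h / (1 - t), which drives the
    equation to h, has a square integrable derivative.  For c > 1/2 a Hardy inequality makes
    this equivalent to finite energy of h; for c <= 1/2 the path (1 - t)^c - (1 - t) lies in
    H^(c) but not in H^(1).
    (c) Near time 1 the process z_t / sqrt (1 - t) is, on the logarithmic time scale,
    stationary with variance 1 / (2c - 1) if c > 1/2 and of unbounded variance otherwise; the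
    frequency of large values distinguishes two values of c almost surely. *)

(** The weighted bridge [(1 - t) ^ (- c) z_t] is the Wiener integral of [(1 - s) ^ (- c)] against B.
    Its integrand is monotone, so integration by parts gives it a meaning for every continuous path,
    and the map from B to z is linear and Lipschitz for the supremum norm. Polygonal interpolation
    of B thus makes z a uniform limit of finite combinations of fixed loops with independent
    Gaussian coefficients. This yields the measurability of the random loop, the Gaussian laws of
    its continuous linear functionals and the upper bound on the Cameron-Martin norm. Conversely,
    the driving path at a time t < 1 is a continuous linear functional of the loop, which yields the
    lower bound. Square integrability of a derivative is tested by duality against step functions,
    so that no weak derivative has to be constructed. In (b), the cross term between h and J costs
    at most half of the energy of J, whence the threshold 1/2. In (c), it is enough to find, for
    each e, an event of probability at most e under one law whose complement has probability at most
    e under the other. *)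

(** * Uniqueness of finite measures and centred Gaussian laws on the line *)

Lemma finite_measure_eq d (T : measurableType d) (R : realType)
    (G : set (set T)) (m1 m2 : {measure set T -> \bar R}) :
  @measurable _ T = <<s G >> -> setI_closed G ->
  (m1 setT < +oo)%E -> m1 setT = m2 setT ->
  (forall A, G A -> m1 A = m2 A) ->
  forall A, measurable A -> m1 A = m2 A.
Proof.
move=> mG IG m1oo m12T m12 A mA.
have fin1 B : measurable B -> m1 B \is a fin_num.
  move=> mB; rewrite ge0_fin_numE//.
  by apply: le_lt_trans m1oo; apply: le_measure; rewrite ?inE.
pose Q := [set B | measurable B -> m1 B = m2 B].
suff : Q A by exact.
apply: (@dynkin_induction _ T G Q) => //.
- by move=> B GB _; exact: m12.
- move=> B mB QB _; have m2oo : (m2 setT < +oo)%E by rewrite -m12T.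
  rewrite -!setTD [LHS]measureD// [RHS]measureD//.
  by rewrite !setTI; congr (_ - _)%E; [exact: m12T|exact: QB].
- move=> F mF tF QF _; rewrite !measure_bigcup//.
  by apply: eq_eseriesr => i _; exact: QF.
- by rewrite -mG.
Qed.

Lemma ge0_integral_affine_ray (R : realType) (G : R -> R) (k b a : R) :
  0 < k -> continuous G -> (forall x, 0 <= G x) ->
  (\int[lebesgue_measure]_(x in `]-oo, (k * a + b)%R]) (G x)%:E =
   \int[lebesgue_measure]_(x in `]-oo, a]) (G (k * x + b) * k)%:E)%E.
Proof.
move=> k0 cG G0; pose F (x : R) := k * x + b.
have dF (x : R) : is_derive x 1 F k.
  by rewrite /F; apply: is_derive_eq; rewrite addr0 scaler1.
have F'E : F^`()%classic = cst k.
  by apply/funext => x; rewrite derive1E; apply: derive_val.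
have cF : continuous F.
  move=> x; apply: differentiable_continuous; apply/derivable1_diffP.
  by have [] := dF x.
have := @increasing_ge0_integration_by_substitutionNy R F G a.
rewrite F'E => ->//.
- move=> x y _ _ xy; by rewrite /F ltrD2r ltr_pM2l.
- by move=> x _; exact: cvg_cst.
- exact: is_cvg_cst.
- exact: cvg_cst.
- split; first by move=> x _; have [] := dF x.
  by apply: cvg_at_left_filter; exact: cF.
- apply/cvgrNyPle => M; exists ((M - b) / k); split; first exact: num_real.
  move=> x; rewrite ltr_pdivlMr// mulrC /F => h; lra.
- exact: continuous_subspaceT.
Qed.

(** The rays form a pi-system that does not contain the line, so the equality of the total masses is
    a separate hypothesis, on which the complements in Dynkin's argument rely. *)
Lemma finite_measure_eq_ray (R : realType)
    (m1 m2 : {measure set (measurableTypeR R) -> \bar R}) :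
  (m1 setT < +oo)%E -> m1 setT = m2 setT ->
  (forall a, m1 `]-oo, a]%classic = m2 `]-oo, a]%classic) ->
  forall A, measurable A -> m1 A = m2 A.
Proof.
move=> m1oo m12T m12.
apply: (@finite_measure_eq _ (measurableTypeR R) R
  [set A | exists a, A = `]-oo, a]%classic] m1 m2) => //.
- rewrite [LHS](RGenOInfty.measurableE R); apply/seteqP; split => A.
    apply: smallest_sub; first exact: smallest_sigma_algebra.
    move=> _ [x ->]; rewrite -setCitvl; apply: sigma_algebraC.
    by apply: sub_sigma_algebra; exists x.
  apply: smallest_sub; first exact: smallest_sigma_algebra.
  move=> _ [x ->]; rewrite -setCitvr; apply: sigma_algebraC.
  by apply: sub_sigma_algebra; exists x.
- move=> _ _ [a ->] [b ->]; exists (Order.min a b).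
  by apply/seteqP; split => x /=; rewrite !in_itv/= le_min => /andP.
- by move=> _ [a ->].
Qed.

Lemma measurable_mulrl (R : realType) (s : R) :
  measurable_fun setT (fun x : measurableTypeR R => (s * x : measurableTypeR R)).
Proof. exact: measurable_funM. Qed.

(** Scaling the standard normal law makes [s = 0] the Dirac mass at 0, unlike [normal_prob 0 0], and
    admits negative [s]; linear combinations with arbitrary coefficients then need no case
    distinction. *)
Definition gauss (R : realType) (s : R) : set (measurableTypeR R) -> \bar R :=
  fun A => normal_prob 0 1 ((fun x : R => s * x) @^-1` A).

Section gauss_measure.
Variables (R : realType) (s : R).

Let m : {measure set (measurableTypeR R) -> \bar R} := normal_prob 0 1.
Let pm := @pushforward _ _ _ _ _ m (fun x : measurableTypeR R => (s * x : measurableTypeR R)).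
Let pm0 : gauss s set0 = 0%E. Proof. by rewrite /gauss preimage_set0 measure0. Qed.
Let pm_ge0 A : (0 <= gauss s A)%E. Proof. exact: measure_ge0. Qed.
Let pm_add : semi_sigma_additive (gauss s).
Proof. 
have h := @measurable_mulrl R s.
pose X : {measure set (measurableTypeR R) -> \bar R} := @measure_function_pushforward__canonical__measure_function_Measure _ _ _ _ _ m _ h.
exact: (@measure_semi_sigma_additive _ _ _ X).
Qed.
HB.instance Definition _ := isMeasure.Build _ _ _ (gauss s) pm0 pm_ge0 pm_add.

Let gauss_setT : gauss s setT = 1%E.
Proof. by rewrite /gauss preimage_setT probability_setT. Qed.
HB.instance Definition _ := Measure_isProbability.Build _ _ _ (gauss s) gauss_setT.
End gauss_measure.

Lemma gaussT (R : realType) (s : R) : gauss s setT = 1%E.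
Proof. exact: (@probability_setT _ _ _ (gauss s)). Qed.

Lemma normal_probT (R : realType) (m s : R) : normal_prob m s setT = 1%E.
Proof. exact: (@probability_setT _ _ _ (normal_prob m s)). Qed.

Lemma gauss_scale (R : realType) (s : R) A :
  gauss s A = normal_prob 0 1 [set x : measurableTypeR R | A (s * x)].
Proof. by []. Qed.

Lemma gauss_gt0E (R : realType) (s : R) : 0 < s ->
  forall A, measurable A -> gauss s A = normal_prob 0 s A.
Proof.
move=> s0.
apply: (@finite_measure_eq_ray _ (gauss s) (normal_prob 0 s)).
- by rewrite [X in (X < _)%E]gaussT ltry.
- by rewrite [LHS]gaussT [RHS]normal_probT.
move=> a; rewrite [LHS]gauss_scale.
have -> : [set x : measurableTypeR R | (`]-oo, a]%classic : set R) (s * x)] = `]-oo, (s^-1 * a + 0)%R]%classic.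
  apply/seteqP; split => x /=; rewrite !in_itv/= addr0.
    by rewrite ler_pdivlMl.
  by rewrite ler_pdivlMl.
rewrite /normal_prob ge0_integral_affine_ray ?invr_gt0//; last 2 first.
- by apply: continuous_normal_pdf; rewrite oner_neq0.
- by move=> x; exact: normal_pdf_ge0.
apply: eq_integral => x _; congr EFin.
rewrite !normal_pdfE ?gt_eqF// /normal_peak /normal_fun !subr0 addr0.
rewrite mulrAC; congr (_ * expR _).
  rewrite expr1n mul1r -mulrnAr sqrtrM ?sqr_ge0// sqrtr_sqr gtr0_norm//.
  by rewrite invfM mulrC.
by field; rewrite gt_eqF.
Qed.

Lemma normal_probE (R : realType) (m s : R) (A : set (measurableTypeR R)) :
  normal_prob m s A = (\int[lebesgue_measure]_(x in A) (normal_pdf m s x)%:E)%E.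
Proof. by []. Qed.


Lemma gaussN (R : realType) (s : R) A : measurable A -> gauss (- s) A = gauss s A.
Proof.
move=> mA; rewrite !gauss_scale.
have : measurable [set x : measurableTypeR R | A (s * x)].
  by rewrite -[X in measurable X]setTI; apply: measurable_mulrl.
(* Factoring [- s] as [s] after [-1] reduces the claim to the symmetry of the standard normal
   law. *)
have -> : [set x : measurableTypeR R | A (- s * x)] =
    [set x | [set x | A (s * x)] (- 1 * x)].
  by apply/seteqP; split => x /=; rewrite mulN1r mulrN mulNr.
move: [set x | A (s * x)] => B mB; rewrite -gauss_scale; move: B mB.
apply: (@finite_measure_eq_ray _ (gauss (-1)) (normal_prob 0 1)).
- by rewrite [X in (X < _)%E]gaussT ltry.
- by rewrite [LHS]gaussT [RHS]normal_probT.
move=> a; rewrite [LHS]gauss_scale.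
have -> : [set x : measurableTypeR R | (`]-oo, a]%classic : set R) (-1 * x)] =
   `[- a, +oo[%classic.
  by apply/seteqP; split => x /=; rewrite mulN1r !in_itv/= andbT lerNl.
rewrite [LHS]normal_probE -[in RHS](opprK a) [RHS]normal_probE.
rewrite ge0_integration_by_substitutionNy//.
- by apply: eq_integral => x _; congr EFin => /=; rewrite !normal_pdfE// /normal_fun !subr0 sqrrN.
- apply: continuous_subspaceT; apply: continuous_normal_pdf; exact: oner_neq0.
- by move=> x _; exact: normal_pdf_ge0.
Qed.

Lemma gauss_norm (R : realType) (s : R) A : measurable A -> gauss `|s| A = gauss s A.
Proof.
by move=> mA; have [s0|s0] := leP 0 s; rewrite ?(ger0_norm s0)// ltr0_norm// gaussN.
Qed.

Lemma gauss0 (R : realType) A : gauss (0 : R) A = \d_(0 : R) A.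
Proof.
rewrite gauss_scale diracE; under eq_set do rewrite mul0r.
have [|A0] := boolP (0 \in A).
  rewrite inE => A0; rewrite (_ : [set _ | _] = setT) ?[LHS]normal_probT//.
  by apply/seteqP; split.
rewrite (_ : [set _ | _] = set0) ?measure0//.
by apply/seteqP; split => // x /= A0'; move: A0; rewrite notin_setE.
Qed.

Section ge0_integral_normal.
Import HBNNSimple.

(** The density formula defines the law on sets only; simple functions and monotone convergence
    carry it to nonnegative functions. *)
Lemma ge0_integral_normal (R : realType) (m s : R)
    (f : measurableTypeR R -> \bar R) :
  measurable_fun setT f -> (forall x, 0 <= f x)%E ->
  (\int[normal_prob m s]_x f x =
   \int[lebesgue_measure]_x (f x * (normal_pdf m s x)%:E))%E.
Proof.
move=> mf f0.
have mp : measurable_fun setT (fun x : measurableTypeR R => (normal_pdf m s x)%:E).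
  by apply/measurable_EFinP; exact: measurable_normal_pdf.
have p0 x : (0 <= (normal_pdf m s x)%:E)%E by rewrite lee_fin normal_pdf_ge0.
pose g := nnsfun_approx measurableT mf.
have gE n : (\int[normal_prob m s]_x (g n x)%:E =
   \int[lebesgue_measure]_x ((g n x)%:E * (normal_pdf m s x)%:E))%E.
  under [LHS]eq_integral do rewrite fimfunE -fsumEFin//.
  rewrite [LHS]ge0_integral_fsum//; last 2 first.
  - by move=> r; exact/measurable_EFinP/measurableT_comp.
  - by move=> k x _; rewrite EFinM nnfun_muleindic_ge0.
  under [RHS]eq_integral.
    move=> x xD; rewrite fimfunE -fsumEFin// ge0_mule_fsuml; last first.
      by move=> r; rewrite EFinM nnfun_muleindic_ge0.
    over.
  rewrite [RHS]ge0_integral_fsum//; last 2 first.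
  - move=> r; apply: emeasurable_funM => //.
    exact/measurable_EFinP/measurableT_comp.
  - by move=> k x _; rewrite EFinM mule_ge0// nnfun_muleindic_ge0.
  apply: eq_fsbigr => r; rewrite inE => -[x _ gxr].
  have r0 : (0 <= r%:E)%E by rewrite lee_fin -gxr.
  under eq_integral do rewrite EFinM.
  rewrite [LHS]ge0_integralZl//; last first.
    exact/measurable_EFinP/measurable_indic.
  under [RHS]eq_integral do rewrite EFinM -muleA.
  rewrite [RHS]ge0_integralZl//; last 2 first.
  - apply: emeasurable_funM => //; exact/measurable_EFinP/measurable_indic.
  - by move=> y _; rewrite mule_ge0// lee_fin.
  congr (_ * _)%E; rewrite integral_indic//= setIT [LHS]normal_probE.
  rewrite [LHS]integral_mkcond; apply: eq_integral => y _.
  rewrite patchE indicE; case: ifPn => _; by rewrite ?mul1e ?mul0e.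
transitivity (limn (fun n => \int[normal_prob m s]_x (g n x)%:E))%E.
  rewrite -monotone_convergence//.
  - apply: eq_integral => x _; apply/esym/cvg_lim => //.
    by apply: cvg_nnsfun_approx => // y _; exact: f0.
  - by move=> n; exact/measurable_EFinP.
  - by move=> n x _; rewrite lee_fin.
  - by move=> x _ a b ab; rewrite lee_fin; exact/lefP/nd_nnsfun_approx.
under eq_fun do rewrite gE.
rewrite -monotone_convergence//.
- apply: eq_integral => x _; apply/cvg_lim => //.
  apply: cvgeZr => //; by apply: cvg_nnsfun_approx => // y _; exact: f0.
- by move=> n; apply: emeasurable_funM => //; exact/measurable_EFinP.
- by move=> n x _; rewrite mule_ge0// lee_fin.
- move=> x _ a b ab; rewrite lee_pmul// ?lee_fin//.
  exact/lefP/nd_nnsfun_approx.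
Qed.
End ge0_integral_normal.

(** Completing the square in [y]. For independent variables of deviations [s] and [t] with sum [z],
    the last factor is the conditional density of the second one given [z]; it integrates to 1 in
    [y], which leaves the law of the sum. *)
Lemma normal_pdf_conv (R : realType) (s t y z : R) : 0 < s -> 0 < t ->
  let r := Num.sqrt (s ^+ 2 + t ^+ 2) in
  normal_pdf 0 s (z - y) * normal_pdf 0 t y =
  normal_pdf 0 r z * normal_pdf (z * t ^+ 2 / r ^+ 2) (s * t / r) y.
Proof.
move=> s0 t0 r.
have r20 : 0 < s ^+ 2 + t ^+ 2 by rewrite addr_gt0 ?exprn_gt0.
have r0 : 0 < r by rewrite sqrtr_gt0.
have r2E : r ^+ 2 = s ^+ 2 + t ^+ 2 by rewrite sqr_sqrtr// ltW.
have q0 : 0 < s * t / r by rewrite !mulr_gt0// invr_gt0.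
rewrite !normal_pdfE ?gt_eqF// /normal_peak /normal_fun !subr0.
rewrite mulrACA [RHS]mulrACA -!expRD; congr (_ * expR _).
  have pk (x : R) : 0 < x -> Num.sqrt (x ^+ 2 * pi *+ 2) = x * Num.sqrt (pi *+ 2).
    by move=> x0; rewrite -mulrnAr sqrtrM ?sqr_ge0// sqrtr_sqr gtr0_norm.
  rewrite !pk// -!invfM; congr (_^-1); field; exact: lt0r_neq0.
rewrite expr_div_n exprMn r2E; field.
by rewrite !gt_eqF// exprn_gt0.
Qed.

Lemma gauss_prodT (R : realType) (s t : R) : (gauss s \x gauss t)%E setT = 1%E.
Proof.
rewrite -setXTT product_measure1E//.
by rewrite [X in (X * _)%E]gaussT [X in (_ * X)%E]gaussT mule1.
Qed.

Lemma gauss_conv_gt0 (R : realType) (s t : R) : 0 < s -> 0 < t ->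
  forall A : set (measurableTypeR R), measurable A ->
  (gauss s \x gauss t)%E
    [set p : measurableTypeR R * measurableTypeR R | A (p.1 + p.2 : R)] =
  gauss (Num.sqrt (s ^+ 2 + t ^+ 2)) A.
Proof.
move=> s0 t0; set r := Num.sqrt _.
have r0 : 0 < r by rewrite sqrtr_gt0 addr_gt0 ?exprn_gt0.
have mD : measurable_fun setT (fun p : measurableTypeR R * measurableTypeR R =>
   (p.1 + p.2 : measurableTypeR R)).
  exact: measurable_funD.
pose m2 : {measure set (measurableTypeR R) -> \bar R} :=
 @measure_function_pushforward__canonical__measure_function_Measure _ _ _ _ _
   (gauss s \x gauss t)%E _ mD.
apply: (@finite_measure_eq_ray _ m2 (gauss r)).
- by rewrite [m2 _]gauss_prodT ltry.
- by rewrite [LHS]gauss_prodT [RHS]gaussT.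
move=> a; pose D : set (measurableTypeR R) := `]-oo, a]%classic.
pose E : set (measurableTypeR R * measurableTypeR R) :=
  [set p | D (p.1 + p.2 : R)].
transitivity (\int[gauss s]_x gauss t (xsection E x))%E.
  by [].
rewrite (@eq_measure_integral _ _ _ _ (normal_prob 0 s)); last first.
  by move=> B mB _; exact: gauss_gt0E.
(* Joint density of the first variable and the sum, cut off where the sum is at most [a]; Tonelli's
   theorem integrates the first variable out. *)
pose F (p : measurableTypeR R * measurableTypeR R) : \bar R :=
  ((normal_pdf 0 t (p.2 - p.1) * normal_pdf 0 s p.1) * \1_D p.2)%:E.
have F0 p : (0 <= F p)%E by rewrite lee_fin !mulr_ge0// normal_pdf_ge0.
have mF : measurable_fun setT F.
  apply/measurable_EFinP; apply: measurable_funM.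
    apply: measurable_funM.
      apply: (measurableT_comp (measurable_normal_pdf 0 t)).
      exact: measurable_funB.
    exact: (measurableT_comp (measurable_normal_pdf 0 s)).
  have mD1 : measurable_fun setT (\1_D : measurableTypeR R -> R).
    by apply: measurable_indic; exact: measurable_itv.
  exact: (measurableT_comp mD1).
have inner (x : R) : (\int[lebesgue_measure]_z F (x, z) =
     gauss t (xsection E x) * (normal_pdf 0 s x)%:E)%E.
  have -> : xsection E x = `]-oo, (1 * a + - x)]%classic.
    apply/seteqP; split => y; rewrite /xsection/= inE /E/D/= !in_itv/= => h; lra.
  rewrite gauss_gt0E// normal_probE ge0_integral_affine_ray//; last 2 first.
  - by apply: continuous_normal_pdf; rewrite gt_eqF.
  - by move=> y; exact: normal_pdf_ge0.
  rewrite -ge0_integralZr//; last 3 first.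
  - apply/measurable_EFinP/measurable_funTS.
    apply: measurable_funM => //.
    apply: (measurableT_comp (measurable_normal_pdf 0 t)).
    exact: measurable_funD.
  - by move=> y _; rewrite lee_fin mulr1 normal_pdf_ge0.
  - by rewrite lee_fin normal_pdf_ge0.
  rewrite [RHS]integral_mkcond.
  apply: eq_integral => z _; rewrite /F/= patchE indicE /D mulr1 mul1r.
  by case: ifPn => _; rewrite ?mul1r ?mulr1 ?mulr0 ?mul0e.
have mgt : measurable_fun setT (fun x : measurableTypeR R => gauss t (xsection E x)).
  apply: measurable_fun_xsection.
  by rewrite -[X in measurable X]setTI; apply: (mD measurableT D); exact: measurable_itv.
rewrite ge0_integral_normal//.
under eq_integral do rewrite -inner.
rewrite (@fubini_tonelli _ _ _ _ _ lebesgue_measure lebesgue_measure F)//.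
rewrite [RHS]gauss_gt0E// normal_probE [RHS]integral_mkcond.
apply: eq_integral => z _; rewrite /F/= patchE indicE.
case: ifPn => zD; last first.
  rewrite integral0_eq// => x _; by rewrite mulr0.
under eq_integral do rewrite mulr1 (normal_pdf_conv _ _ t0 s0) EFinM.
rewrite ge0_integralZl//.
- rewrite integral_normal_pdf mule1 /r addrC; reflexivity.
- apply/measurable_EFinP; exact: measurable_normal_pdf.
- by move=> x _; rewrite lee_fin normal_pdf_ge0.
- by rewrite lee_fin normal_pdf_ge0.
Qed.

Lemma measurable_add_preimage (R : realType) (A : set (measurableTypeR R)) :
  measurable A ->
  measurable [set p : measurableTypeR R * measurableTypeR R | A (p.1 + p.2 : R)].
Proof.
move=> mA.
have mD : measurable_fun setT (fun p : measurableTypeR R * measurableTypeR R =>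
   (p.1 + p.2 : measurableTypeR R)).
  exact: measurable_funD.
by rewrite -[X in measurable X]setTI; exact: (mD measurableT A mA).
Qed.

(** Signs are removed by symmetry; a zero deviation has no density, and the corresponding factor is
    integrated as a Dirac mass. *)
Lemma gauss_conv (R : realType) (s t : R) (A : set (measurableTypeR R)) :
  measurable A ->
  (gauss s \x gauss t)%E
    [set p : measurableTypeR R * measurableTypeR R | A (p.1 + p.2 : R)] =
  gauss (Num.sqrt (s ^+ 2 + t ^+ 2)) A.
Proof.
move=> mA; set E := [set p | _].
have mE : measurable E by exact: measurable_add_preimage.
have -> : (gauss s \x gauss t)%E E = (gauss `|s| \x gauss `|t|)%E E.
  rewrite (@product_measure_unique _ _ _ _ _ (gauss s) (gauss t)
    (gauss `|s| \x gauss `|t|)%E)// => B C mB mC.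
  transitivity (gauss `|s| B * gauss `|t| C)%E; first exact: product_measure1E.
  by congr (_ * _)%E; exact: gauss_norm.
rewrite -(real_normK (num_real s)) -(real_normK (num_real t)).
move: (normr_ge0 s) (normr_ge0 t); move: `|s| `|t| => {}s {}t.
rewrite le_eqVlt => /predU1P[<- t0|s0].
  rewrite expr0n add0r sqrtr_sqr ger0_norm//.
  transitivity (\int[gauss (0:R)]_x gauss t (xsection E x))%E => //.
  rewrite (@eq_measure_integral _ _ _ _ (\d_(0 : measurableTypeR R))); last first.
    by move=> B mB _; rewrite [LHS]gauss0.
  rewrite integral_dirac//; last first.
    exact: measurable_fun_xsection.
  rewrite diracT mul1e; congr (gauss t _).
  by apply/seteqP; split => y; rewrite /xsection/= inE /E/= add0r.
rewrite le_eqVlt => /predU1P[<-|t0]; last exact: gauss_conv_gt0.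
rewrite expr0n addr0 sqrtr_sqr ger0_norm ?ltW//.
transitivity (\int[gauss s]_x gauss (0:R) (xsection E x))%E => //.
transitivity (\int[gauss s]_x (\1_A x)%:E)%E; last by rewrite integral_indic// setIT.
apply: eq_integral => x _; rewrite [LHS]gauss0 diracE indicE.
congr (nat_of_bool _)%:R%:E.
by apply/idP/idP; rewrite !inE /xsection/= inE /E/= addr0.
Qed.

(** * Joint laws and sums of independent Gaussian variables *)

(** The law of [X] on the event [G] is not normalised, so that independence from [G] can be stated
    without dividing by [P G], even if this is 0. *)
Definition restr_law d (T : measurableType d) (R : realType) (P : set T -> \bar R)
    (G : set T) (mG : measurable G) d' (U : measurableType d') (X : T -> U)
    (mX : measurable_fun setT X) : set U -> \bar R :=
  fun A => P (G `&` X @^-1` A).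

Section restr_law_measure.
Context d (T : measurableType d) (R : realType) (P : probability T R).
Context (G : set T) (mG : measurable G) d' (U : measurableType d') (X : T -> U).
Hypothesis mX : measurable_fun setT X.


Let law0 : restr_law P mG mX set0 = 0%E.
Proof. by rewrite /restr_law preimage_set0 setI0 measure0. Qed.

Let law_ge0 A : (0 <= restr_law P mG mX A)%E.
Proof. exact: measure_ge0. Qed.

Let law_add : semi_sigma_additive (restr_law P mG mX).
Proof.
pose m := @measure_function_pushforward__canonical__measure_function_Measure
  _ _ _ _ _ (mrestr P mG) _ mX.
move=> F mF tF mUF.
have := @measure_semi_sigma_additive _ _ _ m F mF tF mUF.
rewrite /m/= /pushforward /mrestr /restr_law.
by under eq_fun do under eq_bigr do rewrite setIC; rewrite setIC.
Qed.

HB.instance Definition _ :=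
  isMeasure.Build _ _ _ (restr_law P mG mX) law0 law_ge0 law_add.

Let law_fin : fin_num_fun (restr_law P mG mX).
Proof.
move=> A mA; apply: fin_num_measure; apply: measurableI => //.
by rewrite -[X in measurable X]setTI; exact: mX.
Qed.

HB.instance Definition _ :=
  Measure_isFinite.Build _ _ _ (restr_law P mG mX) law_fin.

End restr_law_measure.

Lemma joint_law_eq d (T : measurableType d) (R : realType) (P : probability T R)
    (G : set T) d1 d2 (U1 : measurableType d1) (U2 : measurableType d2)
    (X : T -> U1) (Y : T -> U2) (m : {measure set (U1 * U2) -> \bar R}) :
  measurable G -> measurable_fun setT X -> measurable_fun setT Y ->
  (forall A B, measurable A -> measurable B ->
     P (G `&` [set w | A (X w) /\ B (Y w)]) = m (A `*` B)) ->
  forall C, measurable C -> P (G `&` [set w | C (X w, Y w)]) = m C.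
Proof.
move=> mG mX mY XY.
have mXY : measurable_fun setT (fun w => (X w, Y w)) by exact: measurable_fun_pair.
pose m1 : {measure set (U1 * U2) -> \bar R} := restr_law P mG mXY.
have m1E C : m1 C = P (G `&` [set w | C (X w, Y w)]) by [].
move=> C mC; rewrite -m1E; move: C mC.
apply: (@finite_measure_eq _ _ _ [set A `*` B | A in measurable & B in measurable]).
- exact: measurable_prod_measurableType.
- move=> _ _ [A mA [B mB <-]] [A' mA' [B' mB' <-]].
  exists (A `&` A'); first exact: measurableI.
  by exists (B `&` B'); [exact: measurableI|rewrite setXI].
- have -> : m1 setT = P G.
    by rewrite m1E (_ : [set _ | _] = setT) ?setIT//; apply/seteqP; split.
  by rewrite (le_lt_trans (probability_le1 P mG))// ltry.
- by rewrite -!setXTT -XY.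
- by move=> _ [A mA [B mB <-]]; rewrite -XY.
Qed.

(** The event [G] is meant to hold the constraints on all the other members of a family while two of
    them are added. *)
Lemma gauss_add_law d (T : measurableType d) (R : realType) (P : probability T R)
    (G : set T) (X Y : T -> R) (s t : R) :
  measurable G -> measurable_fun setT X -> measurable_fun setT Y ->
  (forall A B : set (measurableTypeR R), measurable A -> measurable B ->
     P (G `&` [set w | A (X w) /\ B (Y w)]) = (P G * (gauss s A * gauss t B))%E) ->
  forall A : set (measurableTypeR R), measurable A ->
    P (G `&` [set w | A (X w + Y w)]) =
    (P G * gauss (Num.sqrt (s ^+ 2 + t ^+ 2)) A)%E.
Proof.
move=> mG mX mY XY A mA.
have k0 : 0 <= fine (P G) by rewrite fine_ge0.
have kE : (fine (P G))%:E = P G by rewrite fineK// fin_num_measure.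
pose k : {nonneg R} := NngNum k0.
have := @joint_law_eq _ _ _ P G _ _ (measurableTypeR R) (measurableTypeR R) X Y
  (mscale k (gauss s \x gauss t)%E) mG mX mY.
move=> /(_ _ _ (measurable_add_preimage mA)) -> //.
  by rewrite -kE; congr (_ * _)%E; exact: gauss_conv.
move=> B C mB mC; rewrite XY// -kE; congr (_ * _)%E.
by apply/esym; exact: product_measure1E.
Qed.

Lemma measurable_forall_preimage d (T : measurableType d) (R : realType)
    (I : finType) (X : I -> T -> R) (A : I -> set (measurableTypeR R)) :
  (forall i, measurable_fun setT (X i)) -> (forall i, measurable (A i)) ->
  measurable [set w | forall i, A i (X i w)].
Proof.
move=> mX mA.
rewrite (_ : [set _ | _] = \bigcap_(i in [set: I]) (X i @^-1` A i)).
  apply: fin_bigcap_measurable => //.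
  by move=> i _; have := mX i measurableT (A i) (mA i); rewrite setTI.
by apply/seteqP; split => w /= h i; [move=> _; exact: h|exact: h].
Qed.

(* the family indexed by [J] collects the variables already summed, the one
   indexed by [I] the others *)
Lemma gauss_sum_step d (T : measurableType d) (R : realType)
    (P : probability T R) (I J : finType) (S : J -> T -> R) (X : I -> T -> R)
    (r : J -> R) (s : I -> R) (D : pred I) (i0 : I) (j0 : J) (a : R) :
  ~~ D i0 -> (forall i, measurable_fun setT (X i)) ->
  (forall j, measurable_fun setT (S j)) ->
  (forall (A : J -> set (measurableTypeR R)) (C : I -> set (measurableTypeR R)),
    (forall j, measurable (A j)) -> (forall i, measurable (C i)) ->
    (forall i, D i -> C i = setT) ->
    P [set w | (forall j, A j (S j w)) /\ (forall i, C i (X i w))] =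
    (\prod_(j : J) gauss (r j) (A j) * \prod_(i : I) gauss (s i) (C i))%E) ->
  (forall (A : J -> set (measurableTypeR R)) (C : I -> set (measurableTypeR R)),
    (forall j, measurable (A j)) -> (forall i, measurable (C i)) ->
    (forall i, (i == i0) || D i -> C i = setT) ->
    P [set w | (forall j, A j ((if j == j0 then S j w + a * X i0 w else S j w)))
            /\ (forall i, C i (X i w))] =
    (\prod_(j : J) gauss (if j == j0 then Num.sqrt (r j ^+ 2 + (a * s i0) ^+ 2)
         else r j) (A j) *
     \prod_(i : I) gauss (s i) (C i))%E).
Proof.
move=> Di0 mX mS IH A C mA mC CT.
(* All the constraints except the one on the updated sum; its probability is the product of the
   remaining factors. *)
pose G := [set w | (forall j, (if j == j0 then setT else A j) (S j w)) /\
  (forall i, C i (X i w))].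
have mA' j : measurable (if j == j0 then setT else A j : set (measurableTypeR R)).
  by case: ifP.
have mG : measurable G.
  apply: measurableI.
    by have := measurable_forall_preimage mS mA'.
  exact: measurable_forall_preimage.
have PG : P G = (\prod_(j | j != j0) gauss (r j) (A j) *
     \prod_(i : I) gauss (s i) (C i))%E.
  rewrite [LHS](IH _ C mA' mC); last by move=> i Di; apply: CT; rewrite Di orbT.
  congr (_ * _)%E; rewrite (bigD1 j0)//= eqxx [X in (X * _)%E]gaussT mul1e.
  by apply: eq_bigr => j /negbTE ->.
have := @gauss_add_law _ _ _ P G (S j0) (fun w => a * X i0 w) (r j0) (a * s i0) mG (mS j0).
have maX : measurable_fun setT (fun w => a * X i0 w) by exact: measurable_funM.
move=> /(_ maX); have -> : [set w | (forall j, A j (if j == j0 then S j w + a * X i0 w else S j w))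
            /\ (forall i, C i (X i w))] = G `&` [set w | A j0 (S j0 w + a * X i0 w)].
  apply/seteqP; split => w /=.
    move=> [hA hC]; split; last by have := hA j0; rewrite eqxx.
    by split => // j; have := hA j; case: ifP.
  move=> [[hA hC] h0]; split => // j.
  by case: ifPn => [/eqP->//|/negbTE j0j]; have := hA j; rewrite j0j.
move=> -> //.
  have pE : (\prod_(i | i != j0)
      gauss (if i == j0 then Num.sqrt (r i ^+ 2 + (a * s i0) ^+ 2) else r i) (A i) =
      \prod_(j | j != j0) gauss (r j) (A j))%E.
    by apply: eq_bigr => j /negbTE ->.
  rewrite PG [in RHS](bigD1 j0)//= eqxx pE.
  by rewrite muleAC [X in (X * _)%E = _]muleC.
move=> B B' mB mB'.
pose A' j := if j == j0 then B else A j.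
(* A condition on [a * X i0] is one on [X i0], to which the hypothesis applies, as [i0] is not yet
   absorbed. *)
pose B2 : set (measurableTypeR R) := [set x : R | B' (a * x)].
pose C' i := if i == i0 then B2 else C i.
have mA2 j : measurable (A' j) by rewrite /A'; case: ifP.
have mC2 i : measurable (C' i).
  rewrite /C'; case: ifP => _; last exact: mC.
  by have := @measurable_mulrl R a measurableT _ mB'; rewrite setTI.
have := IH A' C' mA2 mC2.
rewrite (_ : [set _ | _] = G `&` [set w | B (S j0 w) /\ B' (a * X i0 w)]); last first.
  apply/seteqP; split => w /=; rewrite /A' /C'.
    move=> [hA hC]; split.
      split=> [j|i]; first by have := hA j; case: ifP.
      have := hC i; case: ifP => // /eqP ->.
      by rewrite CT// eqxx.
    by have := hA j0; have := hC i0; rewrite !eqxx.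
  move=> [[hA hC] [hB hB']]; split=> [j|i].
    by case: ifPn => [/eqP->//|/negbTE j0j]; have := hA j; rewrite j0j.
  by case: ifPn => [/eqP->|_].
move=> -> => [|i Di]; last first.
  rewrite /C'; case: ifPn => [/eqP i0E|_]; first by move: Di; rewrite i0E (negbTE Di0).
  by rewrite CT// Di orbT.
rewrite PG (bigD1 j0)//= (bigD1 i0)//= [in RHS](bigD1 i0)//= /A' /C' !eqxx.
have -> : (\prod_(i | i != j0) gauss (r i) (if i == j0 then B else A i) =
    \prod_(j | j != j0) gauss (r j) (A j))%E.
  by apply: eq_bigr => j /negbTE ->.
have -> : (\prod_(i | i != i0)
      gauss (s i) (if i == i0 then B2 else C i) =
    \prod_(i | i != i0) gauss (s i) (C i))%E.
  by apply: eq_bigr => j /negbTE ->.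
rewrite (CT i0) ?eqxx// gaussT mul1e.
have -> : gauss (s i0) B2 = gauss (a * s i0) B'.
  rewrite !gauss_scale; congr (normal_prob _ _ _).
  by apply/seteqP; split => x /=; rewrite /B2/= mulrA.
by rewrite muleACA muleC.
Qed.

Definition indep_gauss d (T : measurableType d) (R : realType)
    (P : probability T R) (I : finType) (X : I -> T -> R) (s : I -> R) :=
  (forall i, measurable_fun setT (X i)) /\
  forall A : I -> set (measurableTypeR R), (forall i, measurable (A i)) ->
    P [set w | forall i, A i (X i w)] = (\prod_(i : I) gauss (s i) (A i))%E.

(** The indices are absorbed one by one into the partial sums of their fibres. The induction keeps
    the variables not yet absorbed in the joint law, since their independence of the partial sums is
    what the next step consumes. *)
Lemma indep_gauss_sum d (T : measurableType d) (R : realType)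
    (P : probability T R) (I J : finType) (X : I -> T -> R) (s : I -> R)
    (f : I -> J) (a : I -> R) :
  indep_gauss P X s ->
  indep_gauss P (fun j w => \sum_(i | f i == j) a i * X i w)
    (fun j => Num.sqrt (\sum_(i | f i == j) (a i * s i) ^+ 2)).
Proof.
move=> [mX PX].
pose S (l : seq I) j w := \sum_(i <- l | f i == j) a i * X i w.
pose r (l : seq I) j := Num.sqrt (\sum_(i <- l | f i == j) (a i * s i) ^+ 2).
have mS l j : measurable_fun setT (S l j).
  rewrite /S; under eq_fun do rewrite -big_filter.
  apply: measurable_sum => i; exact: measurable_funM.
have main l : uniq l ->
    (forall (A : J -> set (measurableTypeR R)) (C : I -> set (measurableTypeR R)),
    (forall j, measurable (A j)) -> (forall i, measurable (C i)) ->
    (forall i, i \in l -> C i = setT) ->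
    P [set w | (forall j, A j (S l j w)) /\ (forall i, C i (X i w))] =
    (\prod_(j : J) gauss (r l j) (A j) * \prod_(i : I) gauss (s i) (C i))%E).
  elim: l => [_ A C mA mC _|i0 l IH].
    (* Before any absorption the partial sums are 0 and their laws are Dirac masses: the product is
       1 or 0 according to whether all the sets [A j] contain 0. *)
    have rE j : gauss (r [::] j) (A j) = \d_(0 : R) (A j).
      by rewrite /r big_nil sqrtr0; exact: gauss0.
    under eq_bigr do rewrite rE.
    have [A0|/existsNP[j0 Aj0]] := pselect (forall j, A j 0).
      rewrite [X in (X * _)%E]big1 => [|j _]; last first.
        by rewrite diracE mem_set.
      rewrite mul1e -PX//; congr (P _); apply/seteqP; split => w /=; first by case.
      by move=> h; split => // j; rewrite /S big_nil; exact: A0.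
    rewrite (bigD1 j0)//= diracE memNset// mul0e mul0e.
    rewrite (_ : [set _ | _] = set0) ?measure0//.
    apply/seteqP; split => // w /= [/(_ j0)]; by rewrite /S big_nil.
  rewrite cons_uniq => /andP[i0l ul] A C mA mC CT.
  have CT' i : (i == i0) || mem l i -> C i = setT.
    by move=> h; apply: CT; rewrite inE.
  have := @gauss_sum_step _ _ _ P I J (S l) X (r l) s (mem l) i0 (f i0) (a i0)
    i0l mX (mS l) (IH ul) A C mA mC CT'.
  have -> : (\prod_j gauss (r (i0 :: l) j) (A j) = \prod_j
     gauss (if j == f i0 then Num.sqrt (r l j ^+ 2 + (a i0 * s i0) ^+ 2)
         else r l j) (A j))%E.
    apply: eq_bigr => j _.
    suff -> : r (i0 :: l) j = if j == f i0
      then Num.sqrt (r l j ^+ 2 + (a i0 * s i0) ^+ 2) else r l j by [].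
    rewrite /r big_cons eq_sym; case: ifP => // _; rewrite sqr_sqrtr 1?addrC//.
    by apply: sumr_ge0 => i _; exact: sqr_ge0.
  move=> <-; congr (P _); apply/seteqP; split => w /= [hA hC]; split => // j.
    by have := hA j; rewrite /S big_cons eq_sym; case: ifP => // _; rewrite addrC.
  by have := hA j; rewrite /S big_cons eq_sym; case: ifP => // _; rewrite addrC.
split=> [j|A mA].
  exact: mS.
have := main (index_enum I) (index_enum_uniq _) A (fun=> setT) mA (fun=> measurableT) (fun _ _ => erefl).
rewrite [X in (_ * X)%E]big1 ?mule1 => [<-|i _]; last exact: gaussT.
by congr (P _); apply/seteqP; split => w //= [].
Qed.

(** * Borel sets of row vectors *)

Lemma rV_norm_le (R : realType) (m : nat) (x : 'rV[R]_m) (e : R) : 0 <= e ->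
  (forall j, `|x 0 j| <= e) -> `|x| <= e.
Proof.
move=> e0 xe; have [x0|/mx_norm_neq0[[i j]]] := eqVneq (mx_norm x) 0.
  by rewrite [leLHS]x0.
by move=> xij; rewrite [leLHS]xij /= ord1; exact: xe.
Qed.

Lemma rV_coord_le (R : realType) (m : nat) (x : 'rV[R]_m) j : `|x 0 j| <= `|x|.
Proof.
rewrite [leRHS]mx_normrE.
exact: (le_bigmax _ (fun ij : 'I_1 * 'I_m => `|x ij.1 ij.2|) (0, j)).
Qed.

Lemma measurable_coord (R : realType) (m : nat) (j : 'I_m) :
  measurable_fun setT (fun x : borel 'rV[R]_m => (x : 'rV[R]_m) 0 j).
Proof.
apply: (measurability _ (RGenOpens.measurableE R)) => //.
move=> _ [_ [a [b ->] <-]]; rewrite setTI; apply: sub_sigma_algebra.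
apply: open_comp; last exact: interval_open.
by move=> x _; exact: coord_continuous.
Qed.

(** Every open set is the union of the rational cubes that it contains, and there are countably many
    of them; so measurable coordinates suffice. *)
Lemma measurable_fun_rV d (T : measurableType d) (R : realType) (m : nat)
    (X : T -> 'rV[R]_m) :
  (forall j, measurable_fun setT (fun w => X w 0 j)) ->
  measurable_fun setT (X : T -> borel 'rV[R]_m).
Proof.
move=> mX.
pose B (q : 'rV[rat]_m * nat) : set 'rV[R]_m :=
  [set x | forall j, `|x 0 j - ratr (q.1 0 j)| < q.2.+1%:R^-1].
have mB q : measurable (X @^-1` B q).
  rewrite (_ : _ @^-1` _ = \bigcap_(j in [set: 'I_m])
      ((fun w => X w 0 j) @^-1` [set y | `|y - ratr (q.1 0 j)| < q.2.+1%:R^-1])); last first.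
    by apply/seteqP; split => w /= h j; [move=> _|]; exact: h.
  apply: fin_bigcap_measurable => // j _; rewrite -[X in measurable X]setTI.
  apply: mX => //; rewrite (_ : [set _ | _] = `](ratr (q.1 0 j) - q.2.+1%:R^-1),
     (ratr (q.1 0 j) + q.2.+1%:R^-1)[%classic); first exact: measurable_itv.
  by apply/seteqP; split => y /=; rewrite in_itv/= ltr_distl.
apply: (@measurability _ _ T (borel 'rV[R]_m) setT X (@open 'rV[R]_m) erefl).
move=> _ [U oU <-]; rewrite setTI.
rewrite (_ : X @^-1` U = \bigcup_(q in [set: 'rV[rat]_m * nat])
   (if `[< B q `<=` U >] then X @^-1` B q else set0)).
  apply: countable_bigcupT_measurable => [|q]; first exact: countableP.
  by case: ifP.
apply/seteqP; split => [w /= UXw|w [q _]]; last first.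
  by case: ifPn => // /asboolP BU ?; exact: BU.
have [e /= e0 eU] : exists2 e : R, 0 < e & ball (X w) e `<=` U.
  by have /nbhs_ballP[e e0 he] := open_nbhs_nbhs (conj oU UXw); exists e.
(* Two points of a cube of radius [1 / (k + 1)] are at distance at most twice that radius, whence
   the half of [e]. *)
have [k ke] : exists k : nat, k.+1%:R^-1 < e / 2.
  have e20 : 0 < e / 2 by rewrite divr_gt0.
  have [k _ hk] := @near_infty_natSinv_lt R (PosNum e20).
  by exists k; apply: hk => /=.
have qP j : exists q : rat, `|X w 0 j - ratr q| < k.+1%:R^-1.
  have [|q] := @rat_in_itvoo R (X w 0 j - k.+1%:R^-1) (X w 0 j + k.+1%:R^-1).
    by rewrite ltrBlDr -addrA ltrDl addr_gt0// invr_gt0.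
  by rewrite in_itv/= => qX; exists q; rewrite distrC ltr_distl.
pose q := \row_j xchoose (qP j).
have qE j : `|X w 0 j - ratr (q 0 j)| < k.+1%:R^-1.
  by rewrite mxE; exact: (xchooseP (qP j)).
exists (q, k) => //=; rewrite ifT//; apply/asboolP => x Bx; apply: eU.
rewrite mx_norm_ball /ball_/=; apply: (@le_lt_trans _ _ (2 * k.+1%:R^-1)); last first.
  by rewrite mulrC -ltr_pdivlMr.
apply: rV_norm_le => [|j]; first by rewrite mulr_ge0// invr_ge0.
rewrite !mxE (_ : _ - _ = (X w 0 j - ratr (q 0 j)) - (x 0 j - ratr (q 0 j))); last by ring.
rewrite (le_trans (ler_normB _ _))// mulr2n mulrDl mul1r lerD// ltW//.
Qed.

Definition box (R : realType) (m : nat) (A : 'I_m -> set (measurableTypeR R)) :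
  set 'rV[R]_m := [set x | forall j, A j (x 0 j)].

Lemma measurable_box (R : realType) (m : nat)
    (A : 'I_m -> set (measurableTypeR R)) :
  (forall j, measurable (A j)) -> measurable (box A : set (borel 'rV[R]_m)).
Proof.
move=> mA; apply: (@measurable_forall_preimage _ (borel 'rV[R]_m) R 'I_m
  (fun j (x : borel 'rV[R]_m) => (x : 'rV[R]_m) 0 j) A) => // j.
exact: measurable_coord.
Qed.

(** The identity from the sigma-algebra of boxes to the Borel one is measurable because its
    coordinates are. *)
Lemma measurable_rV_boxE (R : realType) (m : nat) :
  @measurable _ (borel 'rV[R]_m) =
  <<s [set box A | A in [set A : 'I_m -> set (measurableTypeR R) |
         forall j, measurable (A j)]] >>.
Proof.
set G := [set box A | A in _]; apply/seteqP; split => A; last first.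
  apply: smallest_sub; first exact: sigma_algebra_measurable.
  by move=> _ [B mB <-]; exact: measurable_box.
move=> mA.
have : measurable_fun setT (fun x : g_sigma_algebraType G => (x : borel 'rV[R]_m)).
  apply: (@measurable_fun_rV _ (g_sigma_algebraType G) R m
    (fun x : g_sigma_algebraType G => (x : 'rV[R]_m))) => j _ B mB.
  rewrite setTI; apply: sub_sigma_algebra.
  exists (fun i => if i == j then B else setT).
    by move=> i /=; case: ifP.
  apply/seteqP; split => x /=; first by move=> /(_ j); rewrite eqxx.
  by move=> Bx i; case: ifPn => // /eqP ->.
by move=> /(_ measurableT A mA); rewrite setTI.
Qed.

Lemma rV_measure_eq (R : realType) (m : nat)
    (m1 m2 : {measure set (borel 'rV[R]_m) -> \bar R}) :
  (m1 setT < +oo)%E ->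
  (forall A : 'I_m -> set (measurableTypeR R), (forall j, measurable (A j)) ->
     m1 (box A) = m2 (box A)) ->
  forall A, measurable A -> m1 A = m2 A.
Proof.
move=> m1oo m12; apply: (@finite_measure_eq _ (borel 'rV[R]_m) R
  [set box A | A in [set A : 'I_m -> set (measurableTypeR R) |
         forall j, measurable (A j)]] m1 m2) => //.
- exact: measurable_rV_boxE.
- move=> _ _ [A mA <-] [B mB <-]; exists (fun j => A j `&` B j).
    by move=> j; exact: measurableI.
  apply/seteqP; split => x /=; first by move=> h; split => j; have [] := h j.
  by move=> [hA hB] j; split.
- have -> : setT = box (fun=> setT) :> set (borel 'rV[R]_m) by apply/seteqP; split.
  exact: m12.
- by move=> _ [A mA <-]; exact: m12.
Qed.

(** * Almost sure limits of vectors with equal laws *)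

(** Dominated convergence for the indicators of the deviation events, which are bounded by 1. *)
Lemma ae_cvg_proba d (T : measurableType d) (R : realType) (P : probability T R)
    (f_ : nat -> T -> R) (f : T -> R) (e dl : R) :
  (forall k, measurable_fun setT (f_ k)) -> measurable_fun setT f ->
  {ae P, forall w, f_ ^~ w @ \oo --> f w} -> 0 < e -> 0 < dl ->
  \forall k \near \oo, (P [set w | (e <= `|f_ k w - f w|)%R] < dl%:E)%E.
Proof.
move=> mf_ mf ff e0 dl0.
pose E k := [set w | (e <= `|f_ k w - f w|)%R].
have mE k : measurable (E k).
  have mg : measurable_fun setT (fun w => `|f_ k w - f w|).
    by apply: measurableT_comp => //; exact: measurable_funB.
  rewrite (_ : E k = (fun w => `|f_ k w - f w|) @^-1` `[e, +oo[%classic).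
    by rewrite -[X in measurable X]setTI; apply: mg.
  by apply/seteqP; split => w; rewrite /E/= in_itv/= andbT.
pose F k w : \bar R := (\1_(E k) w)%:E.
have mI k : measurable_fun setT (F k).
  exact/measurable_EFinP/measurable_indic.
have I0 : {ae P, forall w, [set: T] w -> F ^~ w @ \oo --> (0 : \bar R)}.
  apply: filterS ff => w fw _; apply: cvg_near_cst.
  have /cvgrPdist_lt /(_ e e0) := fw.
  apply: filterS => k; rewrite /F indicE => h; rewrite memNset// /E/=.
  by apply/negP; rewrite -ltNge distrC.
have I1 : P.-integrable setT (cst 1%E : T -> \bar R).
  exact: finite_measure_integrable_cst.
have I2 : {ae P, forall w k, [set: T] w -> (`|F k w| <= (cst 1 w : \bar R))%E}.
  apply: aeW => w k _ /=; rewrite lee_fin indicE.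
  by case: (_ \in _); rewrite ?normr1// normr0.
have [_ _] := dominated_convergence measurableT mI (measurable_cst _) I0 I1 I2.
rewrite integral0 => /fine_cvgP[_ /cvgrPdist_lt /(_ dl dl0)].
apply: filterS => k; rewrite sub0r normrN /= integral_indic// setIT.
rewrite ger0_norm ?fine_ge0// => h.
by move: h; rewrite -lte_fin fineK//; exact: fin_num_measure.
Qed.

Lemma measurable_oray (R : realType) (a : option R) :
  measurable (if a is Some x then `]-oo, x]%classic else setT : set (measurableTypeR R)).
Proof. by case: a => // x; exact: measurable_itv. Qed.

Lemma cvg_sumr (R : numFieldType) (V : normedModType R) (T : Type)
    (F : set_system T) (FF : Filter F) (I : Type) (r : seq I) (Q : pred I)
    (f : T -> I -> V) (l : I -> V) :
  (forall i, Q i -> f t i @[t --> F] --> l i) ->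
  \sum_(i <- r | Q i) f t i @[t --> F] --> \sum_(i <- r | Q i) l i.
Proof.
move=> fl; elim: r => [|i r IH].
  by rewrite big_nil; under eq_fun do rewrite big_nil; exact: cvg_cst.
rewrite big_cons; under eq_fun do rewrite big_cons.
by case: ifPn => // Qi; apply: cvgD => //; exact: fl.
Qed.

Section same_law_limit.
Context d (T : measurableType d) (R : realType) (P : probability T R) (I : finType).

(** [None] leaves a coordinate unconstrained. *)
Let oray (a : option R) : set (measurableTypeR R) :=
  if a is Some x then `]-oo, x]%classic else setT.

Let mle (X : I -> T -> R) (A : I -> set (measurableTypeR R)) :=
  [set w | forall i, A i (X i w)].

(** Enlarging the bounds by [e] absorbs the deviations of both sequences: the event for [X] passes
    to [X_ k], then to [Y_ k] by equality of laws, then to [Y]. The rays are closed, so they are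
    recovered as [e] decreases to 0. *)
Let le_of_limit (X Y : I -> T -> R) (X_ Y_ : nat -> I -> T -> R) :
  (forall i, measurable_fun setT (X i)) -> (forall i, measurable_fun setT (Y i)) ->
  (forall k i, measurable_fun setT (X_ k i)) ->
  (forall k i, measurable_fun setT (Y_ k i)) ->
  (forall k A, (forall i, measurable (A i)) -> P (mle (X_ k) A) = P (mle (Y_ k) A)) ->
  (forall i, {ae P, forall w, X_ ^~ i ^~ w @ \oo --> X i w}) ->
  (forall i, {ae P, forall w, Y_ ^~ i ^~ w @ \oo --> Y i w}) ->
  forall a, (P (mle X (oray \o a)) <= P (mle Y (oray \o a)))%E.
Proof.
move=> mX mY mX_ mY_ XY cX cY a.
pose D (U : I -> T -> R) (U_ : nat -> I -> T -> R) k w :=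
  \sum_(i : I) `|U_ k i w - U i w|.
have mD U U_ k : (forall i, measurable_fun setT (U i)) ->
    (forall k i, measurable_fun setT (U_ k i)) -> measurable_fun setT (D U U_ k).
  move=> mU mU_; apply: measurable_sum => i.
  by apply: measurableT_comp => //; exact: measurable_funB.
have cD U U_ : (forall i, {ae P, forall w, U_ ^~ i ^~ w @ \oo --> U i w}) ->
    {ae P, forall w, (D U U_) ^~ w @ \oo --> (0 : R)}.
  move=> cU; have : {ae P, forall w, forall i, U_ ^~ i ^~ w @ \oo --> U i w}.
    exact: filter_forall.
  apply: filterS => w cw.
  rewrite [X in _ --> X](_ : 0 = \sum_(i : I) `|U i w - U i w|); last first.
    by rewrite big1// => i _; rewrite subrr normr0.
  apply: cvg_sumr => i _; apply: cvg_norm; apply: cvgB => //; exact: cvg_cst.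
pose ap (e : R) := fun i => oray (omap (fun x => x + e) (a i)).
have map e i : measurable (ap e i) by exact: measurable_oray.
have shift U U_ k e e' : 0 < e' -> (forall i, measurable_fun setT (U i)) ->
    (forall k i, measurable_fun setT (U_ k i)) ->
    (P (mle U (ap e)) <= P (mle (U_ k) (ap (e + e'))%R) +
       P [set w | (e' <= `|D U U_ k w - 0|)%R])%E /\ (P (mle (U_ k) (ap e)) <= P (mle U (ap (e + e'))%R) +
       P [set w | (e' <= `|D U U_ k w - 0|)%R])%E.
  move=> e'0 mU mU_.
  have mS : measurable [set w | (e' <= `|D U U_ k w - 0|)%R].
    rewrite (_ : [set _ | _] = (fun w => `|D U U_ k w - 0|) @^-1` `[e', +oo[%classic); last first.
      by apply/seteqP; split => w; rewrite /=/= in_itv/= andbT.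
    rewrite -[X in measurable X]setTI.
    have : measurable_fun setT (fun w => `|D U U_ k w - 0|).
      by apply: measurableT_comp => //; apply: measurable_funB => //; exact: mD.
    exact.
  have mm V e1 : (forall i, measurable_fun setT (V i)) -> measurable (mle V (ap e1)).
    by move=> mV; exact: measurable_forall_preimage.
  have near (V V' : I -> T -> R) e1 w : (forall i, `|V i w - V' i w| <= e') ->
      mle V (ap e1) w -> mle V' (ap (e1 + e')) w.
    move=> VV' h i; have := h i; rewrite /ap/=; case: (a i) => //= x.
    rewrite !in_itv/= => Vx; have := VV' i; rewrite ler_norml => /andP[]; lra.
  have dle w i : ~ (e' <= `|D U U_ k w - 0|) -> `|U_ k i w - U i w| <= e'.
    rewrite subr0 => /negP; rewrite -ltNge => h; apply: ltW; apply: le_lt_trans h.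
    apply: (le_trans _ (ler_norm _)); rewrite /D (bigD1 i)//= lerDl.
    by rewrite sumr_ge0.
  have step (U1 U2 : I -> T -> R) : (forall i, measurable_fun setT (U1 i)) ->
      (forall i, measurable_fun setT (U2 i)) ->
      (forall w i, ~ (e' <= `|D U U_ k w - 0|) -> `|U1 i w - U2 i w| <= e') ->
      (P (mle U1 (ap e)) <= P (mle U2 (ap (e + e'))%R) +
        P [set w | (e' <= `|D U U_ k w - 0|)%R])%E.
    move=> mU1 mU2 h12; apply: (le_trans _ (measureU2 _ _ mS)); last exact: mm.
    apply: le_measure.
    - by rewrite inE; exact: mm.
    - by rewrite inE; apply: measurableU => //; exact: mm.
    - move=> w hw; have [|h] := pselect (e' <= `|D U U_ k w - 0|); first by right.
      by left; apply: near hw => i; exact: h12.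
  split.
    by apply: (step _ _ mU (mU_ k)) => w i h; rewrite distrC; exact: dle.
  by apply: (step _ _ (mU_ k) mU) => w i h; exact: dle.
have main (e : R) : 0 < e -> (P (mle X (oray \o a)) <= P (mle Y (ap e)))%E.
  move=> e0; apply/lee_addgt0Pr => dl dl0.
  have e20 : 0 < e / 2 by rewrite divr_gt0.
  have dl20 : 0 < dl / 2 by rewrite divr_gt0.
  have [k _ hk] := filterI
    (@ae_cvg_proba _ _ _ P (D X X_) (cst 0) _ _ (fun k => mD X X_ k mX mX_) (measurable_cst _) (cD _ _ cX) e20 dl20)
    (@ae_cvg_proba _ _ _ P (D Y Y_) (cst 0) _ _ (fun k => mD Y Y_ k mY mY_) (measurable_cst _) (cD _ _ cY) e20 dl20).
  have /= [hX hY] := hk k (leqnn k).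
  have -> : oray \o a = ap 0.
    by apply/funext => i; rewrite /ap/=; case: (a i) => //= x; rewrite addr0.
  have [h1 _] := shift X X_ k 0 _ e20 mX mX_.
  have [_ h2] := shift Y Y_ k (e / 2) _ e20 mY mY_.
  apply: (le_trans h1); rewrite add0r XY//.
  rewrite -splitr in h2.
  rewrite (splitr dl) EFinD addeA.
  apply: leeD; last exact: ltW.
  by apply: (le_trans h2); rewrite leeD2l// ltW.
have {}main k : (P (mle X (oray \o a)) <= P (mle Y (ap (k.+1%:R^-1)%R)))%E.
  exact: main.
have cv : P (mle Y (ap k.+1%:R^-1)) @[k --> \oo] --> P (mle Y (oray \o a)).
  have -> : mle Y (oray \o a) = \bigcap_k mle Y (ap k.+1%:R^-1).
    apply/seteqP; split => w.
      move=> h k _ i; have := h i; rewrite /ap/=; case: (a i) => //= x.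
      rewrite !in_itv/= => /le_trans; apply; by rewrite lerDl.
    move=> h i; rewrite /=; have hi k := h k Logic.I i; move: hi; rewrite /ap/=.
    case: (a i) => //= x hi; rewrite in_itv/=; apply/ler_addgt0Pr => e e0.
    have [k _ hk] := @near_infty_natSinv_lt R (PosNum e0).
    have := hi k; rewrite in_itv/= => /le_trans; apply; rewrite lerD2l ltW//.
    exact: (hk k (leqnn k)).
  apply: nonincreasing_cvg_mu.
  - by rewrite (le_lt_trans (probability_le1 _ _)) ?ltry//; exact: measurable_forall_preimage.
  - by move=> k; exact: measurable_forall_preimage.
  - by apply: bigcapT_measurable => k; exact: measurable_forall_preimage.
  - move=> k l kl; apply/subsetPset => w h i; have := h i; rewrite /ap.
    case: (a i) => //= x; rewrite !in_itv/= => /le_trans; apply.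
    by rewrite lerD2l lef_pV2 ?posrE// ler_nat.
by apply: (cvge_ge _ cv); apply: nearW => k; exact: main.
Qed.

(** Serves to identify the law of a limit: [X_] is a sequence of approximations, and [Y_] an
    explicit sequence with the same laws whose limit is known. Both live on one probability space,
    which spares any theory of convergence in law. *)
Lemma same_law_limit (X Y : I -> T -> R) (X_ Y_ : nat -> I -> T -> R) :
  (forall i, measurable_fun setT (X i)) -> (forall i, measurable_fun setT (Y i)) ->
  (forall k i, measurable_fun setT (X_ k i)) ->
  (forall k i, measurable_fun setT (Y_ k i)) ->
  (forall k (A : I -> set (measurableTypeR R)), (forall i, measurable (A i)) ->
    P [set w | forall i, A i (X_ k i w)] = P [set w | forall i, A i (Y_ k i w)]) ->
  (forall i, {ae P, forall w, X_ ^~ i ^~ w @ \oo --> X i w}) ->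
  (forall i, {ae P, forall w, Y_ ^~ i ^~ w @ \oo --> Y i w}) ->
  forall A : I -> set (measurableTypeR R), (forall i, measurable (A i)) ->
    P [set w | forall i, A i (X i w)] = P [set w | forall i, A i (Y i w)].
Proof.
move=> mX mY mX_ mY_ XY cX cY.
have base a : P (mle X (oray \o a)) = P (mle Y (oray \o a)).
  apply/eqP; rewrite eq_le; apply/andP; split.
    exact: (le_of_limit mX mY mX_ mY_).
  by apply: (le_of_limit mY mX mY_ mX_) => // k A mA; apply/esym; exact: XY.
(* The coordinates of [l] carry arbitrary Borel sets, the others still rays; each step frees one
   coordinate, by uniqueness of a measure given on rays. *)
have main (l : seq I) (A : I -> set (measurableTypeR R)) :
    (forall i, measurable (A i)) ->
    (forall i, i \notin l -> exists a, A i = oray a) ->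
    P (mle X A) = P (mle Y A).
  elim: l A => [|i0 l IH] A mA lA.
    have /choice[a aE] : forall i, exists a, A i = oray a by move=> i; exact: lA.
    by have -> : A = oray \o a by apply/funext => i; exact: aE.
  pose AT (B : set (measurableTypeR R)) i := if i == i0 then B else A i.
  have mAT B : measurable B -> forall i, measurable (AT B i).
    by move=> mB i; rewrite /AT; case: ifP.
  have mG (V : I -> T -> R) : (forall i, measurable_fun setT (V i)) ->
      measurable (mle V (AT setT)).
    by move=> mV; apply: measurable_forall_preimage => // i; exact: mAT.
  pose law (V : I -> T -> R) (mV : forall i, measurable_fun setT (V i)) :
      {measure set (measurableTypeR R) -> \bar R} :=
    @restr_law _ T R P _ (mG V mV) _ (measurableTypeR R) (V i0) (mV i0).
  have lE (V : I -> T -> R) (mV : forall i, measurable_fun setT (V i)) B :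
      law V mV B = P (mle V (AT B)).
    transitivity (P (mle V (AT setT) `&` V i0 @^-1` B)) => //; congr (P _); apply/seteqP; split => w.
      move=> [h hB] i; have := h i; rewrite /AT; case: ifPn => // /eqP -> _.
      exact: hB.
    move=> h; split; last by have := h i0; rewrite /AT eqxx.
    by move=> i; have := h i; rewrite /AT; case: ifP.
  have ray B : oray B = if B is Some x then `]-oo, x]%classic else setT by [].
  have mo a : measurable (oray a) by exact: measurable_oray.
  have step a : P (mle X (AT (oray a))) = P (mle Y (AT (oray a))).
    apply: IH => [i|i il]; first exact: mAT.
    rewrite /AT; case: ifPn => [_|ii0]; first by exists a.
    by apply: lA; rewrite inE negb_or ii0.
  have AE : A = AT (A i0).
    by apply/funext => i; rewrite /AT; case: ifPn => [/eqP->|].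
  rewrite AE -(lE X mX) -(lE Y mY).
  apply: (@finite_measure_eq_ray _ (law X mX) (law Y mY)).
  - rewrite lE (le_lt_trans (probability_le1 _ _)) ?ltry//.
    by apply: measurable_forall_preimage => // i; exact: mAT.
  - by rewrite !lE; exact: (step None).
  - by move=> x; rewrite !lE; exact: (step (Some x)).
  - exact: mA.
move=> A mA; apply: (main (enum I)) => // i.
by rewrite mem_enum.
Qed.

End same_law_limit.

(** * Moments of Gaussian variables *)

Section normal_moments.
Variable R : realType.
Local Notation N := (normal_prob (0 : R) 1).

Lemma integral_normal_exp (k q : R) : 0 < q -> q ^+ 2 = 1 - k *+ 2 ->
  (\int[N]_x (expR (k * x ^+ 2))%:E = (q^-1)%:E)%E.
Proof.
move=> q0 qk; rewrite ge0_integral_normal//; last first.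
  apply/measurable_EFinP; apply: measurableT_comp => //.
  by apply: measurable_funM => //; exact: measurable_funX.
under eq_integral => x _.
  rewrite -EFinM (_ : _ * _ = q^-1 * normal_pdf 0 q^-1 x); last first.
    rewrite !normal_pdfE ?invr_neq0 ?gt_eqF// /normal_peak /normal_fun !subr0.
    rewrite mulrCA -expRD [RHS]mulrA; congr (_ * expR _).
      rewrite expr1n mul1r -mulrnAr sqrtrM ?sqr_ge0// sqrtr_sqr ger0_norm ?invr_ge0 ?ltW//.
      by rewrite invfM invrK mulKf// gt_eqF.
    transitivity (- x ^+ 2 * q ^+ 2 / 2); first by rewrite qk; field.
    by field; rewrite gt_eqF.
  rewrite EFinM; over.
rewrite ge0_integralZl//.
- by rewrite integral_normal_pdf mule1.
- by apply/measurable_EFinP; exact: measurable_normal_pdf.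
- by move=> x _; rewrite lee_fin normal_pdf_ge0.
- by rewrite lee_fin invr_ge0 ltW.
Qed.

(** The exponent [1 / 4] lies below the critical value [1 / 2]: the previous formula applies with
    [q ^ 2 = 1 / 2]. *)
Lemma integrable_normal_expR (C : R) (f : measurableTypeR R -> R) :
  measurable_fun setT f -> (forall x, `|f x| <= C * expR (4^-1 * x ^+ 2)) ->
  N.-integrable setT (EFin \o f).
Proof.
move=> mf fC.
have q0 : 0 < Num.sqrt (2^-1) :> R by rewrite sqrtr_gt0 invr_gt0.
have qk : Num.sqrt (2^-1) ^+ 2 = 1 - 4^-1 *+ 2 :> R.
  by rewrite sqr_sqrtr ?invr_ge0//; lra.
have mexp : measurable_fun setT (fun x : measurableTypeR R => expR (4^-1 * x ^+ 2)).
  by apply: measurableT_comp => //; apply: measurable_funM => //; exact: measurable_funX.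
have iexp : N.-integrable setT (fun x => (expR (4^-1 * x ^+ 2))%:E).
  apply/integrableP; split; first exact/measurable_EFinP.
  under eq_integral do rewrite gee0_abs ?lee_fin ?expR_ge0//.
  by rewrite (integral_normal_exp q0 qk) ltry.
have := @integrableZl _ _ _ N setT measurableT C _ iexp.
apply: le_integrable => //; first exact/measurable_EFinP.
move=> x _ /=; rewrite lee_fin.
by rewrite (le_trans (fC x))// ler_norm.
Qed.

(** With [y = x ^ 2] and [e = expR (y / 8)], the bound [1 + y / 8 <= e] gives [1 <= e ^ 2] and
    [y ^ 2 <= 64 e ^ 2], whence [65]. *)
Lemma normal_mean_bound (x : R) k : (k <= 4)%N ->
  `|x| ^+ k <= 65 * expR (4^-1 * x ^+ 2).
Proof.
move=> k4.
have h1 : `|x| ^+ k <= 1 + x ^+ 4.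
  have [x1|x1] := leP `|x| 1.
    rewrite (@le_trans _ _ 1) ?exprn_ile1// lerDl.
    by rewrite exprn_even_ge0.
  apply: (@le_trans _ _ (`|x| ^+ 4)); first by rewrite ler_weXn2l// ltW.
  by rewrite -normrX ger0_norm ?exprn_even_ge0// lerDr.
apply: (le_trans h1).
have y0 : 0 <= 4^-1 * x ^+ 2 by rewrite mulr_ge0// sqr_ge0.
have h2 : expR (4^-1 * x ^+ 2) = expR (8^-1 * x ^+ 2) ^+ 2.
  by rewrite -expRM_natl; congr expR; lra.
have h3 : 1 + 8^-1 * x ^+ 2 <= expR (8^-1 * x ^+ 2) by exact: expR_ge1Dx.
have x20 : 0 <= x ^+ 2 by exact: sqr_ge0.
have x44 : x ^+ 4 = x ^+ 2 * x ^+ 2 by rewrite -exprD.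
rewrite h2 x44; move: h3 x20; set e := expR _; set y := x ^+ 2 => h3 x20.
have : (1 + 8^-1 * y) ^+ 2 <= e ^+ 2 by rewrite ler_pXn2r// nnegrE; lra.
nra.
Qed.

Lemma integrable_normal_poly k (k4 : (k <= 4)%N) :
  N.-integrable setT (EFin \o (fun x : measurableTypeR R => x ^+ k)).
Proof.
apply: (@integrable_normal_expR 65); first exact: measurable_funX.
by move=> x; rewrite normrX; exact: normal_mean_bound.
Qed.

(** The second moment is read off from the exponential one: for [ep = 2 dl + dl ^ 2], the mean of
    [expR (- (ep / 2) x ^ 2)] is [1 / (1 + dl)]. Expanding to first order in [dl] gives 1, and the
    fourth moment controls the error. *)
Lemma integral_normal_sqr : (\int[N]_x (x ^+ 2)%:E = 1)%E.
Proof.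
pose m2 := \int[N]_x (x ^+ 2); pose m4 := \int[N]_x (x ^+ 4).
have i2 := integrable_normal_poly (isT : (2 <= 4)%N).
have i4 := integrable_normal_poly (isT : (4 <= 4)%N).
have i1 : N.-integrable setT (EFin \o cst (1 : R)).
  exact: finite_measure_integrable_cst.
have I1 : \int[N]_x (cst (1 : R)) x = 1.
  by rewrite Rintegral_cst// mul1r (_ : _ setT = 1%E)// [LHS]normal_probT.
have main (dl : R) : 0 < dl ->
    (dl *+ 2 + dl ^+ 2) * m2 / 2 - (dl *+ 2 + dl ^+ 2) ^+ 2 * m4 / 4 <= dl / (1 + dl) <=
    (dl *+ 2 + dl ^+ 2) * m2 / 2.
  move=> dl0; set ep := dl *+ 2 + dl ^+ 2.
  have ep0 : 0 < ep by rewrite addr_gt0 ?exprn_gt0// pmulrn_lgt0.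
  have q0 : 0 < 1 + dl by rewrite addr_gt0.
  have qk : (1 + dl) ^+ 2 = 1 - (- (ep / 2)) *+ 2 by rewrite /ep; lra.
  have Ie := integral_normal_exp q0 qk.
  pose f (x : measurableTypeR R) : R := expR (- (ep / 2) * x ^+ 2).
  have fE : \int[N]_x f x = (1 + dl)^-1 by rewrite /Rintegral Ie.
  have if_ : N.-integrable setT (EFin \o f).
    apply/integrableP; split.
      apply/measurable_EFinP; apply: measurableT_comp => //.
      by apply: measurable_funM => //; exact: measurable_funX.
    under eq_integral do rewrite /= ger0_norm ?expR_ge0//.
    by rewrite Ie ltry.
  have -> : dl / (1 + dl) = \int[N]_x (cst 1 x - f x).
    by rewrite RintegralB// I1 fE; field; rewrite gt_eqF.
  have i2e : N.-integrable setT (EFin \o (fun x => ep / 2 * x ^+ 2)).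
    by have := @integrableZl _ _ _ N setT measurableT (ep / 2) _ i2.
  have i4e : N.-integrable setT (EFin \o (fun x => ep ^+ 2 / 4 * x ^+ 4)).
    by have := @integrableZl _ _ _ N setT measurableT (ep ^+ 2 / 4) _ i4.
  have -> : ep * m2 / 2 = \int[N]_x (ep / 2 * x ^+ 2).
    by rewrite RintegralZl// -/m2; lra.
  have -> : ep ^+ 2 * m4 / 4 = \int[N]_x (ep ^+ 2 / 4 * x ^+ 4).
    by rewrite RintegralZl// -/m4; lra.
  have i1f : N.-integrable setT (EFin \o (fun x => cst 1 x - f x)).
    by have := @integrableB _ _ _ N setT measurableT _ _ i1 if_.
  have i24 : N.-integrable setT (EFin \o (fun x => ep / 2 * x ^+ 2 - ep ^+ 2 / 4 * x ^+ 4)).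
    by have := @integrableB _ _ _ N setT measurableT _ _ i2e i4e.
  rewrite -RintegralB//; apply/andP; split; apply: le_Rintegral => // x _.
    rewrite /f/=; set y := ep / 2 * x ^+ 2.
    have y0 : 0 <= y by rewrite mulr_ge0 ?sqr_ge0// ltW// divr_gt0.
    have -> : ep ^+ 2 / 4 * x ^+ 4 = y ^+ 2.
      by rewrite /y exprMn -exprM; field.
    rewrite mulNr -/y.
    have h : 1 + y <= expR y by exact: expR_ge1Dx.
    have h2 : expR (- y) <= (1 + y)^-1.
      by rewrite expRN lef_pV2 ?posrE ?expR_gt0//; lra.
    have h3 : (1 + y)^-1 <= 1 - y + y ^+ 2.
      rewrite -[leLHS]mul1r ler_pdivrMr; last lra.
      have : 0 <= y ^+ 3 by rewrite exprn_ge0.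
      by rewrite !exprS expr0; lra.
    lra.
  rewrite /f/= mulNr; have := expR_ge1Dx (- (ep / 2 * x ^+ 2)); lra.
have m40 : 0 <= m4.
  by apply: Rintegral_ge0 => x _; rewrite exprn_even_ge0.
have m20 : 0 <= m2 by apply: Rintegral_ge0 => x _; rewrite sqr_ge0.
have main2 (dl : R) : 0 < dl -> dl <= 1 -> `|m2 - 1| <= dl * (3 * m2 + 9 * m4 + 3).
  move=> dl0 dl1; have /andP[h1 h2] := main dl dl0.
  have q0 : 0 < 1 + dl by lra.
  have h3 : (1 + dl)^-1 <= 1 by rewrite invf_le1; lra.
  have h4 : 1 - dl <= (1 + dl)^-1.
    by rewrite -[leRHS]mul1r ler_pdivlMr//; nra.
  have e1 : (dl *+ 2 + dl ^+ 2) * m2 / 2 = dl * ((1 + dl / 2) * m2) by field.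
  have e2 : (dl *+ 2 + dl ^+ 2) ^+ 2 * m4 / 4 = dl * (dl * (1 + dl / 2) ^+ 2 * m4) by field.
  have {}h1 : (1 + dl / 2) * m2 - dl * (1 + dl / 2) ^+ 2 * m4 <= (1 + dl)^-1.
    by move: h1; rewrite e1 e2 -mulrBr ler_pM2l.
  have {}h2 : (1 + dl)^-1 <= (1 + dl / 2) * m2 by move: h2; rewrite e1 ler_pM2l.
  have h5 : (1 + dl / 2) ^+ 2 <= 9 by rewrite expr2; nra.
  have h6 : dl * ((1 + dl / 2) ^+ 2 * m4) <= dl * (9 * m4).
    by rewrite ler_pM2l// ler_wpM2r.
  have h7 : 0 <= dl * m2 by rewrite mulr_ge0// ltW.
  have h8 : 0 <= dl * m4 by rewrite mulr_ge0// ltW.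
  rewrite ler_norml; apply/andP; split; nra.
have -> : (\int[N]_x (x ^+ 2)%:E = m2%:E)%E.
  by rewrite /m2 /Rintegral fineK//; exact: integrable_fin_num i2.
suff -> : m2 = 1 by [].
apply/eqP; rewrite -subr_eq0 -normr_le0; apply/ler_addgt0Pr => e e0; rewrite add0r.
pose K := 3 * m2 + 9 * m4 + 3.
have K0 : 0 < K by rewrite /K; lra.
have [eK|eK] := leP (e / K) 1.
  rewrite (le_trans (main2 (e / K) _ eK))//; first exact: divr_gt0.
  by rewrite -/K divfK// gt_eqF.
rewrite (le_trans (main2 1 _ _))// mul1r -/K.
by move: eK; rewrite ltr_pdivlMr// mul1r => /ltW.
Qed.

End normal_moments.

Lemma ge0_integral_same_law d1 d2 d3 (T1 : measurableType d1)
    (T2 : measurableType d2) (U : measurableType d3) (R : realType)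
    (P1 : {measure set T1 -> \bar R}) (P2 : {measure set T2 -> \bar R})
    (X1 : T1 -> U) (X2 : T2 -> U) (f : U -> \bar R) :
  measurable_fun setT X1 -> measurable_fun setT X2 ->
  (forall A, measurable A -> P1 (X1 @^-1` A) = P2 (X2 @^-1` A)) ->
  measurable_fun setT f -> (forall x, 0 <= f x)%E ->
  (\int[P1]_w f (X1 w) = \int[P2]_w f (X2 w))%E.
Proof.
move=> mX1 mX2 h mf f0.
have := @ge0_integral_pushforward _ _ _ _ R X1 mX1 P1 setT f measurableT mf (fun x _ => f0 x).
rewrite preimage_setT => <-.
have := @ge0_integral_pushforward _ _ _ _ R X2 mX2 P2 setT f measurableT mf (fun x _ => f0 x).
rewrite preimage_setT => <-.
by apply: eq_measure_integral => A mA _; exact: h.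
Qed.

Definition has_gauss d (T : measurableType d) (R : realType)
    (P : probability T R) (X : T -> R) (s : R) :=
  measurable_fun setT X /\
  forall A : set (measurableTypeR R), measurable A -> P (X @^-1` A) = gauss s A.

Lemma has_gaussZ d (T : measurableType d) (R : realType) (P : probability T R)
    (X : T -> R) (s a : R) :
  has_gauss P X s -> has_gauss P (fun w => a * X w) (a * s).
Proof.
move=> [mX hX]; split=> [|A mA]; first exact: measurable_funM.
have mA' : measurable [set x : measurableTypeR R | A (a * x)].
  by have := @measurable_mulrl R a measurableT A mA; rewrite setTI.
transitivity (P (X @^-1` [set x | A (a * x)])) => //.
transitivity (gauss s [set x : measurableTypeR R | A (a * x)]); first exact: hX.
rewrite !gauss_scale; congr (normal_prob _ _ _).
by apply/seteqP; split => x /=; rewrite mulrA.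
Qed.

Section has_gauss_moments.
Context d (T : measurableType d) (R : realType) (P : probability T R).
Context (X : T -> R) (s : R) (Xs : has_gauss P X s).

Lemma ge0_integral_has_gauss (f : measurableTypeR R -> \bar R) :
  measurable_fun setT f -> (forall x, 0 <= f x)%E ->
  (\int[P]_w f (X w) = \int[normal_prob 0 1]_x f (s * x)%R)%E.
Proof.
move=> mf f0; have [mX hX] := Xs.
exact: (@ge0_integral_same_law _ _ _ T (measurableTypeR R) (measurableTypeR R)
  R P (normal_prob 0 1) X (fun x : measurableTypeR R => (s * x : measurableTypeR R))
  f mX (@measurable_mulrl R s) hX mf f0).
Qed.

Lemma has_gauss_sqr : (\int[P]_w (X w ^+ 2)%:E = (s ^+ 2)%:E)%E.
Proof.
rewrite (@ge0_integral_has_gauss (fun x => (x ^+ 2)%:E)); last 2 first.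
- by apply/measurable_EFinP; exact: measurable_funX.
- by move=> x; rewrite lee_fin sqr_ge0.
under eq_integral do rewrite exprMn EFinM.
rewrite ge0_integralZl//.
- by rewrite integral_normal_sqr mule1.
- by apply/measurable_EFinP; exact: measurable_funX.
- by move=> x _; rewrite lee_fin sqr_ge0.
- by rewrite lee_fin sqr_ge0.
Qed.

Lemma has_gauss_integrable k (f : measurableTypeR R -> R) : (k <= 4)%N ->
  measurable_fun setT f -> (forall x, `|f x| <= `|x| ^+ k) ->
  P.-integrable setT (fun w => (f (X w))%:E).
Proof.
move=> k4 mf fk; have [mX hX] := Xs; apply/integrableP; split.
  by apply/measurable_EFinP; exact: (measurableT_comp mf).
rewrite (@ge0_integral_has_gauss (fun x => `|(f x)%:E|%E)); last 2 first.
- by apply: measurableT_comp => //; exact/measurable_EFinP.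
- by [].
have mfs : measurable_fun setT (fun x : measurableTypeR R => f (s * x)).
  exact: (measurableT_comp mf (@measurable_mulrl R s)).
have /integrableP[_] : (normal_prob 0 1).-integrable setT
    (EFin \o (fun x : measurableTypeR R => f (s * x))).
  apply: (@integrable_normal_expR R (`|s| ^+ k * 65)) => // x.
  rewrite (le_trans (fk _))// normrM exprMn -mulrA ler_wpM2l ?exprn_ge0//.
  exact: normal_mean_bound.
by apply: le_lt_trans; apply: ge0_le_integral => //=; exact/measurable_EFinP/measurableT_comp.
Qed.

(** By symmetry the positive and the negative part have the same finite integral. *)
Lemma has_gauss_mean : (\int[P]_w (X w)%:E = 0)%E.
Proof.
have [mX hX] := Xs.
have iX : P.-integrable setT (fun w => (X w)%:E).
  exact: (@has_gauss_integrable 1 id).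
have mN : measurable_fun setT (fun w => - X w) by exact: measurableT_comp.
have pos : (\int[P]_w (Num.max (X w) 0)%:E = \int[P]_w (Num.max (- X w) 0)%:E)%E.
  apply: (@ge0_integral_same_law _ _ _ T T (measurableTypeR R) R P P X (fun w => - X w)
    (fun x => (Num.max x 0)%:E)) => //.
  - move=> A mA; transitivity (gauss s A); first exact: hX.
    have [_ hN] := has_gaussZ (-1) Xs.
    rewrite -gaussN// -[in LHS]mulN1r -hN//.
    by congr (P _); apply/seteqP; split => w /=; rewrite mulN1r.
  - apply/measurable_EFinP; exact: measurable_maxr.
  - by move=> x; rewrite lee_fin le_max lexx orbT.
have ip (Y : T -> R) : measurable_fun setT Y -> (forall w, `|Y w| <= `|X w|) ->
    P.-integrable setT (fun w => (Num.max (Y w) 0)%:E).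
  move=> mY YX; apply: (le_integrable _ _ _ iX) => //.
    by apply/measurable_EFinP; exact: measurable_maxr.
  move=> w _ /=; rewrite lee_fin; apply: le_trans (YX w).
  by case: (leP (Y w) 0) => h; rewrite ?normr0.
transitivity (\int[P]_w ((Num.max (X w) 0)%:E - (Num.max (- X w) 0)%:E))%E.
  apply: eq_integral => w _; rewrite -EFinB; congr EFin.
  by rewrite /Num.max; case: ifP; case: ifP; lra.
rewrite integralB//; [|exact: ip|by apply: ip => // w; rewrite normrN].
rewrite pos subee//; apply: integrable_fin_num => //.
by apply: ip => // w; rewrite normrN.
Qed.
End has_gauss_moments.

(** * Small balls, tails and limits of Gaussian variables *)

(** The density is at most [1 / |s|]: a large variance leaves little mass in a fixed ball. *)
Lemma gauss_small_ball (R : realType) (s K : R) : s != 0 -> 0 <= K ->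
  (gauss s [set x : measurableTypeR R | (`|x : R| <= K)%R] <= (K *+ 2 / `|s|)%:E)%E.
Proof.
move=> s0 K0.
have -> : [set x : measurableTypeR R | (`|x : R| <= K)%R] = `[(- K), K]%classic.
  by apply/seteqP; split => x; rewrite /= in_itv/= ler_norml.
have s1 : 0 < `|s| by rewrite normr_gt0.
have mK : measurable (`[(- K), K]%classic : set (measurableTypeR R)) by exact: measurable_itv.
rewrite -gauss_norm// gauss_gt0E// normal_probE.
apply: (@le_trans _ _ (\int[lebesgue_measure]_(x in `[(- K)%R, K]) (`|s|^-1)%:E)%E).
  apply: ge0_le_integral => //.
  - by move=> x _; rewrite lee_fin normal_pdf_ge0.
  - by apply/measurable_EFinP/measurable_funTS; exact: measurable_normal_pdf.
  - move=> x _; rewrite lee_fin (le_trans (normal_pdf_ub _ _ _)) ?gt_eqF//.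
    rewrite /normal_peak lef_pV2 ?posrE//; last first.
      by rewrite sqrtr_gt0 pmulrn_lgt0// mulr_gt0 ?pi_gt0// exprn_gt0.
    have {1}-> : `|s| = Num.sqrt (`|s| ^+ 2) by rewrite sqrtr_sqr normr_id.
    rewrite ler_wsqrtr// -mulrnAr ler_peMr ?sqr_ge0//.
    by have := @pi_ge2 R; rewrite mulr2n; lra.
rewrite integral_cst//= lebesgue_measure_itv/= lte_fin.
case: ifPn => h; last by rewrite mule0 lee_fin mulr_ge0// ?mulrn_wge0// invr_ge0 ltW.
by rewrite -EFinB -EFinM lee_fin opprK mulrC mulr2n.
Qed.

(** [X / (k + 1)] tends to 0 everywhere, hence in probability. *)
Lemma tight d (T : measurableType d) (R : realType) (P : probability T R)
    (X : T -> R) (e : R) : measurable_fun setT X -> 0 < e ->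
  exists2 M : R, 0 < M & (P [set w | (M <= `|X w|)%R] < e%:E)%E.
Proof.
move=> mX e0.
pose f_ (k : nat) w := k.+1%:R^-1 * X w.
have mf k : measurable_fun setT (f_ k) by exact: measurable_funM.
have cf : {ae P, forall w, f_ ^~ w @ \oo --> cst (0 : R) w}.
  apply: aeW => w.
  rewrite /= -(mul0r (X w)).
  by apply: (@cvgM _ _ _ _ (fun k => k.+1%:R^-1) (fun=> X w)); [exact: cvg_harmonic|exact: cvg_cst].
have [k _ hk] := ae_cvg_proba mf (measurable_cst _) cf ltr01 e0.
exists k.+1%:R => //; have := hk k (leqnn k); congr (_ < _)%E; congr (P _).
apply/seteqP; split => w /=; rewrite /f_ subr0 normrM ger0_norm ?invr_ge0//.
  by rewrite ler_pdivlMl// mulr1.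
by rewrite ler_pdivlMl// mulr1.
Qed.

(** The deviations are bounded, for otherwise the small ball estimate would contradict the tightness
    of [X]; a cluster point [p] of their absolute values is the deviation of the limit. The variable
    [g] realises the comparison laws on the same space. The subsequence belongs to the conclusion
    because later bounds pass to the limit along it. *)
Lemma has_gauss_limit d (T : measurableType d) (R : realType)
    (P : probability T R) (X : T -> R) (X_ : nat -> T -> R) (s : nat -> R)
    (g : T -> R) :
  has_gauss P g 1 -> (forall k, has_gauss P (X_ k) (s k)) ->
  measurable_fun setT X -> {ae P, forall w, X_ ^~ w @ \oo --> X w} ->
  exists p : R, exists2 phi : nat -> nat,
    (forall k, (k <= phi k)%N) /\ `|s (phi k)| @[k --> \oo] --> p &
    0 <= p /\ has_gauss P X p.
Proof.
move=> Pg PX mX XX.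
have q4 : 0 < 4^-1 :> R by rewrite invr_gt0.
have [M M0 PM] := tight P mX q4.
have [N _ hN] := ae_cvg_proba (fun k => (PX k).1) mX XX ltr01 q4.
(* If [|s k|] exceeded [4 (M + 1)], three events of probabilities at most 1/2, below 1/4 and below
   1/4 would cover the space. *)
have sb k : (N <= k)%N -> `|s k| <= (M + 1) *+ 4.
  move=> Nk; rewrite leNgt; apply/negP => sk.
  have M10 : 0 < M + 1 by rewrite addr_gt0.
  have sk0 : 0 < `|s k| by apply: le_lt_trans sk; rewrite mulrn_wge0 ?ltW.
  have s0 : s k != 0 by rewrite -normr_gt0.
  have mB (Y : T -> R) (B : set (measurableTypeR R)) : measurable_fun setT Y ->
      measurable B -> measurable (Y @^-1` B).
    by move=> mY mB; rewrite -[X in measurable X]setTI; exact: (mY measurableT B mB).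
  have mball (K : R) : measurable [set x : measurableTypeR R | (`|x : R| <= K)%R].
    rewrite (_ : [set _ | _] = `[(- K), K]%classic); first exact: measurable_itv.
    by apply/seteqP; split => x; rewrite /= in_itv/= ler_norml.
  have mballC (K : R) : measurable [set x : measurableTypeR R | (K <= `|x : R|)%R].
    have mn : measurable_fun setT (fun x : measurableTypeR R => (`|x : R| : measurableTypeR R)).
      exact: measurableT_comp.
    have := mn measurableT `[K, +oo[%classic (measurable_itv _); rewrite setTI.
    by congr measurable; apply/seteqP; split => x; rewrite /= in_itv/= andbT.
  have m1 := mB _ _ (PX k).1 (mball (M + 1)).
  have m2 := mB _ _ mX (mballC M).
  have mD : measurable_fun setT (fun w => X_ k w - X w).
    by apply: measurable_funB => //; exact: (PX k).1.
  have m3 := mB _ _ mD (mballC 1).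
  have cover : setT `<=` (X_ k @^-1` [set x | `|x| <= M + 1] `|`
     (X @^-1` [set x | M <= `|x|])) `|` ((fun w => X_ k w - X w) @^-1` [set x | 1 <= `|x|]).
    move=> w _ /=; have [h|h] := leP 1 `|X_ k w - X w|; first by right.
    left; have [h'|h'] := leP M `|X w|; first by right.
    left; rewrite -[X_ k w](subrK (X w)) (le_trans (ler_normD _ _))//.
    by rewrite addrC lerD// ltW.
  have h1 : (P (X_ k @^-1` [set x | (`|x| <= M + 1)%R]) <= (2^-1)%:E)%E.
    rewrite (PX k).2//; apply: le_trans (gauss_small_ball s0 (ltW M10)) _.
    rewrite lee_fin ler_pdivrMr//; lra.
  set E1 := X_ k @^-1` _ in m1 h1 cover; set E2 := X @^-1` _ in m2 cover.
  set E3 := (fun w => _) @^-1` _ in m3 cover.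
  have : (P setT <= ((2^-1 : R)%:E + (4^-1)%:E) + P E3)%E.
    apply: (@le_trans _ _ (P ((E1 `|` E2) `|` E3))).
      by apply: le_measure; rewrite ?inE//; apply: measurableU => //; exact: measurableU.
    apply: (le_trans (measureU2 _ _ _)) => //; first exact: measurableU.
    rewrite leeD2r//; apply: (le_trans (measureU2 _ _ _)) => //.
    by apply: leeD => //; exact: ltW.
  rewrite probability_setT; apply/negP; rewrite -ltNge.
  apply: (@lt_le_trans _ _ ((2^-1 : R)%:E + (4^-1)%:E + (4^-1)%:E)%E).
    rewrite lteD2lE// ?fin_numD//; exact: hN.
  by rewrite -!EFinD lee_fin; lra.
have ccl : compact (`[0, (M + 1) *+ 4]%classic : set R) by exact: segment_compact.
have [] := ccl ((fun k => `|s k|) @ \oo) _ _.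
  exists N => // k /= Nk; rewrite in_itv/= normr_ge0; exact: sb.
move=> p [pK clp].
have sel k : exists j, (k <= j)%N /\ `| `|s j| - p | < k.+1%:R^-1.
  have kp : 0 < k.+1%:R^-1 :> R by rewrite invr_gt0.
  have [|//|x [[j kj ->] hj]] := clp [set x | exists2 j, (k <= j)%N & x = `|s j|]
    (ball p k.+1%:R^-1).
  - by exists k => // j /= kj; exists j.
  - exact: nbhsx_ballx.
  by exists j; split => //; rewrite distrC.
have [phi phiP] := choice sel.
have phi_cvg : phi k @[k --> \oo] --> \oo.
  by move=> A [m _ mA]; exists m => // k /= mk; apply: mA => /=; exact: leq_trans (phiP k).1.
have sphi : `|s (phi k)| @[k --> \oo] --> p.
  apply/cvgrPdist_lt => e e0; near=> k; rewrite distrC (lt_trans (phiP k).2)//.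
  by near: k; exact: near_infty_natSinv_lt (PosNum e0).
exists p, phi; first by split => // k; exact: (phiP k).1.
split; first by move: pK; rewrite /= in_itv/= => /andP[].
split=> // A mA.
have mg := Pg.1.
pose law := @same_law_limit _ T R P unit (fun=> X) (fun _ w => p * g w)
  (fun k _ => X_ (phi k)) (fun k _ w => `|s (phi k)| * g w).
have hg (q : R) B : measurable B -> P [set w | B (q * g w)] = gauss q B.
  by move=> mB; have [_ h] := has_gaussZ q Pg; rewrite -[X in gauss X]mulr1 -h.
have E (B : set T) : [set w | unit -> B w] = B.
  by apply/seteqP; split => w /=; [apply; exact: tt|move=> h []].
transitivity (P [set w | unit -> (X @^-1` A) w]); first by rewrite E.
transitivity (P [set w | unit -> A (p * g w)]); last by rewrite E hg.
apply: (law (fun=> mX) (fun=> measurable_funM (measurable_cst _) mg)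
  (fun k _ => (PX (phi k)).1)
  (fun k _ => measurable_funM (measurable_cst _) mg) _ _ _ (fun=> A)) => //.
- move=> k B mB.
  have E2 (Y : T -> R) : [set w | forall i : unit, B i (Y w)] = Y @^-1` B tt.
    by apply/seteqP; split => w /=; [exact|move=> h []].
  rewrite !E2 (PX (phi k)).2//; transitivity (gauss `|s (phi k)| (B tt)).
    by rewrite gauss_norm.
  by rewrite -(hg _ _ (mB tt)).
- move=> _; apply: filterS XX => w Xw; exact: (cvg_comp _ _ phi_cvg Xw).
- move=> _; apply: aeW => w; apply: cvgM => //; exact: cvg_cst.
Unshelve. all: by end_near.
Qed.

(** The ratio of the two densities decreases with [|x|], so beyond [y] it is at most its value at
    [y]. *)
Lemma gauss_tail_ratio (R : realType) (s t y : R) : 0 < s -> s < t -> 0 <= y ->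
  (gauss s [set x : measurableTypeR R | (y < `|x : R|)%R] <=
   (t / s * expR (- ((s ^- 2 - t ^- 2) / 2) * y ^+ 2))%:E *
   gauss t [set x : measurableTypeR R | (y < `|x : R|)%R])%E.
Proof.
move=> s0 st y0; have t0 : 0 < t by exact: lt_trans st.
set D := [set x | _]; set C := _ * expR _.
have mD : measurable (D : set (measurableTypeR R)).
  have mn : measurable_fun setT (fun x : measurableTypeR R => (`|x : R| : measurableTypeR R)).
    exact: measurableT_comp.
  have := mn measurableT `]y, +oo[%classic (measurable_itv _); rewrite setTI.
  by congr measurable; apply/seteqP; split => x; rewrite /= in_itv/= andbT.
rewrite !gauss_gt0E// !normal_probE -ge0_integralZl//; last 3 first.
- by apply/measurable_EFinP/measurable_funTS; exact: measurable_normal_pdf.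
- by move=> x _; rewrite lee_fin normal_pdf_ge0.
- by rewrite lee_fin mulr_ge0 ?expR_ge0// divr_ge0 ?ltW.
apply: ge0_le_integral => //.
- by move=> x _; rewrite lee_fin normal_pdf_ge0.
- by apply/measurable_EFinP/measurable_funTS; exact: measurable_normal_pdf.
- apply/measurable_EFinP/measurable_funTS; apply: measurable_funM => //.
  exact: measurable_normal_pdf.
move=> x Dx; rewrite -EFinM lee_fin !normal_pdfE ?gt_eqF// /normal_peak /normal_fun !subr0.
have pk (u : R) : 0 < u -> (Num.sqrt (u ^+ 2 * pi *+ 2))^-1 = u^-1 * (Num.sqrt (pi *+ 2))^-1.
  by move=> u0; rewrite -mulrnAr sqrtrM ?sqr_ge0// sqrtr_sqr gtr0_norm// invfM.
rewrite !pk// /C mulrACA -expRD.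
have -> : t / s * (t^-1 * (Num.sqrt (pi *+ 2))^-1) = s^-1 * (Num.sqrt (pi *+ 2))^-1.
  by rewrite mulrA; congr (_ / _); field; rewrite !gt_eqF.
rewrite ler_wpM2l ?divr_ge0 ?sqrtr_ge0 ?invr_ge0 ?(ltW s0)// ler_expR.
have xy : y ^+ 2 <= x ^+ 2.
  rewrite -(real_normK (num_real x)) ler_pXn2r ?nnegrE//; exact: ltW.
have h : 0 <= (s ^- 2 - t ^- 2) / 2.
  rewrite divr_ge0// subr_ge0 lef_pV2 ?posrE ?exprn_gt0//.
  by rewrite ler_pXn2r ?nnegrE ?ltW.
have -> : - x ^+ 2 / (s ^+ 2 *+ 2) = - ((s ^- 2 - t ^- 2) / 2) * x ^+ 2 + - x ^+ 2 / (t ^+ 2 *+ 2).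
  by field; rewrite !gt_eqF.
by rewrite lerD2r !mulNr lerN2 ler_wpM2l.
Qed.

Lemma gauss_tail_gt0 (R : realType) (s y : R) : 0 < s -> 0 <= y ->
  (0 < gauss s [set x : measurableTypeR R | (y < `|x : R|)%R])%E.
Proof.
move=> s0 y0; set D := [set x | _].
have mD : measurable (D : set (measurableTypeR R)).
  have mn : measurable_fun setT (fun x : measurableTypeR R => (`|x : R| : measurableTypeR R)).
    exact: measurableT_comp.
  have := mn measurableT `]y, +oo[%classic (measurable_itv _); rewrite setTI.
  by congr measurable; apply/seteqP; split => x; rewrite /= in_itv/= andbT.
pose I : set (measurableTypeR R) := `]y, y + 1]%classic.
have mI : measurable I by exact: measurable_itv.
have ID : I `<=` D.
  by move=> x; rewrite /I/D/= in_itv/= => /andP[yx _]; rewrite (lt_le_trans yx)// ler_norm.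
apply: (@lt_le_trans _ _ (gauss s I)); last by apply: le_measure; rewrite ?inE.
rewrite gauss_gt0E// normal_probE.
apply: (@lt_le_trans _ _ (\int[lebesgue_measure]_(x in I) (normal_pdf 0 s (y + 1))%:E)%E).
  rewrite integral_cst//= lebesgue_measure_itv/= lte_fin ltrDl ltr01 -EFinB -EFinM lte_fin.
  rewrite normal_pdfE ?gt_eqF// addrAC subrr add0r mulr1.
  by rewrite mulr_gt0 ?expR_gt0// normal_peak_gt0// gt_eqF.
apply: ge0_le_integral => //.
- by move=> x _; rewrite lee_fin normal_pdf_ge0.
- by apply/measurable_EFinP/measurable_funTS; exact: measurable_normal_pdf.
move=> x; rewrite /I/= in_itv/= => /andP[yx xy]; rewrite lee_fin !normal_pdfE ?gt_eqF//.
rewrite ler_wpM2l ?normal_peak_ge0// /normal_fun !subr0 ler_expR.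
rewrite !mulNr lerN2 ler_wpM2r//; first by rewrite invr_ge0 mulrn_wge0// sqr_ge0.
by rewrite ler_pXn2r ?nnegrE//; lra.
Qed.

(** * Derivatives and integrals of paths *)

Section calculus.
Variable R : realType.
Implicit Types (f g b z : R -> R) (c s t : R).

Lemma is_derive_continuous f t df : is_derive t 1 f df -> {for t, continuous f}.
Proof.
by move=> [df' _]; apply: differentiable_continuous; exact/derivable1_diffP.
Qed.

(** Both [g + f] and [g - f] have a nonnegative derivative. Most estimates of integrals below
    compare derivatives in this form. *)
Lemma le_derive_dist f g df dg s t : s <= t ->
  (forall x, s <= x <= t -> is_derive x 1 f (df x)) ->
  (forall x, s <= x <= t -> is_derive x 1 g (dg x)) ->
  (forall x, s <= x <= t -> `|df x| <= dg x) ->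
  `|f t - f s| <= g t - g s.
Proof.
move=> st ff gg fg.
have inI x : x \in `]s, t[ -> s <= x <= t.
  by rewrite in_itv/= => /andP[/ltW-> /ltW->].
have cont (h : R -> R) dh : (forall x, s <= x <= t -> is_derive x 1 h (dh x)) ->
    {within `[s, t], continuous h}.
  move=> hh; apply: continuous_in_subspaceT => x; rewrite inE/= in_itv/= => xst.
  exact: is_derive_continuous (hh x xst).
have hD x : s <= x <= t -> is_derive x 1 (g \+ f) (dg x + df x).
  by move=> xst; apply: is_deriveD; [exact: gg|exact: ff].
have hB x : s <= x <= t -> is_derive x 1 (g \- f) (dg x - df x).
  by move=> xst; apply: is_deriveB; [exact: gg|exact: ff].
have [x xst Ex] := MVT_segment st (fun x xs => hD x (inI x xs)) (cont _ _ hD).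
have [y yst Ey] := MVT_segment st (fun x xs => hB x (inI x xs)) (cont _ _ hB).
rewrite in_itv/= in xst; rewrite in_itv/= in yst.
have px : 0 <= dg x + df x by have := fg x xst; rewrite ler_norml => /andP[]; lra.
have py : 0 <= dg y - df y by have := fg y yst; rewrite ler_norml => /andP[]; lra.
have ts : 0 <= t - s by rewrite subr_ge0.
have := mulr_ge0 px ts; have := mulr_ge0 py ts; rewrite -Ex -Ey.
by rewrite ler_norml /= => h1 h2; apply/andP; split; lra.
Qed.

Lemma heine f s t e : (forall x, s <= x <= t -> {for x, continuous f}) -> 0 < e ->
  exists2 d, 0 < d & forall x y, s <= x <= t -> `|x - y| < d -> `|f x - f y| <= e.
Proof.
move=> cf e0.
have /compact_near_coveringP/near_covering_withinP cpt : compact `[s, t]%classic.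
  exact: segment_compact.
pose Q (d x : R) := forall y, `|x - y| < d -> `|f x - f y| <= e.
have := @cpt R (0^'+) Q _.
case.
  move=> x; rewrite /= in_itv/= => xst.
  have e20 : 0 < e / 2 by rewrite divr_gt0.
  have := cf x xst => /cvgrPdist_lt /(_ _ e20) [r /= r0 hr].
  have r20 : 0 < r / 2 by rewrite divr_gt0.
  exists (ball x (r / 2), [set d | 0 < d < r / 2]).
    split; first exact: nbhsx_ballx.
    near=> d; apply/andP; split; near: d; first exact: nbhs_right_gt.
    exact: nbhs_right_lt.
  move=> [x' d] [/= xx' /andP[d0 dr]] _ y x'y.
  have h1 : `|f x - f x'| < e / 2.
    apply: hr; rewrite /ball_/=; apply: (lt_trans xx').
    by rewrite ltr_pdivrMr// ltr_pMr// ltr1n.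
  have h2 : `|f x - f y| < e / 2.
    apply: hr; rewrite /ball_/= (_ : x - y = (x - x') + (x' - y)); last by ring.
    rewrite (le_lt_trans (ler_normD _ _))// [ltRHS](splitr r) ltrD// (lt_trans x'y)//.
  rewrite (_ : f x' - f y = (f x - f y) - (f x - f x')); last by ring.
  by rewrite (le_trans (ler_normB _ _))// [leRHS](splitr e) lerD// ltW.
move=> r /= r0 hr; exists (r / 2); first by rewrite divr_gt0.
move=> x y xst xy; apply: (hr (r / 2)) => //=.
- by rewrite sub0r normrN ger0_norm ?divr_ge0 ?ltW// ltr_pdivrMr// ltr_pMr// ltr1n.
- by rewrite divr_gt0.
Unshelve. all: by end_near.
Qed.

Lemma is_derive_powR_onem (p t : R) : t < 1 ->
  is_derive t 1 (fun x => (1 - x) `^ p) (- p * (1 - t) `^ (p - 1)).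
Proof.
move=> t1; have u0 : 0 < 1 - t by rewrite subr_gt0.
have h1 : is_derive t 1 (fun x : R => 1 - x) (- 1).
  have := is_deriveB (is_derive_cst (1 : R^o) t 1) (is_derive_id t 1).
  by rewrite sub0r.
have h2 := is_derive1_powR p u0.
have := @is_derive1_comp R (fun x => x `^ p) (fun x => 1 - x) t _ _ h2 h1.
by rewrite mulrN1 mulNr.
Qed.

(** Integrals start at -1 rather than 0, so that time 0 is interior and the derivative there is
    two-sided; the integrands of interest vanish at negative times. *)
Lemma is_derive_integral f t : (forall s, s < 1 -> {for s, continuous f}) ->
  -1 < t -> t < 1 ->
  is_derive t 1 (fun x => \int[lebesgue_measure]_(s in `[(-1)%R, x]) f s) (f t).
Proof.
move=> cf t1 t2.
pose u := (1 + t) / 2.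
have tu : t < u by rewrite /u; lra.
have u1 : u < 1 by rewrite /u; lra.
have fi : lebesgue_measure.-integrable `[(-1)%R, u] (EFin \o f).
  apply: continuous_compact_integrable; first exact: segment_compact.
  apply: continuous_in_subspaceT => x; rewrite inE/= in_itv/= => /andP[_ xu].
  by apply: cf; exact: le_lt_trans u1.
have [h1 h2] := continuous_FTC1_closed tu fi t1 (cf t t2).
by apply: DeriveDef => //; rewrite -derive1E.
Qed.

Lemma continuous_powR_onem (p s : R) : s < 1 ->
  {for s, continuous (fun x : R => (1 - x) `^ p)}.
Proof. by move=> s1; exact: is_derive_continuous (is_derive_powR_onem p s1). Qed.

Lemma integral_eq0_neg f t : (forall s, s <= 0 -> f s = 0) -> t <= 0 ->
  \int[lebesgue_measure]_(s in `[(-1)%R, t]) f s = 0.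
Proof.
move=> f0 t0; rewrite (@eq_Rintegral _ _ _ _ _ (fun=> 0)); last first.
  move=> x; rewrite inE/= in_itv/= => /andP[_ xt].
  by rewrite f0// (le_trans xt).
by rewrite Rintegral_cst ?mul0r.
Qed.

Lemma integrable_lt1 f t : (forall s, s < 1 -> {for s, continuous f}) -> t < 1 ->
  lebesgue_measure.-integrable `[(-1)%R, t] (EFin \o f).
Proof.
move=> cf t1; apply: continuous_compact_integrable; first exact: segment_compact.
apply: continuous_in_subspaceT => x; rewrite inE/= in_itv/= => /andP[_ xu].
by apply: cf; exact: le_lt_trans t1.
Qed.
End calculus.

(** * The pathwise solution of the equation *)

Definition bridge_int (R : realType) (c : R) (b : R -> R) (t : R) : R :=
  \int[lebesgue_measure]_(s in `[(-1)%R, t]) ((1 - s) `^ (- c - 1) * b s).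

(** The cut-off imposes the value 0 outside (0, 1). At nonpositive times the formula would give 0
    anyway when [b] vanishes there; at time 1 continuity has to be proved. *)
Definition bridge_path (R : realType) (c : R) (b : R -> R) (t : R) : R :=
  if 0 < t < 1 then b t - c * (1 - t) `^ c * bridge_int c b t else 0.

Section bridge_path.
Variables (R : realType) (c : R).
Hypothesis c0 : 0 < c.
Implicit Types (b z : R -> R) (s t K M : R).

Let cw b s : s < 1 -> {for s, continuous b} ->
  {for s, continuous (fun x : R => (1 - x) `^ (- c - 1) * b x)}.
Proof. by move=> s1 cb; apply: cvgM => //; exact: continuous_powR_onem. Qed.

Lemma is_derive_bridge_int b t : (forall s, s < 1 -> {for s, continuous b}) ->
  -1 < t -> t < 1 ->
  is_derive t 1 (bridge_int c b) ((1 - t) `^ (- c - 1) * b t).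
Proof.
by move=> cb; apply: is_derive_integral => s s1; apply: cw => //; exact: cb.
Qed.

Lemma bridge_int_neg b t : (forall s, s <= 0 -> b s = 0) -> t <= 0 ->
  bridge_int c b t = 0.
Proof. by move=> b0; apply: integral_eq0_neg => s s0; rewrite b0// mulr0. Qed.

(** Since [c (1 - x) ^ (- c - 1)] is the derivative of [(1 - x) ^ (- c)], the product
    [c * bridge_int c b] integrates [b] against the increasing function [(1 - x) ^ (- c)]; [K] is a
    frozen value of [b]. *)
Lemma bridge_int_dist b s t K M : (forall x, x < 1 -> {for x, continuous b}) ->
  -1 < s -> s <= t -> t < 1 -> (forall x, s <= x <= t -> `|b x - K| <= M) ->
  `|c * (bridge_int c b t - bridge_int c b s) -
    K * ((1 - t) `^ (- c) - (1 - s) `^ (- c))| <=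
  M * ((1 - t) `^ (- c) - (1 - s) `^ (- c)).
Proof.
move=> cb s1 st t1 bM.
have dp x : s <= x <= t -> is_derive x 1 (fun x : R => (1 - x) `^ (- c))
    (c * (1 - x) `^ (- c - 1)).
  move=> /andP[_ xt]; have := @is_derive_powR_onem R (- c) x (le_lt_trans xt t1).
  by rewrite opprK.
have dF x : s <= x <= t -> is_derive x 1 (bridge_int c b) ((1 - x) `^ (- c - 1) * b x).
  by move=> /andP[sx xt]; apply: is_derive_bridge_int; [|exact: lt_le_trans sx|exact: le_lt_trans t1].
pose f x := c * bridge_int c b x - K * (1 - x) `^ (- c).
pose g x := M * (1 - x) `^ (- c).
have fE : f = c *: bridge_int c b - K *: (fun x : R => (1 - x) `^ (- c)) by [].
have gE : g = M *: (fun x : R => (1 - x) `^ (- c)) by [].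
have := @le_derive_dist R f g
  (fun x => c * ((1 - x) `^ (- c - 1) * b x) - K * (c * (1 - x) `^ (- c - 1)))
  (fun x => M * (c * (1 - x) `^ (- c - 1))) s t st.
have -> : f t - f s = c * (bridge_int c b t - bridge_int c b s) -
    K * ((1 - t) `^ (- c) - (1 - s) `^ (- c)) by rewrite /f; ring.
have -> : g t - g s = M * ((1 - t) `^ (- c) - (1 - s) `^ (- c)) by rewrite /g; ring.
apply.
- by move=> x xst; rewrite fE; apply: is_deriveB; apply: is_deriveZ; [exact: dF|exact: dp].
- by move=> x xst; rewrite gE; apply: is_deriveZ; exact: dp.
- move=> x xst; rewrite (_ : _ - _ = (b x - K) * (c * (1 - x) `^ (- c - 1))); last by ring.
  by rewrite normrM [X in _ * X]ger0_norm ?mulr_ge0 ?powR_ge0 ?(ltW c0)// ler_wpM2r ?mulr_ge0 ?powR_ge0 ?(ltW c0)// bM.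
Qed.

Lemma powR_onemK (t : R) : t < 1 -> (1 - t) `^ c * (1 - t) `^ (- c) = 1.
Proof.
by move=> t1; rewrite powRN divff// gt_eqF// powR_gt0// subr_gt0.
Qed.

(** The drift term is an average of [b] with weights of total mass [1 - (1 - t) ^ c]. *)
Lemma bridge_drift_bound b M t : continuous b -> (forall s, s <= 0 -> b s = 0) ->
  (forall s, `|b s| <= M) -> 0 <= t -> t < 1 ->
  `|c * (1 - t) `^ c * bridge_int c b t| <= M.
Proof.
move=> cb b0 bM t0 t1.
have := @bridge_int_dist b 0 t 0 M (fun x _ => cb x) (ltrN10 _) t0 t1.
rewrite mul0r subr0 subr0 (@bridge_int_neg b 0)// subr0 powR1 => /(_ _)/[dup] h.
have {}h : `|c * bridge_int c b t| <= M * ((1 - t) `^ (- c) - 1).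
  by apply: h => x _; rewrite subr0.
move=> _; rewrite mulrAC mulrC normrM ger0_norm ?powR_ge0//.
have M0 : 0 <= M by exact: le_trans (normr_ge0 _) (bM 0).
apply: (le_trans (ler_wpM2l (powR_ge0 _ _) h)).
rewrite mulrCA mulrBr mulr1 powR_onemK//.
by rewrite ler_piMr// gerBl powR_ge0.
Qed.

(** Applied to a difference of driving paths, this is the Lipschitz continuity of the solution,
    uniform in time despite the singular drift. *)
Lemma bridge_path_bound b M t : continuous b -> (forall s, s <= 0 -> b s = 0) ->
  (forall s, `|b s| <= M) -> `|bridge_path c b t| <= M + M.
Proof.
move=> cb b0 bM; rewrite /bridge_path; case: ifPn => [/andP[t0 t1]|_].
  rewrite (le_trans (ler_normB _ _))// lerD//.
  by apply: bridge_drift_bound => //; exact: ltW.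
by rewrite normr0 addr_ge0//; exact: le_trans (normr_ge0 _) (bM 0).
Qed.

Lemma bridge_pathE b t : (forall s, s <= 0 -> b s = 0) -> t < 1 ->
  bridge_path c b t = b t - c * (1 - t) `^ c * bridge_int c b t.
Proof.
move=> b0 t1; rewrite /bridge_path t1 andbT; case: ltP => // t0.
by rewrite b0// bridge_int_neg// mulr0 subr0.
Qed.

(** The weights of the average concentrate at time 1, so the drift term tends to [b 1] and cancels
    the limit of [b]. *)
Lemma bridge_path_cvg1 b : continuous b -> (forall s, s <= 0 -> b s = 0) ->
  bridge_path c b t @[t --> 1^'-] --> 0.
Proof.
move=> cb b0; apply/cvgrPdist_le => e e0.
have e40 : 0 < e / 4 by rewrite divr_gt0.
have /cvgrPdist_le /(_ _ e40) [d /= d0 hd] := cb 1.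
pose s := Num.max 0 (1 - d / 2).
have s0 : 0 <= s by rewrite le_max lexx.
have d20 : 0 < d / 2 by rewrite divr_gt0.
have s1 : s < 1 by rewrite gt_max ltr01 ltrBlDr ltrDl.
have bs x : s <= x <= 1 -> `|b x - b 1| <= e / 4.
  move=> /andP[sx x1]; rewrite distrC; apply: hd; rewrite /ball_/=.
  have : 1 - d / 2 <= s by rewrite le_max lexx orbT.
  rewrite ger0_norm ?subr_ge0//; lra.
pose K := `|c * bridge_int c b s - b 1 * (1 - s) `^ (- c)|.
have pc : (1 - t) `^ c @[t --> 1^'-] --> 0.
  have h : (1 - t : R) @[t --> 1^'-] --> 0^'+.
    move=> A [r /= r0 hr]; exists r => //= x xr x1; apply: hr; last by rewrite /= subr_gt0.
    by move: xr; rewrite /ball_/= sub0r normrN.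
  exact: (cvg_comp _ _ h (powR_cvg0 c0)).
have /cvgrPdist_le := pc.
have K1 : 0 < K + 1 by rewrite ltr_wpDl// normr_ge0.
move=> /(_ (e / 4 / (K + 1)) (divr_gt0 e40 K1)) hpc.
near=> t.
have t1 : t < 1 by near: t; exact: nbhs_left_lt.
have st : s < t by near: t; exact: nbhs_left_gt.
have t0 : 0 <= t by exact: le_trans (ltW st).
have h1 := @bridge_int_dist b s t (b 1) (e / 4) (fun x _ => cb x)
  (lt_le_trans (ltrN10 _) s0) (ltW st) t1.
have {}h1 : `|c * (bridge_int c b t - bridge_int c b s) -
    b 1 * ((1 - t) `^ (- c) - (1 - s) `^ (- c))| <=
    e / 4 * ((1 - t) `^ (- c) - (1 - s) `^ (- c)).
  by apply: h1 => x /andP[sx xt]; apply: bs; rewrite sx (le_trans xt)// ltW.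
have pt0 : 0 <= (1 - t) `^ c by exact: powR_ge0.
have h2 : (1 - t) `^ c * K <= e / 4.
  have : `|0 - (1 - t) `^ c| <= e / 4 / (K + 1) by near: t.
  rewrite sub0r normrN ger0_norm// ler_pdivlMr//; apply: le_trans.
  by rewrite ler_wpM2l// lerDl.
have h3 : `|b t - b 1| <= e / 4 by apply: bs; rewrite !ltW.
have pK := powR_onemK t1.
rewrite sub0r normrN bridge_pathE//.
(* Three errors: [b] near time 1, the average over the times after [s], and the part before [s],
   which the factor [(1 - t) ^ c] makes small. *)
have -> : b t - c * (1 - t) `^ c * bridge_int c b t = (b t - b 1) -
    (1 - t) `^ c * (c * (bridge_int c b t - bridge_int c b s) -
    b 1 * ((1 - t) `^ (- c) - (1 - s) `^ (- c))) -
    (1 - t) `^ c * (c * bridge_int c b s - b 1 * (1 - s) `^ (- c)).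
  transitivity (b t - c * (1 - t) `^ c * bridge_int c b t +
    b 1 * ((1 - t) `^ c * (1 - t) `^ (- c)) - b 1); last by ring.
  by rewrite pK; ring.
rewrite (le_trans (ler_normB _ _))// (le_trans (lerD (ler_normB _ _) (lexx _)))//.
rewrite !normrM (ger0_norm pt0) -/K.
have h4 : (1 - t) `^ c * `|c * (bridge_int c b t - bridge_int c b s) -
    b 1 * ((1 - t) `^ (- c) - (1 - s) `^ (- c))| <= e / 4.
  apply: (le_trans (ler_wpM2l pt0 h1)).
  rewrite mulrCA mulrBr pK ler_piMr ?(ltW e40)// gerBl.
  by rewrite mulr_ge0// powR_ge0.
lra.
Unshelve. all: by end_near.
Qed.

Lemma continuous_bridge_path b : continuous b -> (forall s, s <= 0 -> b s = 0) ->
  continuous (bridge_path c b).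
Proof.
move=> cb b0 t; rewrite /continuous_at; have [t0|t0] := ltP t 0.
  have -> : bridge_path c b t = 0 by rewrite /bridge_path ltNge (ltW t0).
  apply: cvg_near_cst; near=> s; rewrite /bridge_path.
  suff /ltW : s < 0 by rewrite leNgt => /negbTE ->.
  by near: s; exact: lt_nbhsl.
have [t1|t1|->] := ltgtP t 1.
- rewrite bridge_pathE//.
  have : {for t, continuous (fun t => b t - c * (1 - t) `^ c * bridge_int c b t)}.
    apply: cvgB; first exact: cb.
    apply: cvgM; last first.
      by apply: (is_derive_continuous (is_derive_bridge_int _ (lt_le_trans (ltrN10 _) t0) t1)) => s _; exact: cb.
    by apply: cvgM; [exact: cvg_cst|exact: continuous_powR_onem].
  apply: cvg_trans; apply: near_eq_cvg; near=> s; rewrite bridge_pathE//.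
  by near: s; exact: lt_nbhsl.
- have -> : bridge_path c b t = 0 by rewrite /bridge_path [t < 1]ltNge (ltW t1) andbF.
  apply: cvg_near_cst; near=> s; rewrite /bridge_path.
  suff /ltW : 1 < s by rewrite leNgt => /negbTE ->; rewrite andbF.
  by near: s; exact: lt_nbhsr.
- have -> : bridge_path c b 1 = 0 by rewrite /bridge_path ltxx andbF.
  have /cvgrPdist_lt hl := bridge_path_cvg1 cb b0.
  apply/cvgrPdist_lt => e e0; have [r /= r0 hr] := hl _ e0.
  exists r => //= s sr; have [s1|s1] := ltP s 1; first exact: hr.
  by rewrite /bridge_path [s < 1]ltNge s1 andbF subrr normr0.
Unshelve. all: by end_near.
Qed.

Lemma bridge_int_sum (I : Type) (r : seq I) (a : I -> R) (b : I -> R -> R) t :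
  (forall i, continuous (b i)) -> t < 1 ->
  bridge_int c (fun s => \sum_(i <- r) a i * b i s) t =
  \sum_(i <- r) a i * bridge_int c (b i) t.
Proof.
move=> cb t1; elim: r => [|i r IH].
  rewrite big_nil /bridge_int; under eq_Rintegral do rewrite big_nil mulr0.
  by rewrite Rintegral_cst ?mul0r.
rewrite big_cons -IH /bridge_int.
have i1 (b' : R -> R) : continuous b' -> lebesgue_measure.-integrable `[(-1)%R, t]
    (EFin \o (fun s => (1 - s) `^ (- c - 1) * b' s)).
  by move=> cb'; apply: integrable_lt1 => // s s1; apply: cw => //; exact: cb'.
have csum : continuous (fun s => \sum_(i <- r) a i * b i s).
  move=> x; apply: cvg_sumr => j _; apply: cvgM; [exact: cvg_cst|exact: cb].
have cab : continuous (fun s => a i * b i s).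
  by move=> x; apply: cvgM; [exact: cvg_cst|exact: cb].
rewrite -RintegralZl//; last exact: i1.
have -> : \int[lebesgue_measure]_(x in `[(-1)%R, t]) (a i * ((1 - x) `^ (- c - 1) * b i x)) =
  \int[lebesgue_measure]_(x in `[(-1)%R, t]) ((1 - x) `^ (- c - 1) * (a i * b i x)).
  by apply: eq_Rintegral => x _; rewrite mulrCA.
rewrite -RintegralD//; [|exact: i1|exact: i1].
by apply: eq_Rintegral => x _; rewrite big_cons mulrDr.
Qed.

Lemma bridge_path_sum (I : Type) (r : seq I) (a : I -> R) (b : I -> R -> R) t :
  (forall i, continuous (b i)) ->
  bridge_path c (fun s => \sum_(i <- r) a i * b i s) t =
  \sum_(i <- r) a i * bridge_path c (b i) t.
Proof.
move=> cb; rewrite /bridge_path; case: ifPn => [/andP[_ t1]|_]; last first.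
  by rewrite big1// => i _; rewrite mulr0.
rewrite bridge_int_sum// mulr_sumr -sumrB; apply: eq_bigr => i _; ring.
Qed.

Lemma bridge_pathB b1 b2 t : continuous b1 -> continuous b2 ->
  bridge_path c (fun s => b1 s - b2 s) t = bridge_path c b1 t - bridge_path c b2 t.
Proof.
move=> cb1 cb2.
have := @bridge_path_sum bool [:: true; false] (fun x => if x then 1 else -1)
  (fun x => if x then b1 else b2) t.
rewrite !big_cons !big_nil mul1r mulN1r !addr0 => <-; last by case.
congr bridge_path; apply/funext => s.
by rewrite !big_cons !big_nil mul1r mulN1r addr0.
Qed.

(** Variation of constants: the drift integral multiplied by [(1 - x) ^ (- c)] has the same
    derivative as [c * bridge_int c b], so their difference [f] is constant. *)
Lemma bridge_path_unique b z t : (forall s, s < 1 -> {for s, continuous b}) ->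
  (forall s, s < 1 -> {for s, continuous z}) ->
  (forall s, s <= 0 -> z s = 0) -> (forall s, s <= 0 -> b s = 0) ->
  (forall s, 0 <= s -> s < 1 ->
    z s = b s - \int[lebesgue_measure]_(x in `[(-1)%R, s]) (c / (1 - x) * z x)) ->
  0 <= t -> t < 1 -> z t = b t - c * (1 - t) `^ c * bridge_int c b t.
Proof.
move=> cb cz z0 b0 zE t0 t1.
pose G s := \int[lebesgue_measure]_(x in `[(-1)%R, s]) (c / (1 - x) * z x).
have dG x : 0 <= x <= t -> is_derive x 1 G (c / (1 - x) * z x).
  move=> /andP[x0 xt]; apply: is_derive_integral.
  - move=> s s1; apply: cvgM; last exact: cz.
    apply: cvgM; first exact: cvg_cst.
    apply: cvgV; first by rewrite subr_eq0 gt_eqF.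
    by apply: cvgB; [exact: cvg_cst|exact: cvg_id].
  - exact: lt_le_trans (ltrN10 _) x0.
  - exact: le_lt_trans t1.
have dF x : 0 <= x <= t -> is_derive x 1 (bridge_int c b) ((1 - x) `^ (- c - 1) * b x).
  move=> /andP[sx xt]; apply: is_derive_bridge_int => //; last exact: le_lt_trans t1.
  exact: lt_le_trans (ltrN10 _) sx.
have dp x : 0 <= x <= t -> is_derive x 1 (fun x : R => (1 - x) `^ (- c))
    (c * (1 - x) `^ (- c - 1)).
  move=> /andP[_ xt]; have := @is_derive_powR_onem R (- c) x (le_lt_trans xt t1).
  by rewrite opprK.
pose f x := (1 - x) `^ (- c) * G x - c * bridge_int c b x.
have fE : f = (fun x : R => (1 - x) `^ (- c)) * G - c *: bridge_int c b by [].
have df x : 0 <= x <= t -> is_derive x 1 f 0.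
  move=> xt; rewrite fE.
  have := is_deriveB (is_deriveM (dp x xt) (dG x xt)) (is_deriveZ c (dF x xt)).
  move/andP : xt => [x0 xt]; have x1 : x < 1 by exact: le_lt_trans t1.
  congr is_derive; rewrite (zE x x0 x1) -/(G x) /GRing.scale/=.
  have -> : (1 - x) `^ (- c) = (1 - x) * (1 - x) `^ (- c - 1).
    rewrite -{2}(powRr1 (a := 1 - x)) ?subr_ge0 ?(ltW x1)// -powRD ?subrKC//.
    by apply/implyP => _; rewrite subr_eq0 gt_eqF.
  by field; rewrite subr_eq0 gt_eqF.
have := @le_derive_dist R f (cst 0) (fun=> 0) (fun=> 0) 0 t t0 df
  (fun x _ => is_derive_cst (0 : R^o) x 1).
have f0 : f 0 = 0.
  by rewrite /f bridge_int_neg// /G integral_eq0_neg ?mulr0 ?subr0// => s s0; rewrite z0// mulr0.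
rewrite f0 subrr subr0 normr0 => /(_ (fun _ _ => lexx _)).
rewrite normr_le0 => /eqP ft.
have e1 : (1 - t) `^ (- c) * G t = c * bridge_int c b t.
  by apply/eqP; rewrite -subr_eq0; apply/eqP.
rewrite (zE _ t0 t1) -/(G t); congr (_ - _).
by rewrite mulrAC -e1 mulrC mulrA powR_onemK// mul1r.
Qed.
End bridge_path.

(** * Riemann sums and polygonal interpolation *)

Definition grid (R : realType) (s t : R) (N i : nat) : R :=
  s + (t - s) * (i%:R / N.+1%:R).

Lemma grid0 (R : realType) (s t : R) N : grid s t N 0 = s.
Proof. by rewrite /grid mul0r mulr0 addr0. Qed.

Lemma gridN (R : realType) (s t : R) N : grid s t N N.+1 = t.
Proof. by rewrite /grid divff ?mulr1 ?subrKC// pnatr_eq0. Qed.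

Lemma gridS (R : realType) (s t : R) N i :
  grid s t N i.+1 - grid s t N i = (t - s) / N.+1%:R.
Proof. by rewrite /grid -[i.+1]addn1 natrD; ring. Qed.

Lemma grid_le (R : realType) (s t : R) N i j : s <= t -> (i <= j)%N ->
  grid s t N i <= grid s t N j.
Proof.
move=> st ij; rewrite lerD2l ler_wpM2l ?subr_ge0//.
by rewrite ler_wpM2r ?invr_ge0// ler_nat.
Qed.

Lemma grid_bound (R : realType) (s t : R) N i : s <= t -> (i <= N.+1)%N ->
  s <= grid s t N i <= t.
Proof.
move=> st iN; apply/andP; split.
  by rewrite -[leLHS](grid0 s t N) grid_le.
by rewrite -[leRHS](gridN s t N) grid_le.
Qed.

(** Primitive of [(1 - t) ^ (- 2 c)] vanishing at 0, logarithmic when [c = 1 / 2]. *)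
Definition bridge_var (R : realType) (c t : R) : R :=
  if c == 2^-1 then - ln (1 - t) else ((1 - t) `^ (1 - c *+ 2) - 1) / (c *+ 2 - 1).

Section riemann_sums.
Variables (R : realType) (c : R).
Hypothesis c0 : 0 < c.
Implicit Types (b : R -> R) (s t : R).

Lemma is_derive_bridge_var t : t < 1 ->
  is_derive t 1 (bridge_var c) ((1 - t) `^ (- (c *+ 2))).
Proof.
move=> t1; have u0 : 0 < 1 - t by rewrite subr_gt0.
rewrite /bridge_var; have [cE|cN] := eqVneq c 2^-1.
  have h1 : is_derive t 1 (fun x : R => 1 - x) (- 1).
    have := is_deriveB (is_derive_cst (1 : R^o) t 1) (is_derive_id t 1).
    by rewrite sub0r.
  have h2 := is_derive1_ln u0.
  have := is_deriveN (@is_derive1_comp R (@ln R) (fun x => 1 - x) t _ _ h2 h1).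
  rewrite cE (_ : 2^-1 *+ 2 = 1 :> R); last by lra.
  by rewrite powR_inv1 ?ltW// mulrN1 opprK.
have c21 : c *+ 2 - 1 != 0.
  by apply: contraNneq cN => h; apply/eqP; lra.
have h := @is_derive_powR_onem R (1 - c *+ 2) t t1.
have := is_deriveZ ((c *+ 2 - 1)^-1) (is_deriveB h (is_derive_cst (1 : R^o) t 1)).
have -> : (c *+ 2 - 1)^-1 *: (- (1 - c *+ 2) * (1 - t) `^ (1 - c *+ 2 - 1) - 0) =
    (1 - t) `^ (- (c *+ 2)).
  rewrite subr0 /GRing.scale/= opprB mulrA mulVf// mul1r.
  by congr powR; lra.
by congr is_derive; apply/funext => x; rewrite /= mulrC.
Qed.

(** The integrand is monotone, so the error of a cell is at most the increment of the integrand
    times the mesh, and the increments telescope. *)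
Lemma bridge_var_Riemann s t : 0 <= s -> s <= t -> t < 1 ->
  \sum_(i < N.+1) ((1 - grid s t N i) `^ (- c)) ^+ 2 * (grid s t N i.+1 - grid s t N i)
   @[N --> \oo] --> bridge_var c t - bridge_var c s.
Proof.
move=> s0 st t1.
pose p x := (1 - x) `^ (- (c *+ 2)).
have pE x : ((1 - x) `^ (- c)) ^+ 2 = p x.
  by rewrite -powR_mulrn ?powR_ge0// -powRrM; congr powR; lra.
have p_le x y : x <= y -> y < 1 -> p x <= p y.
  move=> xy y1; rewrite /p !powRN lef_pV2 ?posrE ?powR_gt0 ?subr_gt0//; last exact: le_lt_trans y1.
  by apply: ge0_ler_powR; rewrite ?nnegrE ?subr_ge0 ?mulrn_wge0 ?(ltW c0)//; lra.
have cell N i : (i < N.+1)%N ->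
    `|(bridge_var c (grid s t N i.+1) - bridge_var c (grid s t N i)) -
     p (grid s t N i) * (grid s t N i.+1 - grid s t N i)| <=
    (p (grid s t N i.+1) - p (grid s t N i)) * ((t - s) / N.+1%:R).
  move=> iN; set x := grid s t N i; set y := grid s t N i.+1.
  have xy : x <= y by exact: grid_le.
  have y1 : y < 1 by have /andP[_] := grid_bound st iN; move/le_lt_trans; apply.
  pose f z := bridge_var c z - p x * z; pose g z := (p y - p x) * z.
  have := @le_derive_dist R f g (fun z => p z - p x) (fun=> p y - p x) x y xy.
  have -> : f y - f x = (bridge_var c y - bridge_var c x) - p x * (y - x) by rewrite /f; ring.
  have -> : g y - g x = (p y - p x) * ((t - s) / N.+1%:R).
    by rewrite -(gridS s t N i) -/x -/y /g; ring.
  apply => z /andP[xz zy].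
  - have zz := is_deriveB (is_derive_bridge_var (le_lt_trans zy y1))
      (is_deriveZ (p x) (is_derive_id z 1)).
    by move: zz; rewrite /GRing.scale/= mulr1.
  - have zz := is_deriveZ (p y - p x) (is_derive_id z 1).
    by move: zz; rewrite /GRing.scale/= mulr1.
  - rewrite ger0_norm ?subr_ge0 ?lerD2r; last exact: p_le xz (le_lt_trans zy y1).
    exact: p_le.
have main N : `|bridge_var c t - bridge_var c s - \sum_(i < N.+1) ((1 - grid s t N i) `^ (- c)) ^+ 2 *
    (grid s t N i.+1 - grid s t N i)| <= (p t - p s) * (t - s) * N.+1%:R^-1.
  have tel (h : R -> R) : h t - h s = \sum_(i < N.+1) (h (grid s t N i.+1) - h (grid s t N i)).
    rewrite -(big_mkord predT (fun i => h (grid s t N i.+1) - h (grid s t N i))).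
    by rewrite telescope_sumr// gridN grid0.
  rewrite tel -sumrB (le_trans (ler_norm_sum _ _ _))// tel !mulr_suml ler_sum// => i _.
  by rewrite pE -mulrA; exact: cell.
apply/cvgrPdist_le => e e0.
have K0 : 0 <= (p t - p s) * (t - s) by rewrite mulr_ge0 ?subr_ge0// p_le.
have K1 : 0 < (p t - p s) * (t - s) + 1 by rewrite ltr_wpDl.
near=> N; apply: (le_trans (main N)).
have : N.+1%:R^-1 < e / ((p t - p s) * (t - s) + 1).
  by near: N; exact: near_infty_natSinv_lt (PosNum (divr_gt0 e0 K1)).
rewrite ltr_pdivlMr// => h; apply: ltW; apply: le_lt_trans h.
by rewrite mulrC ler_wpM2l ?invr_ge0// lerDl.
Unshelve. all: by end_near.
Qed.

(** These are the sums of the Wiener integral of [(1 - x) ^ (- c)] against [b]. They converge path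
    by path because, after summation by parts, the error of a cell is the oscillation of [b] times
    the increment of a monotone weight. *)
Lemma bridge_path_Riemann b s t : continuous b -> (forall x, x <= 0 -> b x = 0) ->
  0 <= s -> s <= t -> t < 1 ->
  \sum_(i < N.+1) (1 - grid s t N i) `^ (- c) * (b (grid s t N i.+1) - b (grid s t N i))
   @[N --> \oo] --> (1 - t) `^ (- c) * bridge_path c b t - (1 - s) `^ (- c) * bridge_path c b s.
Proof.
move=> cb b0 s0 st t1.
pose p x := (1 - x) `^ (- c); pose m x := p x * b x - c * bridge_int c b x.
have mE x : x < 1 -> p x * bridge_path c b x = m x.
  move=> x1; rewrite bridge_pathE// /m mulrBr; congr (_ - _).
  have := @powR_onemK R c x x1; rewrite -/(p x) => h.
  transitivity ((1 - x) `^ c * p x * (c * bridge_int c b x)); first by ring.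
  by rewrite h mul1r.
rewrite -/(p t) -/(p s) !mE//; last exact: le_lt_trans t1.
have p_le x y : x <= y -> y < 1 -> p x <= p y.
  move=> xy y1; rewrite /p !powRN lef_pV2 ?posrE ?powR_gt0 ?subr_gt0//; last exact: le_lt_trans y1.
  by apply: ge0_ler_powR; rewrite ?nnegrE ?subr_ge0 ?(ltW c0)//; lra.
apply/cvgrPdist_le => e e0.
have K1 : 0 < p t - p s + 1 by rewrite ltr_wpDl// subr_ge0 p_le.
have [d d0 hd] := @heine R b s t (e / (p t - p s + 1)) (fun x _ => cb x) (divr_gt0 e0 K1).
have ts1 : 0 < t - s + 1 by rewrite ltr_wpDl// subr_ge0.
near=> N.
have mesh : (t - s) / N.+1%:R < d.
  have : N.+1%:R^-1 < d / (t - s + 1).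
    by near: N; exact: near_infty_natSinv_lt (PosNum (divr_gt0 d0 ts1)).
  rewrite ltr_pdivlMr// => h; apply: le_lt_trans h.
  by rewrite mulrC ler_wpM2l ?invr_ge0// lerDl.
have tel (h : R -> R) : h t - h s = \sum_(i < N.+1) (h (grid s t N i.+1) - h (grid s t N i)).
  rewrite -(big_mkord predT (fun i => h (grid s t N i.+1) - h (grid s t N i))).
  by rewrite telescope_sumr// gridN grid0.
rewrite tel -sumrB (le_trans (ler_norm_sum _ _ _))//.
apply: (@le_trans _ _ (\sum_(i < N.+1) e / (p t - p s + 1) *
    (p (grid s t N i.+1) - p (grid s t N i)))).
  apply: ler_sum => i _; set x := grid s t N i; set y := grid s t N i.+1.
  have xy : x <= y by exact: grid_le.
  have /andP[_ yt] := grid_bound st (ltn_ord i : (i.+1 <= N.+1)%N).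
  have /andP[sx _] := grid_bound st (ltnW (ltn_ord i)).
  have y1 : y < 1 by exact: le_lt_trans t1.
  have := @bridge_int_dist R c c0 b x y (b y) (e / (p t - p s + 1)) (fun z _ => cb z)
    (lt_le_trans (ltrN10 _) (le_trans s0 sx)) xy y1.
  have -> : m y - m x - p x * (b y - b x) = - (c * (bridge_int c b y - bridge_int c b x) -
     b y * (p y - p x)) by rewrite /m; ring.
  rewrite normrN; apply => z /andP[xz zy]; apply: hd.
    by rewrite (le_trans sx xz) (le_trans zy yt).
  rewrite distrC ger0_norm ?subr_ge0//; apply: le_lt_trans mesh.
  by rewrite -(gridS s t N i) -/x -/y lerD2l lerN2.
rewrite -mulr_sumr -tel mulrAC ler_pdivrMr// ler_wpM2l ?(ltW e0)//.
by rewrite lerDl.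
Unshelve. all: by end_near.
Qed.
End riemann_sums.

Definition ramp (R : realType) (N k : nat) (t : R) : R :=
  Num.max 0 (Num.min 1 (N.+1%:R * t - k%:R)).

Lemma continuous_ramp (R : realType) N k : continuous (@ramp R N k).
Proof.
move=> x; rewrite /ramp; apply: (@continuous_max _ R (fun=> 0) _ x); first exact: cvg_cst.
apply: (@continuous_min _ R (fun=> 1) _ x); first exact: cvg_cst.
apply: cvgB; last exact: cvg_cst.
by apply: cvgM; [exact: cvg_cst|exact: cvg_id].
Qed.

Lemma ramp_neg (R : realType) N k (t : R) : t <= 0 -> ramp N k t = 0.
Proof.
move=> t0; rewrite /ramp; apply: max_l; rewrite ge_min; apply/orP; right.
by rewrite subr_le0 (@le_trans _ _ 0)// mulr_ge0_le0.
Qed.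

(** Polygonal interpolation on the grid, written with ramps so that its coefficients are the
    increments of [b], which are independent when [b] is Brownian. *)
Lemma interp_dist (R : realType) (b : R -> R) (e : R) :
  continuous b -> (forall t, t <= 0 -> b t = 0) -> (forall t, 1 <= t -> b t = b 1) ->
  0 < e -> \forall N \near \oo, forall t,
    `|\sum_(k < N.+1) (b (grid 0 1 N k.+1) - b (grid 0 1 N k)) * ramp N k t - b t| <= e.
Proof.
move=> cb b0 b1 e0.
have [d d0 hd] := @heine R b 0 1 e (fun x _ => cb x) e0.
have gE N k : grid 0 1 N k = k%:R / N.+1%:R :> R by rewrite /grid subr0 mul1r add0r.
near=> N.
have mesh : N.+1%:R^-1 < d by near: N; exact: near_infty_natSinv_lt (PosNum d0).
have N0 : 0 < N.+1%:R :> R by [].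
pose S K t := \sum_(k < K) (b (grid 0 1 N k.+1) - b (grid 0 1 N k)) * ramp N k t.
(* The first [K] ramps reproduce the interpolation up to the [K]-th grid point and stay constant
   beyond it. *)
have main K t : (K <= N.+1)%N -> 0 <= t ->
    (grid 0 1 N K <= t -> S K t = b (grid 0 1 N K)) /\
    (t <= grid 0 1 N K -> `|S K t - b t| <= e).
  elim: K => [_ t0|K IH KN t0].
    rewrite /S big_ord0 gE mul0r; split=> [_|t0']; first by rewrite b0.
    by rewrite b0// subrr normr0 ltW.
  have [IH1 IH2] := IH (ltnW KN) t0.
  have SS : S K.+1 t = S K t + (b (grid 0 1 N K.+1) - b (grid 0 1 N K)) * ramp N K t.
    by rewrite /S big_ord_recr.
  have gKS : grid 0 1 N K <= grid 0 1 N K.+1 :> R by apply: grid_le => //; exact: ler01.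
  split=> [tK|tK].
    rewrite SS IH1; last exact: le_trans tK.
    rewrite /ramp min_l; last first.
      by move: tK; rewrite gE ler_pdivrMr// -[K.+1]addn1 natrD; lra.
    by rewrite max_r// mulr1 subrKC.
  rewrite SS; have [tK'|Kt] := leP t (grid 0 1 N K).
    rewrite /ramp max_l ?mulr0 ?addr0; first exact: IH2.
    rewrite ge_min; apply/orP; right.
    by move: tK'; rewrite gE ler_pdivlMr//; lra.
  rewrite (IH1 (ltW Kt)).
  have r01 : 0 <= ramp N K t <= 1.
    by rewrite /ramp le_max lexx/= ge_max ler01/= ge_min lexx.
  set r := ramp N K t in r01 *; move: r01 => /andP[r0 r1].
  (* On the active cell the error is a convex combination of the errors at its two ends. *)
  have -> : b (grid 0 1 N K) + (b (grid 0 1 N K.+1) - b (grid 0 1 N K)) * r - b t =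
    (1 - r) * (b (grid 0 1 N K) - b t) + r * (b (grid 0 1 N K.+1) - b t) by ring.
  have gb1 := @grid_bound R 0 1 N K ler01 (ltnW KN).
  have gb2 := @grid_bound R 0 1 N K.+1 ler01 KN.
  have gd := gridS 0 1 N K : _ = _ :> R.
  rewrite subr0 mul1r in gd.
  have gd2 : grid 0 1 N K.+1 - grid 0 1 N K < d by rewrite gd.
  have h1 : `|b (grid 0 1 N K) - b t| <= e.
    by apply: hd => //; rewrite distrC ger0_norm ?subr_ge0 ?(ltW Kt)//; lra.
  have h2 : `|b (grid 0 1 N K.+1) - b t| <= e.
    by apply: hd => //; rewrite ger0_norm ?subr_ge0//; lra.
  rewrite (le_trans (ler_normD _ _))// !normrM (ger0_norm r0) ger0_norm ?subr_ge0//.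
  have := ler_wpM2l r0 h2; have : (1 - r) * `|b (grid 0 1 N K) - b t| <= (1 - r) * e.
    by rewrite ler_wpM2l// subr_ge0.
  lra.
move=> t; have [t0|t0] := leP t 0.
  rewrite b0// big1 ?subrr ?normr0 ?ltW// => k _; by rewrite ramp_neg// mulr0.
have [h1 h2] := main N.+1 t (leqnn _) (ltW t0).
rewrite -/(S N.+1 t); have [t1|t1] := leP t 1; first by apply: h2; rewrite gridN.
by rewrite h1 ?gridN ?(ltW t1)// b1 ?subrr ?normr0 ?ltW.
Unshelve. all: by end_near.
Qed.

(** * Paths of finite energy and the Hardy inequality *)

Definition drift_int (R : realType) (c : R) (h : R -> R) (t : R) : R :=
  \int[lebesgue_measure]_(x in `[(-1)%R, t]) (c / (1 - x) * h x).

(** Dual form of the property that [k] has a derivative whose squared L2 norm on [0, 1) is at most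
    [E]: the weights [a] are the values of a step function, whose integral against [k] is compared
    with its L2 norm. The same finite sums are values of linear functionals of a loop, which gives a
    direct link with the Cameron-Martin norm. *)
Definition energy_le (R : realType) (k : R -> R) (E : R) :=
  forall N (t a : nat -> R), 0 <= t 0%N ->
    (forall i, (i < N)%N -> t i <= t i.+1) -> t N < 1 ->
    (\sum_(i < N) a i * (k (t i.+1) - k (t i))) ^+ 2 <=
    E * \sum_(i < N) a i ^+ 2 * (t i.+1 - t i).

Section energy.
Variable R : realType.
Implicit Types (k h : R -> R) (E : R).

Lemma nondecreasing_steps (t : nat -> R) N :
  (forall i, (i < N)%N -> t i <= t i.+1) ->
  forall i j, (i <= j)%N -> (j <= N)%N -> t i <= t j.
Proof.
move=> tS i; elim=> [|j IH]; first by rewrite leqn0 => /eqP->.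
rewrite leq_eqVlt => /predU1P[->//|ij] jN.
by rewrite (le_trans (IH _ (ltnW jN)))// tS.
Qed.

Lemma energy_dist k E s t : energy_le k E -> 0 <= s -> s <= t -> t < 1 ->
  (k t - k s) ^+ 2 <= E * (t - s).
Proof.
move=> kE s0 st t1.
have := kE 1%N (fun i => if i == 0%N then s else t) (fun=> 1) s0.
by rewrite !big_ord_recl !big_ord0 /= !addr0 !mul1r expr1n mul1r; apply => // -[].
Qed.

Lemma energy_ge0 k E : energy_le k E -> 0 <= E.
Proof.
move=> kE; have h : 0 <= 2^-1 :> R by rewrite invr_ge0.
have := @energy_dist k E 0 2^-1 kE (lexx 0) h; rewrite invf_lt1// ltr1n => /(_ isT).
rewrite subr0 => /(le_trans (sqr_ge0 _)); by rewrite pmulr_lge0// invr_gt0.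
Qed.

Lemma energy_leD k1 k2 E1 E2 l : energy_le k1 E1 -> energy_le k2 E2 ->
  energy_le (fun t => k1 t + l * k2 t) (2 * E1 + 2 * l ^+ 2 * E2).
Proof.
move=> h1 h2 N t a t0 tS tN.
have := h1 N t a t0 tS tN; have := h2 N t a t0 tS tN.
set S := \sum_(i < N) a i ^+ 2 * _; set X1 := \sum_(i < N) _; set X2 := \sum_(i < N) _.
have -> : \sum_(i < N) a i * (k1 (t i.+1) + l * k2 (t i.+1) - (k1 (t i) + l * k2 (t i))) =
    X2 + l * X1.
  by rewrite /X1 /X2 mulr_sumr -big_split/=; apply: eq_bigr => i _; ring.
move=> hX1 hX2; have hl : l ^+ 2 * X1 ^+ 2 <= l ^+ 2 * (E2 * S) by rewrite ler_wpM2l ?sqr_ge0.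
have : 0 <= (X2 - l * X1) ^+ 2 by exact: sqr_ge0.
have -> : (X2 - l * X1) ^+ 2 = X2 ^+ 2 - 2 * (l * X1 * X2) + l ^+ 2 * X1 ^+ 2 by ring.
have -> : (X2 + l * X1) ^+ 2 = X2 ^+ 2 + 2 * (l * X1 * X2) + l ^+ 2 * X1 ^+ 2 by ring.
have -> : (2 * E1 + 2 * l ^+ 2 * E2) * S = 2 * (E1 * S) + 2 * (l ^+ 2 * (E2 * S)) by ring.
lra.
Qed.

Lemma eq_energy_le k1 k2 E : (forall t, 0 <= t -> t < 1 -> k1 t = k2 t) ->
  energy_le k1 E -> energy_le k2 E.
Proof.
move=> k12 h N t a t0 tS tN; have := h N t a t0 tS tN.
congr (_ ^+ 2 <= _); apply: eq_bigr => i _.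
have mono := nondecreasing_steps tS.
have b j : (j <= N)%N -> 0 <= t j /\ t j < 1.
  by move=> jN; split; [exact: le_trans (mono 0%N j _ _)|exact: le_lt_trans (mono j N _ _) tN].
have [h1 h2] := b i (ltnW (ltn_ord i)); have [h3 h4] := b i.+1 (ltn_ord i).
by rewrite !k12.
Qed.

(** Cauchy-Schwarz, obtained by expanding the sum of squares centred at [X]; the times span a length
    at most 1. *)
Lemma energy_linear (l : R) : energy_le (fun t => l * t) (l ^+ 2).
Proof.
move=> N t a t0 tS tN.
set S := \sum_(i < N) a i ^+ 2 * _.
have -> : \sum_(i < N) a i * (l * t i.+1 - l * t i) = l * \sum_(i < N) a i * (t i.+1 - t i).
  by rewrite mulr_sumr; apply: eq_bigr => i _; ring.
set X := \sum_(i < N) _; rewrite exprMn ler_wpM2l ?sqr_ge0//.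
have T : \sum_(i < N) (t i.+1 - t i) = t N - t 0%N.
  by rewrite -(big_mkord predT (fun i => t i.+1 - t i)) telescope_sumr.
have XE : X = \sum_(i < N) a i * (t i.+1 - t i) by [].
have : 0 <= \sum_(i < N) (a i - X) ^+ 2 * (t i.+1 - t i).
  by apply: sumr_ge0 => i _; rewrite mulr_ge0 ?sqr_ge0// subr_ge0 tS.
have -> : \sum_(i < N) (a i - X) ^+ 2 * (t i.+1 - t i) = S - 2 * X * X + X ^+ 2 * (t N - t 0%N).
  rewrite -T /S [2 * X * X](_ : _ = \sum_(i < N) 2 * X * (a i * (t i.+1 - t i))); last first.
    by rewrite -mulr_sumr -XE.
  move: (X) => Y; rewrite mulr_sumr -sumrB -big_split/=; apply: eq_bigr => i _; ring.
have : X ^+ 2 * (t N - t 0%N) <= X ^+ 2 by rewrite ler_piMr ?sqr_ge0//; lra.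
rewrite -mulrA -expr2; lra.
Qed.

Lemma is_derive_drift (c : R) h (t : R) : (forall s, s < 1 -> {for s, continuous h}) ->
  -1 < t -> t < 1 -> is_derive t 1 (drift_int c h) (c / (1 - t) * h t).
Proof.
move=> ch t0 t1; apply: is_derive_integral => // s s1.
apply: cvgM; last exact: ch.
apply: cvgM; first exact: cvg_cst.
apply: cvgV; first by rewrite subr_eq0 gt_eqF.
by apply: cvgB; [exact: cvg_cst|exact: cvg_id].
Qed.

Lemma drift_int_neg (c : R) h (t : R) : (forall s, s <= 0 -> h s = 0) -> t <= 0 ->
  drift_int c h t = 0.
Proof. by move=> h0; apply: integral_eq0_neg => s s0; rewrite h0// mulr0. Qed.

Lemma drift_intZ (c : R) h (t : R) : (forall s, s < 1 -> {for s, continuous h}) -> t < 1 ->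
  drift_int c h t = c * drift_int 1 h t.
Proof.
move=> ch t1; rewrite /drift_int -RintegralZl//.
  by apply: eq_Rintegral => x _; rewrite mul1r mulrA.
apply: integrable_lt1 => // s s1; apply: cvgM; last exact: ch.
apply: cvgM; first exact: cvg_cst.
apply: cvgV; first by rewrite subr_eq0 gt_eqF.
by apply: cvgB; [exact: cvg_cst|exact: cvg_id].
Qed.

(** The weights [w] are only required to be bounded. In the Hardy inequality, weight 1 gives the
    convergence of the Riemann sums of [g ^ 2], and weight [g] compares them with the sums of [g]
    times the increments of [J]. *)
Lemma weighted_riemann (f F : R -> R) (w : nat -> nat -> R) (B T : R) : 0 <= T ->
  (forall x, 0 <= x <= T -> {for x, continuous f}) ->
  (forall x, 0 <= x <= T -> is_derive x 1 F (f x)) ->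
  0 <= B -> (forall N i, (i < N.+1)%N -> `|w N i| <= B) ->
  \sum_(i < N.+1) w N i * (f (grid 0 T N i.+1) * (grid 0 T N i.+1 - grid 0 T N i) -
    (F (grid 0 T N i.+1) - F (grid 0 T N i))) @[N --> \oo] --> 0.
Proof.
move=> T0 cf dF B0 wB; apply/cvgrPdist_le => e e0.
have BT : 0 < B * T + 1 by rewrite ltr_wpDl// mulr_ge0.
have [d d0 hd] := @heine R f 0 T (e / (B * T + 1)) cf (divr_gt0 e0 BT).
have T2 : 0 < T + 1 by rewrite ltr_wpDl.
near=> N.
have mesh : T / N.+1%:R < d.
  have : N.+1%:R^-1 < d / (T + 1).
    by near: N; exact: near_infty_natSinv_lt (PosNum (divr_gt0 d0 T2)).
  rewrite ltr_pdivlMr// => hN; apply: le_lt_trans hN.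
  by rewrite mulrC ler_wpM2l ?invr_ge0// lerDl.
rewrite sub0r normrN (le_trans (ler_norm_sum _ _ _))//.
apply: (@le_trans _ _ (\sum_(i < N.+1) B * (e / (B * T + 1)) *
    (grid 0 T N i.+1 - grid 0 T N i))); last first.
  rewrite -mulr_sumr -(big_mkord predT (fun i => grid 0 T N i.+1 - grid 0 T N i)).
  rewrite telescope_sumr// gridN grid0 subr0 mulrAC mulrA ler_pdivrMr//.
  by rewrite mulrC ler_wpM2l ?(ltW e0)// lerDl.
apply: ler_sum => i _; rewrite normrM -mulrA ler_pM//; first exact: wB.
set x := grid 0 T N i; set y := grid 0 T N i.+1.
have xy : x <= y by exact: grid_le.
have /andP[x0 _] := grid_bound T0 (ltnW (ltn_ord i)).
have /andP[_ yT] := grid_bound T0 (ltn_ord i : (i.+1 <= N.+1)%N).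
pose p z := f y * z - F z; pose q z := e / (B * T + 1) * z.
have := @le_derive_dist R p q (fun z => f y - f z) (fun=> e / (B * T + 1)) x y xy.
have -> : p y - p x = f y * (y - x) - (F y - F x) by rewrite /p; ring.
have -> : q y - q x = e / (B * T + 1) * (y - x) by rewrite /q; ring.
apply => z /andP[xz zy].
- have zT : 0 <= z <= T by rewrite (le_trans x0 xz) (le_trans zy yT).
  have zz := is_deriveB (is_deriveZ (f y) (is_derive_id z 1)) (dF z zT).
  by move: zz; rewrite /GRing.scale/= mulr1.
- have zz := is_deriveZ (e / (B * T + 1)) (is_derive_id z 1).
  by move: zz; rewrite /GRing.scale/= mulr1.
- apply: hd; first by rewrite yT (le_trans x0 xy).
  rewrite ger0_norm ?subr_ge0//; apply: le_lt_trans mesh.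
  have := gridS 0 T N i; rewrite subr0 -/x -/y => <-; rewrite lerD2l lerN2.
Unshelve. all: by end_near.
Qed.

Lemma continuous_div_onem h (s : R) : s < 1 -> {for s, continuous h} ->
  {for s, continuous (fun x => h x / (1 - x))}.
Proof.
move=> s1 ch; apply: cvgM; first exact: ch.
apply: cvgV; first by rewrite subr_eq0 gt_eqF.
by apply: cvgB; [exact: cvg_cst|exact: cvg_id].
Qed.

(* Multiplying the increments of h + c J by g = J' = h / (1 - t) and summing by
   parts leaves (c - 1/2) times a Riemann sum of g ^ 2. *)
Lemma hardy_bound (c E T : R) h : 2^-1 < c ->
  (forall s, s < 1 -> {for s, continuous h}) -> (forall s, s <= 0 -> h s = 0) ->
  energy_le (fun t => h t + drift_int c h t) E -> 0 <= T -> T < 1 ->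
  (c - 2^-1) ^+ 2 * \int[lebesgue_measure]_(x in `[(-1)%R, T]) ((h x / (1 - x)) ^+ 2) <= E.
Proof.
move=> c2 ch h0 kE T0 T1.
pose g x := h x / (1 - x); pose J := drift_int 1 h.
pose G2 T := \int[lebesgue_measure]_(x in `[(-1)%R, T]) (g x ^+ 2).
have cg s : s < 1 -> {for s, continuous g}.
  by move=> s1; apply: continuous_div_onem => //; exact: ch.
have cg2 s : s < 1 -> {for s, continuous (fun x => g x ^+ 2)}.
  by move=> s1; apply: cvgM; exact: cg.
have dJ x : 0 <= x <= T -> is_derive x 1 J (g x).
  move=> /andP[x0 xT]; rewrite /g mulrC -[_^-1]mul1r; apply: is_derive_drift => //.
    exact: lt_le_trans (ltrN10 _) x0.
  exact: le_lt_trans T1.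
have dG x : 0 <= x <= T -> is_derive x 1 G2 (g x ^+ 2).
  move=> /andP[x0 xT]; apply: is_derive_integral => //.
    exact: lt_le_trans (ltrN10 _) x0.
  exact: le_lt_trans T1.
have G20 : G2 0 = 0 by apply: integral_eq0_neg => // s s0; rewrite /g h0// mul0r expr0n.
have J0 : J 0 = 0 by exact: drift_int_neg.
have g0 : g 0 = 0 by rewrite /g h0// mul0r.
pose r N i := grid 0 T N i.
pose Q N := \sum_(i < N.+1) g (r N i.+1) ^+ 2 * (r N i.+1 - r N i).
pose X N := \sum_(i < N.+1) g (r N i.+1) *
   ((h (r N i.+1) + drift_int c h (r N i.+1)) - (h (r N i) + drift_int c h (r N i))).
have XQ N : X N ^+ 2 <= E * Q N.
  apply: (kE N.+1 (r N) (fun i => g (r N i.+1))).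
  - by rewrite /r grid0.
  - by move=> i _; exact: grid_le.
  - by rewrite /r gridN.
have inT x : 0 <= x <= T -> x < 1 by move=> /andP[_ /le_lt_trans]; apply.
have rT N i : (i <= N.+1)%N -> 0 <= r N i <= T by move=> iN; exact: grid_bound.
have [M M0 gM] : exists2 M, 0 <= M & forall x, 0 <= x <= T -> `|g x| <= M.
  have cgT : {within `[0, T], continuous (fun x => `|g x|)}.
    apply: continuous_in_subspaceT => x; rewrite inE/= in_itv/= => xT.
    by apply: cvg_norm; apply: cg; exact: inT.
  have [m _ hm] := EVT_max T0 cgT.
  by exists `|g m| => // x xT; apply: hm; rewrite in_itv.
have cvQ : Q N @[N --> \oo] --> G2 T.
  have := @weighted_riemann _ G2 (fun _ _ => 1) 1 T T0 (fun x xT => cg2 x (inT x xT)) dG ler01.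
  move=> /(_ (fun _ _ _ => eq_ind_r (fun z => z <= 1) (lexx 1) (normr1 R))) cv.
  rewrite -[G2 T]add0r; apply: cvg_trans (cvgD cv (cvg_cst (G2 T))).
  apply: near_eq_cvg; near=> N; apply/esym; rewrite /GRing.add/=.
  under eq_bigr do rewrite mul1r.
  rewrite sumrB -[X in _ - X + _](big_mkord predT (fun i => G2 (r N i.+1) - G2 (r N i))).
  by rewrite telescope_sumr// /r gridN grid0 G20 subr0 subrK.
pose eta N := \sum_(i < N.+1) g (r N i.+1) *
    (g (r N i.+1) * (r N i.+1 - r N i) - (J (r N i.+1) - J (r N i))).
have cve : eta N @[N --> \oo] --> 0.
  apply: (@weighted_riemann g J (fun N i => g (r N i.+1)) M T T0) => //.
    by move=> x xT; exact: cg (inT x xT).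
  by move=> N i iN; exact/gM/rT.
have XE N : (c - 2^-1) * Q N - c * eta N <= X N.
  have -> : X N = (\sum_(i < N.+1) g (r N i.+1) * (h (r N i.+1) - h (r N i))) +
      c * (Q N - eta N).
    rewrite /Q /eta -sumrB mulr_sumr -big_split/=; apply: eq_bigr => i _.
    have hr j : (j <= N.+1)%N -> drift_int c h (r N j) = c * J (r N j).
      by move=> jN; apply: drift_intZ => //; apply: inT; exact: rT.
    by rewrite !hr//; [ring|exact: ltnW].
  (* Discrete integration by parts. With [h = (1 - x) g], the term of each cell exceeds the claimed
     lower bound plus the increment of [A] by [(1 - x) (p - q) ^ 2 / 2], and [A] telescopes from 0
     to a nonnegative value. *)
  suff : - 2^-1 * Q N <= \sum_(i < N.+1) g (r N i.+1) * (h (r N i.+1) - h (r N i)).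
    by rewrite mulrBr mulrBl; lra.
  have hg x : 0 <= x <= T -> h x = (1 - x) * g x.
    by move=> xT; rewrite /g mulrC divfK// subr_eq0 gt_eqF// inT.
  pose A i := 2^-1 * ((1 - r N i) * g (r N i) ^+ 2).
  have : \sum_(i < N.+1) (A i.+1 - A i) = A N.+1.
    rewrite -(big_mkord predT (fun i => A i.+1 - A i)) telescope_sumr//.
    by rewrite [A 0%N]/A /r grid0 g0 expr0n/= !mulr0 subr0.
  have : 0 <= A N.+1.
    by rewrite /A mulr_ge0 ?invr_ge0// mulr_ge0 ?sqr_ge0// subr_ge0 ltW// inT// rT.
  move=> h1 h2; rewrite -h2 in h1.
  apply: (@le_trans _ _ (- 2^-1 * Q N + \sum_(i < N.+1) (A i.+1 - A i))); first by rewrite lerDl.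
  rewrite /Q mulr_sumr -big_split/=; apply: ler_sum => i _.
  have ri := rT N i (ltnW (ltn_ord i)); have ri' := rT N i.+1 (ltn_ord i).
  rewrite !hg// /A; have /inT := ri.
  move: (r N i) (r N i.+1) (g (r N i)) (g (r N i.+1)) => x y p q x1.
  have : 0 <= (1 - x) * (p - q) ^+ 2 by rewrite mulr_ge0 ?sqr_ge0// subr_ge0 ltW.
  by rewrite sqrrB; lra.
pose q := G2 T; pose k := c - 2^-1.
have k0 : 0 < k by rewrite subr_gt0.
have q0 : 0 <= q by apply: Rintegral_ge0 => x _; exact: sqr_ge0.
(* The square of [X N] is bounded below by its tangent line at [k * q], so that the lower bound on
   [X N] is enough. *)
have lim : 2 * (k * q) * (k * q) - (k * q) ^+ 2 <= E * q.
  have FF : ProperFilter (nbhs (\oo : set_system nat)) by exact: eventually_filter.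
  apply: (ler_cvg_to (f := fun N => 2 * (k * q) * (k * Q N - c * eta N) - (k * q) ^+ 2)
    (g := fun N => E * Q N) (a := nbhs \oo)).
  - apply: cvgB; last exact: cvg_cst.
    have kk : k * q = k * q - c * 0 by rewrite mulr0 subr0.
    apply: cvgM; first exact: cvg_cst.
    rewrite [X in _ --> X]kk.
    by apply: cvgB; apply: cvgM => //; exact: cvg_cst.
  - by apply: cvgM => //; exact: cvg_cst.
  - near=> N; apply: le_trans (XQ N).
    have := XE N; rewrite -/k => hX.
    have kq : 0 <= 2 * (k * q) by rewrite mulr_ge0// mulr_ge0// ltW.
    have := ler_wpM2l kq hX; have := sqr_ge0 (X N - k * q); rewrite sqrrB; lra.
have [q1|] := ltP 0 q; last first.
  by move=> q1; rewrite [X in _ * X](_ : _ = q)// (le_anti (introT andP (conj q1 q0))) mulr0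
    (energy_ge0 kE).
rewrite -(ler_pM2r q1) -[X in _ * X * _]/q; apply: le_trans lim.
by rewrite -/k expr2; nra.
Unshelve. all: by end_near.
Qed.

(** The choice [l = X / S] is optimal; when [S = 0], a suitable [l] rules out [X] different from
    0. *)
Lemma discriminant_le (X K S : R) : (forall l, 2 * l * X <= K + l ^+ 2 * S) -> 0 <= S ->
  X ^+ 2 <= K * S.
Proof.
move=> h; rewrite le_eqVlt => /predU1P[S0|S0].
  have [->|X0] := eqVneq X 0; first by rewrite expr0n/= -S0 mulr0.
  have := h ((K + 1) / (2 * X)); rewrite -S0 mulr0 addr0.
  have -> : 2 * ((K + 1) / (2 * X)) * X = K + 1 by field.
  by move=> h1; exfalso; lra.
have := h (X / S); have -> : 2 * (X / S) * X = 2 * (X ^+ 2 / S) by ring.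
have -> : (X / S) ^+ 2 * S = X ^+ 2 / S by field; rewrite gt_eqF.
by rewrite -ler_pdivrMr//; lra.
Qed.

(** The derivative [g] of [J] satisfies the Hardy bound up to every time below 1; integrating
    [(g - l a) ^ 2 >= 0] cell by cell gives the quadratic inequality in [l]. *)
Lemma drift_energy (c E : R) h : 2^-1 < c ->
  (forall s, s < 1 -> {for s, continuous h}) -> (forall s, s <= 0 -> h s = 0) ->
  energy_le (fun t => h t + drift_int c h t) E ->
  energy_le (drift_int 1 h) (E / (c - 2^-1) ^+ 2).
Proof.
move=> c2 ch h0 kE N t a t0 tS tN.
pose g x := h x / (1 - x); pose J := drift_int 1 h.
pose G2 T := \int[lebesgue_measure]_(x in `[(-1)%R, T]) (g x ^+ 2).
have cg2 s : s < 1 -> {for s, continuous (fun x => g x ^+ 2)}.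
  by move=> s1; apply: cvgM; apply: continuous_div_onem => //; exact: ch.
have mono := nondecreasing_steps tS.
apply: discriminant_le; last first.
  by apply: sumr_ge0 => i _; rewrite mulr_ge0 ?sqr_ge0// subr_ge0 tS.
move=> l; pose K := G2 (t N) - G2 (t 0%N).
apply: (@le_trans _ _ (K + l ^+ 2 * \sum_(i < N) a i ^+ 2 * (t i.+1 - t i))); last first.
  rewrite lerD2r; apply: (@le_trans _ _ (G2 (t N))).
    by rewrite gerBl; apply: Rintegral_ge0 => x _; exact: sqr_ge0.
  rewrite ler_pdivlMr ?exprn_gt0 ?subr_gt0// mulrC.
  by apply: hardy_bound => //; exact: le_trans (mono 0%N N _ _).
have -> : K = \sum_(i < N) (G2 (t i.+1) - G2 (t i)).
  by rewrite -(big_mkord predT (fun i => G2 (t i.+1) - G2 (t i))) telescope_sumr.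
rewrite !mulr_sumr -big_split/=; apply: ler_sum => i _.
have t0i : 0 <= t i by exact: le_trans (mono 0%N i _ (ltnW _)).
have ti1 : t i.+1 < 1 by exact: le_lt_trans (mono i.+1 N (ltn_ord i) _) tN.
pose p (x : R) := G2 x - 2 * l * a i * J x + l ^+ 2 * a i ^+ 2 * x.
have := @le_derive_dist R (cst 0) p (fun=> 0) (fun x => (g x - l * a i) ^+ 2) (t i) (t i.+1)
  (tS i (ltn_ord i)).
rewrite subrr normr0 /p => H; rewrite -subr_ge0; apply: le_trans (H _ _ _) _.
- move=> x /andP[x0 x1].
  have x1' : x < 1 by exact: le_lt_trans ti1.
  have x0' : -1 < x by rewrite (lt_le_trans (ltrN10 _))// (le_trans t0i).
  have dJ : is_derive x 1 J (g x).
    by rewrite /g mulrC -[_^-1]mul1r; exact: is_derive_drift.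
  have dG : is_derive x 1 G2 (g x ^+ 2) by exact: is_derive_integral.
  have := is_deriveD (is_deriveB dG (is_deriveZ (2 * l * a i) dJ))
    (is_deriveZ (l ^+ 2 * a i ^+ 2) (is_derive_id x 1)).
  rewrite /GRing.scale/= mulr1.
  by have -> : g x ^+ 2 - 2 * l * a i * g x + l ^+ 2 * a i ^+ 2 = (g x - l * a i) ^+ 2 by ring.
- by move=> x _; rewrite sqr_ge0.
- by rewrite -/J; lra.
Qed.

(** The two driving paths differ by [c' - c] times [J]. Only the starting exponent has to exceed
    1/2. *)
Lemma energy_drift_change (c c' E : R) h : 2^-1 < c ->
  (forall s, s < 1 -> {for s, continuous h}) -> (forall s, s <= 0 -> h s = 0) ->
  energy_le (fun t => h t + drift_int c h t) E ->
  energy_le (fun t => h t + drift_int c' h t)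
    (2 * E + 2 * (c' - c) ^+ 2 * (E / (c - 2^-1) ^+ 2)).
Proof.
move=> c2 ch h0 kE; have := energy_leD (c' - c) kE (drift_energy c2 ch h0 kE).
apply: eq_energy_le => t _ t1.
by rewrite (drift_intZ c)// (drift_intZ c')//; ring.
Qed.

(** Finite energy bounds the increments of [k] by the square root of the elapsed time, so [k] has a
    limit at time 1; the extension by this limit is a driving path to which polygonal interpolation
    applies. *)
Lemma energy_extend k E : (forall s, s < 1 -> {for s, continuous k}) -> energy_le k E ->
  exists kh : R -> R, [/\ continuous kh, forall t, t < 1 -> kh t = k t,
    forall t, 1 <= t -> kh t = kh 1
    & forall N (t a : nat -> R), 0 <= t 0%N -> (forall i, (i < N)%N -> t i <= t i.+1) ->
        t N <= 1 -> (\sum_(i < N) a i * (kh (t i.+1) - kh (t i))) ^+ 2 <=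
          E * \sum_(i < N) a i ^+ 2 * (t i.+1 - t i)].
Proof.
move=> ck kE; have E0 := energy_ge0 kE.
have near_left (s : R) : s < 1 -> \forall t \near 1^'-, s < t < 1.
  move=> s1; near=> t; apply/andP; split; last by near: t; exact: nbhs_left_lt.
  by near: t; exact: nbhs_left_gt.
have ex_cvg : cvg (k t @[t --> 1^'-]).
  apply/cauchy_cvgP/cauchy_exP => e e0.
  pose s : R := Num.max 0 (1 - e ^+ 2 / (E + 1)).
  have E1 : 0 < E + 1 by rewrite ltr_wpDl.
  have s1 : s < 1 by rewrite gt_max ltr01/= ltrBlDr ltrDl divr_gt0// exprn_gt0.
  have s0 : 0 <= s by rewrite le_max lexx.
  exists (k s); change (\forall t \near 1^'-, ball (k s) e (k t)); near=> t.
  have /andP[st t1] : s < t < 1 by near: t; exact: near_left.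
  have h := energy_dist kE s0 (ltW st) t1.
  rewrite /ball/= distrC -ltr_sqr ?nnegrE ?(ltW e0)// real_normK ?num_real//.
  apply: le_lt_trans h _; have : 1 - s <= e ^+ 2 / (E + 1).
    by rewrite lerBlDl -lerBlDr le_max lexx orbT.
  rewrite ler_pdivlMr// => h2; nra.
pose kap := lim (k t @[t --> 1^'-]).
have cv1 : k t @[t --> 1^'-] --> kap by exact: ex_cvg.
pose kh t := if t < 1 then k t else kap.
have khE t : t < 1 -> kh t = k t by rewrite /kh => ->.
have kh1 t : 1 <= t -> kh t = kap by rewrite /kh ltNge => ->.
have ckh : continuous kh.
  move=> t; have [t1|t1] := ltP t 1.
    rewrite /continuous_at khE//; apply: cvg_trans (ck t t1).
    apply: near_eq_cvg; near=> s; apply/esym/khE.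
    by near: s; exact: lt_nbhsl.
  rewrite /continuous_at kh1//; apply/cvgrPdist_le => e e0.
  move: t1; rewrite le_eqVlt => /predU1P[<-|t1].
    move/cvgrPdist_le: (cv1) => /(_ e e0) h; near=> s.
    have [s1|s1] := ltP s 1; last by rewrite kh1// subrr normr0 ltW.
    by rewrite khE//; move: s1; near: s; exact: h.
  near=> s; rewrite kh1 ?subrr ?normr0 ?(ltW e0)// ltW//.
  by near: s; exact: lt_nbhsr.
exists kh; split => //.
  by move=> t t1; rewrite !kh1.
move=> N t a t0 tS tN.
have mono := nondecreasing_steps tS.
have cm i : (i <= N)%N -> Num.min (t i) s @[s --> (1 : R)^'-] --> t i.
  move=> iN; have ti : t i = Num.min (t i) 1.
    by rewrite min_l// (le_trans (mono i N iN _)).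
  rewrite [X in _ --> X]ti; apply: cvg_at_left_filter.
  by apply: (@continuous_min _ R (fun=> t i) id 1); [exact: cvg_cst|exact: cvg_id].
have ckm i : (i <= N)%N -> kh (Num.min (t i) s) @[s --> (1 : R)^'-] --> kh (t i).
  by move=> iN; apply: continuous_cvg; [exact: ckh|exact: cm].
apply: (ler_cvg_to
  (f := fun s : R => (\sum_(i < N) a i * (kh (Num.min (t i.+1) s) - kh (Num.min (t i) s))) ^+ 2)
  (g := fun s : R => E * \sum_(i < N) a i ^+ 2 * (Num.min (t i.+1) s - Num.min (t i) s))
  (a := 1^'-)).
- rewrite expr2; apply: cvgM; apply: cvg_sumr => i _; apply: cvgM;
    first [exact: cvg_cst|by apply: cvgB; apply: ckm => //; exact: ltnW].
- apply: cvgM; first exact: cvg_cst.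
  apply: cvg_sumr => i _; apply: cvgM; first exact: cvg_cst.
  by apply: cvgB; apply: cm => //; exact: ltnW.
(* The truncated partition stays below time 1. Truncation may merge times, which [energy_le]
   permits. *)
- near=> s; have /andP[s0 s1] : 0 < s < 1 by near: s; exact: near_left.
  have kEs := @kE N (fun i => Num.min (t i) s) a.
  rewrite [X in X ^+ 2 <= _](_ : _ = \sum_(i < N) a i *
    (k (Num.min (t i.+1) s) - k (Num.min (t i) s))); last first.
    by apply: eq_bigr => i _; rewrite !khE// gt_min s1 orbT.
  apply: kEs.
  + by rewrite le_min t0 ltW.
  + by move=> i iN; rewrite le_min !ge_min tS// lexx orbT.
  + by rewrite gt_min s1 orbT.
Unshelve. all: by end_near.
Qed.

Lemma eq_derive (f g df : R -> R) (s t : R) : s <= t ->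
  (forall x, s <= x <= t -> is_derive x 1 f (df x)) ->
  (forall x, s <= x <= t -> is_derive x 1 g (df x)) -> f s = g s -> f t = g t.
Proof.
move=> st hf hg fg.
have : `|f t - g t - (f s - g s)| <= cst 0 t - cst 0 s :> R.
  apply: (@le_derive_dist R (fun x => f x - g x) (cst 0) (fun=> 0) (fun=> 0) s t st) => x xst.
  - by have := is_deriveB (hf x xst) (hg x xst); rewrite subrr.
  - by rewrite normr0.
by rewrite /= fg !subrr subr0 normr_le0 subr_eq0 => /eqP.
Qed.

Lemma bridge_path_drift (c t : R) (b : R -> R) : 0 < c -> continuous b -> (forall s, s <= 0 -> b s = 0) ->
  t < 1 -> bridge_path c b t + drift_int c (bridge_path c b) t = b t.
Proof.
move=> c0 cb b0 t1; have [t0|t0] := leP t 0.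
  by rewrite drift_int_neg// /bridge_path ?ltNge ?t0 ?addr0 ?b0// => s s0; rewrite ltNge s0.
suff : drift_int c (bridge_path c b) t = c * (1 - t) `^ c * bridge_int c b t.
  by move=> ->; rewrite bridge_pathE// subrK.
apply: (@eq_derive (drift_int c (bridge_path c b))
  (fun x => c * (1 - x) `^ c * bridge_int c b x) (fun x => c / (1 - x) * bridge_path c b x) 0 t (ltW t0)).
- move=> x /andP[x0 xt]; apply: is_derive_drift.
  + by move=> s _; exact: continuous_bridge_path.
  + exact: lt_le_trans (ltrN10 _) x0.
  + exact: le_lt_trans t1.
- move=> x /andP[x0 xt]; have x1 : x < 1 by exact: le_lt_trans t1.
  have x1' : -1 < x by exact: lt_le_trans (ltrN10 _) x0.
  have h1 := is_derive_powR_onem c x1.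
  have h2 := is_derive_bridge_int c (fun s _ => cb s) x1' x1.
  have h3 := is_deriveZ c (is_deriveM h1 h2).
  have -> : (fun x => c * (1 - x) `^ c * bridge_int c b x) =
      c *: ((fun x => (1 - x) `^ c) * bridge_int c b).
    by apply/funext => y; rewrite -mulrA.
  have u0 : 0 < 1 - x by rewrite subr_gt0.
  have e1 : (1 - x) `^ (c - 1) = (1 - x) `^ c / (1 - x).
    by rewrite powRD ?powR_inv1 ?ltW// (gt_eqF u0) implybT.
  have e2 : (1 - x) `^ c * (1 - x) `^ (- c - 1) = (1 - x)^-1.
    rewrite -powRD; last by rewrite (gt_eqF u0) implybT.
    by rewrite addrA subrr sub0r powR_inv1// ltW.
  have -> : c / (1 - x) * bridge_path c b x =
    c *: ((1 - x) `^ c *: ((1 - x) `^ (- c - 1) * b x) +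
      bridge_int c b x *: (- c * (1 - x) `^ (c - 1))).
    rewrite /GRing.scale/= mulrA e2 e1 bridge_pathE//; ring.
  exact: h3.
- by rewrite drift_int_neg ?bridge_int_neg ?mulr0// => s s0; rewrite /bridge_path ltNge s0.
Qed.

(* The path h = (1 - t) ^ c - (1 - t): here h + c J = (1 - c) t, whereas h + J is a
   multiple of 1 - (1 - t) ^ c, whose derivative is not square integrable. *)
Lemma energy_gap (c : R) : 0 < c -> c <= 2^-1 -> exists h : R -> R,
  [/\ continuous h, forall t, t \notin `]0, 1[ -> h t = 0,
      exists E, energy_le (fun t => h t + drift_int c h t) E
    & forall E, ~ energy_le (fun t => h t + drift_int 1 h t) E].
Proof.
move=> c0 c2; have c1 : c < 1 by rewrite (le_lt_trans c2)// invf_lt1// ltr1n.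
(* The driving path [(1 - c) t], truncated so as to be continuous on the line and 0 at negative
   times. *)
pose b (t : R) := (1 - c) * Num.max 0 (Num.min 1 t).
have b_neg t : t <= 0 -> b t = 0.
  by move=> t0; rewrite /b max_l ?mulr0// ge_min t0 orbT.
have b_id t : 0 <= t -> t < 1 -> b t = (1 - c) * t.
  by move=> t0 t1; rewrite /b min_r ?(ltW t1)// max_r.
have cb : continuous b.
  move=> x; apply: cvgM; first exact: cvg_cst.
  apply: (@continuous_max _ R (fun=> 0) _ x); first exact: cvg_cst.
  by apply: (@continuous_min _ R (fun=> 1) id x); [exact: cvg_cst|exact: cvg_id].
pose h := bridge_path c b.
have h_neg t : t <= 0 -> h t = 0 by move=> t0; rewrite /h /bridge_path ltNge t0.
have hE t : 0 <= t -> t < 1 -> h t = (1 - t) `^ c - (1 - t).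
  move=> t0 t1; rewrite /h bridge_pathE// b_id//.
  have K := powR_onemK c t1; have cn0 : c != 0 by rewrite gt_eqF.
  suff -> : bridge_int c b t = ((1 - c * t) * (1 - t) `^ (- c) - 1) / c.
    rewrite (_ : c * _ * _ = (1 - c * t) * ((1 - t) `^ c * (1 - t) `^ (- c)) - (1 - t) `^ c).
      by rewrite K; ring.
    by move: ((1 - t) `^ c) ((1 - t) `^ (- c)) => x y; field.
  apply: (@eq_derive (bridge_int c b) (fun x => ((1 - c * x) * (1 - x) `^ (- c) - 1) / c)
    (fun x => (1 - x) `^ (- c - 1) * b x) 0 t t0).
  - move=> x /andP[x0 xt]; apply: is_derive_bridge_int => //.
    + by move=> s _; exact: cb.
    + exact: lt_le_trans (ltrN10 _) x0.
    + exact: le_lt_trans t1.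
  - move=> x /andP[x0 xt]; have x1 : x < 1 by exact: le_lt_trans t1.
    have u0 : 0 < 1 - x by rewrite subr_gt0.
    have h1 := is_derive_powR_onem (- c) x1.
    have h2 : is_derive x 1 (fun x : R => 1 - c * x) (- c).
      have := is_deriveB (is_derive_cst (1 : R^o) x 1) (is_deriveZ c (is_derive_id x 1)).
      by rewrite /GRing.scale/= sub0r mulr1.
    have h3 := is_deriveZ c^-1 (is_deriveB (is_deriveM h2 h1) (is_derive_cst (1 : R^o) x 1)).
    have -> : (fun x => ((1 - c * x) * (1 - x) `^ (- c) - 1) / c) =
        c^-1 *: ((fun x => 1 - c * x) * (fun x => (1 - x) `^ (- c)) - cst 1).
      by apply/funext => y; rewrite mulrC.
    apply: (is_derive_eq h3); rewrite /GRing.scale/= subr0 b_id//.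
    have -> : (1 - x) `^ (- c) = (1 - x) `^ (- c - 1) * (1 - x).
      rewrite -{3}(powRr1 (ltW u0)) -powRD ?subrK//.
      by rewrite (gt_eqF u0) implybT.
    by move: ((1 - x) `^ (- c - 1)) => y; field.
  - rewrite bridge_int_neg// mulr0 !subr0 mul1r powR1 subrr mul0r//.
exists h; split.
- exact: continuous_bridge_path.
- by move=> t; rewrite in_itv/= => /negPf t01; rewrite /h /bridge_path t01.
- exists ((1 - c) ^+ 2); apply: eq_energy_le (energy_linear (1 - c)) => t t0 t1.
  by rewrite /= bridge_path_drift// b_id.
move=> E hE1.
pose K := c^-1 - 1.
have {}hE1 : energy_le (fun t => K - K * (1 - t) `^ c) E.
  apply: eq_energy_le hE1 => t t0 t1.
  have := bridge_path_drift c0 cb b_neg t1.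
  rewrite -/h drift_intZ//; last by move=> s _; exact: continuous_bridge_path.
  rewrite hE// b_id// => e1.
  have -> : drift_int 1 h t = ((1 - c) * t - ((1 - t) `^ c - (1 - t))) / c.
    by rewrite -e1; field; rewrite gt_eqF.
  by rewrite /K; field; rewrite gt_eqF.
have K0 : 0 < K by rewrite /K subr_gt0 invf_gt1.
pose q : R := 2^-1 `^ c.
have q0 : 0 < q by rewrite powR_gt0// invr_gt0.
have q1 : q < 1.
  have <- : 1 `^ c = 1 :> R by rewrite powR1.
  rewrite gt0_ltr_powR//.
  - by rewrite nnegrE invr_ge0.
  - by rewrite nnegrE.
  - by rewrite invf_lt1// ltr1n.
have q2 : 2^-1 <= q ^+ 2.
  rewrite /q -powR_mulrn ?powR_ge0// -powRrM ger1_powR//.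
    by rewrite invr_gt0 invf_le1// ler1n ltr0n.
  by rewrite -ler_pdivlMr// mul1r.
pose kap := 2 * K ^+ 2 * (1 - q) ^+ 2.
have kap0 : 0 < kap.
  apply: mulr_gt0; last by rewrite exprn_gt0 ?subr_gt0.
  by apply: mulr_gt0 => //; exact: exprn_gt0.
have [N hN] : exists N : nat, E < N%:R * kap.
  exists (Num.truncn (E / kap)).+1; rewrite -ltr_pdivrMr//; exact: truncnS_gt.
(* Dyadic times approaching 1. The squared increment over the [i]-th cell divided by its length is
   [kap] times the [i]-th power of [2 q ^ 2], hence at least [kap], since [c <= 1 / 2] means
   [2 q ^ 2 >= 1]. So [N] cells carry an energy of at least [N * kap]. *)
pose t (i : nat) : R := 1 - 2^-1 ^+ i.
have tc i : (1 - t i) `^ c = q ^+ i.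
  have h2 : 0 <= 2^-1 :> R by rewrite invr_ge0.
  rewrite /t opprB addrC subrK -(powR_mulrn i h2) -powRrM mulrC powRrM -/q.
  by rewrite powR_mulrn// ltW.
have dt i : t i.+1 - t i = 2^-1 ^+ i.+1.
  by rewrite /t exprS; move: (2^-1 ^+ i) => x; field.
pose D i := K * q ^+ i * (1 - q).
pose S := \sum_(i < N) D i ^+ 2 * 2 ^+ i.+1.
have t0 : t 0%N = 0 by rewrite /t expr0 subrr.
have p2 i : 0 < 2^-1 ^+ i :> R by rewrite exprn_gt0// invr_gt0.
have : S ^+ 2 <= E * S.
  (* The optimal weights, increment over length, turn the energy bound into [S ^ 2 <= E * S]. *)
  have := hE1 N t (fun i => D i * 2 ^+ i.+1); rewrite t0 => /(_ (lexx 0)).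
  have S1 i : (i < N)%N -> t i <= t i.+1 by move=> _; rewrite -subr_ge0 dt ltW.
  have tN1 : t N < 1 by rewrite /t ltrBlDr ltrDl.
  move=> /(_ S1 tN1); congr (_ ^+ 2 <= _ * _); apply: eq_bigr => i _.
    by rewrite !tc /D [q ^+ i.+1]exprS; ring.
  rewrite dt exprMn -mulrA; congr (_ * _).
  by rewrite expr2 -mulrA -exprMn divff ?pnatr_eq0// expr1n mulr1.
have SN : N%:R * kap <= S.
  rewrite mulrC -[N in leLHS]card_ord mulr_natr -sumr_const; apply: ler_sum => i _.
  have -> : D i ^+ 2 * 2 ^+ i.+1 = kap * (2 * q ^+ 2) ^+ i.
    by rewrite /D /kap [(2 * _) ^+ i]exprMn -exprM mulnC exprM [2 ^+ i.+1]exprS; ring.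
  rewrite ler_peMr ?(ltW kap0)// exprn_ege1//; lra.
have E0 := energy_ge0 hE1.
have S0 : 0 < S by rewrite (lt_le_trans _ SN)// (le_lt_trans E0).
rewrite expr2 ler_pM2r// => SE.
by move: (lt_le_trans hN SN); rewrite ltNge SE.
Qed.
End energy.

(** * Brownian paths and the laws of the bridge increments *)

Lemma measure_ae_eq d (T : measurableType d) (R : realType) (P : probability T R)
    (A B : set T) : measurable A -> measurable B -> {ae P, forall w, A w <-> B w} ->
  P A = P B.
Proof.
move=> mA mB [N [mN N0 NAB]].
have sub (C D : set T) : (forall w, ~ N w -> C w -> D w) -> C `<=` D `|` N.
  by move=> CD w Cw; have [|] := pselect (N w); [right|left; exact: CD].
have e w : ~ N w -> (A w <-> B w) by move=> Nw; apply: contrapT => h; apply: Nw; exact: NAB.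
have half (C D : set T) : measurable C -> measurable D -> C `<=` D `|` N -> (P C <= P D)%E.
  move=> mC mD CD; apply: (@le_trans _ _ (P (D `|` N))).
    by apply: le_measure; rewrite ?inE//; exact: measurableU.
  by rewrite -[leRHS]adde0 -N0; exact: measureU2.
by apply/eqP; rewrite eq_le !half//; apply: sub => w /e [].
Qed.

Lemma ae_conull d (T : measurableType d) (R : realType) (P : probability T R)
    (Q : T -> Prop) : {ae P, forall w, Q w} ->
  exists G : set T, [/\ measurable G, P (~` G) = 0%E & forall w, G w -> Q w].
Proof.
move=> [N [mN N0 NQ]]; exists (~` N); split; first exact: measurableC.
  by rewrite setCK.
by move=> w Nw; apply: contrapT => h; apply: Nw; exact: NQ.
Qed.

(* Coordinates of a Brownian motion stopped at time 1, with every path continuous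
   and extended by 0 to the negative times. *)
Definition wiener d (T : measurableType d) (R : realType) (P : probability T R)
    (n : nat) (W : 'I_n -> T -> R -> R) :=
  [/\ forall j w, continuous (W j w), forall j w t, t <= 0 -> W j w t = 0,
      forall j w t, 1 <= t -> W j w t = W j w 1,
      forall j t, measurable_fun setT (fun w => W j w t)
    & forall M (t : nat -> R), 0 <= t 0%N -> (forall i, (i < M)%N -> t i < t i.+1) ->
        t M <= 1 ->
        indep_gauss P (fun (p : 'I_M * 'I_n) w => W p.2 w (t p.1.+1) - W p.2 w (t p.1))
          (fun p => Num.sqrt (t p.1.+1 - t p.1))].

Lemma strict_steps (R : realType) (t : nat -> R) M :
  (forall i, (i < M)%N -> t i < t i.+1) ->
  forall i j, (i <= j)%N -> (j <= M)%N -> t i <= t j.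
Proof. by move=> tS; apply: nondecreasing_steps => i iM; exact/ltW/tS. Qed.

(** Paths are set to 0 off a conull set on which they start at 0 and are continuous, and times are
    clamped to [0, 1]. The almost sure properties become sure, so that the pathwise lemmas apply to
    every [w]. *)
Lemma brownian_wiener d (T : measurableType d) (R : realType) (P : probability T R)
    (n : nat) (B : R -> T -> 'rV[R]_n) : brownian_motion P B ->
  exists2 W, wiener P W &
    {ae P, forall w t j, 0 <= t <= 1 -> W j w t = B t w 0 j}.
Proof.
move=> [mB B0 indB lawB cB].
have [G [mG PG hG]] := ae_conull (filterI B0 cB).
pose cl (t : R) := Num.min (Num.max t 0) 1.
have cl01 t : 0 <= cl t <= 1 by rewrite /cl le_min ge_min le_max !lexx ler01 !orbT.
have clE t : 0 <= t <= 1 -> cl t = t by move=> /andP[t0 t1]; rewrite /cl max_l// min_l.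
pose W (j : 'I_n) w t : R := \1_G w * B (cl t) w 0 j.
have WG j w t : G w -> W j w t = B (cl t) w 0 j by move=> Gw; rewrite /W indicE mem_set// mul1r.
have aeG : {ae P, forall w, G w}.
  by exists (~` G); split => //; exact: measurableC.
have mBj j t : 0 <= t -> measurable_fun setT (fun w => B t w 0 j).
  move=> t0; exact: (measurableT_comp (@measurable_coord R n j) (mB t t0)).
have mW j t : measurable_fun setT (fun w => W j w t).
  apply: measurable_funM; first exact: measurable_indic.
  by apply: mBj; have /andP[] := cl01 t.
exists W; last first.
  by apply: filterS aeG => w Gw t j t01; rewrite WG// clE.
split => //.
- move=> j w; have [Gw|Gw] := pselect (G w); last first.
    rewrite /W indicE memNset//; under eq_fun do rewrite mul0r; exact: cst_continuous.
  have -> : W j w = (fun t => B t w 0 j) \o cl by apply/funext => t; rewrite /= WG.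
  have [_ cw] := hG w Gw.
  have ccl : continuous cl.
    move=> t; apply: (@continuous_min _ R (fun x => Num.max x 0) (fun=> 1) t).
      by apply: (@continuous_max _ R id (fun=> 0) t); [exact: cvg_id|exact: cvg_cst].
    exact: cvg_cst.
  move=> t; apply: (@cvg_comp _ _ _ (fun t => B (cl t) w) (fun x : 'rV[R]_n => x 0 j) _ (nbhs (B (cl t) w))); last exact: coord_continuous.
  have cBt : B x w @[x --> within `[0, +oo[%classic (nbhs (cl t))] --> B (cl t) w.
    by move/subspace_continuousP: cw; apply; rewrite /= in_itv/= andbT; have /andP[] := cl01 t.
  move=> U /cBt hU; 
  have h : nbhs t (fun s : R => `[0, +oo[%classic (cl s) -> U (B (cl s) w)) := ccl t _ hU.
  change (nbhs t (fun s : R => U (B (cl s) w))); apply: filterS h => s; apply.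
  by rewrite /= in_itv/= andbT; have /andP[] := cl01 s.
- move=> j w t t0; have [Gw|Gw] := pselect (G w); last by rewrite /W indicE memNset// mul0r.
  rewrite WG// /cl max_r// min_l//; have [-> _] := hG w Gw; by rewrite mxE.
- by move=> j w t t1; rewrite /W /cl !max_l// ?min_r// ?ler01// (le_trans ler01).
move=> M t t0 tS tM; split=> [p|A mA]; first exact: measurable_funB.
have mono := strict_steps tS.
have t01 i : (i <= M)%N -> 0 <= t i <= 1.
  by move=> iM; rewrite (le_trans t0 (mono 0%N i _ _))// (le_trans (mono i M _ _) tM).
(* The independence hypothesis takes sets indexed by all natural numbers; the indices from [M] on
   receive the whole space. *)
pose A' (i : nat) : set (borel 'rV[R]_n) :=
  if insub i is Some i' then box (fun j => A (i', j)) else setT.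
have A'E (i : 'I_M) : A' i = box (fun j => A (i, j)) by rewrite /A' valK.
have mA' i : measurable (A' i).
  by rewrite /A'; case: insub => [i'|]; [exact: measurable_box|exact: measurableT].
have mBt i : (i <= M)%N -> measurable_fun setT (B (t i) : T -> borel 'rV[R]_n).
  by move=> /t01/andP[t0i _]; exact: mB.
have mF : measurable [set w | forall p : 'I_M * 'I_n,
    A p (B (t p.1.+1) w 0 p.2 - B (t p.1) w 0 p.2)].
  apply: (@measurable_forall_preimage _ T R ('I_M * 'I_n)%type
    (fun (p : 'I_M * 'I_n) w => B (t p.1.+1) w 0 p.2 - B (t p.1) w 0 p.2) A) => // p.
  have /andP[t1 _] := t01 _ (ltn_ord p.1); have /andP[t2 _] := t01 _ (ltnW (ltn_ord p.1)).
  by apply: measurable_funB; exact: mBj.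
rewrite (@measure_ae_eq _ _ _ P _ _ _ mF); last 2 first.
- apply: measurable_forall_preimage => // p; exact: measurable_funB.
- apply: filterS aeG => w Gw; split => h p; have := h p; rewrite !WG// !clE//; apply: t01 => //; exact/ltnW.
have := indB M t A' t0 tS mA'; cbv zeta; set inc := fun i : nat => _ @^-1` _ => indE.
have -> : [set w | forall p : 'I_M * 'I_n,
    A p (B (t p.1.+1) w 0 p.2 - B (t p.1) w 0 p.2)] = \big[setI/setT]_(i < M) inc i.
  rewrite -bigcap_mkord; apply/seteqP; split => w h.
    move=> i /= iM; rewrite /inc/= (A'E (Ordinal iM)) => j; rewrite !mxE.
    exact: (h (Ordinal iM, j)).
  move=> [i j]; have := h i (ltn_ord i); rewrite /inc/= A'E => /(_ j).
  by rewrite !mxE.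
rewrite indE; transitivity (\prod_(i < M) \prod_(j < n) gauss (Num.sqrt (t i.+1 - t i)) (A (i, j)))%E; last first.
  by rewrite pair_bigA; apply: eq_bigr => -[i j] _.
apply: eq_bigr => i _.
have /andP[ti0 _] := t01 _ (ltnW (ltn_ord i)).
rewrite /inc A'E; transitivity (P [set w | forall j, A (i, j) ((B (t i.+1) w - B (t i) w) 0 j)]) => //.
rewrite (lawB (t i) (t i.+1) (fun j => A (i, j)) ti0 (tS i (ltn_ord i))); last first.
  by move=> j; exact: (mA (i, j)).
apply: eq_bigr => j _; rewrite gauss_gt0E//; last by rewrite sqrtr_gt0 subr_gt0 tS.
Qed.

Lemma bridge_sde_path d (T : measurableType d) (R : realType) (P : probability T R)
    (n : nat) (B : R -> T -> 'rV[R]_n) (W : 'I_n -> T -> R -> R) (c : R)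
    (z : R -> T -> 'rV[R]_n) : 0 < c -> wiener P W ->
  {ae P, forall w t j, 0 <= t <= 1 -> W j w t = B t w 0 j} -> bridge_sde P B c z ->
  {ae P, forall w t j, 0 <= t < 1 -> z t w 0 j = bridge_path c (W j w) t}.
Proof.
move=> c0 [cW W0 W1 mW _] aeW [_ z0 cz zE].
apply: filterS (filterI (filterI aeW z0) (filterI cz zE)) => w [[WB z0w] [czw zEw]] t j /andP[t0 t1].
rewrite bridge_pathE//; last exact: W0.
(* Extension to negative times by the value at 0, which is 0 here; it turns the integral from 0 into
   one from -1. *)
pose zz s := z (Num.max s 0) w 0 j.
have zz0 s : s <= 0 -> zz s = 0 by move=> s0; rewrite /zz max_r// z0w mxE.
have zzE s : 0 <= s -> zz s = z s w 0 j by move=> s0; rewrite /zz max_l.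
rewrite -zzE//; apply: bridge_path_unique => //.
- by move=> s _; exact: cW.
- move=> s s1.
  have s01 : 0 <= Num.max s 0 < 1 by rewrite le_max lexx orbT gt_max s1 ltr01.
  have cmax : {for s, continuous (fun s : R => Num.max s 0)}.
    by apply: (@continuous_max _ R id (fun=> 0) s); [exact: cvg_id|exact: cvg_cst].
  apply: (@cvg_comp _ _ _ (fun s => z (Num.max s 0) w) (fun x : 'rV[R]_n => x 0 j) _
    (nbhs (z (Num.max s 0) w))); last exact: coord_continuous.
  have czs : z x w @[x --> within `[0, 1[%classic (nbhs (Num.max s 0))] --> z (Num.max s 0) w.
    by move/subspace_continuousP: czw; apply; rewrite /= in_itv.
  move=> U /czs hU.
  have h : nbhs s (fun x : R => `[0, 1[%classic (Num.max x 0) -> U (z (Num.max x 0) w)).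
    exact: (cmax _ hU).
  have h1 : nbhs s (fun x : R => x < 1) by exact: lt_nbhsl.
  change (nbhs s (fun x : R => U (z (Num.max x 0) w))).
  apply: filterS (filterI h h1) => x [hx x1]; apply: hx.
  by rewrite /= in_itv/= le_max lexx orbT gt_max x1 ltr01.
- exact: W0.
- move=> s s0 s1; rewrite zzE// zEw ?s0// WB ?s0 ?(ltW s1)//; congr (_ - _).
  rewrite /Rintegral integral_mkcond [in RHS]integral_mkcond; congr fine.
  apply: eq_integral => x _; rewrite /patch/=.
  have [x0|x0] := ltP x 0.
    rewrite memNset; last by rewrite /= in_itv/= leNgt x0.
    by case: ifP => // _; rewrite zz0 ?(ltW x0)// mulr0.
  rewrite zzE//; congr (if _ then _ else _); apply/idP/idP; rewrite !inE/= !in_itv/= ?x0.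
    by move=> /andP[_ ->]; rewrite andbT (le_trans (lerN10 _)).
  by move=> /andP[_ ->].
Qed.

(** The path integral is measurable in [w] as a limit of Riemann sums, which are finite combinations
    of the variables [W j w t]. *)
Lemma measurable_bridge_path d (T : measurableType d) (R : realType) (P : probability T R)
    (n : nat) (W : 'I_n -> T -> R -> R) (c t : R) (j : 'I_n) : 0 < c -> wiener P W ->
  measurable_fun setT (fun w => bridge_path c (W j w) t).
Proof.
move=> c0 [cW W0 _ mW _]; have [t01|t01] := boolP (0 < t < 1); last first.
  rewrite /bridge_path (negPf t01); exact: measurable_cst.
have /andP[t0 t1] := t01.
pose S N w := (1 - t) `^ c * \sum_(q < N.+1) (1 - grid 0 t N q) `^ (- c) *
  (W j w (grid 0 t N q.+1) - W j w (grid 0 t N q)).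
apply: (@measurable_fun_cvg _ _ _ _ S) => [N|w _].
  apply: measurable_funM => //; apply: measurable_sum => q.
  by apply: measurable_funM => //; exact: measurable_funB.
have := bridge_path_Riemann c0 (cW j w) (W0 j w) (lexx 0) (ltW t0) t1.
rewrite [bridge_path _ _ 0]/bridge_path ltxx/= mulr0 subr0 => h.
have -> : bridge_path c (W j w) t =
    (1 - t) `^ c * ((1 - t) `^ (- c) * bridge_path c (W j w) t).
  by rewrite mulrA powR_onemK// mul1r.
by apply: cvgM => //; exact: cvg_cst.
Qed.

Lemma indep_gaussZ d (T : measurableType d) (R : realType) (P : probability T R)
    (I : finType) (X : I -> T -> R) (s a : I -> R) : indep_gauss P X s ->
  indep_gauss P (fun i w => a i * X i w) (fun i => a i * s i).
Proof.
move=> [mX hX]; split=> [i|A mA]; first exact: measurable_funM.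
have mA' i : measurable [set x : measurableTypeR R | A i (a i * x)].
  by have := @measurable_mulrl R (a i) measurableT (A i) (mA i); rewrite setTI.
transitivity (\prod_(i : I) gauss (s i) [set x : measurableTypeR R | A i (a i * x)%R])%E.
  exact: (hX (fun i => [set x : measurableTypeR R | A i (a i * x)])).
apply: eq_bigr => i _; rewrite !gauss_scale; congr (normal_prob _ _ _).
by apply/seteqP; split => x /=; rewrite mulrA.
Qed.

(* The weights (1 - t) ^ (- c) turn the bridge into a process with independent
   increments. *)
Lemma bridge_increments d (T : measurableType d) (R : realType) (P : probability T R)
    (n : nat) (W : 'I_n -> T -> R -> R) (c : R) (k : nat) (u : nat -> R) :
  0 < c -> wiener P W -> 0 <= u 0%N -> (forall i, (i < k)%N -> u i < u i.+1) -> u k < 1 ->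
  indep_gauss P (fun (p : 'I_k * 'I_n) w =>
      (1 - u p.1.+1) `^ (- c) * bridge_path c (W p.2 w) (u p.1.+1) -
      (1 - u p.1) `^ (- c) * bridge_path c (W p.2 w) (u p.1))
    (fun p => Num.sqrt (bridge_var c (u p.1.+1) - bridge_var c (u p.1))).
Proof.
move=> c0 [cW W0 W1 mW iW] u0 uS uk.
have mono := strict_steps uS.
pose S N (p : 'I_k * 'I_n) w := \sum_(q < N.+1) (1 - grid (u p.1) (u p.1.+1) N q) `^ (- c) *
  (W p.2 w (grid (u p.1) (u p.1.+1) N q.+1) - W p.2 w (grid (u p.1) (u p.1.+1) N q)).
pose v N (p : 'I_k * 'I_n) := \sum_(q < N.+1) (1 - grid (u p.1) (u p.1.+1) N q) `^ (- c) ^+ 2 *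
  (grid (u p.1) (u p.1.+1) N q.+1 - grid (u p.1) (u p.1.+1) N q).
have iS N : indep_gauss P (S N) (fun p => Num.sqrt (v N p)).
  (* The [k] grids concatenated: the index [i * N.+1 + q] is the [q]-th point of the [i]-th
     interval. *)
  pose t i := grid (u (i %/ N.+1)%N) (u (i %/ N.+1).+1) N (i %% N.+1)%N.
  have tE i q : (q <= N.+1)%N -> t (i * N.+1 + q)%N = grid (u i) (u i.+1) N q.
    rewrite leq_eqVlt => /predU1P[->|qN].
      by rewrite -mulSnr /t mulnK// modnMl grid0 gridN.
    by rewrite /t divnMDl// divn_small// addn0 modnMDl modn_small.
  have tSi i : (i < k * N.+1)%N -> t i < t i.+1.
    move=> iM; have ik : (i %/ N.+1 < k)%N by rewrite ltn_divLR.
    rewrite (divn_eq i N.+1) -addnS !tE//; last 2 first.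
    - by rewrite ltn_mod.
    - by rewrite ltnW// ltn_mod.
    by rewrite -subr_gt0 gridS divr_gt0// subr_gt0 uS.
  have t0 : 0 <= t 0%N by have := tE 0%N 0%N isT; rewrite mul0n => ->; rewrite grid0.
  have tM : t (k * N.+1)%N <= 1.
    by have := tE k 0%N isT; rewrite addn0 => ->; rewrite grid0 ltW.
  have fP (i : 'I_(k * N.+1)) : (i %/ N.+1 < k)%N by rewrite ltn_divLR.
  pose f (x : 'I_(k * N.+1) * 'I_n) : 'I_k * 'I_n := (Ordinal (fP x.1), x.2).
  pose a (x : 'I_(k * N.+1) * 'I_n) : R := (1 - t x.1) `^ (- c).
  have hP (i : 'I_k) (q : 'I_N.+1) : (i * N.+1 + q < k * N.+1)%N.
    by rewrite (@leq_trans (i.+1 * N.+1))%N ?leq_mul2r ?ltn_ord ?orbT// mulSnr ltn_add2l.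
  have reix (p : 'I_k * 'I_n) (F : 'I_(k * N.+1) * 'I_n -> R) :
      \sum_(x | f x == p) F x = \sum_(q < N.+1) F (Ordinal (hP p.1 q), p.2).
    have gP (x : 'I_(k * N.+1) * 'I_n) : (x.1 %% N.+1 < N.+1)%N by rewrite ltn_mod.
    rewrite (reindex_onto (fun q : 'I_N.+1 => (Ordinal (hP p.1 q), p.2)) (fun x => Ordinal (gP x))).
      apply: eq_bigl => q; apply/andP; split.
        case: p => i j; rewrite /f/=; apply/eqP; congr (_, _); apply/val_inj => /=.
        by rewrite divnMDl// divn_small// addn0.
      by apply/eqP/val_inj; rewrite /= modnMDl modn_small.
    move=> [i j] /eqP <-; congr (_, _); apply/val_inj => /=.
    by rewrite -divn_eq.
  have [mI hI] := indep_gauss_sum f a (iW _ t t0 tSi tM).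
  have SE p w : \sum_(x | f x == p) a x * (W x.2 w (t x.1.+1) - W x.2 w (t x.1)) = S N p w.
    rewrite reix; apply: eq_bigr => q _; rewrite /a/= -addnS !tE//; exact: ltnW.
  have vE p : \sum_(x | f x == p) (a x * Num.sqrt (t x.1.+1 - t x.1)) ^+ 2 = v N p.
    rewrite reix; apply: eq_bigr => q _; rewrite /a/= exprMn sqr_sqrtr; last first.
      by rewrite subr_ge0 ltW// tSi.
    rewrite -addnS !tE//; exact: ltnW.
  split=> [p|A mA].
    by have := mI p; under eq_fun do rewrite SE.
  have := hI A mA; under eq_bigr do rewrite vE; move=> <-; congr (P _).
  by apply/seteqP; split => w h p; have := h p; rewrite SE.
(* Rescaled increments of [W] at the times [i / k] provide, on the same space, independent Gaussians
   [Y r] of prescribed deviations [r], to be compared with the Riemann sums. *)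
pose tau (i : nat) : R := i%:R / k%:R.
have tau0 : 0 <= tau 0%N by rewrite /tau mul0r.
have tauS i : (i < k)%N -> tau i < tau i.+1.
  move=> ik; have k0 : (0 < k)%N by exact: leq_ltn_trans ik.
  by rewrite ltr_pM2r ?ltr_nat// invr_gt0 ltr0n.
have tauM : tau k <= 1.
  by rewrite /tau; case: (k) => [|k']; [rewrite mul0r|rewrite divff// pnatr_eq0].
pose G (p : 'I_k * 'I_n) w := W p.2 w (tau p.1.+1) - W p.2 w (tau p.1).
pose Y (r : 'I_k * 'I_n -> R) (p : 'I_k * 'I_n) w := r p * Num.sqrt k%:R * G p w.
have iY (r : 'I_k * 'I_n -> R) : indep_gauss P (Y r) r.
  have := indep_gaussZ (fun p => r p * Num.sqrt k%:R) (iW k tau tau0 tauS tauM).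
  congr indep_gauss; apply/funext => -[p j]; rewrite -mulrA -sqrtrM ?ler0n//.
  have k0 : (0 < k)%N by exact: leq_ltn_trans (ltn_ord p).
  suff -> : k%:R * (tau p.+1 - tau p) = 1 by rewrite sqrtr1 mulr1.
  by rewrite /tau -mulrBl -natrB// subSnn mul1r divff// pnatr_eq0 -lt0n.
pose r N (p : 'I_k * 'I_n) := Num.sqrt (v N p).
pose rr (p : 'I_k * 'I_n) := Num.sqrt (bridge_var c (u p.1.+1) - bridge_var c (u p.1)).
have u0i i : (i <= k)%N -> 0 <= u i by move=> ik; rewrite (le_trans u0)// mono.
have u1i i : (i <= k)%N -> u i < 1 by move=> ik; rewrite (le_lt_trans _ uk)// mono.
have mX (p : 'I_k * 'I_n) : measurable_fun setT (fun w =>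
    (1 - u p.1.+1) `^ (- c) * bridge_path c (W p.2 w) (u p.1.+1) -
    (1 - u p.1) `^ (- c) * bridge_path c (W p.2 w) (u p.1)).
  by apply: measurable_funB; apply: measurable_funM => //;
    exact: (@measurable_bridge_path _ _ _ P).
split => // A mA; rewrite -(proj2 (iY rr) A mA).
apply: (@same_law_limit _ _ _ P _ _ (Y rr) S (fun N => Y (r N))) => //.
- by move=> i; exact: (proj1 (iY rr)).
- by move=> N i; exact: (proj1 (iS N)).
- by move=> N i; exact: (proj1 (iY (r N))).
- by move=> N C mC; rewrite (proj2 (iS N) C mC) (proj2 (iY (r N)) C mC).
- move=> p; apply: aeW => w; apply: bridge_path_Riemann => //.
  + exact: W0.
  + by apply: u0i; exact: ltnW.
  + by rewrite ltW// uS.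
  + exact: u1i.
- move=> p; apply: aeW => w; rewrite /Y; apply: cvgM; last exact: cvg_cst.
  apply: cvgM; last exact: cvg_cst.
  apply: continuous_cvg; first exact: sqrt_continuous.
  apply: bridge_var_Riemann => //.
  + by apply: u0i; exact: ltnW.
  + by rewrite ltW// uS.
  + exact: u1i.
Qed.

Lemma indep_gauss_marginal d (T : measurableType d) (R : realType) (P : probability T R)
    (I : finType) (X : I -> T -> R) (s : I -> R) i :
  indep_gauss P X s -> has_gauss P (X i) (s i).
Proof.
move=> [mX hX]; split=> // A mA.
pose C k : set (measurableTypeR R) := if k == i then A else setT.
have mC k : measurable (C k) by rewrite /C; case: ifP.
transitivity (P [set w | forall k, C k (X k w)]).
  congr (P _); apply/seteqP; split => w /=; last by move=> /(_ i); rewrite /C eqxx.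
  by move=> h k; rewrite /C; case: eqP => // ->.
rewrite hX// (bigD1 i)//= big1 ?mule1; first by rewrite /C eqxx.
by move=> k /negPf ki; rewrite /C ki gaussT.
Qed.

Lemma has_gauss_sum d (T : measurableType d) (R : realType) (P : probability T R)
    (I : finType) (X : I -> T -> R) (s a : I -> R) : indep_gauss P X s ->
  has_gauss P (fun w => \sum_i a i * X i w) (Num.sqrt (\sum_i (a i * s i) ^+ 2)).
Proof.
move=> iX; have := indep_gauss_marginal tt (indep_gauss_sum (fun=> tt) a iX).
by congr has_gauss; apply/funext => w; apply: eq_bigl.
Qed.

(** * The bridge as a random element of the loop space *)

(** [insubd] returns the zero loop when the driving path does not yield a loop; [good_paths]
    excludes this case. *)
Definition bridge_loop (R : realType) (n : nat) (c : R) (b : 'I_n -> R -> R) : loop R n :=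
  insubd (0 : loop R n) (fun t => \row_j bridge_path c (b j) t).

Section bridge_loop.
Context (R : realType) (n : nat) (c : R).
Hypothesis c0 : 0 < c.
Implicit Types b : 'I_n -> R -> R.

Definition good_paths b := forall j, continuous (b j) /\ forall s, s <= 0 -> b j s = 0.

Lemma continuous_row (g : 'I_n -> R -> R) : (forall j, continuous (g j)) ->
  continuous (fun t => \row_j g j t).
Proof.
move=> cg t; apply/cvgrPdist_le => e e0.
have h j : \forall s \near t, `|g j t - g j s| <= e.
  by have := cg j t; move/cvgrPdist_le => /(_ e e0).
have := filter_forall (nbhs_filter t) h; apply: filterS => s hs.
by apply: rV_norm_le; rewrite ?ltW// => j; rewrite !mxE.
Qed.

Lemma bridge_loopE b t j : good_paths b -> bridge_loop c b t 0 j = bridge_path c (b j) t.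
Proof.
move=> gb; transitivity (\val (bridge_loop c b) t 0 j) => //.
rewrite /bridge_loop val_insubd ifT ?mxE//.
apply/asboolP; split=> [|s s01].
  by apply: continuous_row => i; have [cb b0] := gb i; exact: continuous_bridge_path.
apply/rowP => i; rewrite !mxE /bridge_path; move: s01; rewrite in_itv/= => /negPf -> //.
Qed.

Lemma loop_norm_le (f : loop R n) M : (forall t j, `|f t 0 j| <= M) -> 0 <= M -> `|f| <= M.
Proof. by move=> fM M0; apply: sup_norm_le => t; apply: rV_norm_le. Qed.

Lemma loop_norm_ge (f : loop R n) t j : `|f t 0 j| <= `|f|.
Proof. exact: le_trans (rV_coord_le _ _) (sup_norm_ub f t). Qed.

Lemma loopP (f g : loop R n) : (forall t j, f t 0 j = g t 0 j) -> f = g.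
Proof. by move=> fg; apply/val_inj/funext => t; apply/rowP => j; exact: fg. Qed.

Lemma bridge_loop_dist b1 b2 M : good_paths b1 -> good_paths b2 -> 0 <= M ->
  (forall j s, `|b1 j s - b2 j s| <= M) -> `|bridge_loop c b1 - bridge_loop c b2| <= M + M.
Proof.
move=> g1 g2 M0 h; apply: loop_norm_le; last exact: addr_ge0.
move=> t j; rewrite [X in `|X|](_ : _ = bridge_loop c b1 t 0 j - bridge_loop c b2 t 0 j); last first.
  by rewrite [LHS]mxE [in LHS]mxE.
rewrite !bridge_loopE// -bridge_pathB//; [|by have [] := g1 j|by have [] := g2 j].
apply: bridge_path_bound => //.
- by move=> s; apply: cvgB; [have [+ _] := g1 j|have [+ _] := g2 j]; apply.
- by move=> s s0; rewrite (proj2 (g1 j) s s0) (proj2 (g2 j) s s0) subrr.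
Qed.

Lemma bridge_path0 t : bridge_path c (fun=> 0 : R) t = 0.
Proof.
have := @bridge_path_sum R c unit [::] (fun=> 0) (fun _ _ => 0) t (fun _ => @cst_continuous _ _ 0).
by rewrite !big_nil.
Qed.

(** The loop driven by one ramp in one coordinate. The approximations are combinations of these
    fixed loops, with the increments of the driving path as coefficients. *)
Definition bridge_ramp N (p : 'I_N.+1 * 'I_n) : loop R n :=
  bridge_loop c (fun j t => if j == p.2 then ramp N p.1 t else 0).

Definition bridge_approx N (x : 'I_N.+1 * 'I_n -> R) : loop R n :=
  \sum_p x p *: bridge_ramp p.

Definition steps N b (p : 'I_N.+1 * 'I_n) : R := b p.2 (grid 0 1 N p.1.+1) - b p.2 (grid 0 1 N p.1).

Lemma loop_sumE (I : Type) (r : seq I) (F : I -> loop R n) t j :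
  (\sum_(i <- r) F i : loop R n) t 0 j = \sum_(i <- r) F i t 0 j.
Proof.
elim/big_ind2 : _ => // [|x1 x2 y1 y2 <- <-]; first by rewrite [LHS]mxE.
by rewrite [LHS]mxE.
Qed.

Lemma good_ramp N (p : 'I_N.+1 * 'I_n) :
  good_paths (fun j t => if j == p.2 then ramp N p.1 t else 0).
Proof.
move=> j; split=> [t|s s0]; last by case: ifP => // _; exact: ramp_neg.
by case: (j == p.2); [exact: continuous_ramp|exact: cvg_cst].
Qed.

Lemma bridge_approxE N b t j : bridge_approx (@steps N b) t 0 j =
  bridge_path c (fun s => \sum_(k < N.+1) (b j (grid 0 1 N k.+1) - b j (grid 0 1 N k)) * ramp N k s) t.
Proof.
rewrite bridge_path_sum//; last by move=> i; exact: continuous_ramp.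
rewrite /bridge_approx loop_sumE.
transitivity (\sum_(k < N.+1) \sum_(i < n) (b i (grid 0 1 N k.+1) - b i (grid 0 1 N k)) *
    (if j == i then bridge_path c (ramp N k) t else 0)).
  rewrite pair_bigA; apply: eq_bigr => -[k i] _ /=.
  rewrite [LHS]mxE bridge_loopE; last exact: good_ramp.
  rewrite /steps/=; congr (_ * _); case: eqP => //.
  by move=> _; exact: bridge_path0.
apply: eq_bigr => k _; rewrite (bigD1 j)//= eqxx big1 ?addr0// => i ij.
by rewrite eq_sym (negPf ij) mulr0.
Qed.

(** The interpolated driving path converges uniformly, and the solution is Lipschitz in it. *)
Lemma bridge_approx_cvg b : good_paths b -> (forall j t, 1 <= t -> b j t = b j 1) ->
  bridge_approx (@steps N b) @[N --> \oo] --> bridge_loop c b.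
Proof.
move=> gb b1; apply/cvgrPdist_le => e e0.
have e20 : 0 < e / 2 by exact: divr_gt0.
have h j := @interp_dist R (b j) (e / 2) (proj1 (gb j)) (proj2 (gb j)) (b1 j) e20.
have := filter_forall (eventually_filter : Filter \oo) h; apply: filterS => N hN.
pose bN j s := \sum_(k < N.+1) (b j (grid 0 1 N k.+1) - b j (grid 0 1 N k)) * ramp N k s.
have gN : good_paths bN.
  move=> j; split=> [s|s s0]; last by apply: big1 => k _; rewrite ramp_neg ?mulr0.
  apply: cvg_sumr => k _; apply: cvgM; [exact: cvg_cst|exact: continuous_ramp].
have -> : bridge_approx (@steps N b) = bridge_loop c bN.
  by apply: loopP => t j; rewrite bridge_approxE bridge_loopE.
rewrite distrC (splitr e); apply: bridge_loop_dist => //; exact: ltW.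
Qed.

End bridge_loop.

(** The argument uses no countable base of [E]: with [V m] the points around which a ball of radius
    more than [1 / (m + 1)] lies in [U], the limit is in [U] iff the sequence is eventually in some
    [V m]. *)
Lemma measurable_fun_limit d (T : measurableType d) (R : realType) (E : normedModType R)
    (Z_ : nat -> T -> E) (Z : T -> E) :
  (forall N (U : set E), open U -> measurable (Z_ N @^-1` U)) ->
  (forall w, Z_ N w @[N --> \oo] --> Z w) ->
  measurable_fun setT (Z : T -> borel E).
Proof.
move=> mZ ZZ; apply: (@measurability _ _ T (borel E) setT Z (@open E) erefl).
move=> _ [U oU <-]; rewrite setTI.
pose V (m : nat) : set E := [set x | exists r : R, m.+1%:R^-1 < r /\ ball x r `<=` U].
have oV m : open (V m).
  rewrite openE => x [r [mr xr]]; pose e := (r - m.+1%:R^-1) / 2.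
  have e0 : 0 < e by rewrite divr_gt0// subr_gt0.
  apply/nbhs_ballP; exists e => // y xy; exists (r - e); split.
    by move: mr; rewrite /e; move: (m.+1%:R^-1) => q; lra.
  move=> t yt; apply: xr; rewrite -(subrKC e r); exact: ball_triangle yt.
rewrite (_ : Z @^-1` U = \bigcup_m \bigcup_N0 \bigcap_(N in [set N | (N0 <= N)%N]) Z_ N @^-1` V m).
  apply: bigcup_measurable => m _; apply: bigcup_measurable => N0 _.
  by apply: bigcap_measurable => [|N _]; [exists N0 => /=|exact: mZ].
apply/seteqP; split => [w /= Uw|w [m _ [N0 _ h]]]; last first.
  have /cvgrPdist_lt/(_ m.+1%:R^-1) := ZZ w; rewrite invr_gt0 ltr0n => /(_ isT)[N1 _ hN1].
  have [r [mr]] := h (maxn N0 N1) (leq_maxl _ _); apply.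
  rewrite -ball_normE /ball_/= distrC (lt_trans _ mr)//.
  by apply: hN1 => /=; exact: leq_maxr.
have [e e0 eU] : exists2 e : R, 0 < e & ball (Z w) e `<=` U.
  by have /nbhs_ballP[e e0 he] := open_nbhs_nbhs (conj oU Uw); exists e.
have [m me] : exists m : nat, m.+1%:R^-1 < e / 2.
  have e20 : 0 < e / 2 by rewrite divr_gt0.
  have [k _ hk] := @near_infty_natSinv_lt R (PosNum e20).
  by exists k; apply: hk => /=.
have e20 : 0 < e / 2 by rewrite divr_gt0.
have /cvgrPdist_lt/(_ (e / 2) e20) [N0 _ hN0] := ZZ w.
exists m => //; exists N0 => // N /= N0N; exists (e / 2); split => // y Ny.
apply: eU; rewrite (splitr e); apply: ball_triangle Ny.
by rewrite -ball_normE /ball_/=; exact: hN0.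
Qed.

(** The map factors through the row vector of coefficients and a continuous map, so that an open set
    of loops pulls back to a Borel set of vectors. *)
Lemma measurable_bridge_approx d (T : measurableType d) (R : realType) (n : nat) (c : R) N
    (X : 'I_N.+1 * 'I_n -> T -> R) (U : set (loop R n)) :
  (forall p, measurable_fun setT (X p)) -> open U ->
  measurable ((fun w => bridge_approx c (X ^~ w)) @^-1` U).
Proof.
move=> mX oU.
pose m := #|{: 'I_N.+1 * 'I_n}|.
pose F (x : 'rV[R]_m) : loop R n := \sum_(i < m) x 0 i *: bridge_ramp c (enum_val i).
pose Y w : 'rV[R]_m := \row_i X (enum_val i) w.
have mY : measurable_fun setT (Y : T -> borel 'rV[R]_m).
  apply: measurable_fun_rV => j.
  by rewrite (_ : (fun w => _) = X (enum_val j)) //; apply/funext => w; rewrite mxE.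
have cF : continuous F.
  move=> x; apply: (@cvg_sumr _ _ _ (nbhs x) (nbhs_filter x) _ _ _
    (fun (y : 'rV[R]_m) (i : 'I_m) => y 0 i *: bridge_ramp c (enum_val i))) => i _; by apply: cvgZr_tmp; exact: coord_continuous.
have -> : (fun w => bridge_approx c (X ^~ w)) = F \o Y.
  apply/funext => w; rewrite /= /bridge_approx /F (reindex_onto enum_val enum_rank)/=.
    apply: eq_big => [i|i _]; first by rewrite enum_valK eqxx.
    by rewrite mxE.
  by move=> i _; rewrite enum_rankK.
rewrite comp_preimage; rewrite -[X in measurable X]setTI; apply: mY => //.
by apply: sub_sigma_algebra; move/continuousP: cF; apply.
Qed.

Section bridge_law.
Context d (T : measurableType d) (R : realType) (P : probability T R) (n : nat).
Context (W : 'I_n -> T -> R -> R) (c : R).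
Hypotheses (c0 : 0 < c) (PW : wiener P W).

Definition bridge_rv w : loop R n := bridge_loop c (fun j => W j w).

Lemma wiener_good w : good_paths (fun j => W j w).
Proof. by have [cW W0 _ _ _] := PW; move=> j; split; [exact: cW|exact: W0]. Qed.

Lemma wiener_step_indep N : indep_gauss P (fun p w => steps (fun j => W j w) p)
  (fun _ : 'I_N.+1 * 'I_n => Num.sqrt N.+1%:R^-1).
Proof.
have [_ _ _ _ iW] := PW.
have := iW N.+1 (grid 0 1 N); rewrite grid0 gridN => /(_ (lexx _)).
have gS i : (i < N.+1)%N -> grid 0 1 N i < grid 0 1 N i.+1 :> R.
  by move=> _; rewrite -subr_gt0 gridS subr0 mul1r invr_gt0.
move=> /(_ gS (lexx _)); congr indep_gauss; apply/funext => p.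
by rewrite gridS subr0 mul1r.
Qed.

Definition bridge_rv_approx N w := bridge_approx c (@steps R n N (fun j => W j w)).

Lemma bridge_rv_approx_cvg w : bridge_rv_approx N w @[N --> \oo] --> bridge_rv w.
Proof.
apply: bridge_approx_cvg => //; first exact: wiener_good.
by move=> j t; have [_ _ W1 _ _] := PW; exact: W1.
Qed.

Lemma measurable_bridge_rv : measurable_fun setT (bridge_rv : T -> borel (loop R n)).
Proof.
apply: measurable_fun_limit bridge_rv_approx_cvg => N U oU.
apply: (@measurable_bridge_approx _ T R n c N (fun p w => steps (fun j => W j w) p)) => // p.
exact: (wiener_step_indep N).1.
Qed.

Lemma bridge_rvE w t j : bridge_rv w t 0 j = bridge_path c (W j w) t.
Proof. by rewrite bridge_loopE//; exact: wiener_good. Qed.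

Lemma continuous_measurable_functional (l : loop R n -> R) : continuous l ->
  measurable_fun setT (l : borel (loop R n) -> measurableTypeR R).
Proof.
move=> cl; apply: (measurability _ (RGenOpens.measurableE R)) => //.
move=> _ [_ [a [b ->] <-]]; rewrite setTI; apply: sub_sigma_algebra.
by move/continuousP: cl; apply; exact: interval_open.
Qed.

Definition functional_sd (l : loop R n -> R) N : R :=
  Num.sqrt (\sum_(p : 'I_N.+1 * 'I_n) (l (bridge_ramp c p) * Num.sqrt N.+1%:R^-1) ^+ 2).

Lemma linear_approx (l : {linear loop R n -> R^o}) N (x : 'I_N.+1 * 'I_n -> R) :
  l (bridge_approx c x) = \sum_p l (bridge_ramp c p) * x p.
Proof.
rewrite /bridge_approx linear_sum; apply: eq_bigr => p _.
by rewrite linearZ mulrC.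
Qed.

(** On the approximations [l] is a finite combination of independent increments, and these values
    converge for every [w]. The hypothesis [0 < n] supplies a coordinate from which the auxiliary
    standard Gaussian is taken. *)
Lemma has_gauss_functional (l : {linear loop R n -> R^o}) : continuous l -> (0 < n)%N ->
  exists p : R, exists2 phi : nat -> nat,
    (forall k, (k <= phi k)%N) /\ functional_sd l (phi k) @[k --> \oo] --> p &
    0 <= p /\ has_gauss P (fun w => l (bridge_rv w)) p.
Proof.
move=> cl n0.
have hN N : has_gauss P (fun w => l (bridge_rv_approx N w)) (functional_sd l N).
  have := has_gauss_sum (fun p => l (bridge_ramp c p)) (wiener_step_indep N).
  by congr has_gauss; apply/funext => w; rewrite linear_approx.
have hg : has_gauss P (fun w => steps (fun j => W j w) (ord0 : 'I_1, Ordinal n0)) 1.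
  by have := indep_gauss_marginal (ord0, Ordinal n0) (wiener_step_indep 0); rewrite invr1 sqrtr1.
have cvl w : l (bridge_rv_approx N w) @[N --> \oo] --> l (bridge_rv w).
  by apply: continuous_cvg; [exact: cl|exact: bridge_rv_approx_cvg].
have ml : measurable_fun setT (fun w => l (bridge_rv w)).
  exact: measurableT_comp (continuous_measurable_functional cl) measurable_bridge_rv.
have [p [phi [phi1 phi2] [p0 hp]]] := has_gauss_limit hg hN ml (aeW P cvl).
exists p; exists phi; split => //; apply: cvg_trans phi2; apply: near_eq_cvg.
by apply: nearW => k; rewrite ger0_norm// sqrtr_ge0.
Qed.

End bridge_law.

Section loop_law.
Context d (T : measurableType d) (R : realType) (P : probability T R) (n : nat).
Context (W : 'I_n -> T -> R -> R) (c : R).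
Hypotheses (c0 : 0 < c) (PW : wiener P W).
Local Notation Z := (bridge_rv W c).

Let mZ : measurable_fun setT (Z : T -> borel (loop R n)).
Proof. exact: (measurable_bridge_rv c0 PW). Qed.

Lemma loop_law_exists (z : R -> T -> 'rV[R]_n) :
  {ae P, forall w t j, 0 <= t < 1 -> z t w 0 j = bridge_path c (W j w) t} ->
  exists nu : probability (borel (loop R n)) R, loop_distribution P (with_zero_end z) nu.
Proof.
move=> hz; pose X : {mfun T >-> borel (loop R n)} := mfun_Sub (mem_set mZ).
exists (distribution P X); exists Z; split => //.
apply: filterS hz => w hw t /andP[t0 t1]; apply/rowP => j.
rewrite (bridge_rvE c0 PW) /with_zero_end; case: ltP => t1'; first by rewrite hw// t0.
by rewrite mxE /bridge_path (le_gtF t1') andbF.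
Qed.

(** The loop that realises the distribution and the pathwise one agree almost surely; the laws for
    all exponents are thus images of one family [W]. *)
Lemma loop_lawE (z : R -> T -> 'rV[R]_n) (nu : probability (borel (loop R n)) R) :
  {ae P, forall w t j, 0 <= t < 1 -> z t w 0 j = bridge_path c (W j w) t} ->
  loop_distribution P (with_zero_end z) nu ->
  forall A : set (borel (loop R n)), measurable A -> nu A = P (Z @^-1` A).
Proof.
move=> hz [Z' [mZ' Z'E nuE]] A mA; rewrite nuE//.
apply: measure_ae_eq.
- by rewrite -[X in measurable X]setTI; exact: mZ'.
- by rewrite -[X in measurable X]setTI; exact: mZ.
apply: filterS (filterI hz Z'E) => w [hw Z'w].
suff e : Z' w = Z w by rewrite /preimage/= e.
apply: loopP => t j; have [t01|t01] := boolP (t \in `]0, 1[); last first.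
  by rewrite !loop_out.
move: t01; rewrite in_itv/= => /andP[t0 t1].
by rewrite Z'w ?(ltW t0) ?(ltW t1)// /with_zero_end t1 (bridge_rvE c0 PW) hw// (ltW t0).
Qed.

Context (nu : probability (borel (loop R n)) R).
Hypothesis nuE : forall A : set (borel (loop R n)), measurable A -> nu A = P (Z @^-1` A).
Hypothesis n0 : (0 < n)%N.

Lemma loop_law_functional (l : {linear loop R n -> R^o}) (p : R) : continuous l ->
  has_gauss P (fun w => l (Z w)) p ->
  has_gauss nu (l : borel (loop R n) -> R) p.
Proof.
move=> cl [_ hp]; have ml := continuous_measurable_functional cl.
split=> // A mA; have mlA := ml measurableT A mA; rewrite setTI in mlA.
by rewrite nuE//; exact: hp.
Qed.

Lemma loop_law_gaussian : centred_gaussian nu.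
Proof.
move=> l cl; have [p [_ _ [p0 /(loop_law_functional cl)[_ hp]]]] := has_gauss_functional c0 PW cl n0.
exists p; split => // A mA; transitivity (gauss p A); first exact: hp.
case: eqP => [->|/eqP pn0]; first by rewrite gauss0.
by rewrite gauss_gt0E// lt_neqAle eq_sym pn0.
Qed.

Lemma loop_law_Lnorm (l : {linear loop R n -> R^o}) (p : R) : continuous l -> 0 <= p ->
  has_gauss P (fun w => l (Z w)) p -> ('N[nu]_2%:E[EFin \o l] = p%:E)%E.
Proof.
move=> cl p0 /(loop_law_functional cl) hp; rewrite unlock /Lnorm.
transitivity ((\int[nu]_x (l x ^+ 2)%:E) `^ 2^-1)%E.
  congr (_ `^ _)%E; apply: eq_integral => x _ /=.
  by rewrite powR_mulrn// real_normK ?num_real.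
by rewrite (has_gauss_sqr hp) poweR12_sqrt ?lee_fin ?sqr_ge0//= sqrtr_sqr ger0_norm.
Qed.

End loop_law.

(** The [i]-th time is shifted by [i] times a small step, and the continuity of [k] lets the step
    tend to 0. *)
Lemma energy_le_strict (R : realType) (k : R -> R) (E : R) :
  (forall s, s < 1 -> {for s, continuous k}) ->
  (forall N (t a : nat -> R), 0 <= t 0%N -> (forall i, (i < N)%N -> t i < t i.+1) -> t N < 1 ->
    (\sum_(i < N) a i * (k (t i.+1) - k (t i))) ^+ 2 <=
    E * \sum_(i < N) a i ^+ 2 * (t i.+1 - t i)) ->
  energy_le k E.
Proof.
move=> ck kE N t a t0 tS tN.
(* Small enough for the last time, shifted by at most [N * dl], to stay below 1. *)
pose dl : R := (1 - t N) / N.+1%:R.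
have dl0 : 0 < dl by rewrite divr_gt0// subr_gt0.
pose tm (m i : nat) := t i + i%:R * (dl * m.+1%:R^-1).
have m0 m : 0 < dl * m.+1%:R^-1 by rewrite mulr_gt0// invr_gt0.
have mono := nondecreasing_steps tS.
have ctm i : tm m i @[m --> \oo] --> t i.
  rewrite -[X in _ --> X]addr0 -(mulr0 i%:R) -(mulr0 dl).
  apply: cvgD; first exact: cvg_cst.
  apply: cvgM; first exact: cvg_cst.
  by apply: cvgM; [exact: cvg_cst|exact: cvg_harmonic].
have cktm i : (i <= N)%N -> k (tm m i) @[m --> \oo] --> k (t i).
  move=> iN; apply: continuous_cvg; last exact: ctm.
  by apply: ck; rewrite (le_lt_trans (mono i N iN _)).
have FF : ProperFilter (nbhs (\oo : set_system nat)) by exact: eventually_filter.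
apply: (ler_cvg_to
  (f := fun m => (\sum_(i < N) a i * (k (tm m i.+1) - k (tm m i))) ^+ 2)
  (g := fun m => E * \sum_(i < N) a i ^+ 2 * (tm m i.+1 - tm m i)) (a := nbhs \oo)).
- rewrite expr2; apply: cvgM; apply: cvg_sumr => i _; apply: cvgM;
    first [exact: cvg_cst|by apply: cvgB; apply: cktm => //; exact: ltnW].
- apply: cvgM; first exact: cvg_cst.
  apply: cvg_sumr => i _; apply: cvgM; first exact: cvg_cst.
  by apply: cvgB; exact: ctm.
- apply: nearW => m; apply: kE.
  + by rewrite /tm mul0r addr0.
  + move=> i iN; rewrite /tm; move: (m0 m) (tS i iN); move: (dl / m.+1%:R) => q q0 ti.
    by rewrite -natr1; nra.
  + have q1 : dl * m.+1%:R^-1 <= dl.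
      by rewrite ler_piMr ?(ltW dl0)// invf_le1// ler1n.
    apply: (@le_lt_trans _ _ (t N + N%:R * dl)); first by rewrite /tm lerD2l ler_wpM2l.
    have : N.+1%:R * dl = 1 - t N by rewrite /dl mulrC divfK// pnatr_eq0.
    by rewrite -natr1 mulrDl mul1r; lra.
Qed.

(** * Cameron-Martin spaces *)

Section cameron_martin.
Context d (T : measurableType d) (R : realType) (P : probability T R) (n : nat).
Context (W : 'I_n -> T -> R -> R) (c : R).
Hypotheses (c0 : 0 < c) (PW : wiener P W).
Local Notation Z := (bridge_rv W c).

(** The driving path recovered from a loop: before time 1 it inverts [bridge_path]. *)
Definition drift_coord (f : loop R n) j t := f t 0 j + drift_int c (fun s => f s 0 j) t.

Lemma continuous_loop_coord (f : loop R n) j : continuous (fun t => f t 0 j).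
Proof.
move=> t; apply: (@cvg_comp _ _ _ (f : R -> 'rV[R]_n) (fun x : 'rV[R]_n => x 0 j) _ (nbhs (f t))).
  exact: loop_continuous.
exact: coord_continuous.
Qed.

Lemma loop_coord_neg (f : loop R n) j t : t <= 0 -> f t 0 j = 0.
Proof. by move=> t0; rewrite loop_out ?mxE// in_itv/= ltNge t0. Qed.

Lemma continuous_drift_coord (f : loop R n) j s : s < 1 -> {for s, continuous (drift_coord f j)}.
Proof.
move=> s1; apply: cvgD; first exact: continuous_loop_coord.
have [s0|s0] := ltP (-1) s.
  apply: (is_derive_continuous (is_derive_drift c _ s0 s1)) => x _.
  exact: continuous_loop_coord.
have z : drift_int c (fun x => f x 0 j) s = 0.
  by apply: drift_int_neg (le_trans s0 _) => // x x0; exact: loop_coord_neg.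
rewrite /continuous_at z; apply: cvg_near_cst; near=> x.
apply: drift_int_neg; first by move=> y y0; exact: loop_coord_neg.
by apply/ltW; near: x; apply: lt_nbhsl; rewrite (le_lt_trans s0).
Unshelve. all: by end_near.
Qed.

(* An energy bound extends the drift-corrected path to time 1, and the loop is the
   limit of the same finite sums as the bridge, with the increments of that path. *)
Lemma energy_functional_bound (h : loop R n) (E : R) (l : {linear loop R n -> R^o})
    (p : R) (phi : nat -> nat) :
  (forall j, energy_le (drift_coord h j) E) -> continuous l ->
  (forall k, (k <= phi k)%N) -> functional_sd c l (phi k) @[k --> \oo] --> p ->
  `|l h| <= n%:R * Num.sqrt E * p.
Proof.
move=> hE cl phi1 phi2.
have ck j s : s < 1 -> {for s, continuous (drift_coord h j)} by exact: continuous_drift_coord.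
have [b bP] := choice (fun j => energy_extend (ck j) (hE j)).
have gb : good_paths b.
  move=> j; have [cb bE _ _] := bP j; split => // s s0.
  rewrite bE ?(le_lt_trans s0)// /drift_coord loop_coord_neg// add0r drift_int_neg// => x.
  exact: loop_coord_neg.
have hb : bridge_loop c b = h.
  apply: loopP => t j; have [t01|t01] := boolP (t \in `]0, 1[); last by rewrite !loop_out.
  move: t01; rewrite in_itv/= => /andP[t0 t1].
  have [cb bE _ _] := bP j; have [_ b0] := gb j.
  rewrite bridge_loopE// bridge_pathE//; apply/esym.
  apply: (@bridge_path_unique _ _ (b j) (fun s => h s 0 j)) => //.
  - by move=> s _; exact: cb.
  - by move=> s _; exact: continuous_loop_coord.
  - by move=> s; exact: loop_coord_neg.
  - by move=> s s0 s1; rewrite bE// /drift_coord addrK.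
  - exact: ltW.
have b1 j t : 1 <= t -> b j t = b j 1 by have [_ _ + _] := bP j; apply.
(* Each coordinate is estimated by the full deviation, which costs the factor [n]; only finiteness
   matters in the end. *)
have bound N : `|l (bridge_approx c (@steps R n N b))| <= n%:R * Num.sqrt E * functional_sd c l N.
  pose S j := \sum_(k < N.+1) l (bridge_ramp c (k, j)) * steps b (k, j).
  have -> : l (bridge_approx c (@steps R n N b)) = \sum_j S j.
    rewrite linear_approx exchange_big pair_bigA/=; apply: eq_bigr => -[k j] _ //.
  apply: (le_trans (ler_norm_sum _ _ _)).
  rewrite -mulrA -[n in n%:R]card_ord mulr_natl -sumr_const; apply: ler_sum => j _.
  have [_ _ _ bE] := bP j.
  have E0 := energy_ge0 (hE j).
  rewrite -sqrtr_sqr /functional_sd -sqrtrM// ler_wsqrtr//.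
  pose a k := l (bridge_ramp c (inord k : 'I_N.+1, j)) : R.
  have := bE N.+1 (grid 0 1 N) a; rewrite grid0 gridN => /(_ (lexx _)) hb'.
  have gS i : (i < N.+1)%N -> grid 0 1 N i <= grid 0 1 N i.+1 :> R by move=> _; exact: grid_le.
  have {hb'} := hb' gS (lexx _).
  have -> : \sum_(i < N.+1) a i * (b j (grid 0 1 N i.+1) - b j (grid 0 1 N i)) = S j.
    by apply: eq_bigr => i _; rewrite /a inord_val.
  move=> /le_trans; apply; rewrite ler_wpM2l//.
  rewrite -(pair_bigA _ (fun k i => (l (bridge_ramp c (k, i)) * Num.sqrt N.+1%:R^-1) ^+ 2))/=.
  apply: ler_sum => k _; rewrite (bigD1 j)//= gridS subr0 mul1r exprMn sqr_sqrtr ?invr_ge0//.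
  rewrite /a inord_val lerDl; apply: sumr_ge0 => i _; exact: sqr_ge0.
rewrite -hb; have FF : ProperFilter (nbhs (\oo : set_system nat)) by exact: eventually_filter.
apply: (ler_cvg_to (f := fun k => `|l (bridge_approx c (@steps R n (phi k) b))|)
  (g := fun k => n%:R * Num.sqrt E * functional_sd c l (phi k)) (a := nbhs \oo)).
- apply: cvg_norm; apply: continuous_cvg; first exact: cl.
  have := bridge_approx_cvg c0 gb b1; apply: cvg_comp => U [N _ hN].
  by exists N => // k /= Nk; apply: hN; exact: leq_trans (phi1 k).
- by apply: cvgM => //; exact: cvg_cst.
- by apply: nearW => k; exact: bound.
Qed.

(** The value is 0 from time 1 on, where the integral against [c / (1 - x)] may diverge; for each
    [t] this is a bounded linear functional. *)
Definition drift_eval (t : R) (j : 'I_n) (f : loop R n) : R^o :=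
  if t < 1 then drift_coord f j t else 0.

Fact drift_eval_linear t j : linear (drift_eval t j).
Proof.
move=> a f g; rewrite /drift_eval; case: ifPn => t1; last by rewrite scaler0 addr0.
have gi (u : loop R n) : lebesgue_measure.-integrable `[(-1)%R, t]
    (EFin \o (fun x => c / (1 - x) * u x 0 j)).
  apply: integrable_lt1 => // s s1; apply: cvgM; last exact: continuous_loop_coord.
  by apply: (@continuous_div_onem R (fun=> c) s s1); exact: cvg_cst.
have E x : (a *: f + g) x 0 j = a * f x 0 j + g x 0 j by rewrite [LHS]mxE; congr (_ + _); exact: mxE.
rewrite /drift_coord E /drift_int.
have -> : \int[lebesgue_measure]_(x in `[(-1)%R, t]) (c / (1 - x) * (a *: f + g) x 0 j) =
    a * \int[lebesgue_measure]_(x in `[(-1)%R, t]) (c / (1 - x) * f x 0 j) +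
    \int[lebesgue_measure]_(x in `[(-1)%R, t]) (c / (1 - x) * g x 0 j).
  rewrite -RintegralZl// -RintegralD//; last first.
    by apply: (integrableZl _ a (gi f)).
  by apply: eq_Rintegral => x _; rewrite E; ring.
by rewrite /GRing.scale/=; ring.
Qed.

Lemma drift_eval_bound t j : exists K, forall f, `|drift_eval t j f| <= K * `|f|.
Proof.
have [t1|t1] := ltP t 1; last first.
  by exists 0 => f; rewrite /drift_eval ltNge t1 normr0 mul0r.
have [t0|t0] := leP t 0.
  exists 0 => f; rewrite /drift_eval t1 /drift_coord loop_coord_neg// add0r drift_int_neg//.
    by rewrite normr0 mul0r.
  by move=> x; exact: loop_coord_neg.
have u0 : 0 < 1 - t by rewrite subr_gt0.
exists (1 + c / (1 - t)) => f; rewrite /drift_eval t1 /drift_coord (le_trans (ler_normD _ _))//.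
rewrite mulrDl mul1r lerD ?loop_norm_ge//.
pose g s := f s 0 j.
have z : drift_int c g 0 = 0 by apply: drift_int_neg => // x; exact: loop_coord_neg.
rewrite -[X in `|X|](subr0 (drift_int c g t)) -[X in _ - X]z.
pose M := c / (1 - t) * `|f|.
have M0 : 0 <= M by rewrite mulr_ge0 ?divr_ge0// ltW.
apply: (@le_trans _ _ (M * t - M * 0)); last first.
  by rewrite mulr0 subr0 ler_piMr// ltW.
apply: (@le_derive_dist R (drift_int c g) (fun x => M * x) (fun x => c / (1 - x) * g x) (fun=> M)).
- exact: ltW.
- move=> x /andP[x0 xt]; apply: is_derive_drift.
  + by move=> s _; exact: continuous_loop_coord.
  + exact: lt_le_trans (ltrN10 _) x0.
  + exact: le_lt_trans t1.
- move=> x _; have zz := is_deriveZ M (is_derive_id x 1).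
  by move: zz; rewrite /GRing.scale/= mulr1.
- move=> x /andP[x0 xt]; rewrite normrM ler_pM//; last exact: loop_norm_ge.
  have x1 : 0 < 1 - x by lra.
  rewrite ger0_norm ?divr_ge0 ?(ltW c0) ?(ltW x1)// ler_wpM2l ?(ltW c0)//.
  by rewrite lef_pV2 ?posrE//; lra.
Qed.

Variables (j : 'I_n) (N : nat) (t a : nat -> R).

(** On the bridge this functional is the same sum over the increments of [W j], so its L2 norm is
    the norm of the step function in [energy_le]. *)
Definition energy_functional (f : loop R n) : R^o :=
  \sum_(i < N) a i * (drift_eval (t i.+1) j f - drift_eval (t i) j f).

Fact energy_functional_linear : linear energy_functional.
Proof.
move=> k f g; rewrite /energy_functional scaler_sumr -big_split/=; apply: eq_bigr => i _.
by rewrite !drift_eval_linear /GRing.scale/=; ring.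
Qed.

HB.instance Definition _ := GRing.isLinear.Build R (loop R n) R^o _ energy_functional
  energy_functional_linear.

Lemma continuous_energy_functional : continuous energy_functional.
Proof.
have [K hK] := choice (fun i => drift_eval_bound (t i) j).
apply/linear_bounded_continuous/linear_boundedP.
exists (\sum_(i < N) `|a i| * (K i.+1 + K i)); split; first exact: num_real.
move=> r hr f; rewrite (le_trans (ler_norm_sum _ _ _))//.
apply: (@le_trans _ _ ((\sum_(i < N) `|a i| * (K i.+1 + K i)) * `|f|)); last first.
  by rewrite ler_wpM2r// ltW.
rewrite mulr_suml; apply: ler_sum => i _; rewrite normrM -mulrA ler_wpM2l//.
by rewrite mulrDl (le_trans (ler_normB _ _))// lerD.
Qed.

Hypotheses (t0 : 0 <= t 0%N) (tS : forall i, (i < N)%N -> t i < t i.+1) (tN : t N < 1).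

Let t1 i : (i <= N)%N -> t i < 1.
Proof. by move=> iN; rewrite (le_lt_trans (strict_steps tS iN (leqnn N))). Qed.

Lemma energy_functionalE f :
  energy_functional f = \sum_(i < N) a i * (drift_coord f j (t i.+1) - drift_coord f j (t i)).
Proof.
by apply: eq_bigr => i _; rewrite /drift_eval !t1// ltnW.
Qed.

Lemma has_gauss_energy_functional : has_gauss P (fun w => energy_functional (Z w))
  (Num.sqrt (\sum_(i < N) a i ^+ 2 * (t i.+1 - t i))).
Proof.
have [cW W0 _ _ iW] := PW.
pose a' (p : 'I_N * 'I_n) := if p.2 == j then a p.1 else 0.
have := has_gauss_sum a' (iW N t t0 tS (ltW tN)).
have split_sum (F : 'I_N -> 'I_n -> R) :
    (forall i k, k != j -> F i k = 0) -> \sum_p F p.1 p.2 = \sum_(i < N) F i j.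
  move=> F0; rewrite -(pair_bigA _ F)/=; apply: eq_bigr => i _.
  by rewrite (bigD1 j)//= big1 ?addr0// => k kj; rewrite F0.
congr has_gauss.
  apply/funext => w; rewrite energy_functionalE.
  rewrite (split_sum (fun i k => a' (i, k) * (W k w (t i.+1) - W k w (t i)))); last first.
    by move=> i k /negPf kj; rewrite /a'/= kj mul0r.
  apply: eq_bigr => i _; rewrite /a'/= eqxx; congr (_ * _).
  have e x : x < 1 -> drift_coord (Z w) j x = W j w x.
    move=> x1; rewrite /drift_coord (bridge_rvE c0 PW).
    have -> : (fun s => Z w s 0 j) = bridge_path c (W j w).
      by apply/funext => s; rewrite (bridge_rvE c0 PW).
    by rewrite bridge_path_drift//; exact: W0.
  by rewrite !e//; apply: t1 => //; exact: ltnW.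
congr Num.sqrt.
rewrite (split_sum (fun i k => (a' (i, k) * Num.sqrt (t i.+1 - t i)) ^+ 2)); last first.
  by move=> i k /negPf kj; rewrite /a'/= kj mul0r expr0n.
apply: eq_bigr => i _; rewrite /a'/= eqxx exprMn sqr_sqrtr// subr_ge0 ltW// tS//.
Qed.

End cameron_martin.

(** Energy bounds the functionals through the polygonal approximations. Conversely, if [C] bounds
    all functionals of norm at most 1 at [h], then [C ^ 2] bounds the energy, because the energy
    functionals are among them after scaling. *)
Lemma cameron_martin_energy d (T : measurableType d) (R : realType) (P : probability T R)
    (n : nat) (W : 'I_n -> T -> R -> R) (c : R) (nu : probability (borel (loop R n)) R)
    (h : loop R n) : 0 < c -> wiener P W -> (0 < n)%N ->
  (forall A : set (borel (loop R n)), measurable A -> nu A = P (bridge_rv W c @^-1` A)) ->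
  cameron_martin nu h <-> exists E, forall j, energy_le (drift_coord c h j) E.
Proof.
move=> c0 PW n0 nuE; rewrite /cameron_martin/=; split; last first.
  move=> [E hE]; have E0 := energy_ge0 (hE (Ordinal n0)).
  apply: (@le_lt_trans _ _ (n%:R * Num.sqrt E)%:E); last exact: ltry.
  apply: ge_ereal_sup => _ [l [cl l1] <-]; rewrite lee_fin.
  have [p [phi [phi1 phi2] [p0 hp]]] := has_gauss_functional c0 PW cl n0.
  have := energy_functional_bound c0 hE cl phi1 phi2; move=> /le_trans; apply.
  rewrite ler_piMr//.
  by move: l1; rewrite (loop_law_Lnorm nuE cl p0 hp) lee_fin.
set S := (X in ereal_sup X) => hS.
have [C C0 hC] : exists2 C : R, 0 <= C & forall l : {linear loop R n -> R^o}, continuous l ->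
    ('N[nu]_2%:E[EFin \o l] <= 1)%E -> `|l h| <= C.
  exists (Num.max 0 (fine (ereal_sup S))); first by rewrite le_max lexx.
  move=> l cl l1; rewrite le_max; apply/orP; right; rewrite -lee_fin fineK.
    by apply: ereal_sup_ubound; exists l.
  rewrite fin_numElt hS andbT (@lt_le_trans _ _ `|l h|%:E) ?ltNyr//.
  by apply: ereal_sup_ubound; exists l.
exists (C ^+ 2) => j; apply: energy_le_strict => [s|N t a t0 tS tN].
  exact: continuous_drift_coord.
set q := \sum_(i < N) a i ^+ 2 * _; pose s := Num.sqrt q.
have q0 : 0 <= q.
  by apply: sumr_ge0 => i _; rewrite mulr_ge0 ?sqr_ge0// subr_ge0 ltW// tS.
have s0 : 0 <= s by exact: sqrtr_ge0.
rewrite -(energy_functionalE c j a tS tN h) -(sqr_sqrtr q0) -exprMn.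
set x := energy_functional _ _ _ _ _ _.
have scaled k : 0 <= k -> k * s <= 1 -> k * `|x| <= C.
  move=> k0 ks; pose l : {linear loop R n -> R^o} := energy_functional c j N t (fun i => k * a i).
  have cl : continuous l by exact: continuous_energy_functional.
  have hl := has_gauss_energy_functional c0 PW j (fun i => k * a i) t0 tS tN.
  have := hC l cl; rewrite (loop_law_Lnorm nuE cl (sqrtr_ge0 _) hl) lee_fin.
  have -> : \sum_(i < N) (k * a i) ^+ 2 * (t i.+1 - t i) = k ^+ 2 * q.
    by rewrite /q [RHS]mulr_sumr; apply: eq_bigr => i _; rewrite exprMn [RHS]mulrA.
  rewrite sqrtrM ?sqr_ge0// sqrtr_sqr ger0_norm// => /(_ ks).
  rewrite [l h](_ : _ = k * x) ?normrM ?(ger0_norm k0)//.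
  by rewrite /l/= /x /energy_functional mulr_sumr; apply: eq_bigr => i _; rewrite mulrA.
rewrite -[x ^+ 2]real_normK ?num_real// ler_pXn2r ?nnegrE ?mulr_ge0//.
apply/ler_addgt0Pr => e e0.
(* The deviation [s] may vanish, so the functional is divided by [s + dl] with [dl] arbitrarily
   small. *)
pose dl := e / (C + 1); have C1 : 0 < C + 1 by rewrite ltr_wpDl.
have dl0 : 0 < dl by rewrite divr_gt0.
have sd0 : 0 < s + dl by rewrite ltr_wpDl.
have := scaled (s + dl)^-1; rewrite invr_ge0 (ltW sd0) => /(_ isT).
rewrite mulrC ler_pdivrMr// mul1r lerDl (ltW dl0) => /(_ isT).
rewrite mulrC ler_pdivrMr// => /le_trans; apply; rewrite mulrDr lerD2l.
by rewrite /dl mulrA ler_pdivrMr// mulrC ler_wpM2l ?(ltW e0)// lerDl.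
Qed.

(** For [c <= 1 / 2] the loop with the path of [energy_gap] in every coordinate separates the two
    spaces; for [c > 1 / 2] the drift can be changed in both directions. *)
Lemma cameron_martin_eq d (T : measurableType d) (R : realType) (P : probability T R)
    (n : nat) (W : 'I_n -> T -> R -> R) (c : R) (nu1 nuc : probability (borel (loop R n)) R) :
  0 < c -> wiener P W -> (0 < n)%N ->
  (forall A : set (borel (loop R n)), measurable A -> nu1 A = P (bridge_rv W 1 @^-1` A)) ->
  (forall A : set (borel (loop R n)), measurable A -> nuc A = P (bridge_rv W c @^-1` A)) ->
  cameron_martin nuc = cameron_martin nu1 <-> 2^-1 < c.
Proof.
move=> c0 PW n0 nu1E nucE.
have half1 : 2^-1 < 1 :> R by rewrite invf_lt1// ltr1n.
have CM1 h := cameron_martin_energy h ltr01 PW n0 nu1E.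
have CMc h := cameron_martin_energy h c0 PW n0 nucE.
have ch (h : loop R n) j (s : R) : s < 1 -> {for s, continuous (fun t => h t 0 j)}.
  by move=> _; exact: continuous_loop_coord.
have h0 (h : loop R n) j (s : R) : s <= 0 -> h s 0 j = 0 by exact: loop_coord_neg.
split=> [eqH|c2].
  rewrite ltNge; apply/negP => c2.
  have [g [cg g0 [E hE] nE]] := energy_gap c0 c2.
  have isl : is_loop (fun t => \row_(j < n) g t).
    apply/asboolP; split=> [|t t01]; first exact: continuous_row.
    by apply/rowP => j; rewrite !mxE g0.
  pose h : loop R n := Loop isl.
  have hg (j : 'I_n) : (fun s => h s 0 j) = g by apply/funext => s; rewrite /h/= mxE.
  have hc d' j : drift_coord d' h j = (fun t => g t + drift_int d' g t).
    by apply/funext => t; rewrite /drift_coord hg; congr (_ + _); rewrite -(hg j).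
  have : cameron_martin nuc h by apply/CMc; exists E => j; rewrite hc.
  rewrite eqH => /CM1[E1 /(_ (Ordinal n0))]; rewrite hc; exact: nE.
apply/seteqP; split => h.
  move=> /CMc[E hE]; apply/CM1.
  by eexists => j; exact: (energy_drift_change 1 c2 (ch h j) (h0 h j) (hE j)).
move=> /CM1[E hE]; apply/CMc.
by eexists => j; exact: (energy_drift_change c half1 (ch h j) (h0 h j) (hE j)).
Qed.

(** * Mutual singularity *)

(* Borel-Cantelli applied to the events of measure at most 2 ^ - (k + 1), on both sides. *)
Lemma small_events_singular d (T : measurableType d) (R : realType)
    (mu nu : probability T R) :
  (forall e : R, 0 < e -> exists E : set T,
     [/\ measurable E, (mu E <= e%:E)%E & (nu (~` E) <= e%:E)%E]) ->
  mutually_singular mu nu.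
Proof.
move=> h; pose e (k : nat) : R := 1 / (2 ^ k.+1)%:R.
have e0 k : 0 < e k by rewrite divr_gt0// ltr0n expn_gt0.
have [E hE] := choice (fun k => h (e k) (e0 k)).
have bc (m : probability T R) (F : nat -> set T) : (forall k, measurable (F k)) ->
    (forall k, (m (F k) <= (e k)%:E)%E) -> m (lim_sup_set F) = 0%E.
  move=> mF Fe; apply: lim_sup_set_cvg0 => //.
  apply: (@le_lt_trans _ _ 1%:E); last exact: ltry.
  apply: le_trans (epsilon_trick0 xpredT (@ler01 R)).
  by apply: lee_nneseries => [k _ _|k _]; [exact: measure_ge0|exact: Fe].
have mE k : measurable (E k) by have [] := hE k.
have mlim (F : nat -> set T) : (forall k, measurable (F k)) -> measurable (lim_sup_set F).
  move=> mF; apply: bigcapT_measurable => m; exact: bigcup_measurable.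
exists (lim_sup_set E); split; first exact: mlim.
  by apply: bc => // k; have [] := hE k.
have mEC k : measurable (~` E k) by exact: measurableC.
apply: (@subset_measure0 _ _ _ _ _ (lim_sup_set (fun k => ~` E k))).
- by apply: measurableC; exact: mlim.
- exact: mlim.
(* A point that avoids all the [E k] from some rank on lies in infinitely many complements. *)
- move=> w; rewrite /lim_sup_set setC_bigcap => -[m _ hm] k _.
  exists (maxn m k) => /=; first exact: leq_maxr.
  by move=> Ew; apply: hm; exists (maxn m k) => //=; exact: leq_maxl.
- by apply: bc => // k; have [] := hE k.
Qed.

Section gauss_tail.
Variable R : realType.
Implicit Types s t x q : R.

Definition gauss_tail s x : \bar R := gauss s [set y : measurableTypeR R | x < `|y : R|].

Lemma measurable_tail x : measurable [set y : measurableTypeR R | x < `|y : R|].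
Proof.
rewrite (_ : [set _ | _] = ~` `[- x, x]%classic); first exact: measurableC.
by apply/seteqP; split => y /=; rewrite in_itv/= -ler_norml ltNge => /negP.
Qed.

Lemma gauss_tail_le s t x : 0 <= s -> s <= t -> (gauss_tail s x <= gauss_tail t x)%E.
Proof.
move=> s0 st; rewrite /gauss_tail !gauss_scale; apply: le_measure; rewrite ?inE.
- by have := @measurable_mulrl R s measurableT _ (measurable_tail x); rewrite setTI.
- by have := @measurable_mulrl R t measurableT _ (measurable_tail x); rewrite setTI.
move=> y /= /lt_le_trans; apply.
by rewrite !normrM ler_wpM2r// !ger0_norm// (le_trans s0).
Qed.

Lemma gauss_tailZ k s x : 0 < k -> gauss_tail (k * s) (k * x) = gauss_tail s x.
Proof.
move=> k0; rewrite /gauss_tail !gauss_scale; congr (normal_prob _ _ _).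
have e y : `|k * s * y| = k * `|s * y| by rewrite -mulrA normrM gtr0_norm.
by apply/seteqP; split => y /=; rewrite e ltr_pM2l.
Qed.

Lemma gauss_tail_fin s x : gauss_tail s x \is a fin_num.
Proof. by apply: fin_num_measure; exact: measurable_tail. Qed.

Lemma gauss_tailC s x :
  gauss s [set y : measurableTypeR R | `|y : R| <= x] = (1 - gauss_tail s x)%E.
Proof.
rewrite -(@probability_setC _ _ _ (gauss s)); last exact: measurable_tail.
by congr (gauss s _); apply/seteqP; split => y /=; [move=> yx /lt_geF; rewrite yx|move/negP; rewrite -leNgt].
Qed.

Lemma gauss_tail_small s e : 0 < e -> exists2 x, 0 < x & (gauss_tail s x <= e%:E)%E.
Proof.
move=> e0; have [x x0 hx] := tight (gauss s : probability (measurableTypeR R) R) (@measurable_id _ _ setT) e0.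
exists x => //; apply: le_trans (ltW hx); apply: le_measure; rewrite ?inE.
- exact: measurable_tail.
- rewrite (_ : [set _ | _] = ~` `](- x), x[%classic); first exact: measurableC.
  by apply/seteqP; split => y /=; rewrite in_itv/= -ltr_norml leNgt => /negP.
- by move=> y /= /ltW.
Qed.

(** A form of Bernoulli's inequality that makes [(1 - q) ^ N] small as soon as [N * q] is large. *)
Lemma bernoulli_inv q N : 0 <= q -> q <= 1 -> (1 - q) ^+ N * (1 + N%:R * q) <= 1.
Proof.
move=> q0 q1; elim: N => [|N IH]; first by rewrite expr0 mul0r addr0 mulr1.
rewrite exprSr -mulrA; apply: le_trans IH.
rewrite ler_wpM2l ?exprn_ge0 ?subr_ge0// -natr1.
have : 0 <= N%:R :> R by [].
by move: (N%:R) => x x0; nra.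
Qed.

End gauss_tail.

Section bridge_singular.
Context d (T : measurableType d) (R : realType) (P : probability T R) (n : nat).
Context (W : 'I_n -> T -> R -> R).
Hypothesis PW : wiener P W.
Variable j : 'I_n.
Implicit Types c t x e : R.

Lemma bridge_var0 c : bridge_var c 0 = 0.
Proof.
by rewrite /bridge_var subr0; case: eqP => _; rewrite ?ln1 ?oppr0// powR1 subrr mul0r.
Qed.

Lemma has_gauss_bridge c t : 0 < c -> 0 < t -> t < 1 ->
  has_gauss P (fun w => bridge_path c (W j w) t) ((1 - t) `^ c * Num.sqrt (bridge_var c t)).
Proof.
move=> c0 t0 t1; pose u (i : nat) := if i == 0%N then 0 else t.
have uS i : (i < 1)%N -> u i < u i.+1 by case: i.
have := bridge_increments c0 PW (lexx 0 : 0 <= u 0%N) uS t1.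
move=> /(indep_gauss_marginal (ord0, j)) /= /(has_gaussZ ((1 - t) `^ c)).
rewrite /u/= bridge_var0 !subr0; set F := (X in has_gauss _ X _ -> _).
suff -> : F = (fun w => bridge_path c (W j w) t) by [].
apply/funext => w; rewrite /F [bridge_path _ _ 0]/bridge_path ltxx/= mulr0 subr0 mulrA powR_onemK// mul1r//.
Qed.

Lemma has_gauss_bridge_scaled c t : 0 < c -> 0 < t -> t < 1 ->
  has_gauss P (fun w => bridge_path c (W j w) t / Num.sqrt (1 - t))
    (Num.sqrt ((1 - t) `^ (c *+ 2 - 1) * bridge_var c t)).
Proof.
move=> c0 t0 t1; have u0 : 0 < 1 - t by rewrite subr_gt0.
have := has_gaussZ (Num.sqrt (1 - t))^-1 (has_gauss_bridge c0 t0 t1).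
congr has_gauss; first by apply/funext => w; rewrite mulrC.
rewrite sqrtrM ?powR_ge0// mulrA; congr (_ * _).
apply/eqP; rewrite -(@eqrXn2 _ 2)//; last by rewrite mulr_ge0 ?powR_ge0// invr_ge0 sqrtr_ge0.
rewrite exprMn exprVn !sqr_sqrtr ?powR_ge0 ?(ltW u0)// powRB ?(gt_eqF u0) ?implybT//.
by rewrite powRr1 ?(ltW u0)// mulrC -mulr_natr powRrM powR_mulrn ?powR_ge0//.
Qed.

(* The variance of z_t / sqrt (1 - t). *)
Definition scaled_var c t := (1 - t) `^ (c *+ 2 - 1) * bridge_var c t.

Lemma scaled_varE c t : c != 2^-1 -> t < 1 ->
  scaled_var c t = (1 - (1 - t) `^ (c *+ 2 - 1)) / (c *+ 2 - 1).
Proof.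
move=> c2 t1; rewrite /scaled_var /bridge_var (negPf c2) mulrA mulrBr mulr1 -powRD.
  by rewrite [X in _ `^ X](_ : _ = 0) ?powRr0//; ring.
by rewrite subr_eq0 (gt_eqF t1) implybT.
Qed.

Lemma scaled_var_le c t : 2^-1 < c -> t < 1 -> 0 <= t -> scaled_var c t <= (c *+ 2 - 1)^-1.
Proof.
move=> c2 t1 t0; have k0 : 0 < c *+ 2 - 1 by rewrite mulr2n; lra.
rewrite scaled_varE ?gt_eqF// ler_pdivrMr// mulVf ?gt_eqF// gerBl powR_ge0//.
Qed.

(** A lower bound uniform in [c], with equality at 1/2; it follows from [1 + x <= expR x]. *)
Lemma scaled_var_ge c t : c <= 2^-1 -> 0 <= t -> t < 1 -> - ln (1 - t) <= scaled_var c t.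
Proof.
move=> c2 t0 t1; have u0 : 0 < 1 - t by rewrite subr_gt0.
have [c2E|c2n] := eqVneq c 2^-1.
  have h2 : 2^-1 *+ 2 - 1 = 0 :> R by rewrite mulr2n; lra.
  by rewrite /scaled_var /bridge_var c2E eqxx h2 powRr0 mul1r.
have c2' : c < 2^-1 by rewrite lt_neqAle c2n.
have k0 : 0 < 1 - c *+ 2 by rewrite mulr2n; lra.
have E (x : R) : (1 - x) / (c *+ 2 - 1) = (x - 1) / (1 - c *+ 2).
  by rewrite -mulrNN -invrN !opprB.
rewrite scaled_varE// E ler_pdivlMr//.
have -> : (1 - t) `^ (c *+ 2 - 1) = expR (- ln (1 - t) * (1 - c *+ 2)).
  rewrite /powR (gt_eqF u0); congr expR; ring.
rewrite lerBrDr addrC; exact: expR_ge1Dx.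
Qed.

Definition scaled_eval t (f : loop R n) : R := f t 0 j / Num.sqrt (1 - t).

Lemma continuous_scaled_eval t : continuous (scaled_eval t).
Proof.
move=> f; apply: (@cvgM _ _ (nbhs f) _ (fun f : loop R n => f t 0 j)
  (fun=> (Num.sqrt (1 - t))^-1)); last exact: cvg_cst.
apply/cvgrPdist_le => e e0.
have h : \forall g \near f, `|f - g| <= e.
  by apply/nbhs_ballP; exists e => // g; rewrite -ball_normE /ball_/= => /ltW.
apply: filterS h => g; apply: le_trans.
by rewrite (_ : f t 0 j - g t 0 j = (f - g) t 0 j) ?loop_norm_ge// [RHS]mxE [in RHS]mxE.
Qed.

Let tail_set x : set (measurableTypeR R) := [set y | x < `|y : R|].

Lemma measurable_scaled_eval t x :
  measurable (scaled_eval t @^-1` tail_set x : set (borel (loop R n))).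
Proof.
have := continuous_measurable_functional (@continuous_scaled_eval t).
by move=> /(_ measurableT _ (measurable_tail x)); rewrite setTI.
Qed.

Lemma scaled_eval_tail c t x : 0 < c -> 0 < t -> t < 1 ->
  P (bridge_rv W c @^-1` (scaled_eval t @^-1` tail_set x)) =
  gauss_tail (Num.sqrt (scaled_var c t)) x.
Proof.
move=> c0 t0 t1; rewrite /gauss_tail /scaled_var -(proj2 (has_gauss_bridge_scaled c0 t0 t1) _ (measurable_tail x)).
congr (P _); apply/seteqP.
by split => w /=; rewrite /tail_set/= /scaled_eval (bridge_rvE c0 PW).
Qed.

Let measurable_rv c (E : set (borel (loop R n))) : 0 < c -> measurable E ->
  measurable (bridge_rv W c @^-1` E).
Proof.
by move=> c0 mE; rewrite -[X in measurable X]setTI; exact: (measurable_bridge_rv c0 PW).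
Qed.

(* At a late time the scaled bridge has variance at most 1 when c = 1, and an
   arbitrarily large one when c <= 1/2. *)
Lemma separating_event_low c e : 0 < c -> c <= 2^-1 -> 0 < e ->
  exists E : set (borel (loop R n)), [/\ measurable E,
    (P (bridge_rv W 1 @^-1` E) <= e%:E)%E & (P (bridge_rv W c @^-1` (~` E)) <= e%:E)%E].
Proof.
move=> c0 c2 e0; have [x x0 hx] := gauss_tail_small 1 e0.
(* With variance at least [L], the ball of radius [x] has mass at most [2 x / sqrt L = e]; the time
   is chosen so that [- ln (1 - t) = L]. *)
pose L := (x *+ 2 / e) ^+ 2.
have L0 : 0 < L by rewrite exprn_gt0// divr_gt0// pmulrn_rgt0.
pose t := 1 - expR (- L).
have t0 : 0 < t by rewrite subr_gt0 expR_lt1 oppr_lt0.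
have t1 : t < 1 by rewrite ltrBlDr ltrDl expR_gt0.
have mE := measurable_scaled_eval t x.
exists (scaled_eval t @^-1` tail_set x); split => //.
  rewrite scaled_eval_tail//; apply: le_trans hx; apply: gauss_tail_le => //.
  rewrite -[leRHS]sqrtr1 ler_wsqrtr//; apply: le_trans (scaled_var_le _ t1 (ltW t0)) _.
    by rewrite invf_lt1// ltr1n.
  by rewrite mulr2n addrK invr1.
have hv := scaled_var_ge c2 (ltW t0) t1.
rewrite /t opprB addrC subrK expRK opprK -/t in hv.
rewrite -preimage_setC probability_setC//; last exact: measurable_rv.
rewrite scaled_eval_tail// -gauss_tailC.
have sd0 : 0 < Num.sqrt (scaled_var c t) by rewrite sqrtr_gt0 (lt_le_trans L0).
apply: (le_trans (gauss_small_ball (lt0r_neq0 sd0) (ltW x0))).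
rewrite lee_fin gtr0_norm// ler_pdivrMr// mulrC -ler_pdivrMr//.
rewrite -[leLHS]gtr0_norm ?divr_gt0 ?pmulrn_rgt0// -sqrtr_sqr.
exact: ler_wsqrtr.
Qed.

(* Along the times t_k = 1 - lam ^ k the variables Y_(k+1) - a Y_k, where Y_k is the
   bridge scaled by sqrt (1 - t_k) and a = lam ^ (c - 1/2), are independent with the
   common variance (1 - a ^ 2) / (2 c - 1). *)
Lemma scaled_bridge_small c lam x N : 2^-1 < c -> 0 < lam -> lam < 1 -> 0 < x ->
  (P [set w | forall k, (k < N)%N ->
      (`|scaled_eval (1 - lam ^+ k.+1)%R (bridge_rv W c w)| <= x)%R] <=
   (1 - gauss_tail (Num.sqrt ((1 - (lam `^ (c - 2^-1)) ^+ 2) / (c *+ 2 - 1))%R)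
     ((1 + lam `^ (c - 2^-1)) * x)%R) ^+ N)%E.
Proof.
move=> c2 l0 l1 x0; pose a := lam `^ (c - 2^-1); rewrite -/a.
set q := gauss_tail _ _; set S := [set w | _].
have c0 : 0 < c by rewrite (lt_trans _ c2)// invr_gt0.
have k0 : 0 < c *+ 2 - 1 by rewrite mulr2n; lra.
have a0 : 0 < a by rewrite powR_gt0.
pose u k := 1 - lam ^+ k.
have lk0 k : 0 < lam ^+ k by exact: exprn_gt0.
have lk k : 1 - u k = lam ^+ k by rewrite /u opprB addrC subrK.
have uS i : (i < N)%N -> u i < u i.+1.
  by move=> _; rewrite /u ltrD2l ltrN2 exprS gtr_pMl.
have u0 : 0 <= u 0%N by rewrite /u expr0 subrr.
have u1 k : u k < 1 by rewrite /u ltrBlDr ltrDl.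
(* This factor turns the increments of the weighted bridge into the variables [Y_(k+1) - a Y_k]. *)
pose b (p : 'I_N * 'I_n) := (lam ^+ p.1.+1) `^ (c - 2^-1).
have [mX hX] := indep_gaussZ b (bridge_increments c0 PW u0 uS (u1 N)).
have powk (r : R) k : (lam ^+ k) `^ r = (lam `^ r) ^+ k.
  by rewrite -(powR_mulrn k (ltW l0)) -powRrM mulrC powRrM powR_mulrn// powR_ge0.
have bE p : b p = a ^+ p.1.+1 by rewrite /b powk.
have aE : lam `^ (1 - c *+ 2) = a ^- 2.
  rewrite /a -(powR_mulrn 2 (powR_ge0 lam _)) -powRrM -powRN; congr (_ `^ _).
  by rewrite mulrBl mulVf ?pnatr_eq0// mulr_natr opprB.
have VE k : bridge_var c (u k) = ((a ^+ k) ^- 2 - 1) / (c *+ 2 - 1).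
  rewrite /bridge_var gt_eqF// lk powk aE; congr ((_ - _) / _).
  by rewrite exprVn -!exprM mulnC.
pose s := Num.sqrt ((1 - a ^+ 2) / (c *+ 2 - 1)).
have sd p : b p * Num.sqrt (bridge_var c (u p.1.+1) - bridge_var c (u p.1)) = s.
  rewrite bE -[a ^+ _]ger0_norm ?exprn_ge0 ?(ltW a0)// -sqrtr_sqr -sqrtrM ?sqr_ge0//.
  rewrite /s !VE; congr Num.sqrt; rewrite [a ^+ p.1.+1]exprS.
  have : a ^+ p.1 != 0 by rewrite gt_eqF// exprn_gt0.
  move: (a ^+ p.1) => y y0; field.
  by rewrite y0 (gt_eqF a0) mulr_natr (gt_eqF k0).
(* If [Y_k] and [Y_(k+1)] are at most [x] in absolute value, their combination is at most
   [(1 + a) x]; the other coordinates are left free. *)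
pose A (p : 'I_N * 'I_n) : set (measurableTypeR R) :=
  if p.2 == j then [set y | `|y : R| <= (1 + a) * x] else setT.
have mle y : measurable [set z : measurableTypeR R | `|z : R| <= y].
  rewrite (_ : [set _ | _] = ~` [set z : measurableTypeR R | y < `|z : R|]).
    by apply: measurableC; exact: measurable_tail.
  by apply/seteqP; split => z /=; rewrite leNgt => /negP.
have mA p : measurable (A p) by rewrite /A; case: ifP.
have -> : ((1 - q) ^+ N)%E = (\prod_(p : 'I_N * 'I_n) gauss s (A p))%E.
  transitivity (\prod_(k < N) \prod_(i < n) gauss s (A (k, i)))%E; last first.
    by rewrite pair_bigA; apply: eq_bigr => -[].
  rewrite (eq_bigr (fun=> 1 - q)%E); last first.
    move=> k _; rewrite (bigD1 j)//= big1 ?mule1.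
      by rewrite /A/= eqxx gauss_tailC.
    by move=> i /negPf ij; rewrite /A/= ij gaussT.
  by rewrite big_const_ord; elim: (N) => [|m IH]; rewrite ?expe0 ?expeS ?IH.
have -> : (\prod_(p : 'I_N * 'I_n) gauss s (A p))%E =
    P [set w | forall p : 'I_N * 'I_n, A p (b p * ((1 - u p.1.+1) `^ (- c) *
      bridge_path c (W p.2 w) (u p.1.+1) - (1 - u p.1) `^ (- c) * bridge_path c (W p.2 w) (u p.1)))].
  by rewrite hX//; apply: eq_bigr => p _; rewrite sd.
apply: le_measure; rewrite ?inE.
- rewrite (_ : S = \bigcap_(k in [set k | (k < N)%N])
      (bridge_rv W c @^-1` ~` (scaled_eval (1 - lam ^+ k.+1) @^-1` tail_set x))).
    apply: bigcap_measurableType => k _; apply: measurable_rv => //; apply: measurableC.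
    exact: measurable_scaled_eval.
  by apply/seteqP; split => w /= h k kN; have := h k kN; rewrite /tail_set/= leNgt => /negP.
- by apply: measurable_forall_preimage.
move=> w Sw [k i]; rewrite /A; case: ifP => //= /eqP ->.
have zE m : bridge_path c (W j w) (u m) = scaled_eval (u m) (bridge_rv W c w) * Num.sqrt (lam ^+ m).
  rewrite /scaled_eval (bridge_rvE c0 PW) lk divfK// gt_eqF// sqrtr_gt0//.
(* Index 0 is covered because the bridge vanishes at the time [u 0 = 0]. *)
have yx m : (m <= N)%N -> `|scaled_eval (u m) (bridge_rv W c w)| <= x.
  case: m => [_|m mN]; last exact: Sw.
  by rewrite /scaled_eval (bridge_rvE c0 PW) /u expr0 subrr /bridge_path ltxx/= mul0r normr0 ltW.
have half m : Num.sqrt (lam ^+ m) = (lam ^+ m) `^ 2^-1 by rewrite powR12_sqrt ?ltW.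
have p1 : (lam ^+ k.+1) `^ (c - 2^-1) * ((lam ^+ k.+1) `^ (- c) * Num.sqrt (lam ^+ k.+1)) = 1.
  rewrite half -!powRD ?(gt_eqF (lk0 _)) ?implybT//.
  by rewrite [X in _ `^ X](_ : _ = 0) ?powRr0//; ring.
have p2 : (lam ^+ k.+1) `^ (c - 2^-1) * ((lam ^+ k) `^ (- c) * Num.sqrt (lam ^+ k)) = a.
  rewrite half !powk exprS -mulrA -!exprMn -!powRD ?(gt_eqF l0) ?implybT//.
  have -> : c - 2^-1 + (- c + 2^-1) = 0 by ring.
  by rewrite powRr0 expr1n mulr1.
rewrite !zE !lk /b/=.
rewrite (_ : _ * _ = (lam ^+ k.+1) `^ (c - 2^-1) * ((lam ^+ k.+1) `^ (- c) * Num.sqrt (lam ^+ k.+1)) *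
    scaled_eval (u k.+1) (bridge_rv W c w) -
  (lam ^+ k.+1) `^ (c - 2^-1) * ((lam ^+ k) `^ (- c) * Num.sqrt (lam ^+ k)) *
    scaled_eval (u k) (bridge_rv W c w)); last by ring.
rewrite p1 p2 mul1r (le_trans (ler_normB _ _))// mulrDl mul1r lerD ?yx//.
rewrite normrM gtr0_norm// ler_wpM2l ?(ltW a0)// yx//; exact: ltnW.
Qed.

(* The same late times for both bridges: the smaller scaled variance gives a tail
   beyond x of probability p at each time, the larger one a tail of probability at
   least q along independent variables, and p / q tends to 0 as x grows.  With
   N ~ K / q times, the first maximum stays below x and the second one exceeds it. *)
Lemma separating_event_high cs cl e : 2^-1 < cl -> cl < cs -> 0 < e ->
  exists E : set (borel (loop R n)), [/\ measurable E,
    (P (bridge_rv W cs @^-1` E) <= e%:E)%E & (P (bridge_rv W cl @^-1` (~` E)) <= e%:E)%E].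
Proof.
move=> cl2 cls e0.
have h2 : 0 < 2^-1 :> R by rewrite invr_gt0.
have cl0 : 0 < cl by exact: lt_trans cl2.
have cs0 : 0 < cs by exact: lt_trans cls.
have cs2 : 2^-1 < cs by exact: lt_trans cls.
have kl0 : 0 < cl *+ 2 - 1 by rewrite mulr2n; lra.
have ks0 : 0 < cs *+ 2 - 1 by rewrite mulr2n; lra.
pose rho := (cl *+ 2 - 1) / (cs *+ 2 - 1).
have rho0 : 0 < rho by rewrite divr_gt0.
have rho1 : rho < 1 by rewrite ltr_pdivrMr// mul1r ltrD2r ltr_pMn2r.
(* Small enough for [(1 - a) / (1 + a) > rho], which is [s < w'] below: the independent variables
   keep an effective deviation larger than that of the other bridge. *)
pose a := (1 - rho) / 4.
have a0 : 0 < a by rewrite divr_gt0// subr_gt0.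
have a1 : a < 1 by rewrite /a; lra.
have g0 : 0 < cl - 2^-1 by rewrite subr_gt0.
pose lam := a `^ (cl - 2^-1)^-1.
have lamE : lam `^ (cl - 2^-1) = a by rewrite /lam -powRrM mulVf ?gt_eqF// powRr1// ltW.
have lam0 : 0 < lam by exact: powR_gt0.
have lam1 : lam < 1.
  rewrite ltNge; apply/negP => l1; have : 1 <= lam `^ (cl - 2^-1).
    have := @ge0_ler_powR R (cl - 2^-1) (ltW g0) 1 lam.
    by rewrite !nnegrE ler01 (ltW lam0) powR1; apply.
  by rewrite lamE leNgt a1.
pose s := Num.sqrt (cs *+ 2 - 1)^-1.
have s0 : 0 < s by rewrite sqrtr_gt0 invr_gt0.
pose w := Num.sqrt ((1 - a ^+ 2) / (cl *+ 2 - 1)).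
pose w' := w / (1 + a).
have a10 : 0 < 1 + a by rewrite ltr_wpDl// ltW.
have w2 : w' ^+ 2 = (1 - a) / (1 + a) / (cl *+ 2 - 1).
  rewrite /w' exprMn exprVn sqr_sqrtr.
    by field; rewrite (gt_eqF a10) mulr_natr (gt_eqF kl0).
  by rewrite divr_ge0 ?(ltW kl0)// subr_ge0 expr_le1// ltW.
have w'0 : 0 <= w' by rewrite divr_ge0 ?sqrtr_ge0// ltW.
have sw : s < w'.
  rewrite -(@ltr_pXn2r _ 2)// ?nnegrE ?(ltW s0)// w2 sqr_sqrtr ?invr_ge0 ?(ltW ks0)//.
  have -> : (cs *+ 2 - 1)^-1 = rho / (cl *+ 2 - 1).
    by rewrite /rho mulrAC divff ?mul1r// gt_eqF.
  rewrite ltr_pM2r ?invr_gt0// ltr_pdivlMr//; rewrite /a; nra.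
have w'p : 0 < w' by exact: lt_trans sw.
pose kap := (s ^- 2 - w' ^- 2) / 2.
have kap0 : 0 < kap.
  by rewrite divr_gt0// subr_gt0 ltf_pV2 ?posrE ?exprn_gt0// ltr_pXn2r ?nnegrE ?ltW.
pose K := e^-1; have K0 : 0 < K by rewrite invr_gt0.
pose A := (K + 1) * (w' / s); have A0 : 0 < A by rewrite mulr_gt0 ?addr_gt0// divr_gt0.
(* Makes [kap * x ^ 2] equal to [A / e], so that [expR (A / e) >= A / e] gives the bound [Ax]. *)
pose x := Num.sqrt (A / (e * kap)).
have x0 : 0 < x by rewrite sqrtr_gt0 divr_gt0// mulr_gt0.
have Ax : A * expR (- kap * x ^+ 2) <= e.
  rewrite sqr_sqrtr; last by rewrite ltW// divr_gt0// mulr_gt0.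
  have -> : - kap * (A / (e * kap)) = - (A / e) by field; rewrite !gt_eqF.
  rewrite expRN ler_pdivrMr ?expR_gt0// -ler_pdivrMl// mulrC.
  by apply: le_trans (expR_ge1Dx _); rewrite lerDr.
pose q := fine (gauss_tail w' x); pose p := fine (gauss_tail s x).
have qE : gauss_tail w' x = q%:E by rewrite fineK// gauss_tail_fin.
have pE : gauss_tail s x = p%:E by rewrite fineK// gauss_tail_fin.
have q0 : 0 < q by rewrite -lte_fin -qE; apply: gauss_tail_gt0 => //; exact: ltW.
have q1 : q <= 1.
  by rewrite -lee_fin -qE; exact: (@probability_le1 _ _ _ (gauss w') _ (measurable_tail x)).
have p0 : 0 <= p by rewrite -lee_fin -pE; exact: measure_ge0.
have pq : (K + 1) * p <= e * q.
  have := gauss_tail_ratio s0 sw (ltW x0).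
  rewrite -/(gauss_tail s x) -/(gauss_tail w' x) qE pE -EFinM lee_fin -/kap => h.
  apply: (@le_trans _ _ (A * expR (- kap * x ^+ 2) * q)); last by rewrite ler_wpM2r// ltW.
  have K1 : 0 <= K + 1 by rewrite ltW// addr_gt0.
  by apply: le_trans (ler_wpM2l K1 h) _; rewrite /A !mulrA.
(* With [N] just above [K / q], one gets [N q >= K = 1 / e], while [N p <= (K + 1) p / q <= e]
   because [q <= 1]. *)
pose N := (Num.truncn (K / q)).+1.
have N1 : K <= N%:R * q by rewrite -ler_pdivrMr// ltW// truncnS_gt.
have N2 : N%:R * p <= e.
  have hN : N%:R <= K / q + 1.
    by rewrite -natr1 lerD2r truncn_le divr_ge0// ltW.
  apply: (le_trans (ler_wpM2r p0 hN)); rewrite -(ler_pM2r q0); apply: le_trans pq.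
  rewrite mulrAC mulrDl divfK ?gt_eqF// mul1r ler_wpM2r// lerD2l//.
pose t k := 1 - lam ^+ k.+1.
have t1 k : t k < 1 by rewrite /t ltrBlDr ltrDl exprn_gt0.
have t0 k : 0 < t k by rewrite /t subr_gt0 exprn_ilt1// ltW.
pose E k : set (borel (loop R n)) := scaled_eval (t k) @^-1` tail_set x.
have mE k : measurable (E k) by exact: measurable_scaled_eval.
exists (\big[setU/set0]_(k < N) E k); split.
- exact: bigsetU_measurable.
- have -> : bridge_rv W cs @^-1` (\big[setU/set0]_(k < N) E k) =
      \big[setU/set0]_(k < N) (bridge_rv W cs @^-1` E k).
    by rewrite -(bigcup_mkord N E) -(bigcup_mkord N (fun k => bridge_rv W cs @^-1` E k)) preimage_bigcup.
  apply: (@le_trans _ _ (\big[+%E/0%E]_(k < N) P (bridge_rv W cs @^-1` E k))).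
    by apply: (@Boole_inequality _ R T P (fun k => bridge_rv W cs @^-1` E k)) => k _; exact: measurable_rv.
  apply: (@le_trans _ _ (\big[+%E/0%E]_(k < N) p%:E)).
    apply: lee_sum => k _; rewrite /E scaled_eval_tail// -pE; apply: gauss_tail_le => //.
    by rewrite ler_wsqrtr// scaled_var_le// ltW.
  by rewrite sumEFin sumr_const card_ord -mulr_natl lee_fin.
- have -> : bridge_rv W cl @^-1` (~` \big[setU/set0]_(k < N) E k) =
      [set v | forall k, (k < N)%N -> `|scaled_eval (1 - lam ^+ k.+1) (bridge_rv W cl v)| <= x].
    rewrite -bigcup_mkord; apply/seteqP; split => v /= h.
      by move=> k kN; rewrite leNgt; apply/negP => hx; apply: h; exists k.
    by move=> [k /= kN]; rewrite /E /tail_set/= ltNge h.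
  apply: (le_trans (scaled_bridge_small N cl2 lam0 lam1 x0)).
  have -> : gauss_tail (Num.sqrt ((1 - (lam `^ (cl - 2^-1)) ^+ 2) / (cl *+ 2 - 1)))
      ((1 + lam `^ (cl - 2^-1)) * x) = q%:E.
    rewrite lamE -qE -(gauss_tailZ w' x a10); congr gauss_tail.
    by rewrite -/w [RHS]mulrC divfK// gt_eqF.
  rewrite -EFinB -EFin_expe lee_fin.
  have := bernoulli_inv N (ltW q0) q1; have : 0 <= (1 - q) ^+ N by rewrite exprn_ge0// subr_ge0.
  move: ((1 - q) ^+ N) => y y0 hy.
  have : y * K <= 1 by apply: le_trans hy; rewrite ler_wpM2l//; lra.
  by rewrite /K ler_pdivrMr// mul1r.
Qed.

End bridge_singular.

(** Above 1/2 the larger exponent has the smaller scaled variance. When [c > 1] it is the exponent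
    of the second law, so the separating event is complemented. *)
Lemma bridge_laws_singular d (T : measurableType d) (R : realType) (P : probability T R)
    (n : nat) (W : 'I_n -> T -> R -> R) (c : R) (nu1 nuc : probability (borel (loop R n)) R) :
  0 < c -> wiener P W -> (0 < n)%N ->
  (forall A : set (borel (loop R n)), measurable A -> nu1 A = P (bridge_rv W 1 @^-1` A)) ->
  (forall A : set (borel (loop R n)), measurable A -> nuc A = P (bridge_rv W c @^-1` A)) ->
  c <> 1 -> mutually_singular nu1 nuc.
Proof.
move=> c0 PW n0 nu1E nucE c1; pose j := Ordinal n0.
apply: small_events_singular => e e0.
have half1 : 2^-1 < 1 :> R by rewrite invf_lt1// ltr1n.
have [c2|c2] := leP c 2^-1.
  have [E [mE E1 Ec]] := separating_event_low PW j c0 c2 e0; exists E.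
  by rewrite nu1E// nucE//; exact: measurableC.
have [c1'|c1'|//] := ltgtP c 1.
- have [E [mE E1 Ec]] := separating_event_high PW j c2 c1' e0; exists E.
  by rewrite nu1E// nucE//; exact: measurableC.
- have [E [mE Ec E1]] := separating_event_high PW j half1 c1' e0; exists (~` E).
  rewrite setCK nu1E ?nucE//; last exact: measurableC.
  by split => //; exact: measurableC.
Qed.

(** * Transition kernels and the Markov property *)

Section affine_kernel.
Context (R : realType) (n : nat) (gam : probability (borel 'rV[R]_n) R).
Implicit Types r s : R.

Definition affine_map r s (x y : 'rV[R]_n) : 'rV[R]_n := r *: x + s *: y.

Lemma measurable_affine_comp d (T : measurableType d) r s (X Y : T -> 'rV[R]_n) :
  measurable_fun setT (X : T -> borel 'rV[R]_n) -> measurable_fun setT (Y : T -> borel 'rV[R]_n) ->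
  measurable_fun setT (fun w => affine_map r s (X w) (Y w) : borel 'rV[R]_n).
Proof.
move=> mX mY; apply: measurable_fun_rV => j.
have e w : affine_map r s (X w) (Y w) 0 j = r * X w 0 j + s * Y w 0 j by rewrite !mxE.
under eq_fun do rewrite e.
apply: measurable_funD; apply: measurable_funM => //.
  exact: (measurableT_comp (@measurable_coord R n j) mX).
exact: (measurableT_comp (@measurable_coord R n j) mY).
Qed.

Lemma measurable_affine r s (x : 'rV[R]_n) :
  measurable_fun setT (affine_map r s x : borel 'rV[R]_n -> borel 'rV[R]_n).
Proof.
by apply: (@measurable_affine_comp _ (borel 'rV[R]_n) r s (fun=> x) id).
Qed.

Definition affine_law r s (x : borel 'rV[R]_n) : {measure set (borel 'rV[R]_n) -> \bar R} :=
  restr_law gam measurableT (measurable_affine r s x).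

Lemma affine_lawE r s x A : affine_law r s x A = gam (affine_map r s x @^-1` A).
Proof. by rewrite /affine_law/= /restr_law setTI. Qed.

Let measurable_affine_set r s (A : set (borel 'rV[R]_n)) : measurable A ->
  measurable [set p : borel 'rV[R]_n * borel 'rV[R]_n | A (affine_map r s p.1 p.2)].
Proof.
move=> mA.
have mm : measurable_fun setT
    (fun p : borel 'rV[R]_n * borel 'rV[R]_n => affine_map r s p.1 p.2 : borel 'rV[R]_n).
  apply: (@measurable_affine_comp _ (borel 'rV[R]_n * borel 'rV[R]_n)%type r s fst snd).
    exact: measurable_fst.
  exact: measurable_snd.
by have := mm measurableT A mA; rewrite setTI.
Qed.

Lemma affine_law_xsection r s x (A : set (borel 'rV[R]_n)) : affine_law r s x A =
  gam (xsection [set p : borel 'rV[R]_n * borel 'rV[R]_n | A (affine_map r s p.1 p.2)] x).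
Proof.
by rewrite affine_lawE; congr (gam _); apply/seteqP; split => y /=; rewrite /xsection/= inE.
Qed.

Lemma measurable_affine_law r s (A : set (borel 'rV[R]_n)) : measurable A ->
  measurable_fun setT (affine_law r s ^~ A).
Proof.
move=> mA; under eq_fun do rewrite affine_law_xsection.
exact: (measurable_fun_xsection gam (measurable_affine_set r s mA)).
Qed.

HB.instance Definition _ r s :=
  isKernel.Build _ _ (borel 'rV[R]_n) (borel 'rV[R]_n) R (affine_law r s)
    (@measurable_affine_law r s).

Let affine_law_prob r s x : affine_law r s x setT = 1%E.
Proof. by rewrite affine_lawE preimage_setT probability_setT. Qed.

HB.instance Definition _ r s :=
  Kernel_isProbability.Build _ _ (borel 'rV[R]_n) (borel 'rV[R]_n) R (affine_law r s)
    (affine_law_prob r s).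

Definition affine_kernel r s : R.-pker (borel 'rV[R]_n) ~> (borel 'rV[R]_n) := affine_law r s.

Lemma ge0_integral_mrestr d (T : measurableType d) (P : {measure set T -> \bar R}) (G : set T)
    (mG : measurable G) (f : T -> \bar R) : measurable_fun setT f -> (forall x, 0 <= f x)%E ->
  (\int[mrestr P mG]_w f w = \int[P]_(w in G) f w)%E.
Proof.
move=> mf f0; transitivity (\int[mrestr P mG]_(w in G) f w)%E.
  rewrite (@ge0_negligible_integral _ _ _ (mrestr P mG) setT (~` G))//.
  - by rewrite setTD setCK.
  - exact: measurableC.
  - by transitivity (P (~` G `&` G)) => //; rewrite setICl measure0.
apply: eq_measure_integral => A mA AG; transitivity (P (A `&` G)) => //.
by rewrite (setIidl AG).
Qed.

(** Freezing [X]: a variable [Y] of law [gam], independent of [X] on the event [G], is integrated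
    out first. Independence is only required on boxes, which determine finite measures. *)
Lemma integral_affine_law d (T : measurableType d) (P : probability T R) (G : set T)
    (X Y : T -> 'rV[R]_n) r s (U : set (borel 'rV[R]_n)) : measurable G ->
  measurable_fun setT (X : T -> borel 'rV[R]_n) -> measurable_fun setT (Y : T -> borel 'rV[R]_n) ->
  (forall (D : set (borel 'rV[R]_n)) (A : 'I_n -> set (measurableTypeR R)),
     measurable D -> (forall j, measurable (A j)) ->
     P (G `&` X @^-1` D `&` Y @^-1` box A) = (P (G `&` X @^-1` D) * gam (box A))%E) ->
  measurable U ->
  P (G `&` [set w | U (affine_map r s (X w) (Y w))]) =
    (\int[P]_(w in G) affine_law r s (X w) U)%E.
Proof.
move=> mG mX mY hXY mU.
have hDB (D B : set (borel 'rV[R]_n)) : measurable D -> measurable B ->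
    P (G `&` X @^-1` D `&` Y @^-1` B) = (P (G `&` X @^-1` D) * gam B)%E.
  move=> mD mB.
  have mGD : measurable (G `&` X @^-1` D).
    by apply: measurableI => //; rewrite -[X in measurable X]setTI; exact: mX.
  have Pfin : P (G `&` X @^-1` D) \is a fin_num by exact: fin_num_measure.
  pose k : {nonneg R} := NngNum (fine_ge0 (measure_ge0 P (G `&` X @^-1` D))).
  have kE : (k%:num)%:E = P (G `&` X @^-1` D) by rewrite /= fineK.
  rewrite -kE; apply: (@rV_measure_eq R n (restr_law P mGD mY) (mscale k gam)) => //.
    by rewrite ltey_eq fin_num_measure.
  move=> A mA; transitivity (P (G `&` X @^-1` D `&` Y @^-1` box A)) => //.
  by rewrite hXY// -kE.
pose law : {measure set (borel 'rV[R]_n) -> \bar R} := restr_law P mG mX.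
pose C := [set p : borel 'rV[R]_n * borel 'rV[R]_n | U (affine_map r s p.1 p.2)].
have mC : measurable C by exact: measurable_affine_set.
have := @joint_law_eq _ T R P G _ _ (borel 'rV[R]_n) (borel 'rV[R]_n) X Y
  (restr_law P mG mX \x gam)%E mG mX mY.
move=> /(_ _ C mC) -> //; last first.
  move=> D B mD mB; transitivity (P (G `&` X @^-1` D) * gam B)%E; last first.
    by apply/esym; exact: product_measure1E.
  rewrite -hDB//; congr (P _).
  by apply/seteqP; split => w /= => [[Gw [Dw Bw]]|[[Gw Dw] Bw]].
transitivity (\int[restr_law P mG mX]_x affine_law r s x U)%E.
  by apply: eq_integral => x _ /=; rewrite affine_law_xsection.
have mf : measurable_fun setT (affine_law r s ^~ U) by exact: measurable_affine_law.
have f0 x : (0 <= affine_law r s x U)%E by exact: measure_ge0.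
rewrite -(@ge0_integral_mrestr _ _ P G mG (fun w => affine_law r s (X w) U))//; last first.
  exact: (measurableT_comp mf mX).
apply/esym; apply: (@ge0_integral_same_law _ _ _ _ _ (borel 'rV[R]_n) R (mrestr P mG)
  (restr_law P mG mX) X id (affine_law r s ^~ U)) => // A mA.
by transitivity (P (X @^-1` A `&` G)) => //; rewrite setIC.
Qed.

End affine_kernel.

(** A subfamily is encoded as a full vector with zeros outside [Q], so that Borel sets of one fixed
    space describe the events that depend on it alone. *)
Definition masked_row (T : Type) (R : realType) (I : finType) (X : I -> T -> R) (Q : pred I)
    (w : T) : 'rV[R]_#|I| :=
  \row_i (if Q (enum_val i) then X (enum_val i) w else 0).

Lemma indep_gauss_block d (T : measurableType d) (R : realType) (P : probability T R)
    (I : finType) (X : I -> T -> R) (s : I -> R) (Q : pred I)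
    (A : I -> set (measurableTypeR R)) (C : set (borel 'rV[R]_#|I|)) :
  indep_gauss P X s -> (forall i, measurable (A i)) -> (forall i, Q i -> A i = setT) ->
  measurable C ->
  P (masked_row X Q @^-1` C `&` [set w | forall i, A i (X i w)]) =
    (P (masked_row X Q @^-1` C) * P [set w | forall i, A i (X i w)])%E.
Proof.
move=> [mX hX] mA QA.
have mV : measurable_fun setT (masked_row X Q : T -> borel 'rV[R]_#|I|).
  apply: measurable_fun_rV => i; rewrite /masked_row; under eq_fun do rewrite mxE.
  by case: (Q (enum_val i)); [exact: mX|exact: measurable_cst].
pose GA := [set w | forall i, A i (X i w)].
have mGA : measurable GA by exact: measurable_forall_preimage.
have Pfin : P GA \is a fin_num by exact: fin_num_measure.
pose k : {nonneg R} := NngNum (fine_ge0 (measure_ge0 P GA)).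
have kE : (k%:num)%:E = P GA by rewrite /= fineK.
suff H D : measurable D -> restr_law P mGA mV D = mscale k (restr_law P measurableT mV) D.
  move=> mC; transitivity (restr_law P mGA mV C); first by rewrite setIC.
  rewrite H//; transitivity (P GA * P (setT `&` masked_row X Q @^-1` C))%E; first by rewrite -kE.
  by rewrite setTI muleC.
move: D; apply: rV_measure_eq.
  by rewrite ltey_eq fin_num_measure.
move=> {}C mC.
transitivity (P (GA `&` masked_row X Q @^-1` box C)) => //.
transitivity (P GA * P (setT `&` masked_row X Q @^-1` box C))%E; last by rewrite -kE.
(* Outside [Q] the masked entry is 0, so the condition there is either void or impossible. *)
pose C' (B : I -> set (measurableTypeR R)) i : set (measurableTypeR R) :=
  if Q i then C (enum_rank i) else if `[< C (enum_rank i) 0 >] then B i else set0.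
have mC' B : (forall i, measurable (B i)) -> forall i, measurable (C' B i).
  by move=> mB i; rewrite /C'; case: ifP => // _; case: ifP.
have boxE w : box C (masked_row X Q w) <-> forall i, C (enum_rank i)
    (if Q i then X i w else 0).
  rewrite /box/=; split => [h i|h i].
    by have := h (enum_rank i); rewrite mxE enum_rankK.
  by rewrite mxE; have := h (enum_val i); rewrite enum_valK.
have e1 : GA `&` masked_row X Q @^-1` box C = [set w | forall i, C' A i (X i w)].
  apply/seteqP; split => w /=.
    move=> [hA /boxE hC] i; have := hC i; rewrite /C'; case: ifP => // Qi Ci.
    by rewrite asboolT//; exact: hA.
  move=> h; split=> [i|]; last apply/boxE => i.
    have := h i; rewrite /C'; case: ifPn => [/QA ->//|_].
    by case: asboolP.
  by have := h i; rewrite /C'; case: ifP => // _; case: asboolP.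
have e2 : setT `&` masked_row X Q @^-1` box C = [set w | forall i, C' (fun=> setT) i (X i w)].
  apply/seteqP; split => w /=.
    move=> [_ /boxE hC] i; have := hC i; rewrite /C'; case: ifP => // Qi Ci.
    by rewrite asboolT.
  move=> h; split => //; apply/boxE => i.
  by have := h i; rewrite /C'; case: ifP => // _; case: asboolP.
rewrite e1 e2 !hX//; [|exact: mC'..].
rewrite -big_split/=; apply: eq_bigr => i _; rewrite /C'; case: ifPn => Qi.
  by rewrite (QA i Qi) gaussT mul1e.
case: ifP => _; first by rewrite gaussT mule1.
by rewrite measure0 mule0.
Qed.

Lemma prod_marginal (R : realType) (M n : nat) (k : 'I_M) (F : 'I_M * 'I_n -> \bar R) :
  (forall p, p.1 != k -> F p = 1%E) -> (\prod_p F p = \prod_(j < n) F (k, j))%E.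
Proof.
move=> F1; transitivity (\prod_(i < M) \prod_(j < n) F (i, j))%E.
  by rewrite pair_bigA; apply: eq_bigr => -[].
by rewrite (bigD1 k)//= [X in (_ * X)%E]big1 ?mule1// => i ik; apply: big1 => j _; exact: F1.
Qed.

Section standard_normal.
Context (R : realType) (n : nat).

Definition standard_normal (gam : set (borel 'rV[R]_n) -> \bar R) :=
  forall A : 'I_n -> set (measurableTypeR R), (forall j, measurable (A j)) ->
    gam (box A) = (\prod_(j < n) gauss 1 (A j))%E.

Lemma law_of_block d (T : measurableType d) (P : probability T R) (M : nat)
    (X : 'I_M * 'I_n -> T -> R) (s : 'I_M * 'I_n -> R) (k : 'I_M)
    (A : 'I_n -> set (measurableTypeR R)) :
  indep_gauss P X s -> (forall j, measurable (A j)) ->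
  P [set w | forall j, A j (X (k, j) w)] = (\prod_(j < n) gauss (s (k, j)) (A j))%E.
Proof.
move=> [mX hX] mA.
pose A' (p : 'I_M * 'I_n) : set (measurableTypeR R) := if p.1 == k then A p.2 else setT.
have mA' p : measurable (A' p) by rewrite /A'; case: ifP.
transitivity (P [set w | forall p, A' p (X p w)]).
  congr (P _); apply/seteqP; split => w /= h.
    by move=> [i j]; rewrite /A'/=; case: eqP => // ->.
  by move=> j; have := h (k, j); rewrite /A'/= eqxx.
rewrite hX// (prod_marginal (k := k)).
  by apply: eq_bigr => j _; rewrite /A'/= eqxx.
by move=> p /negPf pk; rewrite /A' pk gaussT.
Qed.

Lemma standard_normal_exists d (T : measurableType d) (P : probability T R)
    (W : 'I_n -> T -> R -> R) : wiener P W ->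
  exists gam : probability (borel 'rV[R]_n) R, standard_normal gam.
Proof.
move=> [cW W0 W1 mW iW].
pose Y w : borel 'rV[R]_n := \row_j W j w 1.
have mY : measurable_fun setT Y.
  apply: (@measurable_fun_rV _ T R n Y) => j; rewrite /Y.
  by under eq_fun do rewrite mxE; exact: mW.
pose X : {mfun T >-> borel 'rV[R]_n} := mfun_Sub (mem_set mY).
exists (distribution P X) => A mA.
pose t (i : nat) : R := i%:R.
have tS i : (i < 1)%N -> t i < t i.+1 by move=> _; rewrite ltr_nat.
have Wt0 j w : W j w (t 0%N) = 0 by exact: W0.
transitivity (P [set w | forall j, A j (W j w (t 1%N) - W j w (t 0%N))]).
  congr (P _); apply/seteqP; split => w /= h j; have := h j; rewrite /Y mxE Wt0 subr0 //.
transitivity (\prod_(j < n) gauss (Num.sqrt (t 1%N - t 0%N)) (A j))%E.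
  exact: (law_of_block ord0 (iW 1%N t (lexx _) tS (lexx _)) mA).
by apply: eq_bigr => j _; rewrite /t/= subr0 sqrtr1.
Qed.

Context (gam : probability (borel 'rV[R]_n) R) (gamE : standard_normal gam).

Lemma standard_normal_law d (T : measurableType d) (P : probability T R)
    (Y : T -> 'rV[R]_n) (s : R) : measurable_fun setT (Y : T -> borel 'rV[R]_n) ->
  (forall A : 'I_n -> set (measurableTypeR R), (forall j, measurable (A j)) ->
     P [set w | forall j, A j (Y w 0 j)] = (\prod_(j < n) gauss s (A j))%E) ->
  forall x (r : R) (B : set (borel 'rV[R]_n)), measurable B ->
    P [set w | B (affine_map r 1 x (Y w))] = affine_law gam r s x B.
Proof.
move=> mY hY x r.
have base (B : set (borel 'rV[R]_n)) : measurable B ->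
    restr_law P measurableT mY B = affine_law gam 0 s 0 B.
  apply: rV_measure_eq; first by rewrite ltey_eq fin_num_measure.
  move=> A mA; rewrite affine_lawE; transitivity (P [set w | forall j, A j (Y w 0 j)]).
    by transitivity (P (setT `&` Y @^-1` box A)) => //; rewrite setTI.
  rewrite hY//.
  pose A' j : set (measurableTypeR R) := [set y | A j (s * y)].
  have mA' j : measurable (A' j).
    by have := @measurable_mulrl R s measurableT (A j) (mA j); rewrite setTI.
  transitivity (gam (box A')).
    by rewrite gamE//; apply: eq_bigr => j _; rewrite !gauss_scale /A';
      congr (normal_prob _ _ _); apply/seteqP; split => y /=; rewrite mul1r.
  congr (gam _); apply/seteqP; split => y /= h j; have := h j;
    by rewrite /A'/= !mxE mul0r add0r.
move=> B mB; have mB' : measurable [set y : borel 'rV[R]_n | B (affine_map r 1 x y)].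
  by have := measurable_affine r 1 x measurableT mB; rewrite setTI.
transitivity (restr_law P measurableT mY [set y : borel 'rV[R]_n | B (affine_map r 1 x y)]).
  by transitivity (P (setT `&` [set w | B (affine_map r 1 x (Y w))])); [rewrite setTI|].
rewrite base// !affine_lawE; congr (gam _); apply/seteqP; split => y /=;
  by rewrite /affine_map scale0r add0r scale1r.
Qed.

End standard_normal.

(** The derivative of [bridge_var] is at least 1; its increments are therefore nonnegative, and
    positive between distinct times. *)
Lemma bridge_var_growth (R : realType) (c s t : R) : 0 < c -> 0 <= s -> s <= t -> t < 1 ->
  t - s <= bridge_var c t - bridge_var c s.
Proof.
move=> c0 s0 st t1; apply: le_trans (ler_norm _) _.
apply: (@le_derive_dist R id (bridge_var c) (fun=> 1) (fun x => (1 - x) `^ (c *- 2))) => //.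
  by move=> x /andP[_ xt]; apply: is_derive_bridge_var; exact: le_lt_trans t1.
move=> x /andP[sx xt]; rewrite normr1 powRN.
have u0 : 0 < 1 - x by rewrite subr_gt0 (le_lt_trans xt).
rewrite invf_ge1 ?powR_gt0//; have k0 : 0 <= c *+ 2 by rewrite mulrn_wge0// ltW.
have := @ge0_ler_powR R (c *+ 2) k0 (1 - x) 1.
by rewrite powR1 !nnegrE ler01 (ltW u0) => /(_ isT isT); apply; rewrite gerBl (le_trans s0).
Qed.

Section bridge_kernel.
Context (R : realType) (n : nat) (gam : probability (borel 'rV[R]_n) R).
Context (c : R).

Definition bridge_scale s t : R := (1 - t) `^ c * (1 - s) `^ (- c).
Definition bridge_noise s t : R := (1 - t) `^ c * Num.sqrt (bridge_var c t - bridge_var c s).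
Definition bridge_kernel s t : R.-pker (borel 'rV[R]_n) ~> (borel 'rV[R]_n) :=
  affine_kernel gam (bridge_scale s t) (bridge_noise s t).

Hypotheses (c0 : 0 < c) (gamE : standard_normal gam).
Context d (T : measurableType d) (P : probability T R) (W : 'I_n -> T -> R -> R).
Hypothesis PW : wiener P W.

Lemma bridge_scale_id s : s < 1 -> bridge_scale s s = 1.
Proof. by move=> s1; exact: powR_onemK. Qed.

Lemma bridge_noise_id s : bridge_noise s s = 0.
Proof. by rewrite /bridge_noise subrr sqrtr0 mulr0. Qed.

(** Chapman-Kolmogorov follows by realising the two steps with independent standard normal vectors:
    the composed affine map multiplies the scales, and the noise variances add up because the
    increments of [bridge_var] do. *)
Lemma bridge_kernel_transition : transition_kernels bridge_kernel.
Proof.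
split=> [s x A /andP[s0 s1] mA|r s t x A r0 rs st t1 mA].
  transitivity (gam (affine_map (bridge_scale s s) (bridge_noise s s) x @^-1` A)).
    exact: affine_lawE.
  rewrite bridge_scale_id// bridge_noise_id /dirac indicE.
  have e : affine_map 1 0 x @^-1` A = if x \in A then setT else set0.
    apply/seteqP; split => y /=; rewrite /affine_map scale1r scale0r addr0.
      by move=> Ax; rewrite mem_set.
    by case: ifPn => [|_ []]; rewrite inE.
  by rewrite e; case: ifP => _; rewrite ?probability_setT ?measure0.
have s1 : s < 1 by exact: le_lt_trans t1.
have s0 : 0 <= s by exact: le_trans rs.
(* Two increments of length 1/2, multiplied by the square root of 2, are independent standard normal
   vectors. *)
pose tau (i : nat) : R := i%:R / 2.
have tauS i : (i < 2)%N -> tau i < tau i.+1.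
  by move=> _; rewrite ltr_pM2r ?invr_gt0// ltr_nat.
have [cW W0 W1 mW iW] := PW.
have tau0 : 0 <= tau 0%N by rewrite /tau mul0r.
have tau2 : tau 2%N <= 1 by rewrite /tau divff.
have iG := indep_gaussZ (fun=> Num.sqrt 2) (iW 2%N tau tau0 tauS tau2).
pose X (p : 'I_2 * 'I_n) w := Num.sqrt 2 * (W p.2 w (tau p.1.+1) - W p.2 w (tau p.1)).
have {iG}iX : indep_gauss P X (fun=> 1).
  have e p : Num.sqrt 2 * Num.sqrt (tau p.+1 - tau p) = 1 :> R.
    rewrite -sqrtrM// /tau -mulrBl -natrB// subSnn mul1r divff ?pnatr_eq0// sqrtr1//.
  split; first exact: iG.1.
  by move=> B mB; rewrite (iG.2 B mB); apply: eq_bigr => p _; rewrite e.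
pose G1 w : 'rV[R]_n := \row_j X (ord0, j) w.
pose G2 w : 'rV[R]_n := \row_j X (ord_max, j) w.
have mG (i : 'I_2) : measurable_fun setT ((fun w => \row_j X (i, j) w) : T -> borel 'rV[R]_n).
  apply: measurable_fun_rV => j; under eq_fun do rewrite mxE; exact: iX.1.
have Glaw (i : 'I_2) (B : 'I_n -> set (measurableTypeR R)) : (forall j, measurable (B j)) ->
    P [set w | forall j, B j ((\row_k X (i, k) w) 0 j)] = (\prod_(j < n) gauss 1 (B j))%E.
  move=> mB; rewrite -(law_of_block i iX mB); congr (P _).
  by apply/seteqP; split => w /= h j; have := h j; rewrite mxE.
pose r1 := bridge_scale r s; pose s1' := bridge_noise r s.
pose r2 := bridge_scale s t; pose s2 := bridge_noise s t.
pose Xs w := affine_map r1 s1' x (G1 w).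
have mXs : measurable_fun setT (Xs : T -> borel 'rV[R]_n).
  by apply: (@measurable_affine_comp _ _ _ _ r1 s1' (fun=> x) G1) => //; exact: (mG ord0).
have ind (D : set (borel 'rV[R]_n)) (B : 'I_n -> set (measurableTypeR R)) :
    measurable D -> (forall j, measurable (B j)) ->
    P (setT `&` Xs @^-1` D `&` G2 @^-1` box B) = (P (setT `&` Xs @^-1` D) * gam (box B))%E.
  move=> mD mB; rewrite setTI.
  pose Q (p : 'I_2 * 'I_n) := p.1 == ord0.
  pose B' (p : 'I_2 * 'I_n) : set (measurableTypeR R) := if Q p then setT else B p.2.
  have mB' p : measurable (B' p) by rewrite /B'; case: ifP.
  pose H (v : 'rV[R]_#|{: 'I_2 * 'I_n}|) : 'rV[R]_n :=
    affine_map r1 s1' x (\row_j v 0 (enum_rank (ord0 : 'I_2, j))).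
  have mH : measurable_fun setT (H : borel 'rV[R]_#|{: 'I_2 * 'I_n}| -> borel 'rV[R]_n).
    apply: (@measurable_affine_comp _ _ _ _ r1 s1' (fun=> x)) => //.
    apply: measurable_fun_rV => j; under eq_fun do rewrite mxE; exact: measurable_coord.
  have mC : measurable (H @^-1` D : set (borel 'rV[R]_#|{: 'I_2 * 'I_n}|)).
    by have := mH measurableT D mD; rewrite setTI.
  have QB p : Q p -> B' p = setT by rewrite /B' => ->.
  have := indep_gauss_block iX mB' QB mC.
  have -> : masked_row X Q @^-1` (H @^-1` D) = Xs @^-1` D.
    have e w : H (masked_row X Q w) = Xs w.
      by rewrite /H /Xs; congr affine_map; apply/rowP => j; rewrite !mxE enum_rankK /Q eqxx.
    by apply/seteqP; split => w /=; rewrite e.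
  have -> : [set w | forall p, B' p (X p w)] = G2 @^-1` box B.
    apply/seteqP; split => w /= h.
      by move=> j; have := h (ord_max, j); rewrite /B' /Q/= mxE.
    move=> [i j]; rewrite /B' /Q/=; case: ifPn => // i0.
    have -> : i = ord_max by apply/val_inj; case: i i0 => [[|[|]]].
    by have := h j; rewrite mxE.
  move=> ->; congr (_ * _)%E; rewrite gamE// -(Glaw ord_max B mB) //.
have key := integral_affine_law r2 s2 measurableT mXs (mG ord_max) ind mA.
transitivity (P (setT `&` [set w | A (affine_map r2 s2 (Xs w) (G2 w))])); last first.
  rewrite key; transitivity (\int[P]_w affine_law gam r2 s2 (Xs w) A)%E => //.
  apply: (@ge0_integral_same_law _ _ _ _ (borel 'rV[R]_n) (borel 'rV[R]_n) R P
    (affine_law gam r1 s1' x) Xs id (affine_law gam r2 s2 ^~ A)) => //.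
  - move=> B mB; rewrite /= affine_lawE.
    have := @standard_normal_law _ _ gam gamE _ _ P G1 1 (mG ord0) (Glaw ord0) 0 0
      (affine_map r1 s1' x @^-1` B).
    rewrite affine_lawE; have e v : affine_map 0 1 0 v = v :> 'rV[R]_n.
      by rewrite /affine_map scale0r add0r scale1r.
    have mB' : measurable (affine_map r1 s1' x @^-1` B : set (borel 'rV[R]_n)).
      by have := measurable_affine r1 s1' x measurableT mB; rewrite setTI.
    move=> /(_ mB') h; transitivity (P [set w | (affine_map r1 s1' x @^-1` B) (affine_map 0 1 0 (G1 w))]).
      by congr (P _); apply/seteqP; split => w /=; rewrite e.
    by rewrite h; congr (gam _); apply/seteqP; split => w /=; rewrite e.
  - exact: measurable_affine_law.
rewrite setTI; pose a (p : 'I_2 * 'I_n) := if p.1 == ord0 then r2 * s1' else s2.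
have iH := indep_gauss_sum (fun p : 'I_2 * 'I_n => p.2) a iX.
have sum2 (F : 'I_2 * 'I_n -> R) j : \sum_(p | p.2 == j) F p = F (ord0, j) + F (ord_max, j).
  transitivity (\sum_(i < 2) \sum_(k < n) if k == j then F (i, k) else 0).
    by rewrite pair_bigA big_mkcond/=; apply: eq_bigr => -[].
  rewrite !big_ord_recl big_ord0 addr0; congr (_ + _); rewrite -big_mkcond big_pred1_eq//.
  by congr (F (_, _)); apply/val_inj.
pose Hs w : 'rV[R]_n := \row_j \sum_(p | p.2 == j) a p * X p w.
have mHs : measurable_fun setT (Hs : T -> borel 'rV[R]_n).
  apply: measurable_fun_rV => j; rewrite /Hs; under eq_fun do rewrite mxE; exact: iH.1.
pose r3 := bridge_scale r t; pose s3 := bridge_noise r t.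
have sd j : Num.sqrt (\sum_(p : 'I_2 * 'I_n | p.2 == j) (a p * 1) ^+ 2) = s3.
  have V1 := bridge_var_growth c0 r0 rs s1; have V2 := bridge_var_growth c0 s0 st t1.
  have e : r2 * s1' = (1 - t) `^ c * Num.sqrt (bridge_var c s - bridge_var c r).
    rewrite /r2 /s1' /bridge_scale /bridge_noise mulrACA -!mulrA; congr (_ * _).
    by rewrite mulrCA [(1 - s) `^ (- c) * _]mulrA [(1 - s) `^ (- c) * _]mulrC powR_onemK// mul1r.
  rewrite sum2 /a/= !mulr1 e /s2 /s3 /bridge_noise !exprMn !sqr_sqrtr; [|lra..].
  rewrite -mulrDr [X in _ * X](_ : _ = bridge_var c t - bridge_var c r); last by ring.
  by rewrite sqrtrM ?sqr_ge0// sqrtr_sqr ger0_norm// powR_ge0.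
have Hlaw (B : 'I_n -> set (measurableTypeR R)) : (forall j, measurable (B j)) ->
    P [set w | forall j, B j (Hs w 0 j)] = (\prod_(j < n) gauss s3 (B j))%E.
  move=> mB; have := iH.2 B mB; under eq_bigr do rewrite sd; move=> <-; congr (P _).
  by apply/seteqP; split => w /= h j; have := h j; rewrite mxE.
transitivity (affine_law gam r3 s3 x A) => //.
rewrite -(@standard_normal_law _ _ gam gamE _ _ P Hs s3 mHs Hlaw x r3 A mA); congr (P _).
have r12 : r2 * r1 = r3.
  have K := powR_onemK c s1; rewrite /r1 /r2 /r3 /bridge_scale.
  rewrite (_ : _ * _ = (1 - t) `^ c * ((1 - s) `^ c * (1 - s) `^ (- c)) * (1 - r) `^ (- c)).
    by rewrite K mulr1.
  by ring.
have e w : affine_map r3 1 x (Hs w) = affine_map r2 s2 (Xs w) (G2 w).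
  by apply/rowP => j; rewrite !mxE sum2 /a/= -r12; ring.
by apply/seteqP; split => w /=; rewrite e.
Qed.

Section markov_property.
Variables (z : R -> T -> 'rV[R]_n).
Hypothesis mz : forall t, 0 <= t < 1 -> measurable_fun setT (z t : T -> borel 'rV[R]_n).
Hypothesis zE : {ae P, forall w t j, 0 <= t < 1 -> z t w 0 j = bridge_path c (W j w) t}.

Let weighted j t w := (1 - t) `^ (- c) * bridge_path c (W j w) t.

Lemma bridge_weightedK j t w : t < 1 -> bridge_path c (W j w) t = (1 - t) `^ c * weighted j t w.
Proof. by move=> t1; rewrite /weighted mulrA powR_onemK// mul1r. Qed.

(** The innovation between [s] and [t]: dividing by the deviation makes it standard normal, and it
    is independent of the past of [s]. *)
Definition bridge_noise_row s t w : 'rV[R]_n :=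
  \row_j ((weighted j t w - weighted j s w) / Num.sqrt (bridge_var c t - bridge_var c s)).

Lemma measurable_bridge_noise_row s t :
  measurable_fun setT (bridge_noise_row s t : T -> borel 'rV[R]_n).
Proof.
apply: measurable_fun_rV => j; rewrite /bridge_noise_row; under eq_fun do rewrite mxE.
apply: measurable_funM => //; apply: measurable_funB; apply: measurable_funM => //;
  exact: measurable_bridge_path c0 PW.
Qed.

Lemma bridge_var_gt0 s t : 0 <= s -> s < t -> t < 1 -> 0 < bridge_var c t - bridge_var c s.
Proof.
by move=> s0 st t1; apply: lt_le_trans (bridge_var_growth c0 s0 (ltW st) t1); rewrite subr_gt0.
Qed.

Lemma bridge_noise_row_law s t (A : 'I_n -> set (measurableTypeR R)) : 0 <= s -> s < t -> t < 1 ->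
  (forall j, measurable (A j)) -> P (bridge_noise_row s t @^-1` box A) = gam (box A).
Proof.
move=> s0 st t1 mA; rewrite gamE//.
pose u (i : nat) := if i == 0%N then s else t.
have uS i : (i < 1)%N -> u i < u i.+1 by case: i.
have V0 := bridge_var_gt0 s0 st t1.
have := indep_gaussZ (fun=> (Num.sqrt (bridge_var c t - bridge_var c s))^-1)
  (bridge_increments c0 PW (s0 : 0 <= u 0%N) uS t1).
move=> /(law_of_block ord0)/(_ mA) /= h.
transitivity (\prod_(j < n) gauss ((Num.sqrt (bridge_var c t - bridge_var c s))^-1 *
    Num.sqrt (bridge_var c t - bridge_var c s)) (A j))%E; last first.
  by apply: eq_bigr => j _; rewrite mulVf// gt_eqF// sqrtr_gt0.
rewrite -h; congr (P _).
by apply/seteqP; split => w /= hw j; have := hw j; rewrite mxE mulrC.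
Qed.

(* Sorting the times of a cylinder event expresses it through the increments of the
   weighted bridge before s, which are independent of the increment after s. *)
Lemma cylinder_indep s t k (u : nat -> R) (D : nat -> set (borel 'rV[R]_n))
    (A : 'I_n -> set (measurableTypeR R)) : 0 <= s -> s < t -> t < 1 ->
  (forall i, (i < k)%N -> 0 <= u i <= s) -> (forall i, measurable (D i)) ->
  (forall j, measurable (A j)) ->
  let F := [set w | forall i, (i < k)%N -> D i (\row_j bridge_path c (W j w) (u i))] in
  P (F `&` bridge_noise_row s t @^-1` box A) =
    (P F * P (bridge_noise_row s t @^-1` box A))%E.
Proof.
move=> s0 st t1 us mD mA F.
(* Including 0 and [s] makes each weighted value a sum of increments from 0 and lets the last
   increment start at [s]; the default value [t] of [nth] closes the list. *)
pose l := sort <=%R (undup (0 :: s :: [seq u i | i <- iota 0 k])).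
have lin x : x \in l -> 0 <= x <= s.
  rewrite mem_sort mem_undup !inE => /orP[/eqP->|/orP[/eqP->|/mapP[i + ->]]].
  - by rewrite lexx.
  - by rewrite lexx andbT.
  - by rewrite mem_iota => /andP[_ ik]; exact: us.
have l0 : 0 \in l by rewrite mem_sort mem_undup inE eqxx.
have ls : s \in l by rewrite mem_sort mem_undup !inE eqxx orbT.
have lu i : (i < k)%N -> u i \in l.
  move=> ik; rewrite mem_sort mem_undup !inE; apply/orP; right; apply/orP; right.
  by apply/mapP; exists i => //; rewrite mem_iota.
have sl : sorted <%R l.
  by rewrite lt_sorted_uniq_le sort_uniq undup_uniq/= sort_le_sorted.
pose M := size l; pose v i := nth t l i.
have M0 : (0 < M)%N by rewrite /M; case: (l) l0.
have vin i : (i < M)%N -> 0 <= v i <= s by move=> iM; apply: lin; exact: mem_nth.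
have vM : v M = t by rewrite /v nth_default.
have vS i : (i < M)%N -> v i < v i.+1.
  move=> iM; have [iM'|iM'] := ltnP i.+1 M.
    by apply: (sorted_ltn_nth lt_trans) => //; rewrite inE.
  have -> : i.+1 = M by apply/eqP; rewrite eqn_leq iM iM'.
  by rewrite vM; apply: le_lt_trans st; have /andP[] := vin i iM.
have mono := strict_steps vS.
have v0 : v 0%N = 0.
  apply/le_anti; have /andP[-> _] := vin 0%N M0; rewrite andbT.
  have := mono 0%N (index 0 l) (leq0n _); rewrite ltnW ?index_mem// => /(_ isT).
  by rewrite {2}/v nth_index.
have vlast : v M.-1 = s.
  have lastM : (M.-1 < M)%N by rewrite prednK.
  apply/le_anti; have /andP[_ ->] := vin _ lastM; rewrite /=.
  have iM : (index s l <= M.-1)%N by rewrite -ltnS prednK// index_mem.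
  by have := mono _ _ iM (ltnW lastM); rewrite {1}/v nth_index.
have iX := bridge_increments (k := M) c0 PW (eq_ind_r (fun x => 0 <= x) (lexx 0) v0 : 0 <= v 0%N) vS
  (eq_ind_r (fun x => x < 1) t1 vM : v M < 1).
set X := (X in indep_gauss P X _) in iX.
pose Q (p : 'I_M * 'I_n) := (p.1 < M.-1)%N.
pose sd := Num.sqrt (bridge_var c t - bridge_var c s).
pose A' (p : 'I_M * 'I_n) : set (measurableTypeR R) :=
  if Q p then setT else [set y : measurableTypeR R | A p.2 (sd^-1 * y)].
have mA' p : measurable (A' p).
  rewrite /A'; case: ifP => // _.
  by have := @measurable_mulrl R sd^-1 measurableT (A p.2) (mA p.2); rewrite setTI.
have QA' p : Q p -> A' p = setT by rewrite /A' => ->.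
pose N := #|{: 'I_M * 'I_n}|.
(* Recovers the bridge at time [u i] from the increments that precede this time. *)
pose H i (x : 'rV[R]_N) : 'rV[R]_n :=
  \row_j ((1 - u i) `^ c * \sum_(p < M) (if (p < index (u i) l)%N then x 0 (enum_rank (p, j)) else 0)).
have mH i : measurable_fun setT (H i : borel 'rV[R]_N -> borel 'rV[R]_n).
  apply: measurable_fun_rV => j; rewrite /H; under eq_fun do rewrite mxE.
  apply: measurable_funM => //; apply: measurable_sum => p.
  by case: (ltnP p (index (u i) l)) => _; [exact: measurable_coord|exact: measurable_cst].
pose C : set (borel 'rV[R]_N) := [set x | forall i, (i < k)%N -> D i (H i x)].
have mC : measurable C.
  rewrite (_ : C = \bigcap_(i in [set i | (i < k)%N]) (H i @^-1` D i)).
    apply: bigcap_measurableType => i _.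
    by have := mH i measurableT (D i) (mD i); rewrite setTI.
  by apply/seteqP; split => x /= h i; exact: h.
have HE w i : (i < k)%N -> H i (masked_row X Q w) = \row_j bridge_path c (W j w) (u i).
  move=> ik; apply/rowP => j; rewrite !mxE.
  have /andP[ui0 uis] := us i ik.
  rewrite bridge_weightedK; last by rewrite (le_lt_trans uis)// (lt_trans st).
  congr (_ * _); set q := index (u i) l.
  have qM : (q < M)%N by rewrite index_mem lu.
  have qM1 : (q <= M.-1)%N by rewrite -ltnS prednK.
  transitivity (\sum_(0 <= p < q) (weighted j (v p.+1) w - weighted j (v p) w)).
    rewrite -big_mkcond big_mkord/=.
    rewrite (big_ord_widen M (fun p => weighted j (v p.+1) w - weighted j (v p) w) (ltnW qM)).
    apply: eq_bigr => p pq; rewrite mxE enum_rankK /Q/= (leq_trans pq qM1).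
    by [].
  rewrite telescope_sumr// /q {1}/v nth_index ?lu// v0 {2}/weighted /bridge_path ltxx/= mulr0 subr0//.
have -> : F = masked_row X Q @^-1` C.
  by apply/seteqP; split => w /= h i ik; have := h i ik; rewrite HE.
have -> : bridge_noise_row s t @^-1` box A = [set w | forall p, A' p (X p w)].
  have Mlt : (M.-1 < M)%N by rewrite prednK.
  have XE w j : sd^-1 * X (Ordinal Mlt, j) w = bridge_noise_row s t w 0 j.
    by rewrite mxE /X/= prednK// vM vlast mulrC.
  apply/seteqP; split => w /= h.
    move=> [p j]; rewrite /A' /Q/=; case: ltnP => // Mp.
    have -> : p = Ordinal Mlt.
      by apply/val_inj/eqP; rewrite /= eqn_leq Mp -ltnS prednK// ltn_ord.
    by rewrite /= XE; exact: h.
  by move=> j; have := h (Ordinal Mlt, j); rewrite /A' /Q/= ltnn/= XE.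
exact: indep_gauss_block iX mA' QA' mC.
Qed.

Let z' := with_zero_end z.

Lemma measurable_with_zero_end t : 0 <= t <= 1 ->
  measurable_fun setT (z' t : T -> borel 'rV[R]_n).
Proof.
move=> /andP[t0 t1]; rewrite /z' /with_zero_end; case: ltP => t1'; last exact: measurable_cst.
by apply: mz; rewrite t0.
Qed.

Let z'E : {ae P, forall w t, 0 <= t < 1 -> z' t w = \row_j bridge_path c (W j w) t}.
Proof.
apply: filterS zE => w h t t01; apply/rowP => j; rewrite mxE /z' /with_zero_end.
by have /andP[_ ->] := t01; exact: h.
Qed.

(** Events at single times generate the filtration but are not stable under intersection; finite
    cylinders are, and Dynkin's theorem extends the product formula from them. *)
Lemma filtration_indep s t (G : set T) (A : 'I_n -> set (measurableTypeR R)) :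
  0 <= s -> s < t -> t < 1 -> natural_filtration z' s G -> (forall j, measurable (A j)) ->
  measurable G /\ P (G `&` bridge_noise_row s t @^-1` box A) = (P G * gam (box A))%E.
Proof.
move=> s0 st t1 hG mA; set Y := bridge_noise_row s t @^-1` box A.
have s1 : s < 1 by exact: lt_trans t1.
have mY : measurable Y.
  by have := measurable_bridge_noise_row s t measurableT (measurable_box mA); rewrite setTI.
pose cyl := [set F : set T | exists k (u : nat -> R) (D : nat -> set (borel 'rV[R]_n)),
  [/\ forall i, (i < k)%N -> 0 <= u i <= s, forall i, measurable (D i) &
      F = [set w | forall i, (i < k)%N -> D i (z' (u i) w)]]].
have cylI : setI_closed cyl.
  move=> _ _ [k1 [u1 [D1 [h1 m1 ->]]]] [k2 [u2 [D2 [h2 m2 ->]]]].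
  exists (k1 + k2)%N, (fun i => if (i < k1)%N then u1 i else u2 (i - k1)%N),
    (fun i => if (i < k1)%N then D1 i else D2 (i - k1)%N); split.
  - move=> i ik; case: ltnP => ik1; first exact: h1.
    by apply: h2; rewrite ltn_subLR.
  - by move=> i; case: ifP.
  - apply/seteqP; split => w /=.
      move=> [ha hb] i ik; case: ltnP => ik1; first exact: ha.
      by apply: hb; rewrite ltn_subLR.
    move=> h; split=> i ik.
      by have := h i (ltn_addr _ ik); rewrite ik.
    have nk : (k1 + i < k1)%N = false by rewrite ltnNge leq_addr.
    by have := h (k1 + i)%N; rewrite ltn_add2l nk addKn; apply.
have YE : P Y = gam (box A) by exact: bridge_noise_row_law.
have PYfin : gam (box A) \is a fin_num by apply: fin_num_measure; exact: measurable_box.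
pose k : {nonneg R} := NngNum (fine_ge0 (measure_ge0 gam (box A))).
have kE : (k%:num)%:E = gam (box A) by rewrite /= fineK.
pose m1 : {measure set T -> \bar R} := mrestr P mY.
pose m2 : {measure set T -> \bar R} := mscale k P.
have m1E F : m1 F = P (F `&` Y) by [].
have m2E F : m2 F = (P F * gam (box A))%E by rewrite muleC -kE.
have m1fin F : measurable F -> m1 F \is a fin_num.
  by move=> mF; rewrite m1E; apply: fin_num_measure; exact: measurableI.
have m2fin F : measurable F -> m2 F \is a fin_num.
  by move=> mF; rewrite m2E fin_numM// fin_num_measure.
pose good := [set F : set T | measurable F /\ m1 F = m2 F].
have mzu u (D : set (borel 'rV[R]_n)) : 0 <= u <= s -> measurable D -> measurable (z' u @^-1` D).
  move=> /andP[u0 us] mD; have u01 : 0 <= u <= 1 by rewrite u0 (le_trans us)// ltW.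
  by have := measurable_with_zero_end u01 measurableT mD; rewrite setTI.
have cylgood : cyl `<=` good.
  move=> _ [m [u [D [us mD ->]]]].
  have mF : measurable [set w | forall i, (i < m)%N -> D i (z' (u i) w)].
    rewrite (_ : [set _ | _] = \bigcap_(i in [set i | (i < m)%N])
        (if (i < m)%N then z' (u i) @^-1` D i else setT)).
      by apply: bigcap_measurableType => i _; case: ifPn => // ik; apply: mzu => //; exact: us.
    by apply/seteqP; split => w /= h i ik; have := h i ik; rewrite ik.
  split => //; rewrite m1E m2E; have := cylinder_indep s0 st t1 us mD mA; cbv zeta.
  set F := [set w | _] => hF.
  have mF' : measurable F.
    rewrite (_ : F = \bigcap_(i in [set i | (i < m)%N])
        ((fun w => \row_j bridge_path c (W j w) (u i)) @^-1` D i)).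
      apply: bigcap_measurableType => i _.
      have mr : measurable_fun setT ((fun w => \row_j bridge_path c (W j w) (u i)) : T -> borel 'rV[R]_n).
        apply: measurable_fun_rV => j; under eq_fun do rewrite mxE.
        exact: measurable_bridge_path c0 PW.
      by have := mr measurableT (D i) (mD i); rewrite setTI.
    by apply/seteqP; split => w /= h i; exact: h.
  have eF : {ae P, forall w, (forall i, (i < m)%N -> D i (z' (u i) w)) <-> F w}.
    apply: filterS z'E => w h.
    have e i : (i < m)%N -> z' (u i) w = \row_j bridge_path c (W j w) (u i).
      by move=> ik; apply: h; have /andP[-> us'] := us i ik; exact: le_lt_trans s1.
    by split => hD i ik; have := hD i ik; rewrite e.
  rewrite (measure_ae_eq mF mF' eF) -YE -hF; apply: measure_ae_eq.
  - exact: measurableI.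
  - exact: measurableI.
  - by apply: filterS eF => w [h1 h2]; split => -[h ?]; split => //; [exact: h1|exact: h2].
have dgood : dynkin good.
  split.
  - by split => //; rewrite m1E m2E setTI probability_setT mul1e.
  - move=> F [mF hF]; split; first exact: measurableC.
    have mT : (m1 setT < +oo)%E by rewrite ltey_eq m1fin.
    have mT2 : (m2 setT < +oo)%E by rewrite ltey_eq m2fin.
    transitivity (m1 setT - m1 (setT `&` F))%E; first by rewrite -setTD; exact: measureD.
    transitivity (m2 setT - m2 (setT `&` F))%E; last first.
      by apply/esym; rewrite -setTD; exact: measureD.
    rewrite [setT `&` F]setTI; congr (_ - _)%E => //.
    by rewrite m1E m2E setTI probability_setT mul1e.
  - move=> F tF hF; have mF i : measurable (F i) by have [] := hF i.
    split; first exact: bigcupT_measurable.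
    rewrite !measure_bigcup//; apply: eq_eseriesr => i _; by have [] := hF i.
have : good G.
  have : <<d cyl >> G.
    rewrite setI_closed_g_dynkin_g_sigma_algebra//; apply: hG; split.
      exact: smallest_sigma_algebra.
    move=> _ [u [D [us mD ->]]]; apply: sub_gen_smallest.
    exists 1%N, (fun=> u), (fun=> D); split => //.
    by apply/seteqP; split => w /= h; [move=> i _|exact: (h 0%N isT)].
  by apply: smallest_sub.
by rewrite /good/= m1E m2E.
Qed.

Lemma bridge_markov : markov_process P z' bridge_kernel.
Proof.
split; first exact: bridge_kernel_transition.
move=> s t G A s0 st t1 hG mA; have s1 : s < 1 by exact: le_lt_trans t1.
(* For [t = s] the innovation degenerates, so it is taken up to a later time; its coefficient
   [bridge_noise s s] is then 0. *)
pose t' := if s < t then t else (1 + s) / 2.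
have st' : s < t' by rewrite /t'; case: ifP => // _; lra.
have t'1 : t' < 1 by rewrite /t'; case: ifP => // _; lra.
have mG : measurable G.
  by have [] := filtration_indep s0 st' t'1 hG (fun _ => measurableT).
have zs1 : 0 <= s <= 1 by rewrite s0 ltW.
have zt1 : 0 <= t <= 1 by rewrite (le_trans s0)// ltW.
have ind (D : set (borel 'rV[R]_n)) (B : 'I_n -> set (measurableTypeR R)) :
    measurable D -> (forall j, measurable (B j)) ->
    P (G `&` z' s @^-1` D `&` bridge_noise_row s t' @^-1` box B) =
      (P (G `&` z' s @^-1` D) * gam (box B))%E.
  move=> mD mB; have hGD : natural_filtration z' s (G `&` z' s @^-1` D).
    have sa : sigma_algebra setT (natural_filtration z' s) by exact: smallest_sigma_algebra.
    have [_ _ _ sI] :=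
      (sigma_algebraP (fun F (_ : natural_filtration z' s F) => @subsetT T F)).1 sa.
    by apply: sI => //; apply: sub_gen_smallest; exists s, D; rewrite s0 lexx.
  exact: (filtration_indep s0 st' t'1 hGD mB).2.
have key := integral_affine_law (bridge_scale s t) (bridge_noise s t) mG
  (measurable_with_zero_end zs1) (measurable_bridge_noise_row s t') ind mA.
transitivity (\int[P]_(w in G) affine_law gam (bridge_scale s t) (bridge_noise s t) (z' s w) A)%E => //.
rewrite -key; apply: measure_ae_eq.
- by apply: measurableI => //; have := measurable_with_zero_end zt1 measurableT mA; rewrite setTI.
- apply: measurableI => //.
  have := @measurable_affine_comp R n _ T (bridge_scale s t) (bridge_noise s t) (z' s)
    (bridge_noise_row s t') (measurable_with_zero_end zs1) (measurable_bridge_noise_row s t') measurableT A mA.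
  by rewrite setTI.
apply: filterS z'E => w h.
suff e : affine_map (bridge_scale s t) (bridge_noise s t) (z' s w) (bridge_noise_row s t' w) = z' t w.
  by split=> -[Gw]; rewrite /= e.
have t0 : 0 <= t by exact: le_trans st.
rewrite !h ?s0 ?t0//; apply/rowP => j; rewrite !mxE /bridge_scale /bridge_noise -mulrA.
rewrite (_ : (1 - s) `^ (- c) * bridge_path c (W j w) s = weighted j s w)//.
rewrite (bridge_weightedK j w t1) /t'; have [st''|ts] := ltP s t.
  have sd0 : Num.sqrt (bridge_var c t - bridge_var c s) != 0.
    by rewrite gt_eqF// sqrtr_gt0 bridge_var_gt0.
  move: sd0; move: (Num.sqrt _) (weighted j t w) (weighted j s w) => q x y q0.
  by field.
have -> : t = s by apply/le_anti; rewrite st ts.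
by rewrite subrr sqrtr0 mulr0 mul0r addr0.
Qed.

End markov_property.
End bridge_kernel.

(** * Taylor expansions and the generator *)

Section taylor.
Context (R : realType) (n : nat).
Local Notation V := 'rV[R]_n.
Implicit Types (phi : V -> R) (a v : V).

Definition along v phi (x : V) : R := \sum_(i < n) v 0 i * partial i phi x.

Lemma is_derive_line phi a v (t : R) : differentiable phi (a + t *: v) ->
  is_derive t 1 (fun u : R => phi (a + u *: v)) (along v phi (a + t *: v)).
Proof.
move=> dphi; set x := a + t *: v in dphi *.
have E (h : R) : phi (a + (h *: (1 : R) + t) *: v) = phi (h *: v + x).
  by congr phi; apply/rowP => j; rewrite /x !mxE /GRing.scale/=; ring.
have Ef : (fun h : R => h^-1 *: (((fun u : R => phi (a + u *: v)) \o shift t) (h *: (1 : R)) -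
    phi (a + t *: v))) = (fun h : R => h^-1 *: ((phi \o shift x) (h *: v) - phi x)).
  by apply/funext => h; rewrite /= E.
have Dv : derivable phi x v by exact: diff_derivable.
apply: DeriveDef; first by rewrite /derivable Ef.
transitivity ('D_v phi x); first by rewrite /derive Ef.
rewrite deriveE// {1}(row_sum_delta v) linear_sum; apply: eq_bigr => i _.
by rewrite linearZ /partial deriveE.
Qed.

Lemma smooth_partial phi i : smooth phi -> smooth (partial i phi).
Proof. by move=> h s x; have := h (rcons s i) x; rewrite foldr_rcons. Qed.

Lemma smooth_differentiable phi (x : V) : smooth phi -> differentiable phi x.
Proof. by move=> h; exact: (h [::] x). Qed.

Definition along2 v phi (x : V) : R := \sum_(i < n) v 0 i * along v (partial i phi) x.
Definition along3 v phi (x : V) : R := \sum_(i < n) v 0 i * along2 v (partial i phi) x.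

Lemma is_derive_sum_line (F dF : 'I_n -> V -> R) a v (t : R) :
  (forall i, is_derive t 1 (fun u : R => F i (a + u *: v)) (dF i (a + t *: v))) ->
  is_derive t 1 (fun u : R => \sum_(i < n) v 0 i * F i (a + u *: v))
    (\sum_(i < n) v 0 i * dF i (a + t *: v)).
Proof.
move=> h.
have -> : (fun u : R => \sum_(i < n) v 0 i * F i (a + u *: v)) =
    \sum_(i < n) (v 0 i *: (fun u : R => F i (a + u *: v))).
  by apply/funext => u; rewrite fct_sumE; apply: eq_bigr.
by apply: is_derive_sum => i; exact: is_deriveZ.
Qed.

Lemma is_derive_along phi a v (t : R) : smooth phi ->
  is_derive t 1 (fun u : R => along v phi (a + u *: v)) (along2 v phi (a + t *: v)).
Proof.
move=> sphi; apply: (@is_derive_sum_line (fun i => partial i phi)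
  (fun i => along v (partial i phi))) => i; apply: is_derive_line.
by apply: smooth_differentiable; exact: smooth_partial.
Qed.

Lemma is_derive_along2 phi a v (t : R) : smooth phi ->
  is_derive t 1 (fun u : R => along2 v phi (a + u *: v)) (along3 v phi (a + t *: v)).
Proof.
move=> sphi; apply: (@is_derive_sum_line (fun i => along v (partial i phi))
  (fun i => along2 v (partial i phi))) => i; apply: is_derive_along.
exact: smooth_partial.
Qed.

Lemma unit_increment (f df : R -> R) (C : R) :
  (forall t : R, 0 <= t <= 1 -> is_derive t 1 f (df t)) ->
  (forall t : R, 0 <= t <= 1 -> `|df t| <= C) ->
  forall t : R, 0 <= t <= 1 -> `|f t - f 0| <= C.
Proof.
move=> hf hC t /andP[t0 t1]; have C0 : 0 <= C.
  by apply: le_trans (hC 0 _); rewrite ?lexx ?ler01.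
apply: (@le_trans _ _ (C * t - C * 0)); last by rewrite mulr0 subr0 ler_piMr.
pose q (x : R) : R := C * x.
have D := @le_derive_dist R f q df (fun=> C) 0 t t0.
apply: D => [x /andP[x0 xt]|x _|x /andP[x0 xt]].
- by apply: hf; rewrite x0 (le_trans xt).
- by have := is_deriveZ C (is_derive_id x 1); rewrite /GRing.scale/= mulr1.
- by apply: hC; rewrite x0 (le_trans xt).
Qed.

(** The bound is [C] instead of [C / 6]: each of the three successive integrations over [0, 1] is
    estimated crudely. *)
Lemma taylor_line phi a v (C : R) : smooth phi -> (forall x, `|along3 v phi x| <= C) ->
  `|phi (a + v) - phi a - along v phi a - 2^-1 * along2 v phi a| <= C.
Proof.
move=> sphi hC.
pose g0 u := phi (a + u *: v); pose g1 u := along v phi (a + u *: v).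
pose g2 u := along2 v phi (a + u *: v).
have d0 (t : R) : is_derive t 1 g0 (g1 t) by apply: is_derive_line; exact: smooth_differentiable.
have d1 (t : R) : is_derive t 1 g1 (g2 t) by exact: is_derive_along.
have b2 (t : R) : 0 <= t <= 1 -> `|g2 t - g2 0| <= C.
  move=> t01; apply: (@unit_increment g2 (fun t => along3 v phi (a + t *: v))) => // u _.
  exact: is_derive_along2.
pose k1 u := g1 u - u * g2 0.
have e1 (t : R) : is_derive t 1 k1 (g2 t - g2 0).
  have h := is_deriveB (d1 t) (is_deriveZ (g2 0) (is_derive_id t 1)).
  have -> : k1 = g1 - g2 0 *: id by apply/funext => u; rewrite /k1 mulrC.
  by apply: (is_derive_eq h); rewrite /GRing.scale/= mulr1.
have b1 (t : R) : 0 <= t <= 1 -> `|k1 t - k1 0| <= C.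
  exact: (@unit_increment k1 (fun u => g2 u - g2 0) C (fun u _ => e1 u) b2 t).
pose k0 u := g0 u - u * g1 0 - 2^-1 * u ^+ 2 * g2 0.
have e0 (t : R) : is_derive t 1 k0 (k1 t - k1 0).
  have h := is_deriveB (is_deriveB (d0 t) (is_deriveZ (g1 0) (is_derive_id t 1)))
    (is_deriveZ (2^-1 * g2 0) (is_deriveM (is_derive_id t 1) (is_derive_id t 1))).
  have -> : k0 = (g0 - g1 0 *: id) - (2^-1 * g2 0) *: (id * id).
    apply/funext => u; transitivity (g0 u - g1 0 * u - 2^-1 * g2 0 * (u * u)) => //.
    by rewrite /k0 expr2; ring.
  apply: (is_derive_eq h); rewrite /GRing.scale/= /k1; field => //.
have := @unit_increment k0 (fun u => k1 u - k1 0) C (fun u _ => e0 u) b1 1.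
rewrite ler01 lexx => /(_ isT).
rewrite /k0 /g0 /g1 /g2 !scale1r !scale0r !addr0 !mul1r !mul0r expr1n expr0n/= !mulr0 mul0r !subr0 mulr1.
have -> // : phi (a + v) - along v phi a - 2^-1 * along2 v phi a - phi a =
  phi (a + v) - phi a - along v phi a - 2^-1 * along2 v phi a by ring.
Qed.

(** The complement of the support is open and [phi] vanishes on it, so every iterated partial
    derivative does. *)
Lemma test_function_zero phi s (x : V) : ~ closure [set y | phi y != 0] x ->
  foldr (@partial R n) phi s x = 0.
Proof.
set K := closure _; have oK : open (~` K) by apply: closed_openC; exact: closed_closure.
elim: s x => [|i s IH] x Kx /=.
  by apply/eqP; rewrite -[_ == _]negbK; apply/negP => h; apply: Kx; exact: subset_closure.
rewrite /partial (@near_eq_derive _ _ _ _ (cst 0)) ?derive_cst//.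
have : nbhs x (~` K) by apply: open_nbhs_nbhs; split.
by apply: filterS => y Ky /=; exact: IH.
Qed.

Lemma test_function_bound phi s : test_function phi ->
  exists2 B : R, 0 <= B & forall x, `|foldr (@partial R n) phi s x| <= B.
Proof.
move=> [sphi cK]; set p := foldr _ _ _; set K := closure _ in cK.
have cp : continuous p by move=> x; apply: differentiable_continuous; exact: sphi.
have : compact (p @` K) by apply: continuous_compact => //; exact: continuous_subspaceT.
move=> /compact_bounded[M [_ hM]].
exists (Num.max 0 (M + 1)); first by rewrite le_max lexx.
move=> x; have [Kx|Kx] := pselect (K x); last by rewrite /p test_function_zero// normr0 le_max lexx.
rewrite le_max; apply/orP; right; apply: hM; first by rewrite ltrDl.
by exists x.
Qed.

Lemma test_function_support phi : test_function phi ->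
  exists2 M : R, 0 < M & forall x, M < `|x| -> ~ closure [set y | phi y != 0] x.
Proof.
move=> [_ /compact_bounded[M [_ hM]]].
exists (Num.max 1 (M + 1)); first by rewrite lt_max ltr01.
move=> x + Kx; have := hM (M + 1); rewrite ltrDl ltr01 => /(_ isT x Kx) /= h.
by rewrite gt_max => /andP[_]; rewrite ltNge h.
Qed.

End taylor.

Lemma Rintegral_sum d (T : measurableType d) (R : realType) (mu : probability T R)
    (I : Type) (r : seq I) (f : I -> T -> R) :
  (forall i, mu.-integrable setT (EFin \o f i)) ->
  mu.-integrable setT (EFin \o (fun x => \sum_(i <- r) f i x)) /\
  \int[mu]_x (\sum_(i <- r) f i x) = \sum_(i <- r) \int[mu]_x f i x.
Proof.
move=> fi; elim: r => [|i r [h1 h2]].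
  have e : (fun x : T => \sum_(i <- [::]) f i x) = (fun=> 0) by apply/funext => x; rewrite big_nil.
  split; last by rewrite big_nil; under eq_Rintegral do rewrite big_nil; rewrite Rintegral_cst ?mul0r.
  by rewrite e; exact: finite_measure_integrable_cst.
have e : (fun x : T => \sum_(k <- i :: r) f k x) = (fun x => f i x + \sum_(k <- r) f k x).
  by apply/funext => x; rewrite big_cons.
split.
  by rewrite e; apply: eq_integrable (integrableD measurableT (fi i) h1).
by rewrite e RintegralD// h2 big_cons.
Qed.

Lemma continuous_measurable_borel (R : realType) (n : nat) (f : 'rV[R]_n -> R) : continuous f ->
  measurable_fun setT (f : borel 'rV[R]_n -> measurableTypeR R).
Proof.
move=> cf; apply: (measurability _ (RGenOpens.measurableE R)) => //.
move=> _ [_ [u [v ->] <-]]; rewrite setTI; apply: sub_sigma_algebra.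
by move/continuousP: cf; apply; exact: interval_open.
Qed.

Lemma sum_diagonal (R : pzSemiRingType) (n : nat) (F : 'I_n -> 'I_n -> R) :
  \sum_i \sum_j F i j * (i == j)%:R = \sum_i F i i.
Proof.
apply: eq_bigr => i _; rewrite (bigD1 i)//= eqxx mulr1 big1 ?addr0// => j ji.
by rewrite eq_sym (negPf ji) mulr0.
Qed.

Section gaussian_taylor.
Context (R : realType) (n : nat) (gam : probability (borel 'rV[R]_n) R).
Hypothesis gamE : standard_normal gam.
Local Notation V := 'rV[R]_n.

Let co (i : 'I_n) (y : borel V) : R := (y : V) 0 i.

Lemma standard_normal_indep : indep_gauss gam co (fun=> 1).
Proof. by split=> [i|A mA]; [exact: measurable_coord|exact: gamE]. Qed.

Let hco i : has_gauss gam (co i) 1.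
Proof. exact: (indep_gauss_marginal i standard_normal_indep). Qed.

Lemma coord_moment_integrable (k : nat) i : (k <= 4)%N ->
  gam.-integrable setT (EFin \o (fun y => `|co i y| ^+ k)).
Proof.
move=> k4; apply: (has_gauss_integrable (hco i) (f := fun x => `|x| ^+ k) k4).
  by apply: measurable_funX; exact: normr_measurable.
by move=> x; rewrite normrX normr_id.
Qed.

(** Polarisation: the sum of two distinct coordinates is Gaussian of variance 2. *)
Lemma coord_covariance i j : gam.-integrable setT (EFin \o (fun y => co i y * co j y)) /\
  \int[gam]_y (co i y * co j y) = (i == j)%:R.
Proof.
have sq (X : borel V -> R) s : has_gauss gam X s ->
    gam.-integrable setT (EFin \o (fun y => X y ^+ 2)) /\ \int[gam]_y (X y ^+ 2) = s ^+ 2.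
  move=> hX; split; last by rewrite /Rintegral (has_gauss_sqr hX).
  apply: (has_gauss_integrable hX (f := fun x => x ^+ 2) (k := 2)) => //.
  by move=> x; rewrite normrX.
have [i1 i2] := sq _ _ (hco i); have [j1 j2] := sq _ _ (hco j).
have [<-|ij] := eqVneq i j.
  by under eq_Rintegral do rewrite -expr2; rewrite i2 expr1n.
pose a k : R := if k == i then 1 else if k == j then 1 else 0.
have aE (F : 'I_n -> R) : \sum_k a k * F k = F i + F j.
  rewrite (bigD1 i)//= (bigD1 j) /= 1?eq_sym//= big1.
    by rewrite /a eqxx mul1r eq_sym (negPf ij) eqxx mul1r addr0.
  by move=> k /andP[/negPf ki /negPf kj]; rewrite /a ki kj mul0r.
have := has_gauss_sum a standard_normal_indep.
have -> : (fun w => \sum_k a k * co k w) = (fun w => co i w + co j w).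
  by apply/funext => w; rewrite aE.
have -> : \sum_k (a k * 1) ^+ 2 = 2 :> R.
  rewrite (eq_bigr (fun k => a k * 1)); first by rewrite aE.
  by move=> k _; rewrite /a; case: ifP => _; rewrite ?mul1r ?expr1n//; case: ifP => _;
    rewrite ?mul1r ?expr1n// mul0r expr0n.
move=> /sq[s1 s2]; rewrite sqr_sqrtr// in s2.
pose F k (y : borel V) : R := if (k == 0%N) then 2^-1 * (co i y + co j y) ^+ 2
  else if k == 1%N then - 2^-1 * co i y ^+ 2 else - 2^-1 * co j y ^+ 2.
have FI k : gam.-integrable setT (EFin \o F k).
  rewrite /F; case: k => [|[|k]]/=.
  - exact: (integrableZl _ _ s1).
  - exact: (integrableZl _ _ i1).
  - exact: (integrableZl _ _ j1).
have [h1 h2] := Rintegral_sum [:: 0; 1; 2]%N FI.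
have e : (fun y => \sum_(k <- [:: 0; 1; 2]%N) F k y) = (fun y => co i y * co j y).
  by apply/funext => y; rewrite !big_cons big_nil /F/=; field.
rewrite e in h1 h2; split => //; rewrite h2 !big_cons big_nil /F/= !RintegralZl//.
by rewrite s2 i2 j2; field.
Qed.

(** The first-order term has mean 0, and the covariance keeps the diagonal second derivatives, that
    is, the Laplacian. The constant is uniform in [a] because the third derivatives of a test
    function are bounded. *)
Lemma gaussian_taylor phi : test_function phi ->
  exists2 K : R, 0 <= K & forall (a : V) (s : R), 0 <= s ->
    `|\int[gam]_y phi (a + s *: y) - phi a - 2^-1 * s ^+ 2 * laplacian phi a| <= K * s ^+ 3.
Proof.
move=> tphi; have [sphi _] := tphi.
have bd (p : 'I_n * 'I_n * 'I_n) : exists B : R, 0 <= B /\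
    forall x : V, `|partial p.2 (partial p.1.2 (partial p.1.1 phi)) x| <= B.
  by have [B B0 hB] := test_function_bound [:: p.2; p.1.2; p.1.1] tphi; exists B.
have [B hB] := choice bd.
pose CB := \sum_i \sum_j \sum_k B (i, j, k).
pose N3 (y : V) := \sum_(l < n) `|y 0 l| ^+ 3.
have n3 (y : V) i : `|y 0 i| ^+ 3 <= N3 y.
  by rewrite /N3 (bigD1 i)//= lerDl; apply: sumr_ge0 => l _; exact: exprn_ge0.
have n30 y : 0 <= N3 y by apply: sumr_ge0 => l _; exact: exprn_ge0.
have b3 (y : V) (s : R) x : 0 <= s -> `|along3 (s *: y) phi x| <= s ^+ 3 * (3 * N3 y) * CB.
  move=> s0; have -> : along3 (s *: y) phi x = \sum_i \sum_j \sum_k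
      (s ^+ 3 * (y 0 i * y 0 j * y 0 k)) * partial k (partial j (partial i phi)) x.
    rewrite /along3; apply: eq_bigr => i _; rewrite /along2 mulr_sumr; apply: eq_bigr => j _.
    rewrite /along !mulr_sumr; apply: eq_bigr => k _; rewrite !mxE; ring.
  rewrite /CB mulr_sumr (le_trans (ler_norm_sum _ _ _))//; apply: ler_sum => i _.
  rewrite mulr_sumr (le_trans (ler_norm_sum _ _ _))//; apply: ler_sum => j _.
  rewrite mulr_sumr (le_trans (ler_norm_sum _ _ _))//; apply: ler_sum => k _.
  rewrite normrM ler_pM//; last by have [_] := hB (i, j, k); exact.
  rewrite normrM (ger0_norm (exprn_ge0 3 s0)) ler_wpM2l ?exprn_ge0// !normrM.
  have := n3 y i; have := n3 y j; have := n3 y k.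
  move: (normr_ge0 (y 0 i)) (normr_ge0 (y 0 j)) (normr_ge0 (y 0 k)).
  move: (`|y 0 i|) (`|y 0 j|) (`|y 0 k|) (N3 y) => p q r m p0 q0 r0 h1 h2 h3.
  (* Arithmetic-geometric inequality; each cube is at most [N3 y], whence the factor 3. *)
  have : p * q * r <= p ^+ 3 + q ^+ 3 + r ^+ 3.
    have e3 : 0 <= (p + q + r) * ((p - q) ^+ 2 + (q - r) ^+ 2 + (r - p) ^+ 2).
      by rewrite mulr_ge0 ?addr_ge0 ?sqr_ge0.
    have e4 : 0 <= p * q * r by rewrite !mulr_ge0.
    have e5 : (p + q + r) * ((p - q) ^+ 2 + (q - r) ^+ 2 + (r - p) ^+ 2) =
      2 * (p ^+ 3 + q ^+ 3 + r ^+ 3 - 3 * (p * q * r)) by ring.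
    lra.
  lra.
have CB0 : 0 <= CB.
  by apply: sumr_ge0 => i _; apply: sumr_ge0 => j _; apply: sumr_ge0 => k _; have [] := hB (i, j, k).
have [IN3 _] := Rintegral_sum (index_enum 'I_n) (fun i => coord_moment_integrable i (isT : (3 <= 4)%N)).
pose M3 := \int[gam]_y N3 y.
have M30 : 0 <= M3 by apply: Rintegral_ge0 => y _; exact: n30.
exists (3 * CB * M3); first by rewrite !mulr_ge0.
move=> a s s0.
have [Bphi Bphi0 hphi] := test_function_bound [::] tphi.
pose g (y : borel V) : R := phi (a + s *: (y : V)).
have Ig : gam.-integrable setT (EFin \o g).
{
  have cphi : continuous phi by move=> y; apply: differentiable_continuous; exact: (sphi [::]).
  have gE : g = phi \o affine_map 1 s a by apply/funext => y; rewrite /g /= /affine_map scale1r.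
  have mg : measurable_fun setT (EFin \o g).
    apply/measurable_EFinP; rewrite gE.
    exact: (measurableT_comp (continuous_measurable_borel cphi) (measurable_affine 1 s a)).
  apply: (@le_integrable _ _ _ gam setT measurableT (EFin \o g) (EFin \o (fun=> Bphi))) => //; last first.
    exact: finite_measure_integrable_cst.
  by move=> y _ /=; rewrite lee_fin (le_trans (hphi _))// ler_norm.
}
pose f1 (y : borel V) : R := \sum_i (s * partial i phi a) * co i y.
have Hf1 := has_gauss_sum (fun i => s * partial i phi a) standard_normal_indep.
rewrite -/f1 in Hf1.
have If1 : gam.-integrable setT (EFin \o f1).
  by apply: (has_gauss_integrable Hf1 (f := id) (k := 1)) => // x; rewrite expr1.
have Ef1 : \int[gam]_y f1 y = 0 by rewrite /Rintegral (has_gauss_mean Hf1).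
pose cf (p : 'I_n * 'I_n) := 2^-1 * s ^+ 2 * partial p.2 (partial p.1 phi) a.
have [If2 Ef2] := Rintegral_sum (index_enum {: 'I_n * 'I_n})
  (fun p => integrableZl measurableT (cf p) (coord_covariance p.1 p.2).1).
pose f2 (y : borel V) : R := \sum_p cf p * (co p.1 y * co p.2 y).
have {}Ef2 : \int[gam]_y f2 y = 2^-1 * s ^+ 2 * laplacian phi a.
{
  rewrite Ef2 /laplacian mulr_sumr.
  transitivity (\sum_i \sum_j cf (i, j) * (i == j)%:R).
    rewrite pair_bigA; apply: eq_bigr => -[i j] _.
    rewrite -(coord_covariance i j).2.
    change (\int[gam]_x (cf (i, j) * (co i x * co j x)) = cf (i, j) * \int[gam]_y (co i y * co j y)).
    move: (cf (i, j)) => r; rewrite RintegralZl//; exact: (coord_covariance i j).1.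
  exact: (sum_diagonal (fun i j => cf (i, j))).
}
pose h (y : borel V) : R := g y - phi a - f1 y - f2 y.
have Ic : gam.-integrable setT (EFin \o (fun=> phi a : R)) by exact: finite_measure_integrable_cst.
have I1 := integrableB measurableT Ig Ic.
have I2 := integrableB measurableT I1 If1.
have I3 := integrableB measurableT I2 If2.
have Pc : \int[gam]_(y in setT) (fun=> phi a : R) y = phi a.
{
  rewrite /Rintegral integral_cst//; transitivity (fine ((phi a)%:E * 1)%E); last by rewrite mule1.
  by congr (fine (_ * _)%E); exact: probability_setT.
}
have Eh : \int[gam]_y h y = \int[gam]_y g y - phi a - 2^-1 * s ^+ 2 * laplacian phi a.
  rewrite /h (RintegralB _ I2 If2)// (RintegralB _ I1 If1)// (RintegralB _ Ig Ic)// Ef1 Ef2.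
  by rewrite subr0; congr (_ - _ - _); exact: Pc.
rewrite -Eh.
have hb y : `|h y| <= s ^+ 3 * (3 * N3 y) * CB.
  have := taylor_line a sphi (fun x => b3 y s x s0).
  congr (`|_| <= _); rewrite /h /g; congr (_ - _ - _).
    by rewrite /along /f1; apply: eq_bigr => i _; rewrite mxE /co; ring.
  rewrite /along2 /f2 mulr_sumr.
  transitivity (\sum_i \sum_j cf (i, j) * (co i y * co j y)); last first.
    by rewrite pair_bigA; apply: eq_bigr => -[].
  apply: eq_bigr => i _; rewrite /along !mulr_sumr; apply: eq_bigr => j _.
  by rewrite !mxE /cf /co/=; ring.
rewrite (le_trans (le_normr_Rintegral _ I3))//.
apply: (@le_trans _ _ (\int[gam]_y ((s ^+ 3 * 3 * CB) * N3 y))).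
{
  apply: le_Rintegral => //.
  - exact: (integrable_abse I3).
  - exact: (integrableZl measurableT (s ^+ 3 * 3 * CB) IN3).
  - by move=> y _; rewrite (le_trans (hb y))// le_eqVlt; apply/orP; left; apply/eqP; ring.
}
rewrite RintegralZl// -/M3 le_eqVlt; apply/orP; left; apply/eqP; ring.
Qed.

End gaussian_taylor.

Section generator.
Context (R : realType) (n : nat) (gam : probability (borel 'rV[R]_n) R).
Hypothesis gamE : standard_normal gam.
Local Notation V := 'rV[R]_n.

(** The generator is a limit uniform in [x], whereas the radial displacement [(r - 1) x] is
    unbounded; the compact support absorbs the powers of the norm. *)
Lemma test_function_weight (phi : V -> R) s k : test_function phi ->
  exists B : R, 0 <= B /\ forall w : V, `|w| ^+ k * `|foldr (@partial R n) phi s w| <= B.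
Proof.
move=> tphi; have [B B0 hB] := test_function_bound s tphi.
have [M M0 hM] := test_function_support tphi.
exists (M ^+ k * B); split; first by rewrite mulr_ge0// exprn_ge0// ltW.
move=> w; have [wM|Mw] := leP `|w| M.
  by apply: ler_pM => //; rewrite ?exprn_ge0// lerXn2r// nnegrE ?normr_ge0// ltW.
rewrite test_function_zero; last exact: hM.
by rewrite normr0 mulr0 mulr_ge0// exprn_ge0// ltW.
Qed.

Lemma along_weight (phi : V -> R) s : test_function phi ->
  exists B : R, 0 <= B /\ forall w : V, `|along w (foldr (@partial R n) phi s) w| <= B.
Proof.
move=> tphi; have [B hB] := choice (fun i : 'I_n => test_function_weight (i :: s) 1 tphi).
exists (\sum_i B i); split; first by apply: sumr_ge0 => i _; have [] := hB i.
move=> w; rewrite (le_trans (ler_norm_sum _ _ _))//; apply: ler_sum => i _.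
have [_ /(_ w)] := hB i; apply: le_trans.
by rewrite normrM ler_wpM2r// expr1; exact: rV_coord_le.
Qed.

Lemma along2_weight (phi : V -> R) : test_function phi ->
  exists B : R, 0 <= B /\ forall w : V, `|along2 w phi w| <= B.
Proof.
move=> tphi.
have [B hB] := choice (fun p : 'I_n * 'I_n => test_function_weight [:: p.2; p.1] 2 tphi).
exists (\sum_i \sum_j B (i, j)); split.
  by apply: sumr_ge0 => i _; apply: sumr_ge0 => j _; have [] := hB (i, j).
move=> w; rewrite (le_trans (ler_norm_sum _ _ _))//; apply: ler_sum => i _.
rewrite /along mulr_sumr (le_trans (ler_norm_sum _ _ _))//; apply: ler_sum => j _.
have [_ /(_ w)] := hB (i, j); apply: le_trans.
rewrite mulrA normrM ler_wpM2r// normrM expr2.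
by apply: ler_pM => //; exact: rV_coord_le.
Qed.

Lemma alongZ (phi : V -> R) (c : R) (y x : V) : along (c *: y) phi x = c * along y phi x.
Proof. by rewrite /along mulr_sumr; apply: eq_bigr => i _; rewrite mxE mulrA. Qed.

Lemma along2Z (phi : V -> R) (c : R) (y x : V) : along2 (c *: y) phi x = c ^+ 2 * along2 y phi x.
Proof.
by rewrite /along2 mulr_sumr; apply: eq_bigr => i _; rewrite alongZ mxE; ring.
Qed.

(** Every point of the segment is [1 + t (r - 1) >= 1 / 2] times [x], so the displacement is a small
    multiple of the current point, where the weighted bounds apply. *)
Lemma radial_step (x : V) (r t : R) : `|r - 1| <= 2^-1 -> 0 <= t <= 1 ->
  exists2 c : R, `|c| <= 2 * `|r - 1| & (r - 1) *: x = c *: (x + t *: ((r - 1) *: x)).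
Proof.
move=> r1 /andP[t0 t1]; pose l := 1 + t * (r - 1).
have hl : 2^-1 <= l.
{
  have : `|t * (r - 1)| <= 2^-1.
    by rewrite normrM (ger0_norm t0) (le_trans _ r1)// ler_piMl.
  by rewrite ler_norml => /andP[h _]; rewrite /l; lra.
}
have l0 : 0 < l by apply: lt_le_trans hl; rewrite invr_gt0.
exists ((r - 1) / l).
{
  rewrite normrM normfV (gtr0_norm l0) ler_pdivrMr// -mulrA mulrCA ler_peMr//; lra.
}
have -> : x + t *: ((r - 1) *: x) = l *: x by rewrite /l scalerDl scale1r scalerA.
by rewrite scalerA divfK// gt_eqF.
Qed.

Lemma along_radial (phi : V -> R) (x : V) (r t B : R) : `|r - 1| <= 2^-1 -> 0 <= t <= 1 ->
  (forall w : V, `|along w phi w| <= B) ->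
  `|along ((r - 1) *: x) phi (x + t *: ((r - 1) *: x))| <= 2 * `|r - 1| * B.
Proof.
move=> r1 t01 hB; have [c hc] := radial_step x r1 t01.
move: (x + t *: ((r - 1) *: x)) => y ->.
by rewrite alongZ normrM; apply: ler_pM.
Qed.

Lemma along2_radial (phi : V -> R) (x : V) (r t B : R) : `|r - 1| <= 2^-1 -> 0 <= t <= 1 ->
  (forall w : V, `|along2 w phi w| <= B) ->
  `|along2 ((r - 1) *: x) phi (x + t *: ((r - 1) *: x))| <= (2 * `|r - 1|) ^+ 2 * B.
Proof.
move=> r1 t01 hB; have [c hc] := radial_step x r1 t01.
move: (x + t *: ((r - 1) *: x)) => y ->.
rewrite along2Z normrM; apply: ler_pM => //.
by rewrite normrX lerXn2r// nnegrE ?normr_ge0// mulr_ge0.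
Qed.

Lemma line_increment (phi : V -> R) (a v : V) (C : R) : smooth phi ->
  (forall t, 0 <= t <= 1 -> `|along v phi (a + t *: v)| <= C) -> `|phi (a + v) - phi a| <= C.
Proof.
move=> sphi hC.
have d0 (t : R) : 0 <= t <= 1 ->
    is_derive t 1 (fun u => phi (a + u *: v)) (along v phi (a + t *: v)).
  by move=> _; apply: is_derive_line; exact: smooth_differentiable.
have := unit_increment d0 hC (t := 1).
by rewrite ler01 lexx => /(_ isT); rewrite scale1r scale0r addr0.
Qed.

Lemma taylor_line1 (phi : V -> R) (a v : V) (C : R) : smooth phi ->
  (forall t, 0 <= t <= 1 -> `|along2 v phi (a + t *: v)| <= C) ->
  `|phi (a + v) - phi a - along v phi a| <= C.
Proof.
move=> sphi hC.
pose g0 u := phi (a + u *: v); pose g1 u := along v phi (a + u *: v).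
have d0 (t : R) : is_derive t 1 g0 (g1 t) by apply: is_derive_line; exact: smooth_differentiable.
have b1 (t : R) : 0 <= t <= 1 -> `|g1 t - g1 0| <= C.
  move=> t01; apply: (@unit_increment R g1 (fun t => along2 v phi (a + t *: v))) => // u _.
  exact: is_derive_along.
pose k0 u := g0 u - u * g1 0.
have e0 (t : R) : is_derive t 1 k0 (g1 t - g1 0).
  have h := is_deriveB (d0 t) (is_deriveZ (g1 0) (is_derive_id t 1)).
  have -> : k0 = g0 - g1 0 *: id by apply/funext => u; rewrite /k0 mulrC.
  by apply: (is_derive_eq h); rewrite /GRing.scale/= mulr1.
have := @unit_increment R k0 (fun u => g1 u - g1 0) C (fun u _ => e0 u) b1 1.
rewrite ler01 lexx => /(_ isT).
rewrite /k0 /g0 /g1 !scale1r !scale0r !addr0 !mul1r !mul0r !subr0.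
have -> // : phi (a + v) - along v phi a - phi a = phi (a + v) - phi a - along v phi a by ring.
Qed.

(* The five terms are the Gaussian remainder, the radial remainder, and the errors made by
   replacing [s ^+ 2 / h] by [1], [r *: x] by [x] in the Laplacian, and [(r - 1) / h] by [- f]. *)
Lemma generator_error (J a p0 al L0 L1 K A1 A2 SD SE F r s h f e : R) :
  0 < h -> 0 <= s -> 0 <= K -> 0 <= A2 -> `|f| <= F -> e <= 2^-1 ->
  `|r - 1| <= e -> `|(r - 1) / h + f| <= e -> `|s ^+ 2 / h - 1| <= e -> s <= e ->
  `|J - a - 2^-1 * s ^+ 2 * L1| <= K * s ^+ 3 ->
  `|a - p0 - (r - 1) * al| <= (2 * `|r - 1|) ^+ 2 * A2 ->
  `|L1| <= SD -> `|L1 - L0| <= 2 * `|r - 1| * SE -> `|al| <= A1 -> 0 <= SE ->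
  `|(J - p0) / h - (2^-1 * L0 - f * al)| <=
    (K * 2 + 4 * A2 * (F + 1) + 2^-1 * SD + SE + A1) * e.
Proof.
move=> h0 s0 K0 A20 fF e12 re me qe se H1 H2 H3 H4 H5 SE0.
have e0 : 0 <= e by apply: le_trans se.
have hn : h != 0 by rewrite gt_eqF.
pose q := s ^+ 2 / h; pose m := (r - 1) / h.
have q0 : 0 <= q by rewrite divr_ge0 ?sqr_ge0// ltW.
have q2 : q <= 2 by move: qe; rewrite -/q ler_norml => /andP[_ h2]; lra.
have mF : `|m| <= F + 1.
{
  have -> : m = (m + f) - f by rewrite addrK.
  rewrite (le_trans (ler_normB _ _))// addrC lerD// (le_trans me)// (le_trans e12)//; lra.
}
have t1 : `|(J - a - 2^-1 * s ^+ 2 * L1) / h| <= K * 2 * e.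
{
  rewrite normrM normfV (gtr0_norm h0) ler_pdivrMr// (le_trans H1)//.
  have -> : K * s ^+ 3 = K * (s * q) * h by rewrite /q; field.
  rewrite ler_wpM2r ?(ltW h0)// -mulrA ler_wpM2l// mulrC.
  by apply: ler_pM.
}
have t2 : `|(a - p0 - (r - 1) * al) / h| <= 4 * A2 * (F + 1) * e.
{
  rewrite normrM normfV (gtr0_norm h0) ler_pdivrMr// (le_trans H2)//.
  have -> : (2 * `|r - 1|) ^+ 2 * A2 = 4 * A2 * (`|m| * `|r - 1|) * h.
    by rewrite /m normrM normfV (gtr0_norm h0); field.
  rewrite ler_wpM2r ?(ltW h0)// -(mulrA (4 * A2)) ler_wpM2l ?mulr_ge0//.
  by apply: ler_pM.
}
have t3 : `|2^-1 * (q - 1) * L1| <= 2^-1 * SD * e.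
{
  rewrite !normrM (ger0_norm (_ : 0 <= 2^-1))// -!mulrA ler_wpM2l// mulrC.
  by apply: ler_pM.
}
have t4 : `|2^-1 * (L1 - L0)| <= SE * e.
{
  rewrite normrM (ger0_norm (_ : 0 <= 2^-1))// ler_pdivrMl// (le_trans H4)// -mulrA ler_wpM2l//.
  by rewrite mulrC ler_wpM2l.
}
have t5 : `|(m + f) * al| <= A1 * e.
{
  by rewrite normrM mulrC; apply: ler_pM.
}
have -> : (J - p0) / h - (2^-1 * L0 - f * al) = (J - a - 2^-1 * s ^+ 2 * L1) / h +
    (a - p0 - (r - 1) * al) / h + 2^-1 * (q - 1) * L1 + 2^-1 * (L1 - L0) + (m + f) * al.
  by rewrite /q /m; field.
have -> : (K * 2 + 4 * A2 * (F + 1) + 2^-1 * SD + SE + A1) * e = K * 2 * e +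
  4 * A2 * (F + 1) * e + 2^-1 * SD * e + SE * e + A1 * e by ring.
do 4! (apply: (le_trans (ler_normD _ _)); apply: lerD; last by []).
exact: t1.
Qed.

(** One tolerance [e] controls all the parameters; the constant depends on [phi] and on the bound
    [F] of the drift coefficient, but not on [x]. *)
Lemma generator_estimate (phi : V -> R) (F : R) : test_function phi ->
  exists2 C : R, 0 <= C & forall (x : V) (r s h f e : R), 0 < h -> 0 <= s -> `|f| <= F ->
    e <= 2^-1 -> `|r - 1| <= e -> `|(r - 1) / h + f| <= e -> `|s ^+ 2 / h - 1| <= e -> s <= e ->
    `|(\int[gam]_y phi (affine_map r s x y) - phi x) / h -
      (2^-1 * laplacian phi x - f * \sum_(i < n) x 0 i * partial i phi x)| <= C * e.
Proof.
move=> tphi; have [sphi _] := tphi.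
have [K K0 hK] := gaussian_taylor gamE tphi.
have [A1 [A10 hA1]] := along_weight [::] tphi.
have [A2 [A20 hA2]] := along2_weight tphi.
have [D hD] := choice (fun i : 'I_n => test_function_weight [:: i; i] 0 tphi).
have [E hE] := choice (fun i : 'I_n => along_weight [:: i; i] tphi).
pose C := K * 2 + 4 * A2 * (F + 1) + 2^-1 * \sum_i D i + \sum_i E i + A1.
have SD0 : 0 <= \sum_i D i by apply: sumr_ge0 => i _; have [] := hD i.
have SE0 : 0 <= \sum_i E i by apply: sumr_ge0 => i _; have [] := hE i.
exists (Num.max 0 C); first by rewrite le_max lexx.
move=> x r s h f e h0 s0 fF e12 re me qe se.
have e0 : 0 <= e by apply: le_trans se.
have r2 : `|r - 1| <= 2^-1 by exact: le_trans re e12.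
apply: (@le_trans _ _ (C * e)); last by rewrite ler_wpM2r// le_max lexx orbT.
have rx : r *: x = x + (r - 1) *: x by rewrite scalerBl scale1r addrC subrK.
apply: (@generator_error _ (phi (r *: x)) (phi x) _ _ (laplacian phi (r *: x)) K A1 A2
  (\sum_i D i) (\sum_i E i) F r s h f e h0 s0 K0 A20 fF e12 re me qe se).
- exact: hK.
- have := taylor_line1 sphi (fun t t01 => along2_radial x r2 t01 hA2).
  by rewrite -rx alongZ.
- rewrite /laplacian (le_trans (ler_norm_sum _ _ _))//; apply: ler_sum => i _.
  by have [_ /(_ (r *: x))] := hD i; rewrite expr0 mul1r.
- rewrite /laplacian -sumrB (le_trans (ler_norm_sum _ _ _))// mulr_sumr; apply: ler_sum => i _.
  rewrite {1}rx; apply: line_increment => [|t t01].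
    by do 2! apply: smooth_partial.
  by apply: along_radial => //; have [_] := hE i.
- exact: hA1.
- exact: SE0.
Qed.

Lemma Rintegral_affine_law (r s : R) (x : V) (phi : V -> R) : continuous phi ->
  \int[affine_law gam r s x]_y phi y = \int[gam]_y phi (affine_map r s x y).
Proof.
move=> cphi.
have mE : measurable_fun setT (EFin \o phi : borel V -> \bar R).
  by apply/measurable_EFinP; exact: continuous_measurable_borel.
have H (f : borel V -> \bar R) : measurable_fun setT f -> (forall y, 0 <= f y)%E ->
    (\int[affine_law gam r s x]_y f y = \int[gam]_y f (affine_map r s x y))%E.
{
  move=> mf f0; apply: (@ge0_integral_same_law _ _ _ _ (borel V) (borel V) R
    (affine_law gam r s x) gam id (affine_map r s x) f) => //.
    exact: measurable_affine.
  by move=> A mA; rewrite affine_lawE.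
}
rewrite /Rintegral; congr fine; rewrite integralE [RHS]integralE; congr (_ - _)%E.
{
  transitivity (\int[gam]_y ((EFin \o phi)^\+ (affine_map r s x y)))%E.
    apply: (H ((EFin \o phi)^\+)%E); first exact: measurable_funepos.
    by move=> y; exact: funepos_ge0.
  by apply: eq_integral => y _; rewrite !funeposE.
}
{
  transitivity (\int[gam]_y ((EFin \o phi)^\- (affine_map r s x y)))%E.
    apply: (H ((EFin \o phi)^\-)%E); first exact: measurable_funeneg.
    by move=> y; exact: funeneg_ge0.
  by apply: eq_integral => y _; rewrite !funenegE.
}
Qed.

Lemma is_derive_right_quotient (f : R -> R) (x d e : R) : is_derive x 1 f d -> 0 < e ->
  \forall h \near 0^'+, `|(f (x + h) - f x) / h - d| <= e.
Proof.
move=> [D vD] e0.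
have cv : h^-1 *: ((f \o shift x) (h *: (1 : R)) - f x) @[h --> 0^'] --> d by rewrite -vD; exact: D.
have [r /= r0 hr] := (cvgrPdist_le _ _).1 cv e e0.
exists r => //= h hb h0; have := hr h hb (lt0r_neq0 h0).
rewrite distrC; have -> // : h^-1 *: ((f \o shift x) (h *: (1 : R)) - f x) = (f (x + h) - f x) / h.
by rewrite /GRing.scale/= mulr1 [h + x]addrC mulrC.
Qed.

(** At [h = 0] the scale has derivative [- c / (1 - t)], and the squared noise, [G] below, has
    derivative 1, since [(1 - t) ^ (2 c)] cancels the derivative of [bridge_var]. *)
Lemma bridge_kernel_near (c t e : R) : 0 < c -> 0 <= t < 1 -> 0 < e ->
  \forall h \near 0^'+, [/\ 0 < h, 0 <= bridge_noise c t (t + h),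
    `|bridge_scale c t (t + h) - 1| <= e,
    `|(bridge_scale c t (t + h) - 1) / h + c / (1 - t)| <= e
    & `|bridge_noise c t (t + h) ^+ 2 / h - 1| <= e /\ bridge_noise c t (t + h) <= e].
Proof.
move=> c0 /andP[t0 t1] e0; have u0 : 0 < 1 - t by rewrite subr_gt0.
pose f := c / (1 - t); have f0 : 0 <= f by rewrite divr_ge0// ltW.
have uc : (1 - t) `^ c = (1 - t) `^ (c - 1) * (1 - t).
{
  by rewrite -{3}(powRr1 (ltW u0)) -powRD ?subrK// (gt_eqF u0) implybT.
}
have pc : 0 < (1 - t) `^ c by exact: powR_gt0.
have st : bridge_scale c t t = 1 by rewrite /bridge_scale powRN divff// gt_eqF.
have ds : is_derive t 1 (bridge_scale c t) (- f).
{
  have h := is_deriveZ ((1 - t) `^ (- c)) (is_derive_powR_onem c t1).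
  have -> : bridge_scale c t = (1 - t) `^ (- c) *: (fun x : R => (1 - x) `^ c).
    by apply/funext => x; rewrite /bridge_scale mulrC.
  apply: (is_derive_eq h); rewrite /GRing.scale/= powRN uc /f.
  have : (1 - t) `^ (c - 1) != 0 by rewrite gt_eqF// powR_gt0.
  move: ((1 - t) `^ (c - 1)) => p p0; field.
  by rewrite p0 gt_eqF.
}
pose G (x : R) : R := (1 - x) `^ (c *+ 2) * (bridge_var c x - bridge_var c t).
have dG : is_derive t 1 G 1.
{
  have h := is_deriveM (is_derive_powR_onem (c *+ 2) t1)
    (is_deriveB (is_derive_bridge_var c t1) (is_derive_cst (bridge_var c t : R^o) t 1)).
  have -> : G = (fun x : R => (1 - x) `^ (c *+ 2)) * (bridge_var c - cst (bridge_var c t)) by [].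
  apply: (is_derive_eq h).
  have -> : (bridge_var c - cst (bridge_var c t)) t = 0 by exact: subrr.
  by rewrite scale0r addr0 subr0 /GRing.scale/= powRN divff// gt_eqF// powR_gt0.
}
have Gt : G t = 0 by rewrite /G subrr mulr0.
have n1 : \forall h \near 0^'+, `|(bridge_scale c t (t + h) - 1) / h + f| <= e.
  by apply: filterS (is_derive_right_quotient ds e0) => h; rewrite st opprK.
have n2 : \forall h \near 0^'+, `|G (t + h) / h - 1| <= e.
  by apply: filterS (is_derive_right_quotient dG e0) => h; rewrite Gt subr0.
(* Bounds on [h] that give [(f + e) h <= e] for the scale and [(1 + e) h <= e ^ 2] for the squared
   noise. *)
have d1 : 0 < e / (f + e) by rewrite divr_gt0// ltr_wpDl.
have d2 : 0 < e ^+ 2 / (1 + e) by rewrite divr_gt0 ?exprn_gt0// addr_gt0.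
near=> h.
have h0 : 0 < h by near: h; exact: nbhs_right_gt.
have h1 : h < 1 - t by near: h; exact: nbhs_right_lt.
have h2 : h < e / (f + e) by near: h; exact: nbhs_right_lt.
have h3 : h < e ^+ 2 / (1 + e) by near: h; exact: nbhs_right_lt.
have th : t + h < 1 by rewrite -ltrBrDl.
have N0 : 0 <= bridge_noise c t (t + h) by rewrite /bridge_noise mulr_ge0 ?powR_ge0 ?sqrtr_ge0.
have V0 : 0 <= bridge_var c (t + h) - bridge_var c t.
{
  have tth : t <= t + h by rewrite lerDl ltW.
  by apply: le_trans (bridge_var_growth c0 t0 tth th); rewrite addrAC subrr add0r ltW.
}
have N2 : bridge_noise c t (t + h) ^+ 2 = G (t + h).
{
  by rewrite /bridge_noise exprMn sqr_sqrtr// /G; congr (_ * _); rewrite -powR_mulrn ?powR_ge0// -powRrM mulr_natr.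
}
have Q1 : `|(bridge_scale c t (t + h) - 1) / h + f| <= e.
{
  by near: h; exact: n1.
}
have Q2 : `|bridge_noise c t (t + h) ^+ 2 / h - 1| <= e.
{
  by rewrite N2; near: h; exact: n2.
}
split => //.
{
  have -> : bridge_scale c t (t + h) - 1 = ((bridge_scale c t (t + h) - 1) / h + f - f) * h.
    by rewrite addrK divfK// gt_eqF.
  rewrite normrM (gtr0_norm h0); move: h2; rewrite ltr_pdivlMr ?ltr_wpDl// => h2.
  apply: le_trans (ltW h2); rewrite mulrC ler_wpM2l ?(ltW h0)//.
  by rewrite (le_trans (ler_normB _ _))// addrC lerD// ger0_norm.
}
split => //.
rewrite -(@ler_pXn2r _ 2)// ?nnegrE ?(ltW e0)//.
move: h3; rewrite ltr_pdivlMr ?addr_gt0// => h3; apply: le_trans (ltW h3).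
move: Q2; rewrite ler_norml => /andP[_]; rewrite lerBlDr ler_pdivrMr// => Q2.
by rewrite mulrC [1 + e]addrC.
Unshelve. all: by end_near.
Qed.

Lemma bridge_kernel_generator (c : R) : 0 < c ->
  has_generator (bridge_kernel gam c) (bridge_generator (fun t => c / (1 - t))).
Proof.
move=> c0 t phi t01 tphi e e0.
have [C C0 hC] := generator_estimate `|c / (1 - t)| tphi.
(* The value 1/2 is required by the radial estimates, and the last factor 2 makes the final bound
   strict. *)
pose e1 := Num.min 2^-1 (e / (C + 1) / 2).
have C10 : 0 < C + 1 by rewrite ltr_wpDl.
have e10 : 0 < e1 by rewrite lt_min invr_gt0 ltr0n/= !divr_gt0.
have Ce : C * e1 < e.
{
  apply: (@le_lt_trans _ _ ((C + 1) * (e / (C + 1) / 2))).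
    by apply: ler_pM => //; rewrite ?(ltW e10) ?lerDl// ge_min lexx orbT.
  have -> : (C + 1) * (e / (C + 1) / 2) = e / 2 by field; rewrite gt_eqF.
  by lra.
}
have := bridge_kernel_near c0 t01 e10.
apply: filterS => h [h0 N0 s1 s2 [s3 s4]] x.
have cphi : continuous phi.
  by move=> y; apply: differentiable_continuous; exact: (tphi.1 [::]).
have := hC x _ _ h (c / (1 - t)) e1 h0 N0 (lexx _) _ s1 s2 s3 s4.
rewrite ge_min lexx => /(_ isT) H.
apply: le_lt_trans Ce; apply: le_trans H.
have E := Rintegral_affine_law (bridge_scale c t (t + h)) (bridge_noise c t (t + h)) x cphi.
by rewrite -E.
Qed.

End generator.

(** * Smoothness of the drift coefficient and the three assertions *)

(** The functions [a (1 - t) ^ p] are stable under differentiation, so the values of [a] and [p] can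
    stay existential. *)
Lemma derive1n_drift (R : realType) (c : R) k : exists a p : R, forall t : R, t < 1 ->
  derive1n k (fun t : R => c / (1 - t)) t = a * (1 - t) `^ p /\
  derivable (derive1n k (fun t : R => c / (1 - t))) t 1.
Proof.
have N (F : R -> R) (a p t : R) : t < 1 -> (forall u, u < 1 -> F u = a * (1 - u) `^ p) ->
    derivable F t 1 /\ 'D_1 F t = a * (- p) * (1 - t) `^ (p - 1).
{
  move=> t1 FE; pose G (u : R) : R := a * (1 - u) `^ p.
  have h : is_derive t 1 G (a * (- p * (1 - t) `^ (p - 1))).
    exact: (is_deriveZ a (is_derive_powR_onem p t1)).
  have nr : {near t, G =1 F}.
    exists (1 - t); first by rewrite /= subr_gt0.
    by move=> u /=; rewrite ltr_norml => /andP[h1 _]; rewrite FE//; lra.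
  have [D vD] := h; split; first exact: near_eq_derivable nr D.
  transitivity ('D_1 G t); last by rewrite vD mulrA.
  exact: (esym (near_eq_derive _ nr)).
}
elim: k => [|k [a [p IH]]].
  have h0 (u : R) : u < 1 -> c / (1 - u) = c * (1 - u) `^ (- 1).
    by move=> u1; rewrite powR_inv1// subr_ge0 ltW.
  by exists c, (- 1) => t t1; split; [exact: h0|have [] := N _ _ _ t t1 h0].
have FE u : u < 1 -> derive1n k (fun t : R => c / (1 - t)) u = a * (1 - u) `^ p.
  by move=> u1; have [] := IH u u1.
have FS u : u < 1 -> derive1n k.+1 (fun t : R => c / (1 - t)) u = a * (- p) * (1 - u) `^ (p - 1).
  by move=> u1; rewrite derive1nS derive1E; have [_ ->] := N _ _ _ u u1 FE.
by exists (a * - p), (p - 1) => t t1; split; [exact: FS|have [] := N _ _ _ t t1 FS].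
Qed.

Lemma drift_cvgy (R : realType) (c : R) : 0 < c -> (fun t : R => c / (1 - t)) t @[t --> 1^'-] --> +oo.
Proof.
move=> c0; apply/cvgryPge => A; pose M := Num.max A 1.
have M0 : 0 < M by rewrite lt_max ltr01 orbT.
exists (c / M); first by rewrite /= divr_gt0.
move=> t /= tM t1; have u0 : 0 < 1 - t by rewrite subr_gt0.
move: tM; rewrite (gtr0_norm u0) ltr_pdivlMr// => tM.
rewrite ler_pdivlMr// (le_trans _ (ltW tM))// mulrC ler_wpM2l ?(ltW u0)//.
by rewrite le_max lexx.
Qed.

Lemma bridge_generalised d (T : measurableType d) (R : realType) (P : probability T R) (n : nat)
    (W : 'I_n -> T -> R -> R) (B : R -> T -> 'rV[R]_n) (c : R) (z : R -> T -> 'rV[R]_n) :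
  0 < c -> wiener P W ->
  {ae P, forall w t j, 0 <= t < 1 -> z t w 0 j = bridge_path c (W j w) t} ->
  bridge_sde P B c z -> generalised_brownian_bridge P (with_zero_end z).
Proof.
move=> c0 PW zE [mz z0 _ _]; have [cW W0 _ _ _] := PW.
have [gam gamE] := standard_normal_exists PW.
split.
- by move=> t t01; exact: measurable_with_zero_end.
- by apply: filterS z0 => w; rewrite /with_zero_end ltr01.
- exists (fun t => c / (1 - t)), (bridge_kernel gam c); split.
  + move=> k t /andP[_ t1]; have [a [p /(_ t t1)[]]] := derive1n_drift c k.
    by [].
  + exact: drift_cvgy.
  + exact: (bridge_markov c0 gamE PW mz zE).
  + exact: bridge_kernel_generator.
- apply: filterS zE => w zw; apply/cvgrPdist_le => e e0.
  have H (j : 'I_n) : \forall t \near 1^'-, `|bridge_path c (W j w) t| <= e.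
    have /cvgrPdist_le/(_ e e0) := bridge_path_cvg1 c0 (cW j w) (W0 j w).
    by apply: filterS => t; rewrite sub0r normrN.
  near=> t.
  have t1 : t < 1 by near: t; exact: nbhs_left_lt.
  have t0 : 0 < t by near: t; exact: nbhs_left_gt.
  have Ht : forall j, `|bridge_path c (W j w) t| <= e.
    by near: t; apply: filter_forall => j; exact: H.
  rewrite sub0r normrN; apply: rV_norm_le => [|j]; first exact: ltW.
  by rewrite /with_zero_end t1 zw ?(ltW t0).
Unshelve. all: by end_near.
Qed.

Theorem mainTheorem1 (R : realType) (n : nat) (n_ge1 : (1 <= n)%N)
    (d : measure_display) (T : measurableType d) (P : probability T R)
    (B : R -> T -> 'rV[R]_n) (z : R -> R -> T -> 'rV[R]_n)
    (B_bm : brownian_motion P B)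
    (z_sde : forall c, 0 < c -> bridge_sde P B c (z c))
    (c : R) (c_gt0 : 0 < c) :
  (* (a) *)
  generalised_brownian_bridge P (with_zero_end (z c)) /\
  (exists nu : probability (borel (loop R n)) R,
    loop_distribution P (with_zero_end (z c)) nu) /\
  forall nu1 nuc : probability (borel (loop R n)) R,
    loop_distribution P (with_zero_end (z 1)) nu1 ->
    loop_distribution P (with_zero_end (z c)) nuc ->
    [/\ centred_gaussian nuc,
        (* (b) *)
        cameron_martin nuc = cameron_martin nu1 <-> 2^-1 < c
      & (* (c) *)
        c <> 1 -> mutually_singular nu1 nuc].
Proof.
(* One family [W] drives the bridges of both exponents. *)
have [W PW WB] := brownian_wiener B_bm.
have zE := bridge_sde_path c_gt0 PW WB (z_sde c c_gt0).
have zE1 := bridge_sde_path ltr01 PW WB (z_sde 1 ltr01).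
split; first exact: bridge_generalised c_gt0 PW zE (z_sde c c_gt0).
split.
{
  by have [nu hnu] := @loop_law_exists _ _ _ _ _ _ _ c_gt0 PW (z c) zE; exists nu.
}
move=> nu1 nuc h1 hc.
have nu1E A : measurable A -> nu1 A = P (bridge_rv W 1 @^-1` A).
{
  by move=> mA; exact: (loop_lawE ltr01 PW zE1 h1 mA).
}
have nucE A : measurable A -> nuc A = P (bridge_rv W c @^-1` A).
{
  by move=> mA; exact: (loop_lawE c_gt0 PW zE hc mA).
}
split.
{
  exact: (loop_law_gaussian c_gt0 PW nucE n_ge1).
}
{
  exact: (cameron_martin_eq c_gt0 PW n_ge1 nu1E nucE).
}
{
  exact: (bridge_laws_singular c_gt0 PW n_ge1 nu1E nucE).
}
Qed.
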